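(* Let $\{g_s\}_{s\ge0}$ be the $\mathcal C_0(\mathbb R)$-valued process that is the weak limit in $\mathbb D([0,+\infty),\mathcal C_0(\mathbb R))$ of the processes $\{g^N_s\}_{s\ge0}$ as $N\to\infty$. It has the following properties. (i) It obeys the scaling relation $g_s(x)\overset{\mathcal D}{=}s^{3/2}g_1(x/\sqrt s)$ (equality in law of random functions of $x\in\mathbb R$, for $s>0$). (ii) The real-valued process $\{I_s\}_{s\ge0}$, where $I_s:=g_s(0)$, is a stable subordinator with exponent $\alpha=2/3$. (iii) The real-valued process $\{\theta_s\}_{s\ge0}$, where $\theta_s:=\int_{-\infty}^\infty g_s(x)\,dx$, is a stable subordinator with exponent $\alpha=1/2$. (iv) $\{g_s\}_{s\ge0}$ is a pure-jump subordinator in the Banach lattice $\mathcal C_0(\mathbb R)$.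
   Context: Standing assumptions: $\nu$ is an offspring distribution on $\{0,1,2,\dots\}$ with mean $1$ and finite, positive variance $\sigma_\nu^2$; $F$ is a probability distribution on $\mathbb Z$ with span one (not supported on a coset $a+d\mathbb Z$ with $d\ge2$), mean $0$ and finite, positive variance $\sigma_F^2$. Branching random walk and its labeled tree: let $T$ be the genealogical tree of a Galton-Watson process with one ancestor (the root $\rho$) and offspring distribution $\nu$; $T$ is finite almost surely. Conditionally on $T$, let $\{\xi_e\}$ be i.i.d. with law $F$, indexed by the directed edges $e=(u,v)$ of $T$ ($u$ the parent of $v$). Define labels by $l(\rho)=0$ and $l(v)=l(u)+\xi_{(u,v)}$. The labeled tree is $\mathcal T=(T,\{l(v)\}_{v\in T})$. For $j\in\mathbb Z$ let $X(j;\mathcal T)$ be the number of vertices $v\in T$ with $l(v)=j$. Rescaled densities: let $\mathcal T^1,\mathcal T^2,\dots$ be i.i.d. copies of $\mathcal T$. For integers $m\ge 0$ let $X^m(j)=\sum_{i=1}^m X(j;\mathcal T^i)$, $j\in\mathbb Z$, and let $\bar X^m(x)$, $x\in\mathbb R$, be its linear interpolation. For integers $N\ge1$, $s\ge0$, $x\in\mathbb R$ set $g^N_s(x)=N^{-3/2}\,\bar X^{\lfloor sN\rfloor}(\sqrt N\,x)$. $\mathcal C_0(\mathbb R)$ is the space of continuous real functions on $\mathbb R$ vanishing at infinity, with the supremum norm; $\mathbb D([0,+\infty),\mathcal C_0(\mathbb R))$ is the space of càdlàg $\mathcal C_0(\mathbb R)$-valued functions on $[0,+\infty)$ with the Skorohod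 topology. The processes $\{g^N_s\}_{s\ge0}$ converge weakly in this space as $N\to\infty$, so the limit $\{g_s\}_{s\ge0}$ is well defined in law. A Banach lattice is a Banach space $(E,\|\cdot\|)$ with a partial order $\le$ making it an ordered vector space in which any two elements $x,y$ have a least upper bound $x\vee y$ and a greatest lower bound $x\wedge y$, and such that, with $|x|:=x\vee(-x)$, $|x|\le|y|$ implies $\|x\|\le\|y\|$. $\mathcal C_0(\mathbb R)$ is a Banach lattice with the supremum norm and the pointwise order ($f\le g$ iff $f(x)\le g(x)$ for all $x$). An $E$-valued process $\{X_t\}_{t\ge0}$ is a subordinator if it is a Lévy process (stationary, independent increments) and with probability one $X_t-X_s\ge0$ for all $t\ge s\ge0$. A subordinator is a pure jump process if for every $t$, $X_t=\sum_{s\le t}(X_s-X_{s-})$. A stable subordinator with exponent $\alpha\in(0,1)$ is a (nonzero) real-valued subordinator $\{S_s\}$ with $S_{s}\overset{\mathcal D}{=}s^{1/\alpha}S_1$ for all $s>0$. *)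

(* Defs.v *)
From HB Require Import structures.
From mathcomp Require Import all_boot all_order all_algebra finmap.
From mathcomp Require Import ring lra zify.
From mathcomp Require Import all_classical all_reals all_analysis.
From mathcomp.analysis.showcase Require summability.
Set Implicit Arguments.
Unset Strict Implicit.
Unset Printing Implicit Defensive.
Import Order.TTheory GRing.Theory Num.Theory numFieldNormedType.Exports.
Local Open Scope classical_set_scope.
Local Open Scope ring_scope.

HB.mixin Record isBanachLattice (R : realType) E & CompleteNormedModule R E := {
  ble : E -> E -> Prop;
  bjoin : E -> E -> E;
  bmeet : E -> E -> E;
  ble_refl : forall x, ble x x;
  ble_anti : forall x y, ble x y -> ble y x -> x = y;
  ble_trans : forall y x z, ble x y -> ble y z -> ble x z;
  bleD : forall z x y : E, ble x y -> ble (x + z) (y + z);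
  bleZ : forall (a : R) (x y : E), 0 <= a -> ble x y -> ble (a *: x) (a *: y);
  ble_joinl : forall x y, ble x (bjoin x y);
  ble_joinr : forall x y, ble y (bjoin x y);
  bjoin_le : forall x y z, ble x z -> ble y z -> ble (bjoin x y) z;
  ble_meetl : forall x y, ble (bmeet x y) x;
  ble_meetr : forall x y, ble (bmeet x y) y;
  ble_meet : forall x y z, ble z x -> ble z y -> ble z (bmeet x y);
  ble_norm : forall x y : E,
    ble (bjoin x (- x)) (bjoin y (- y)) -> `|x| <= `|y|
}.

#[short(type="banachLatticeType")]
HB.structure Definition BanachLattice (R : realType) :=
  {E of CompleteNormedModule R E & isBanachLattice R E}.

Section real_banach_lattice.
Variable R : realType.
Let le (x y : R) : Prop := x <= y.

Let le_anti (x y : R) : le x y -> le y x -> x = y.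
Proof. by move=> xy yx; apply/eqP; rewrite eq_le xy yx. Qed.

Let le_trans (y x z : R) : le x y -> le y z -> le x z.
Proof. exact: le_trans. Qed.

Let leD (z x y : R) : le x y -> le (x + z) (y + z).
Proof. by rewrite /le lerD2r. Qed.

Let leZ (a x y : R) : 0 <= a -> le x y -> le (a *: x) (a *: y).
Proof. by move=> a0 xy; apply: ler_wpM2l. Qed.

Let le_maxl (x y : R) : le x (Num.max x y).
Proof. by rewrite /le le_max lexx. Qed.

Let le_maxr (x y : R) : le y (Num.max x y).
Proof. by rewrite /le le_max lexx orbT. Qed.

Let max_le (x y z : R) : le x z -> le y z -> le (Num.max x y) z.
Proof. by rewrite /le ge_max => -> ->. Qed.

Let min_lel (x y : R) : le (Num.min x y) x.
Proof. by rewrite /le ge_min lexx. Qed.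

Let min_ler (x y : R) : le (Num.min x y) y.
Proof. by rewrite /le ge_min lexx orbT. Qed.

Let le_min (x y z : R) : le z x -> le z y -> le z (Num.min x y).
Proof. by rewrite /le le_min => -> ->. Qed.

Let le_norm (x y : R) :
  le (Num.max x (- x)) (Num.max y (- y)) -> `|x| <= `|y|.
Proof.
have maxE (z : R) : Num.max z (- z) = `|z|.
  by case: (ger0P z) => z0; [apply/max_idPl|apply/max_idPr]; lra.
by rewrite /le !maxE.
Qed.

HB.instance Definition _ := isBanachLattice.Build R R (@lexx _ R)
  le_anti le_trans leD leZ le_maxl le_maxr max_le min_lel min_ler le_min
  le_norm.

End real_banach_lattice.

Definition C0_pred (R : realType) : {pred R -> R} := fun f =>
  `[< [/\ continuous f, f x @[x --> +oo] --> (0 : R)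
        & f x @[x --> -oo] --> (0 : R)] >].

Record C0 (R : realType) := MkC0 {
  C0_fun :> R -> R;
  C0P : C0_fun \in @C0_pred R
}.

HB.instance Definition _ (R : realType) := [isSub for @C0_fun R].
HB.instance Definition _ (R : realType) := [Choice of C0 R by <:].

Section C0_lmodule.
Variable R : realType.

Lemma C0_submod_closed : submod_closed (@C0_pred R).
Proof.
split.
  by apply/asboolP; split; [move=> x; exact: cvg_cst|exact: cvg_cst..].
move=> a f g /asboolP[cf fp fm] /asboolP[cg gp gm]; apply/asboolP; split.
- by move=> x; apply: cvgD; [apply: cvgZr; exact: cf|exact: cg].
- have := cvgD (cvgZr (k := a) fp) gp; rewrite scaler0 addr0; exact.
- have := cvgD (cvgZr (k := a) fm) gm; rewrite scaler0 addr0; exact.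
Qed.

HB.instance Definition _ := GRing.isSubmodClosed.Build _ _ (@C0_pred R)
  C0_submod_closed.
HB.instance Definition _ := [SubChoice_isSubLmodule of C0 R by <:].

Lemma C0_cts (f : C0 R) : continuous f.
Proof. by have /asboolP[] := C0P f. Qed.
Arguments C0_cts : clear implicits.

Lemma C0_pinfty (f : C0 R) : f x @[x --> +oo] --> (0 : R).
Proof. by have /asboolP[] := C0P f. Qed.

Lemma C0_ninfty (f : C0 R) : f x @[x --> -oo] --> (0 : R).
Proof. by have /asboolP[] := C0P f. Qed.

Lemma C0_bounded (f : C0 R) : exists M, forall x, `|f x| <= M.
Proof.
have /cvgr0Pnorm_le /(_ _ ltr01)[A [_ fA]] := C0_pinfty f.
have /cvgr0Pnorm_le /(_ _ ltr01)[B [_ fB]] := C0_ninfty f.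
have [AB|BA] := ltP A B.
  exists 1 => x; have [xB|Bx] := ltP x B; first exact: fB.
  by apply: fA; exact: lt_le_trans Bx.
have cf : {within `[B, A], continuous (fun x => `|f x|)}.
  apply: continuous_subspaceT => x; apply: cvg_norm; exact: C0_cts.
have [c _ fc] := EVT_max BA cf.
exists (Num.max 1 `|f c|) => x; rewrite le_max.
have [xB|Bx] := ltP x B; first by rewrite fB.
have [Ax|xA] := ltP A x; first by rewrite fA.
by rewrite fc ?orbT// in_itv/= Bx xA.
Qed.

Definition C0_norm (f : C0 R) : R := sup [set `|f x| | x in [set: R]].

Lemma C0_norm_ub (f : C0 R) x : `|f x| <= C0_norm f.
Proof.
apply: ub_le_sup; last by exists x.
by have [M fM] := C0_bounded f; exists M => _ [y _ <-].
Qed.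

Lemma C0_norm_le (f : C0 R) M : (forall x, `|f x| <= M) -> C0_norm f <= M.
Proof.
move=> fM; apply: ge_sup; first by exists `|f 0|; exists 0.
by move=> _ [x _ <-].
Qed.

Let C0_normD (f g : C0 R) : C0_norm (f + g) <= C0_norm f + C0_norm g.
Proof.
apply: C0_norm_le => x; apply: le_trans (ler_normD _ _) _.
by apply: lerD; exact: C0_norm_ub.
Qed.

Let C0_normZ (a : R) (f : C0 R) : C0_norm (a *: f) = `|a| * C0_norm f.
Proof.
have le b h : C0_norm (b *: h) <= `|b| * C0_norm h.
  apply: C0_norm_le => x; rewrite /= normrM.
  by apply: ler_wpM2l => //; exact: C0_norm_ub.
apply/eqP; rewrite eq_le le /=.
have [->|a0] := eqVneq a 0.
  by rewrite normr0 mul0r; apply: le_trans (C0_norm_ub _ 0).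
rewrite -[in X in X <= _](scalerK a0 f) mulrC -ler_pdivlMr ?normr_gt0//.
by rewrite mulrC -normfV le.
Qed.

Let C0_norm_eq0 (f : C0 R) : C0_norm f = 0 -> f = 0.
Proof.
move=> f0; apply/val_inj/funext => x /=; apply/eqP.
by rewrite -normr_le0 -f0; exact: C0_norm_ub.
Qed.

HB.instance Definition _ := Lmodule_isNormed.Build R (C0 R)
  C0_normD C0_normZ C0_norm_eq0.

Lemma C0_normE (f : C0 R) : `|f| = sup [set `|f x| | x in [set: R]].
Proof. by []. Qed.

Lemma C0_approx (l : R -> R) :
  (forall e, 0 < e -> exists f : C0 R, forall x, `|f x - l x| <= e) ->
  l \in @C0_pred R.
Proof.
move=> lf; apply/asboolP; split => [x||].
- apply/cvgrPdist_le => e e0.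
  have e3 : 0 < e / 3 by rewrite divr_gt0.
  have [f fl] := lf _ e3.
  have /cvgrPdist_le/(_ _ e3) := C0_cts f x.
  apply: filterS => y fxy.
  rewrite (_ : l x - l y = (l x - f x) + (f x - f y) + (f y - l y)); last first.
    by rewrite !addrA !subrK.
  rewrite (_ : e = e / 3 + e / 3 + e / 3); last by field.
  do 2 (apply: le_trans (ler_normD _ _) _; apply: lerD => //).
  by rewrite distrC.
- apply/cvgr0Pnorm_le => e e0; have e2 : 0 < e / 2 by rewrite divr_gt0.
  have [f fl] := lf _ e2.
  have /cvgr0Pnorm_le/(_ _ e2) := C0_pinfty f.
  apply: filterS => y fy; rewrite -[l y](subrK (f y)) [leRHS](splitr e).
  apply: le_trans (ler_normD _ _) _; apply: lerD => //.
  by rewrite distrC.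
- apply/cvgr0Pnorm_le => e e0; have e2 : 0 < e / 2 by rewrite divr_gt0.
  have [f fl] := lf _ e2.
  have /cvgr0Pnorm_le/(_ _ e2) := C0_ninfty f.
  apply: filterS => y fy; rewrite -[l y](subrK (f y)) [leRHS](splitr e).
  apply: le_trans (ler_normD _ _) _; apply: lerD => //.
  by rewrite distrC.
Qed.

Let C0_complete (F : set_system (C0 R)) :
  ProperFilter F -> cauchy F -> cvg F.
Proof.
move=> PF /cauchyP Fb.
have Fx x : cauchy ((fun f : C0 R => f x) @ F).
  apply/cauchyP => e /Fb[f Ff]; exists (f x).
  suff: F [set g : C0 R | ball (f x) e (g x)] by [].
  apply: filterS Ff => g; rewrite -!ball_normE /= => fg.
  exact: le_lt_trans (C0_norm_ub (f - g) x) fg.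
pose l x := lim ((fun f : C0 R => f x) @ F).
have Fl x : (fun f : C0 R => f x) @ F --> l x.
  exact: (cauchy_cvg _ (Fx x)).
have near_l (f : C0 R) e : F (ball f e) -> forall x, `|f x - l x| <= e.
  move=> Ff x; apply/ler_addgt0Pr => d d0.
  have /cvgrPdist_le/(_ _ d0) Fd := Fl x.
  have [g [/= fg lg]] := filter_ex (filterI Ff Fd).
  rewrite -(subrKA (g x)); apply: le_trans (ler_normD _ _) _.
  apply: lerD; last by rewrite distrC.
  rewrite -ball_normE /= in fg.
  exact: le_trans (C0_norm_ub (f - g) x) (ltW fg).
have lC : l \in @C0_pred R.
  apply: C0_approx => e e0; have [f Ff] := Fb _ e0.
  by exists f; exact: near_l Ff.
apply/cvg_ex; exists (MkC0 lC); apply/cvgrPdist_le => e e0.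
have e2 : 0 < e / 2 by rewrite divr_gt0.
have [f Ff] := Fb _ e2.
apply: filterS (Ff) => g; rewrite -ball_normE /= => fg.
rewrite [leRHS](splitr e).
apply: le_trans (ler_distD f _ _) _; apply: lerD; last exact: ltW.
by apply: C0_norm_le => x; rewrite /= distrC; exact: near_l Ff x.
Qed.

HB.instance Definition _ := Uniform_isComplete.Build (C0 R) C0_complete.


Definition C0_le (f g : C0 R) : Prop := forall x, f x <= g x.

Lemma C0_max_subproof (f g : C0 R) :
  (fun x => Num.max (f x) (g x)) \in @C0_pred R.
Proof.
have cmax (F : set_system R) (FF : Filter F) (a : R) : f @ F --> a -> g @ F --> a ->
    (fun x => Num.max (f x) (g x)) @ F --> a.
  move=> fa ga; apply/cvgrPdist_le => e e0.
  have /cvgrPdist_le/(_ _ e0) {}fa := fa.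
  have /cvgrPdist_le/(_ _ e0) {}ga := ga.
  by apply: filterS2 fa ga => x; case: (leP (f x) (g x)).
apply/asboolP; split.
- by move=> x; apply: (@continuous_max _ _ f g x); exact: C0_cts.
- by apply: cmax; exact: C0_pinfty.
- by apply: cmax; exact: C0_ninfty.
Qed.

Definition C0_max (f g : C0 R) : C0 R := MkC0 (C0_max_subproof f g).

Lemma C0_min_subproof (f g : C0 R) :
  (fun x => Num.min (f x) (g x)) \in @C0_pred R.
Proof.
have cmin (F : set_system R) (FF : Filter F) (a : R) : f @ F --> a -> g @ F --> a ->
    (fun x => Num.min (f x) (g x)) @ F --> a.
  move=> fa ga; apply/cvgrPdist_le => e e0.
  have /cvgrPdist_le/(_ _ e0) {}fa := fa.
  have /cvgrPdist_le/(_ _ e0) {}ga := ga.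
  by apply: filterS2 fa ga => x; case: (leP (f x) (g x)).
apply/asboolP; split.
- by move=> x; apply: (@continuous_min _ _ f g x); exact: C0_cts.
- by apply: cmin; exact: C0_pinfty.
- by apply: cmin; exact: C0_ninfty.
Qed.

Definition C0_min (f g : C0 R) : C0 R := MkC0 (C0_min_subproof f g).

Let C0_le_refl f : C0_le f f.
Proof. by move=> x. Qed.

Let C0_le_anti f g : C0_le f g -> C0_le g f -> f = g.
Proof.
by move=> fg gf; apply/val_inj/funext => x; apply/eqP; rewrite eq_le fg gf.
Qed.

Let C0_le_trans g f h : C0_le f g -> C0_le g h -> C0_le f h.
Proof. by move=> fg gh x; exact: le_trans (gh x). Qed.

Let C0_leD h f g : C0_le f g -> C0_le (f + h) (g + h).
Proof. by move=> fg x; have := fg x; rewrite -(lerD2r (h x)). Qed.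

Let C0_leZ (a : R) f g : 0 <= a -> C0_le f g -> C0_le (a *: f) (a *: g).
Proof. by move=> a0 fg x; exact: (ler_wpM2l a0 (fg x)). Qed.

Let C0_le_maxl f g : C0_le f (C0_max f g).
Proof. by move=> x; rewrite le_max lexx. Qed.

Let C0_le_maxr f g : C0_le g (C0_max f g).
Proof. by move=> x; rewrite le_max lexx orbT. Qed.

Let C0_max_le f g h : C0_le f h -> C0_le g h -> C0_le (C0_max f g) h.
Proof. by move=> fh gh x; rewrite ge_max fh gh. Qed.

Let C0_min_lel f g : C0_le (C0_min f g) f.
Proof. by move=> x; rewrite ge_min lexx. Qed.

Let C0_min_ler f g : C0_le (C0_min f g) g.
Proof. by move=> x; rewrite ge_min lexx orbT. Qed.

Let C0_le_min f g h : C0_le h f -> C0_le h g -> C0_le h (C0_min f g).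
Proof. by move=> fh gh x; rewrite le_min fh gh. Qed.

Let C0_le_norm (f g : C0 R) :
  C0_le (C0_max f (- f)) (C0_max g (- g)) -> `|f| <= `|g|.
Proof.
have maxE (z : R) : Num.max z (- z) = `|z|.
  by case: (ger0P z) => z0; [apply/max_idPl|apply/max_idPr]; lra.
move=> fg; apply: C0_norm_le => x; apply: le_trans (C0_norm_ub g x).
by have := fg x; rewrite /= !maxE.
Qed.

HB.instance Definition _ := isBanachLattice.Build R (C0 R) C0_le_refl
  C0_le_anti C0_le_trans C0_leD C0_leZ C0_le_maxl C0_le_maxr C0_max_le
  C0_min_lel C0_min_ler C0_le_min C0_le_norm.

Lemma rescale_subproof (a b : R) (f : C0 R) :
  (fun x => if 0 < b then a * f (b * x) else 0) \in @C0_pred R.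
Proof.
case: ltP => [b0|_]; last by apply/asboolP; split => [x||]; exact: cvg_cst.
apply/asboolP; split.
- move=> x; apply: cvgMr; apply: (@continuous_comp _ _ _ ( *%R b) f).
    exact: mulrl_continuous.
  exact: C0_cts.
- rewrite -[X in _ --> X](mulr0 a); apply: cvgMr.
  apply: cvg_comp (@C0_pinfty f).
  by apply: gt0_cvgMry => //; exact: cvg_id.
- rewrite -[X in _ --> X](mulr0 a); apply: cvgMr.
  apply: cvg_comp (@C0_ninfty f).
  by apply: gt0_cvgMrNy => //; exact: cvg_id.
Qed.

(* x |-> a f(b x) when b > 0; the value 0 for b <= 0 is a dummy. *)
Definition rescale (a b : R) (f : C0 R) : C0 R :=
  MkC0 (rescale_subproof a b f).

Lemma rescaleE (a b : R) (f : C0 R) x :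
  0 < b -> rescale a b f x = a * f (b * x).
Proof. by move=> /= ->. Qed.

End C0_lmodule.

Section interpolation.
Variable R : realType.

Definition linear_interpolation (c : int -> R) (x : R) : R :=
  let k := Num.floor x in c k + (x - k%:~R) * (c (k + 1) - c k).

Lemma linear_interpolation_continuous c : continuous (linear_interpolation c).
Proof.
move=> x; pose k := Num.floor x.
have /andP[kx xk] := floor_itv x; rewrite -/k in kx xk.
rewrite intrD in xk.
pose s j := c (j + 1) - c j.
pose M := `|s k| + `|s (k - 1)| + 1.
have M0 : 0 < M by rewrite ltr_wpDl// addr_ge0.
have lip y : k%:~R - 1 < y -> y < k%:~R + 1 ->
    `|linear_interpolation c x - linear_interpolation c y| <= M * `|x - y|.
  move=> ky yk; have [ylk|kley] := ltP y k%:~R.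
    have yE : Num.floor y = k - 1.
      by apply/eqP; rewrite floor_eq intrB subrK (ltW ky) ylk.
    rewrite /linear_interpolation -/k yE subrK -/(s k).
    rewrite (_ : _ - _ = (x - k%:~R) * s k + (k%:~R - y) * s (k - 1)); last first.
      by rewrite /s subrK intrB; ring.
    apply: le_trans (ler_normD _ _) _; rewrite !normrM.
    have -> : `|x - y| = (x - k%:~R) + (k%:~R - y).
      by rewrite addrA subrK ger0_norm// subr_ge0 (le_trans (ltW ylk)).
    have p0 : 0 <= x - k%:~R by rewrite subr_ge0.
    have q0 : 0 <= k%:~R - y by rewrite subr_ge0 ltW.
    rewrite (ger0_norm p0) (ger0_norm q0) /M.
    move: (x - k%:~R) (k%:~R - y) p0 q0 => p q p0 q0.
    have := normr_ge0 (s k); have := normr_ge0 (s (k - 1)).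
    by move: `|s k| `|s (k - 1)| => a b a0 b0; nra.
  have yE : Num.floor y = k.
    by apply/eqP; rewrite floor_eq intrD yk kley.
  rewrite /linear_interpolation yE -/k -/(s k).
  rewrite (_ : _ - _ = s k * (x - y)); last by ring.
  rewrite normrM ler_wpM2r// /M -addrA lerDl addr_ge0//.
apply/cvgrPdist_le => e e0.
have Me : 0 < e / M by rewrite divr_gt0.
have xe : \forall y \near x, `|x - y| <= e / M.
  by move: e {e0} Me => e Me; exact: (@cvgrPdist_le _ _ _ _ _ id x).1 cvg_id _ Me.
near=> y.
apply: le_trans (lip y _ _) _.
- near: y; apply: lt_nbhsr; lra.
- near: y; apply: lt_nbhsl; lra.
- by rewrite mulrC -ler_pdivlMr//; near: y.
Unshelve. all: by end_near. Qed.

Lemma linear_interpolation_subproof c :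
  (exists n : nat, forall j : int, (n < absz j)%N -> c j = 0) ->
  linear_interpolation c \in @C0_pred R.
Proof.
move=> [n cn]; apply/asboolP; split.
- exact: linear_interpolation_continuous.
- apply/cvgr0Pnorm_le => e e0; near=> x.
  have nx : n%:Z + 1 <= Num.floor x.
    rewrite floor_ge_int intrD ltW//; near: x;
      by apply: nbhs_pinfty_gt; rewrite num_real.
  rewrite /linear_interpolation !cn ?subrr ?mulr0 ?addr0 ?normr0 ?ltW//; lia.
- apply/cvgr0Pnorm_le => e e0; near=> x.
  have nx : Num.floor x <= - n%:Z - 2.
    rewrite -(ler_int R); apply: le_trans (ge_floor _) _; near: x;
      by apply: nbhs_ninfty_le; rewrite num_real.
  rewrite /linear_interpolation !cn ?subrr ?mulr0 ?addr0 ?normr0 ?ltW//; lia.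
Unshelve. all: by end_near. Qed.

End interpolation.

Section skorohod.
Variables (R : realType) (E : normedModType R).

Definition is_cadlag (x : R -> E) : Prop :=
  (forall t, 0 <= t -> x u @[u --> t^'+] --> x t) /\
  (forall t, 0 < t -> cvg (x u @[u --> t^'-])).

(* A path indexed by [0, +oo) is encoded by its extension to R that is constant
   on (-oo, 0]. *)
Definition cadlag_pred : {pred R -> E} := fun x =>
  `[< is_cadlag x /\ forall t, t < 0 -> x t = x 0 >].

Record cadlag := MkCadlag {
  cadlag_fun :> R -> E;
  cadlagP : cadlag_fun \in cadlag_pred
}.

HB.instance Definition _ := [isSub for cadlag_fun].
HB.instance Definition _ := [Choice of cadlag by <:].

Definition time_change (l : R -> R) : Prop :=
  [/\ l 0 = 0, {in Num.nneg &, {mono l : s t / s < t}}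
    & forall t, 0 <= t -> exists2 s, 0 <= s & l s = t].

Definition skorohod_ball (x : cadlag) (T e : R) : set cadlag :=
  [set y | exists2 l, time_change l &
     (forall t, 0 <= t -> `|l t - t| < e) /\
     (forall t, 0 <= t <= T -> `|y (l t) - x t| < e)].

(* The J1 topology on D([0, +oo), E): y_n --> x iff there are time changes l_n
   such that sup_t |l_n t - t| --> 0 and sup_(t <= T) |y_n (l_n t) - x t| --> 0
   for all T.  The sets skorohod_ball x T e, for T >= 0 and e > 0, form a base
   of (not necessarily open) neighbourhoods of x for this convergence. *)
Definition skorohod_open : set_system cadlag := [set U |
  forall x, U x -> exists T e, 0 < e /\ skorohod_ball x T e `<=` U].

Let skorohod_openT : skorohod_open setT.
Proof. by move=> x _; exists 0, 1. Qed.

Let skorohod_openI : setI_closed skorohod_open.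
Proof.
move=> U V oU oV x [/oU[T1 [e1 [e10 U1]]] /oV[T2 [e2 [e20 V2]]]].
exists (Num.max T1 T2), (Num.min e1 e2); split; first by rewrite lt_min e10.
move=> y [l tl [lt ly]]; split.
- apply: U1; exists l => //; split => [t /lt|t /andP[t0 tT]].
    by rewrite lt_min => /andP[].
  by have := ly t; rewrite t0 le_max tT lt_min => /(_ isT)/andP[].
- apply: V2; exists l => //; split => [t /lt|t /andP[t0 tT]].
    by rewrite lt_min => /andP[].
  by have := ly t; rewrite t0 le_max tT orbT lt_min => /(_ isT)/andP[].
Qed.

Let skorohod_openU (I : Type) (f : I -> set cadlag) :
  (forall i, skorohod_open (f i)) -> skorohod_open (\bigcup_i f i).
Proof.
move=> of_ x [i _ /of_[T [e [e0 fT]]]]; exists T, e; split => // y /fT fy.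
by exists i.
Qed.

HB.instance Definition _ := isOpenTopological.Build cadlag
  skorohod_openT skorohod_openI skorohod_openU.

Lemma cadlag_step_subproof (f : nat -> E) (N : nat) :
  (fun s => f (Num.truncn (s * N%:R))) \in cadlag_pred.
Proof.
have [->|N0] := posnP N.
  apply/asboolP; split; last by move=> t _; rewrite !mulr0.
  split=> t _; under eq_fun do rewrite mulr0; last exact: is_cvg_cst.
    by rewrite mulr0; exact: cvg_cst.
have NR : 0 < N%:R :> R by rewrite ltr0n.
apply/asboolP; split; last first.
  move=> t t0; rewrite mul0r truncn0; congr f; apply/truncn0Pn.
  by rewrite -ltNge (lt_trans _ ltr01)// pmulr_llt0.
split=> t t0.
- have /andP[tl tr] := truncn_itv (mulr_ge0 t0 (ltW NR)).
  apply: cvg_near_cst; near=> u.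
  have tu : t < u by near: u; exact: nbhs_right_gt.
  congr f; apply/eqP; rewrite truncn_eq; last first.
    by rewrite mulr_ge0// (le_trans t0)// ltW.
  rewrite (le_trans tl) ?ler_pM2r// ?(ltW tu)//=.
  rewrite -ltr_pdivlMr//; near: u; apply: nbhs_right_lt.
  by rewrite ltr_pdivlMr.
- have tN : 0 < t * N%:R by rewrite mulr_gt0.
  have [m /andP[mt tm]] : exists m : nat, m%:R < t * N%:R <= m.+1%:R.
    have /andP[tl tr] := truncn_itv (ltW tN).
    move: tl; rewrite le_eqVlt => /predU1P[tE|tl]; last first.
      by exists (Num.truncn (t * N%:R)); rewrite tl ltW.
    case: (Num.truncn _) tE => [tE|m tE]; first by rewrite -tE ltxx in tN.
    by exists m; rewrite -tE ltr_nat ltnSn lexx.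
  apply: (cvgP (f m)); apply: cvg_near_cst; near=> u.
  have mu : m%:R / N%:R < u.
    near: u; apply: nbhs_left_gt; by rewrite ltr_pdivrMr.
  have ut : u < t by near: u; exact: nbhs_left_lt.
  have mN : m%:R < u * N%:R by rewrite -ltr_pdivrMr.
  congr f; apply/eqP; rewrite truncn_eq; last by rewrite (le_trans _ (ltW mN)).
  by rewrite ltW//= (lt_le_trans _ tm)// ltr_pM2r.
Unshelve. all: by end_near. Qed.

(* truncn is the integer part on [0, +oo) and is 0 on negative numbers *)
Definition cadlag_step (f : nat -> E) (N : nat) : cadlag :=
  MkCadlag (cadlag_step_subproof f N).

End skorohod.

Section random_elements.
Variable R : realType.

Definition random_element d (Om : measurableType d) (S : topologicalType)
    (X : Om -> S) : Prop :=
  forall B, <<s @open S >> B -> measurable (X @^-1` B).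

Definition same_law d (Om : measurableType d) (P : probability Om R)
    (S : topologicalType) (X Y : Om -> S) : Prop :=
  forall B, <<s @open S >> B -> P (X @^-1` B) = P (Y @^-1` B).

Definition cvg_in_law d (Om : measurableType d) (P : probability Om R)
    d' (Om' : measurableType d') (Q : probability Om' R) (S : topologicalType)
    (X : nat -> Om -> S) (Y : Om' -> S) : Prop :=
  forall Phi : S -> R, continuous Phi -> (exists M, forall x, `|Phi x| <= M) ->
    ('E_P[Phi \o X n] @[n --> \oo] --> 'E_Q[Phi \o Y])%E.

Definition mutually_independent d (Om : measurableType d)
    (P : probability Om R) (I : eqType) (C : I -> set_system Om) : Prop :=
  forall (s : seq I) (A : I -> set Om), uniq s ->
    (forall i, i \in s -> C i (A i)) ->
    P (\bigcap_(i in [set` s]) A i) = (\prod_(i <- s) P (A i))%E.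

End random_elements.

HB.instance Definition _ := isPointed.Build int 0.
HB.instance Definition _ := @isMeasurable.Build default_measure_display
  int discrete_measurable discrete_measurable0
  discrete_measurableC discrete_measurableU.

(* Individuals are words over nat (Ulam-Harris labels): the root is [::] and
   rcons u k is the k-th child of u.  K v is the number of children of v and
   xi v the displacement along the edge from the parent of v to v. *)
Section labeled_tree.
Variables (K : seq nat -> nat) (xi : seq nat -> int).

Inductive gw_tree : set (seq nat) :=
| gw_root : gw_tree [::]
| gw_child u k : gw_tree u -> (k < K u)%N -> gw_tree (rcons u k).

Definition label (v : seq nat) : int := \sum_(k < size v) xi (take k.+1 v).

Lemma label_root : label [::] = 0.
Proof. by rewrite /label big_ord0. Qed.

Lemma label_child u k : label (rcons u k) = label u + xi (rcons u k).
Proof.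
rewrite /label size_rcons big_ord_recr /= -[in RHS](take_size (rcons u k)).
rewrite size_rcons; congr (_ + _); apply: eq_bigr => i _.
by rewrite -cats1 takel_cat.
Qed.

(* fset_set A is empty when A is infinite: on the event (of probability 0) that
   the tree is infinite, the counts are set to 0. *)
Definition occupation (j : int) : nat :=
  #|` [fset v in fset_set gw_tree | label v == j]|%fset.

Lemma occupation_bounded :
  exists n : nat, forall j : int, (n < absz j)%N -> occupation j = 0%N.
Proof.
exists (\max_(v <- fset_set gw_tree) absz (label v)) => j nj.
apply/eqP; rewrite cardfs_eq0; apply/eqP/fsetP => v.
rewrite !inE; apply/negbTE/negP => /andP[vT /eqP vj].
move: nj; rewrite -vj ltnNge => /negP; apply.
by apply: (@leq_bigmax_seq _ _ predT (fun v => absz (label v))).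
Qed.

End labeled_tree.

Section rescaled_densities.
Variables (R : realType) (K : nat -> seq nat -> nat) (xi : nat -> seq nat -> int).

Definition total_occupation (m : nat) (j : int) : nat :=
  \sum_(i < m) occupation (K i) (xi i) j.

Lemma total_occupation_bounded m : exists n : nat, forall j : int,
  (n < absz j)%N -> (total_occupation m j)%:R = 0 :> R.
Proof.
have [b bP] := choice (fun i => occupation_bounded (K i) (xi i)).
exists (\max_(i < m) b i) => j mj; rewrite /total_occupation big1// => i _.
by apply: bP; apply: leq_ltn_trans mj; exact: (@leq_bigmax _ (b \o val)).
Qed.

Definition interpolated_occupation (m : nat) : C0 R :=
  MkC0 (linear_interpolation_subproof (total_occupation_bounded m)).

Definition density_process (N : nat) : cadlag (C0 R) :=
  cadlag_step (fun m => rescale (N%:R `^ (- (3 / 2))) (Num.sqrt N%:R)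
                          (interpolated_occupation m)) N.

Lemma density_processE (N : nat) (s x : R) : (0 < N)%N ->
  density_process N s x = N%:R `^ (- (3 / 2)) *
    linear_interpolation
      (fun j => (\sum_(i < Num.truncn (s * N%:R)) occupation (K i) (xi i) j)%:R)
      (Num.sqrt N%:R * x).
Proof. by move=> N0; rewrite /= sqrtr_gt0 ltr0n N0. Qed.

End rescaled_densities.

(* K i v and xi i v are given for all words v, not only for those in the i-th
   tree; since the displacements are independent of the offspring numbers, they
   are i.i.d. with law F along the edges of the trees, given the trees. *)
Record iid_branching_random_walks (R : realType) d (Om : measurableType d)
    (P : probability Om R) (nu : probability nat R) (F : probability int R)
    (K : nat -> seq nat -> {RV P >-> nat})
    (xi : nat -> seq nat -> {RV P >-> int}) : Prop := {
  law_offspring : forall i v B, distribution P (K i v) B = nu B;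
  law_displacement : forall i v B, distribution P (xi i v) B = F B;
  indep_offspring_displacement : mutually_independent P
    (fun a : (nat * seq nat) + (nat * seq nat) => match a with
       | inl (i, v) => [set K i v @^-1` B | B in [set: set nat]]
       | inr (i, v) => [set xi i v @^-1` B | B in [set: set int]]
     end)
}.

Section subordinators.
Variables (R : realType) (d : measure_display) (Om : measurableType d).
Variable P : probability Om R.

Record levy_process (E : normedModType R) (X : R -> Om -> E) : Prop := {
  levy_random : forall t, 0 <= t -> random_element (X t);
  levy0 : {ae P, forall w, X 0 w = 0};
  levy_cadlag : {ae P, forall w, is_cadlag (X^~ w)};
  levy_stationary : forall s t h, 0 <= s <= t -> 0 <= h ->
    same_law P (fun w => X (t + h) w - X (s + h) w) (fun w => X t w - X s w);
  levy_independent : forall t : nat -> R, 0 <= t 0%N ->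
    {homo t : m n / (m <= n)%N >-> m <= n} ->
    mutually_independent P (fun k =>
      [set (fun w => X (t k.+1) w - X (t k) w) @^-1` B | B in <<s @open E >>])
}.

Definition subordinator (E : banachLatticeType R) (X : R -> Om -> E) : Prop :=
  levy_process X /\
  {ae P, forall w, forall s t, 0 <= s <= t -> ble 0 (X t w - X s w)}.

(* The jumps are summed in norm over the (uncountable) set ]0, t], as the limit
   of the sums over its finite subsets *)
Definition pure_jump_process (E : normedModType R) (X : R -> Om -> E) : Prop :=
  {ae P, forall w, forall t, 0 <= t ->
    summability.partial_sum
      (fun u => if 0 < u <= t then X u w - lim (X v w @[v --> u^'-]) else 0) A
      @[A --> summability.totally] --> X t w}.

Definition stable_subordinator (alpha : R) (S : R -> Om -> R) : Prop :=
  [/\ 0 < alpha < 1, subordinator S,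
      ~ {ae P, forall w, forall s, 0 <= s -> S s w = 0}
    & forall s, 0 < s -> same_law P (S s) (fun w => s `^ alpha^-1 * S 1 w)].

End subordinators.

(* Main.v *)
Require Import Defs.
From HB Require Import structures.
From mathcomp Require Import all_boot all_order all_algebra finmap.
From mathcomp Require Import ring lra zify.
From mathcomp Require Import all_classical all_reals all_analysis measurable_realfun.
From mathcomp.analysis.showcase Require summability.
Set Implicit Arguments.
Unset Strict Implicit.
Unset Printing Implicit Defensive.
Import Order.TTheory GRing.Theory Num.Theory numFieldNormedType.Exports.
Local Open Scope classical_set_scope.
Local Open Scope ring_scope.

(* The partial sums of rescaled densities of i.i.d. trees have independent increments that are
   stationary up to one tree; single trees being negligible, the increments of the limit are
   independent and stationary, and they are nonnegative because the cone of nonnegative functions is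
   closed.  The time change N -> N s of the sums is a rescaling of space and values, exactly for
   rational s, and the scaling relation follows by right continuity.  Evaluation at 0 and integration
   are additive and turn it into the stability of the local time and of the total mass.

   That the local time is not 0 is Paley-Zygmund: the expected number of visits to 0 before
   generation n is of order sqrt n, with the matching bound for the second moment.  The total mass is
   finite because a critical tree survives n generations with probability O(1/n).

   For the jumps, let zeta be the norm of g at time 1.  The 4^r increments of mesh 4^-r over [0, 1] are
   independent, distributed as zeta / 8^r in norm and dominated by zeta, so that
   P(zeta > M 8^r) <= 4^-r for some M.  Hence the expected sum of the norms of the increments of mesh
   4^-m whose norm is at most M 8^-l is O(2^-l), uniformly in m: the small increments do not
   contribute, and the path is the sum of its jumps. *)

(** * Expectations of bounded random variables and independence *)

(** The limit is known only through bounded continuous functionals of the path, and evaluation at a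
    fixed time is not one of them. Evaluations are therefore smoothed by a supremum over nearby
    times, and the error is controlled before the limit: the increment over [[s, s + eps]] is a sum
    of about [eps N] trees, so it is dominated in law by the value at time [2 eps], which is small
    because the limit is right continuous and null at 0. Finite-dimensional laws then converge at
    every time, without a set of exceptional times. Before the limit everything is a function of
    finitely many trees with values in a countable type; measurability and independence are settled
    on a space of integer coordinates, where passing to a subtree or to later trees is a reindexing.
    The powers of 4 and 8 come from the scaling exponent, since 4^(3/2) = 8. On a mesh 4^-m there
    are 4^m increments of size zeta / 8^m per unit of time, and zeta truncated at M 8^(m-l) has mean
    of order 2^(m-l), its tail at z being at most of order z^(-2/3); the product is of order
    2^-l. *)

Section real_expectation.
Context d (T : measurableType d) (R : realType) (P : probability T R).
Implicit Types f g : T -> R.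

(** An algebra of integrable functions: inside it expectations are real numbers, and linearity comes
    without integrability conditions. *)
Definition bmeas f := measurable_fun [set: T] f /\ exists M : R, forall x, `|f x| <= M.

Definition Ex f : R := \int[P]_x f x.

Lemma bmeas_integrable f : bmeas f -> P.-integrable [set: T] (EFin \o f).
Proof.
move=> [mf [M fM]]; apply: measurable_bounded_integrable => //.
  by rewrite ltey_eq fin_num_measure.
exists M; split; first exact: num_real.
by move=> x Mx y _ /=; apply: le_trans (fM y) (ltW Mx).
Qed.

Lemma ExE f : bmeas f -> 'E_P[f]%E = (Ex f)%:E.
Proof.
move=> bf; rewrite unlock /Ex /Rintegral fineK//.
by apply: integrable_fin_num => //; exact: bmeas_integrable.
Qed.

Lemma bmeasD f g : bmeas f -> bmeas g -> bmeas (fun x => f x + g x).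
Proof.
move=> [mf [M fM]] [mg [N gN]]; split; first exact: measurable_funD.
by exists (M + N) => x; apply: le_trans (ler_normD _ _) _; exact: lerD.
Qed.

Lemma bmeasN f : bmeas f -> bmeas (fun x => - f x).
Proof.
move=> [mf [M fM]]; split; first exact: measurableT_comp.
by exists M => x; rewrite normrN.
Qed.

Lemma bmeasB f g : bmeas f -> bmeas g -> bmeas (fun x => f x - g x).
Proof. by move=> bf bg; apply: bmeasD => //; exact: bmeasN. Qed.

Lemma bmeasM f g : bmeas f -> bmeas g -> bmeas (fun x => f x * g x).
Proof.
move=> [mf [M fM]] [mg [N gN]]; split; first exact: measurable_funM.
by exists (M * N) => x; rewrite normrM ler_pM.
Qed.

Lemma bmeas_cst (c : R) : bmeas (fun=> c).
Proof. by split; [exact: measurable_cst|exists `|c|]. Qed.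

Lemma bmeas_sum (I : Type) (s : seq I) (F : I -> T -> R) :
  (forall i, bmeas (F i)) -> bmeas (fun x => \sum_(i <- s) F i x).
Proof.
move=> bF; elim: s => [|i s ih].
  by under eq_fun do rewrite big_nil; exact: bmeas_cst.
by under eq_fun do rewrite big_cons; exact: bmeasD.
Qed.

Lemma ExD f g : bmeas f -> bmeas g -> Ex (fun x => f x + g x) = Ex f + Ex g.
Proof. by move=> bf bg; rewrite /Ex RintegralD//; exact: bmeas_integrable. Qed.

Lemma ExB f g : bmeas f -> bmeas g -> Ex (fun x => f x - g x) = Ex f - Ex g.
Proof. by move=> bf bg; rewrite /Ex RintegralB//; exact: bmeas_integrable. Qed.

Lemma Ex_cst (c : R) : Ex (fun=> c) = c.
Proof. rewrite /Ex Rintegral_cst// [X in fine X](_ : _ = 1%E) ?mulr1//.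
exact: probability_setT. Qed.

Lemma ExZ (c : R) f : bmeas f -> Ex (fun x => c * f x) = c * Ex f.
Proof. by move=> bf; rewrite /Ex RintegralZl//; exact: bmeas_integrable. Qed.

Lemma le_Ex f g : bmeas f -> bmeas g -> (forall x, f x <= g x) -> Ex f <= Ex g.
Proof.
by move=> bf bg fg; apply: le_Rintegral => //; exact: bmeas_integrable.
Qed.

Lemma Ex_ge0 f : (forall x, 0 <= f x) -> 0 <= Ex f.
Proof. by move=> f0; apply: Rintegral_ge0. Qed.

Lemma Ex_sum (I : Type) (s : seq I) (F : I -> T -> R) :
  (forall i, bmeas (F i)) ->
  Ex (fun x => \sum_(i <- s) F i x) = \sum_(i <- s) Ex (F i).
Proof.
move=> bF; elim: s => [|i s ih].
  by under eq_fun do rewrite big_nil; rewrite Ex_cst big_nil.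
under eq_fun do rewrite big_cons.
by rewrite ExD ?ih ?big_cons//; exact: bmeas_sum.
Qed.

Lemma distr_Ex f g h : bmeas f -> bmeas g -> bmeas h ->
  (forall x, `|f x - g x| <= h x) -> `|Ex f - Ex g| <= Ex h.
Proof.
move=> bf bg bh fgh; rewrite -ExB// ler_norml; apply/andP; split.
  rewrite lerNl -mulN1r -ExZ; last exact: bmeasB.
  apply: le_Ex => //.
    by apply: bmeasM; [exact: bmeas_cst|exact: bmeasB].
  by move=> x; rewrite mulN1r opprB (le_trans _ (fgh x))// distrC ler_norm.
apply: le_Ex => //; first exact: bmeasB.
by move=> x; rewrite (le_trans _ (fgh x))// ler_norm.
Qed.

Lemma Ex_cvg (f_ : nat -> T -> R) f (M : R) :
  (forall n, measurable_fun [set: T] (f_ n)) -> (forall n x, `|f_ n x| <= M) ->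
  (forall x, f_ n x @[n --> \oo] --> f x) ->
  bmeas f /\ Ex (f_ n) @[n --> \oo] --> Ex f.
Proof.
move=> mf fM ff.
have bf_ n : bmeas (f_ n) by split => //; exists M.
have mfl : measurable_fun [set: T] f.
  by apply: (measurable_fun_cvg (h := f_)) => // x _; exact: ff.
have bfl : bmeas f.
  split=> //; exists M => x.
  have fl : `|f_ n x| @[n --> \oo] --> `|f x| by apply: cvg_norm; exact: ff.
  rewrite -(cvg_lim _ fl)//.
  apply: limr_le; last exact: nearW.
  by apply/cvg_ex; exists `|f x|.
split=> //.
have := @dominated_convergence _ T R P setT measurableT
  (fun n x => (f_ n x)%:E) (fun x => (f x)%:E) (fun=> M%:E).
case.
- by move=> n; exact/measurable_EFinP.
- exact/measurable_EFinP.
- by apply: aeW => x _; apply: cvg_EFin; [exact: nearW|exact: ff].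
- by apply: bmeas_integrable; exact: bmeas_cst.
- by apply: aeW => x n _; rewrite lee_fin.
move=> _ _ H; rewrite /Ex /Rintegral.
apply: fine_cvg; rewrite fineK//.
by apply: integrable_fin_num => //; exact: bmeas_integrable.
Qed.

Lemma Ex_indic (A : set T) : measurable A -> (Ex \1_A)%:E = P A.
Proof.
move=> mA; rewrite -ExE; last first.
  split; first exact: measurable_indic.
  by exists 1 => x; rewrite indicE; case: (_ \in _); rewrite ?normr1 ?normr0.
by rewrite expectation_indic.
Qed.

Lemma Ex_eq0 f : bmeas f -> (forall x, 0 <= f x) -> Ex f = 0 ->
  {ae P, forall x, f x = 0}.
Proof.
move=> bf f0 Ef0.
have := ae_eq_integral_abs P measurableT (f := EFin \o f) _.
case; first by apply/measurable_EFinP; case: bf.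
move=> + _; move=> H.
have /H : (\int[P]_(x in setT) `|(EFin \o f) x| = 0)%E.
  rewrite (eq_integral (EFin \o f)); last first.
    by move=> x _ /=; rewrite ger0_norm.
  by have := ExE bf; rewrite unlock Ef0.
by apply: filterS => x /(_ Logic.I) /= [].
Qed.

End real_expectation.

(** * Independence of generated sigma-algebras *)

Section sigma_independence.
Context d (T : measurableType d) (R : realType) (P : probability T R).
Variables (I : eqType) (C : I -> set_system T).
Hypothesis mC : forall i, C i `<=` measurable.
Hypothesis IC : forall i, setI_closed (C i).

Let msC i A : <<s C i >> A -> measurable A.
Proof.
by apply: smallest_sub; [exact: sigma_algebra_measurable|exact: mC].
Qed.

(** Pi-systems are enlarged to sigma-algebras one index at a time, by uniqueness of finite measures:
    for a fixed intersection [D] of the other events, [B] is sent to P(B and D) by one measure and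
    to P(B) P(D) by the other. *)
Lemma mutually_independent_sigma : mutually_independent P C ->
  mutually_independent P (fun i => <<s C i >>).
Proof.
move=> indC.
(* Interpolation for the induction: indices in [t] carry generated events, the others still carry
   generators. *)
suff H (t s : seq I) (A : I -> set T) : uniq s ->
    (forall i, i \in s -> if i \in t then <<s C i >> (A i) else C i (A i)) ->
    P (\bigcap_(i in [set` s]) A i) = (\prod_(i <- s) P (A i))%E.
  by move=> s A us sA; apply: (H s) => // i si; rewrite si; exact: sA.
elim: t s A => [|x t ih] s A us sA; first exact: indC.
have [xs|xs] := boolP (x \in s); last first.
  apply: ih => // i si; have := sA i si; rewrite inE.
  by case: eqVneq => // ix; rewrite -ix si in xs.
have [xt|xt] := boolP (x \in t).
  apply: ih => // i si; have := sA i si; rewrite inE.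
  by case: eqVneq => // ->; rewrite xt.
set s' := rem x s.
have us' : uniq s' by exact: rem_uniq.
have s's i : i \in s' = (i != x) && (i \in s) by rewrite mem_rem_uniq.
pose D := \bigcap_(i in [set` s']) A i.
have capE (A' : I -> set T) : (forall i, i \in s' -> A' i = A i) ->
    \bigcap_(i in [set` s]) A' i = A' x `&` D.
  move=> A'A; apply/seteqP; split => [w Aw|w [Ax Dw] i /= si].
    split; first by apply: Aw.
    move=> i /= i_s'; rewrite -A'A//; apply: Aw.
    by move: i_s'; rewrite s's => /andP[].
  have [->//|ix] := eqVneq i x.
  by rewrite A'A; [apply: Dw|]; rewrite /= s's ix.
have prodE (A' : I -> set T) : (forall i, i \in s' -> A' i = A i) ->
    (\prod_(i <- s) P (A' i) = P (A' x) * \prod_(i <- s') P (A i))%E.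
  move=> A'A; rewrite (perm_big _ (perm_to_rem xs)) big_cons; congr (_ * _)%E.
  by apply: eq_big_seq => i i_s'; rewrite A'A.
have mA i : i \in s' -> measurable (A i).
  rewrite s's => /andP[_ /sA]; case: ifP => _; [exact: msC|exact: mC].
have mD : measurable D by apply: fin_bigcap_measurable; [exact: finite_seq|exact: mA].
have PD : P D = (\prod_(i <- s') P (A i))%E.
  apply: ih => // i; rewrite s's => /andP[ix si].
  by have := sA i si; rewrite inE (negPf ix).
have PDfin : P D \is a fin_num by exact: fin_num_measure.
have c0 : 0 <= fine (P D) by rewrite fine_ge0.
pose m1 := mrestr P mD.
pose m2 := mscale (NngNum c0) P.
have m2E B : m2 B = (P B * P D)%E.
  by rewrite /m2 /mscale /= fineK// muleC.
(* The whole space is added to the generators as the exhausting sequence required by uniqueness of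
   measures; it keeps them closed under intersection. *)
pose G := C x `|` [set setT].
rewrite capE// prodE// -PD -m2E.
have m12 B : G B -> m1 B = m2 B.
  rewrite m2E /m1 /mrestr => -[CB|->]; last first.
    rewrite setTI [X in (_ = X * _)%E](_ : _ = 1%E) ?mul1e//.
    exact: probability_setT.
  pose A' i := if i == x then B else A i.
  have A'x : A' x = B by rewrite /A' eqxx.
  have A'A i : i \in s' -> A' i = A i by rewrite s's /A' => /andP[/negPf->].
  have := ih s A' us _; rewrite capE// prodE// A'x -PD => H.
  apply: H => i si.
  have := sA i si; rewrite inE /A'; case: eqVneq => // ->.
  by rewrite (negPf xt).
suff : forall B, <<s G >> B -> m1 B = m2 B.
  apply; have := sA _ xs; rewrite mem_head; apply: sub_smallest2r.
    exact: smallest_sigma_algebra.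
  by move=> B; left.
apply: (@g_sigma_algebra_measure_unique _ R T G _ (fun=> setT)) => //.
- by move=> B [/mC//|->]; exact: measurableT.
- by move=> i; right.
- by rewrite bigcup_const//; exists 0%N.
- move=> B B' [CB|->] [CB'|->]; rewrite ?setIT ?setTI; [|by left..|by right].
  by left; exact: IC.
- by move=> _; rewrite -[X in (X < _)%E]/(P (setT `&` D)) setTI ltey_eq PDfin.
Qed.

End sigma_independence.

Lemma minr_lip (R : realType) (c a b : R) :
  `|Num.min c a - Num.min c b| <= `|a - b|.
Proof.
by case: (leP c a) => a1; case: (leP c b) => b1;
  rewrite ler_norml; case: (ger0P (a - b)); lra.
Qed.

Lemma cvg_bigprod (R : realType) (T I : Type) (F : set_system T) (FF : Filter F)
    (s : seq I) (f : I -> T -> R) (l : I -> R) :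
  (forall i, f i x @[x --> F] --> l i) ->
  \prod_(i <- s) f i x @[x --> F] --> \prod_(i <- s) l i.
Proof.
move=> fl; elim: s => [|i s ih].
  by rewrite big_nil; under eq_fun do rewrite big_nil; exact: cvg_cst.
by rewrite big_cons; under eq_fun do rewrite big_cons; exact: cvgM.
Qed.

(** * Lipschitz test functions and laws in a normed space *)

Section test_functions.
Variables (R : realType) (E : normedModType R).
Implicit Types (U : set E) (f g : E) (phi : E -> R).

(** Lipschitz rather than merely continuous: such functions already determine laws, and a Lipschitz
    constant turns closeness of random elements into closeness of expectations. *)
Definition tests phi := (forall x, 0 <= phi x <= 1) /\
  exists L : R, forall x y, `|phi x - phi y| <= L * `|x - y|.

(** The distance to the complement of [U], truncated at 1; the point 1 also keeps the set nonempty
    when [U] is the whole space. *)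
Definition dist_compl U f : R := inf ([set `|f - h| | h in ~` U] `|` [set 1]).

Let lbS U f : lbound ([set `|f - h| | h in ~` U] `|` [set 1]) 0.
Proof. by move=> _ [[h _ <-]|->]. Qed.

Let hlb U f : has_lbound ([set `|f - h| | h in ~` U] `|` [set 1]).
Proof. by exists 0; exact: lbS. Qed.

Lemma dist_compl_ge0 U f : 0 <= dist_compl U f.
Proof. by apply: lb_le_inf; [exists 1; right|exact: lbS]. Qed.

Lemma dist_compl_le1 U f : dist_compl U f <= 1.
Proof. by apply: ge_inf; [exact: hlb|right]. Qed.

Lemma dist_compl_le U f h : ~ U h -> dist_compl U f <= `|f - h|.
Proof. by move=> Uh; apply: ge_inf; [exact: hlb|left; exists h]. Qed.

Lemma dist_compl_lip U f g : `|dist_compl U f - dist_compl U g| <= `|f - g|.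
Proof.
have H f' g' : dist_compl U f' - dist_compl U g' <= `|f' - g'|.
  rewrite lerBlDr -lerBlDl; apply: lb_le_inf; first by exists 1; right.
  move=> _ [[h Uh <-]|->].
    rewrite lerBlDl; apply: le_trans (dist_compl_le f' Uh) _.
    exact: ler_distD.
  by rewrite lerBlDl (le_trans (dist_compl_le1 _ _))// lerDr.
by rewrite ler_norml H lerNl opprB distrC H.
Qed.

Lemma dist_compl_gt0 U f : open U -> (0 < dist_compl U f) <-> U f.
Proof.
move=> oU; split=> [d0|Uf].
  apply: contrapT => Uf; have := dist_compl_le f Uf.
  by rewrite subrr normr0 leNgt d0.
have /nbhs_ballP[e /= e0 eU] : nbhs f U by exact: open_nbhs_nbhs.
apply: (@lt_le_trans _ _ (Num.min e 1)); first by rewrite lt_min e0 ltr01.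
apply: lb_le_inf; first by exists 1; right.
move=> _ [[h Uh <-]|->]; last by rewrite ge_min lexx orbT.
rewrite ge_min leNgt; apply/orP; left; apply/negP => fh.
by apply: Uh; apply: eU; rewrite -ball_normE.
Qed.

(** For open [U] these tests increase to the indicator of [U], which carries statements about tests
    over to open sets. *)
Definition near_indic U (n : nat) f : R := Num.min 1 (n%:R * dist_compl U f).

Lemma near_indic_tests U n : tests (near_indic U n).
Proof.
split=> [x|].
  by rewrite /near_indic ge_min lexx le_min ler01 mulr_ge0// dist_compl_ge0.
exists n%:R => x y; rewrite /near_indic.
apply: (@le_trans _ _ `|n%:R * dist_compl U x - n%:R * dist_compl U y|).
  exact: minr_lip.
rewrite -mulrBr normrM normr_nat ler_wpM2l//; exact: dist_compl_lip.
Qed.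

Lemma near_indic_cvg U f : open U ->
  near_indic U n f @[n --> \oo] --> (\1_U f : R).
Proof.
move=> oU; rewrite indicE; case: (pselect (U f)) => Uf; last first.
  rewrite memNset//; have -> : (fun n => near_indic U n f) = fun=> 0.
    apply/funext => n; rewrite /near_indic.
    have -> : dist_compl U f = 0.
      apply/eqP; rewrite eq_le dist_compl_ge0 andbT leNgt.
      by apply/negP => /dist_compl_gt0-/(_ oU).
    by rewrite mulr0; apply/min_idPr.
  exact: cvg_cst.
rewrite mem_set//; have d0 := (dist_compl_gt0 f oU).2 Uf.
apply: cvg_near_cst; near=> n; rewrite /near_indic; apply/min_idPl.
rewrite -ler_pdivrMr// div1r; near: n; exact: nbhs_infty_ger.
Unshelve. all: by end_near. Qed.

Lemma tests_continuous phi : tests phi -> continuous phi.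
Proof.
move=> [_ [L phiL]] x; apply/cvgrPdist_le => e e0.
have L1 : 0 < `|L| + 1 by rewrite ltr_wpDl.
near=> y; apply: le_trans (phiL _ _) _.
apply: (@le_trans _ _ ((`|L| + 1) * `|x - y|)).
  by rewrite ler_wpM2r// (le_trans (ler_norm _))// lerDl.
rewrite mulrC -ler_pdivlMr//; near: y.
have : 0 < e / (`|L| + 1) by exact: divr_gt0.
by move: (e / _); apply: (@cvgrPdist_le _ _ _ _ _ id x).1; exact: cvg_id.
Unshelve. all: by end_near. Qed.

End test_functions.

Section random_elements_tests.
Context d (Om : measurableType d) (R : realType) (P : probability Om R).

Lemma random_element_cont (S : topologicalType) (X : Om -> S) (phi : S -> R) :
  random_element X -> continuous phi -> measurable_fun [set: Om] (phi \o X).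
Proof.
move=> rX cphi; apply: (measurability _ (RGenOInfty.measurableE R)) => //.
move=> _ [_ [x ->] <-]; rewrite setTI comp_preimage; apply: rX.
apply: sub_sigma_algebra; apply: open_comp; last exact: rray_open.
by move=> y _; exact: cphi.
Qed.

Lemma random_element_preimage (S : topologicalType) (X : Om -> S) :
  (forall U, open U -> measurable (X @^-1` U)) -> random_element X.
Proof.
move=> mX B; apply: (@smallest_sub _ _ _ [set B | measurable (X @^-1` B)]) => //.
split=> /= [|A mA|F mF].
- by rewrite preimage_set0; exact: measurable0.
- by rewrite setTD preimage_setC; exact: measurableC.
- by rewrite preimage_bigcup; exact: bigcupT_measurable.
Qed.

Variable E : normedModType R.
Implicit Types X Y : Om -> E.

Lemma random_element_tests X :
  (forall phi, tests phi -> measurable_fun [set: Om] (phi \o X)) -> random_element X.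
Proof.
move=> mX; apply: random_element_preimage => U oU.
have -> : X @^-1` U = (near_indic U 1 \o X) @^-1` `]0, +oo[.
  apply/seteqP; split => w /=; rewrite in_itv /= andbT /near_indic lt_min ltr01 mul1r.
    by move/(dist_compl_gt0 _ oU).
  by move/(dist_compl_gt0 _ oU).
rewrite -[X in measurable X]setTI; apply: mX => //; exact: near_indic_tests.
Qed.

Lemma tests_bmeas X phi : random_element X -> tests phi -> bmeas (phi \o X).
Proof.
move=> rX tphi; split.
  by apply: random_element_cont => //; exact: tests_continuous.
exists 1 => w /=; have /andP[h0 h1] := tphi.1 (X w).
by rewrite ger0_norm.
Qed.

Lemma near_indic_Ex X U : random_element X -> open U ->
  Ex P (near_indic U n \o X) @[n --> \oo] --> fine (P (X @^-1` U)).
Proof.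
move=> rX oU; have mU : measurable (X @^-1` U).
  by apply: rX; exact: sub_sigma_algebra.
have -> : fine (P (X @^-1` U)) = Ex P (\1_U \o X).
  by rewrite -[RHS]/(fine (Ex P \1_(X @^-1` U))%:E) Ex_indic.
apply: (Ex_cvg P (M := 1) _ _ _).2.
- by move=> n; case: (tests_bmeas rX (near_indic_tests U n)).
- move=> n w; have /andP[h0 h1] := (near_indic_tests U n).1 (X w).
  by rewrite /= ger0_norm.
- by move=> w; exact: near_indic_cvg.
Qed.

(** Open sets form a pi-system that generates the Borel sets, and their probabilities are limits of
    expectations of tests. *)
Lemma same_law_tests X Y : random_element X -> random_element Y ->
  (forall phi, tests phi -> Ex P (phi \o X) = Ex P (phi \o Y)) ->
  same_law P X Y.
Proof.
move=> rX rY XY.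
pose G := g_sigma_algebraType (@open E).
have mX : measurable_fun setT (X : Om -> G) by move=> _ B mB; rewrite setTI; exact: rX.
have mY : measurable_fun setT (Y : Om -> G) by move=> _ B mB; rewrite setTI; exact: rY.
pose X' : {RV P >-> G} := HB.pack (X : Om -> G) (isMeasurableFun.Build _ _ _ _ _ mX).
pose Y' : {RV P >-> G} := HB.pack (Y : Om -> G) (isMeasurableFun.Build _ _ _ _ _ mY).
move=> B mB; rewrite -[LHS]/(distribution P X' B) -[RHS]/(distribution P Y' B).
apply: (measure_unique (@open E : set (set G)) (fun=> setT)) => //.
- by move=> A A'; exact: openI.
- by move=> _; exact: openT.
- by rewrite bigcup_const//; exists 0%N.
- move=> U oU; rewrite /= /distribution /pushforward.
  have mXU : measurable (X @^-1` U) by apply: rX; exact: sub_sigma_algebra.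
  have mYU : measurable (Y @^-1` U) by apply: rY; exact: sub_sigma_algebra.
  rewrite -[LHS]fineK ?fin_num_measure// -[RHS]fineK ?fin_num_measure//.
  congr (_%:E).
  apply: (cvg_unique _ (near_indic_Ex rX oU)).
    exact: norm_hausdorff.
  rewrite (_ : (fun n => _) = (fun n => Ex P (near_indic U n \o Y))).
    exact: near_indic_Ex.
  by apply/funext => n; apply: XY; exact: near_indic_tests.
- by move=> _; rewrite ltey_eq fin_num_measure.
Qed.

Lemma independent_tests (X : nat -> Om -> E) :
  (forall k, random_element (X k)) ->
  (forall m (phi : nat -> E -> R), (forall j, tests (phi j)) ->
     Ex P (fun w => \prod_(j < m) phi j (X j w)) =
     \prod_(j < m) Ex P (phi j \o X j)) ->
  mutually_independent P (fun k => [set X k @^-1` B | B in <<s @open E >>]).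
Proof.
move=> rX indX.
pose C k : set_system Om := [set X k @^-1` U | U in @open E].
have mC k : C k `<=` measurable.
  by move=> _ [U oU <-]; apply: rX; exact: sub_sigma_algebra.
have IC k : setI_closed (C k).
  by move=> _ _ [U oU <-] [V oV <-]; exists (U `&` V); [exact: openI|].
have indC : mutually_independent P C.
  move=> s A us sA.
  have [U UP] : exists U : nat -> set E, forall i, i \in s -> open (U i) /\ A i = X i @^-1` U i.
    have H i : exists U, i \in s -> open U /\ A i = X i @^-1` U.
      have [/sA[U oU UA]|_] := boolP (i \in s); last by exists setT.
      by exists U.
    by have [U UP] := choice H; exists U.
  (* Indices outside [s] receive the whole space, so that the product runs over an initial segment,
     the form in which [indX] is given. *)
  pose V i := if i \in s then U i else setT.
  have oV i : open (V i) by rewrite /V; case: ifP => [/UP[]//|_]; exact: openT.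
  pose m := (\max_(i <- s) i).+1.
  have sm i : i \in s -> (i < m)%N.
    by move=> si; rewrite ltnS; exact: (@leq_bigmax_seq _ s predT id).
  have mV i : measurable (X i @^-1` V i) by apply: rX; exact: sub_sigma_algebra.
  have capE : \bigcap_(i in [set` s]) A i = \bigcap_(i in `I_m) X i @^-1` V i.
    apply/seteqP; split => w H i /=.
      rewrite /V; case: ifPn => // si _; have := H i si.
      by have [_ ->] := UP _ si.
    move=> si; have := H i (sm _ si); rewrite /V si.
    by have [_ ->] := UP _ si.
  have prodE : (\prod_(i <- s) P (A i) = \prod_(j < m) P (X j @^-1` V j))%E.
    rewrite -(big_mkord xpredT (fun j => P (X j @^-1` V j))) /index_iota subn0.
    have -> : (\prod_(0 <= j < m) P (X j @^-1` V j) =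
        \prod_(0 <= j < m | j \in s) P (A j))%E.
      rewrite [RHS]big_mkcond; apply: eq_bigr => j _; rewrite /V.
      case: ifPn => [si|_]; first by have [_ ->] := UP _ si.
      by rewrite preimage_setT [LHS]probability_setT.
    rewrite -[RHS]big_filter; apply: perm_big; apply: uniq_perm => //.
      by rewrite filter_uniq// iota_uniq.
    move=> i; rewrite mem_filter mem_index_iota /=.
    by case: (boolP (i \in s)) => // /sm ->.
  have L1 : Ex P (fun w => \prod_(j < m) near_indic (V j) n (X j w)) @[n --> \oo]
      --> fine (P (\bigcap_(i in `I_m) X i @^-1` V i)).
    have mcap : measurable (\bigcap_(i in `I_m) X i @^-1` V i).
      by apply: fin_bigcap_measurable; [exact: finite_II|move=> i _; exact: mV].
    rewrite -[X in _ --> fine X]Ex_indic//=.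
    apply: (Ex_cvg P (M := 1) _ _ _).2.
    - move=> n; apply: measurable_prod => j _.
      by case: (tests_bmeas (rX j) (near_indic_tests (V j) n)).
    - move=> n w; rewrite normr_prod; apply: prodr_ile1 => j _.
      have /andP[h0 h1] := (near_indic_tests (V j) n).1 (X j w).
      by rewrite normr_ge0 ger0_norm.
    - move=> w; have -> : \1_(\bigcap_(i in `I_m) X i @^-1` V i) w =
          \prod_(j < m) (\1_(V j) (X j w) : R).
        rewrite indicE; have [/set_mem H|/negP H] := boolP (w \in _).
          rewrite big1// => j _; rewrite indicE mem_set//.
          by apply: H => /=.
        have [j Vj] : exists j : 'I_m, ~ V j (X j w).
          apply: contrapT => /forallNP K; apply: H; apply/mem_set => i im.
          by have /contrapT := K (Ordinal im).
        by rewrite (bigD1 j)//= indicE memNset// mul0r.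
      by apply: cvg_bigprod => j; exact: near_indic_cvg.
  have L2 : (\prod_(j < m) Ex P (near_indic (V j) n \o X j)) @[n --> \oo]
      --> \prod_(j < m) fine (P (X j @^-1` V j)).
    by apply: cvg_bigprod => j; exact: near_indic_Ex.
  rewrite capE prodE -[LHS]fineK; last first.
    apply: fin_num_measure.
    by apply: fin_bigcap_measurable; [exact: finite_II|move=> i _; exact: mV].
  have -> : (\prod_(j < m) P (X j @^-1` V j) = (\prod_(j < m) fine (P (X j @^-1` V j)))%:E)%E.
    rewrite -prodEFin; apply: eq_bigr => j _.
    by rewrite fineK// fin_num_measure.
  congr (_%:E); apply: (cvg_unique _ L1); first exact: norm_hausdorff.
  rewrite (_ : (fun n => _) =
    (fun n => \prod_(j < m) Ex P (near_indic (V j) n \o X j)))//.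
  apply/funext => n; apply: (indX m (fun j => near_indic (V j) n)) => j.
  exact: near_indic_tests.
move=> s A us sA; apply: (mutually_independent_sigma mC IC indC) => // i si.
have [B BB <-] := sA _ si.
move: B BB; apply: smallest_sub.
  split=> /= [|B mB|F mF].
  - by rewrite preimage_set0; apply: sigma_algebra0; exact: smallest_sigma_algebra.
  - rewrite setTD preimage_setC -setTD.
    by apply: sigma_algebraCD => //; exact: smallest_sigma_algebra.
  - rewrite preimage_bigcup; exact: sigma_algebra_bigcup.
by move=> U oU; apply: sub_sigma_algebra; exists U.
Qed.

End random_elements_tests.

(** * Finite-dimensional convergence from convergence in the Skorohod topology *)

Section smooth_evaluation.
Variables (R : realType) (E : normedModType R).
Implicit Types (x y : cadlag E) (Psi : (nat -> E) -> R) (s u : nat -> R).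

(** The sum stops at [k], so the bound also forces [Psi] to depend on the first [k] coordinates
    only. *)
Definition mlip (k : nat) (L : R) Psi :=
  forall a b, `|Psi a - Psi b| <= L * \sum_(j < k) `|a j - b j|.

Definition mtests (k : nat) (L : R) Psi :=
  [/\ 0 <= L, (forall a, 0 <= Psi a <= 1) & mlip k L Psi].

(** The penalty is centred at [s j + eps] instead of [s j]: a positive term forces
    [s j < u j < s j + 2 * eps] for every [j < k], to the right of [s j], where right continuity
    controls the path. *)
Definition smooth_term k s (eps : R) Psi x u : R :=
  Num.max 0 (Psi (fun j => x (u j)) - \sum_(j < k) `|u j - (s j + eps)| / eps).

(* Unlike evaluation at fixed times, this supremum is continuous for the Skorohod topology; by right
   continuity it tends to Psi (x \o s) as eps tends to 0. *)
Definition smooth_eval k s (eps : R) Psi x : R :=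
  sup [set smooth_term k s eps Psi x u | u in [set u | forall j, 0 <= u j]].

Variables (k : nat) (s : nat -> R) (eps L : R) (Psi : (nat -> E) -> R).
Hypotheses (s0 : forall j, 0 <= s j) (eps0 : 0 < eps).
Hypothesis tPsi : mtests k L Psi.

Let pen u := \sum_(j < k) `|u j - (s j + eps)| / eps.

Let pen_ge0 u : 0 <= pen u.
Proof. by apply: sumr_ge0 => j _; rewrite divr_ge0// ltW. Qed.

Let L0 : 0 <= L. Proof. by case: tPsi. Qed.
Let Psi01 a : 0 <= Psi a <= 1. Proof. by case: tPsi. Qed.
Let Psilip : mlip k L Psi. Proof. by case: tPsi. Qed.

Lemma smooth_term_le1 x u : smooth_term k s eps Psi x u <= 1.
Proof.
rewrite /smooth_term ge_max ler01 /= -/(pen u).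
have /andP[_ h1] := Psi01 (fun j => x (u j)).
by rewrite lerBlDr (le_trans h1)// lerDl.
Qed.

Lemma smooth_term_le_eval x u : (forall j, 0 <= u j) ->
  smooth_term k s eps Psi x u <= smooth_eval k s eps Psi x.
Proof.
move=> u0; apply: ub_le_sup; last by exists u.
by exists 1 => _ [v _ <-]; exact: smooth_term_le1.
Qed.

Lemma smooth_eval_le x (M : R) :
  (forall u, (forall j, 0 <= u j) -> smooth_term k s eps Psi x u <= M) ->
  smooth_eval k s eps Psi x <= M.
Proof.
move=> uM; apply: ge_sup; last by move=> _ [u u0 <-]; exact: uM.
by exists (smooth_term k s eps Psi x s), s.
Qed.

Lemma smooth_eval_ge0 x : 0 <= smooth_eval k s eps Psi x.
Proof.
by apply: le_trans (smooth_term_le_eval x s0); rewrite /smooth_term le_max lexx.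
Qed.

Lemma smooth_eval_le1 x : smooth_eval k s eps Psi x <= 1.
Proof. by apply: smooth_eval_le => u _; exact: smooth_term_le1. Qed.

Lemma smooth_term_gt0 x u : 0 < smooth_term k s eps Psi x u ->
  forall j, (j < k)%N -> s j < u j < s j + 2 * eps.
Proof.
rewrite /smooth_term lt_max ltxx /= -/(pen u) => h j jk.
have /andP[_ h1] := Psi01 (fun j => x (u j)).
have : `|u (Ordinal jk) - (s (Ordinal jk) + eps)| / eps <= pen u.
  rewrite /pen (bigD1 (Ordinal jk))//= lerDl.
  by apply: sumr_ge0 => i _; rewrite divr_ge0// ltW.
rewrite /= => h2; have : `|u j - (s j + eps)| / eps < 1 by lra.
by rewrite ltr_pdivrMr// mul1r ltr_norml; lra.
Qed.

(** Only times with a positive term matter, so paths are compared on bounded windows. Moving a time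
    by [e] costs at most [e / eps] in the penalty and moving a value by [e] costs at most [L * e],
    for each of the [k] coordinates. *)
Let le_compare x y e (D := (L + eps^-1) * k%:R * e) : 0 <= e ->
  (forall u, (forall j, 0 <= u j) ->
     (forall j, (j < k)%N -> s j < u j < s j + 2 * eps) ->
   exists2 v, (forall j, 0 <= v j) & forall j, (j < k)%N ->
     `|u j - v j| <= e /\ `|y (u j) - x (v j)| <= e) ->
  smooth_eval k s eps Psi y <= smooth_eval k s eps Psi x + D.
Proof.
move=> e0 yx; have D0 : 0 <= D.
  by do 2 apply: mulr_ge0 => //; apply: addr_ge0 => //; rewrite invr_ge0 ltW.
apply: smooth_eval_le => u u0.
have [h|h] := leP (smooth_term k s eps Psi y u) 0.
  by rewrite (le_trans h)// addr_ge0// smooth_eval_ge0.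
have [v v0 uv] := yx u u0 (smooth_term_gt0 h).
have : smooth_term k s eps Psi x v <= smooth_eval k s eps Psi x.
  exact: smooth_term_le_eval.
suff : smooth_term k s eps Psi y u <= smooth_term k s eps Psi x v + D by lra.
have h1 : `|Psi (fun j => y (u j)) - Psi (fun j => x (v j))| <= L * (k%:R * e).
  apply: le_trans (Psilip _ _) _; rewrite ler_wpM2l//.
  rewrite -[X in X%:R * e]card_ord -sumr_const mulr_suml.
  by apply: ler_sum => j _; rewrite mul1r; exact: (uv _ (ltn_ord j)).2.
have h2 : pen v <= pen u + eps^-1 * (k%:R * e).
  rewrite -[X in X%:R * e]card_ord -sumr_const mulr_suml mulr_sumr -big_split/=.
  apply: ler_sum => j _; rewrite mul1r mulrC [eps^-1 * e]mulrC [X in _ <= X + _]mulrC.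
  rewrite -[X in _ <= X + _]mulrC -mulrDl mulrC ler_wpM2r ?invr_ge0 ?(ltW eps0)//.
  have [] := uv _ (ltn_ord j).
  rewrite ler_norml => /andP[a b] _.
  by rewrite ler_norml; case: (ger0P (u j - _)); lra.
rewrite /smooth_term -/(pen u) -/(pen v) ge_max; apply/andP; split.
  by rewrite addr_ge0// le_max lexx.
rewrite -lerBlDr le_max; apply/orP; right.
move: h1; rewrite ler_norml /D mulrDl mulrDl -!mulrA => /andP[]; lra.
Qed.

Lemma smooth_eval_continuous : continuous (smooth_eval k s eps Psi).
Proof.
apply/continuousP => U oU.
suff : skorohod_open (smooth_eval k s eps Psi @^-1` U) by [].
move=> x Ux.
have /nbhs_ballP[eta /= eta0 etaU] : nbhs (smooth_eval k s eps Psi x) U.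
  exact: open_nbhs_nbhs.
pose C := (L + eps^-1) * k%:R.
have C0 : 0 <= C by rewrite /C mulr_ge0// addr_ge0// invr_ge0 ltW.
pose e := Num.min 1 (eta / 2 / (C + 1)).
have e0 : 0 < e by rewrite lt_min ltr01 /= !divr_gt0// ltr_wpDl.
have e1 : e <= 1 by rewrite ge_min lexx.
have Ce : C * e < eta.
  apply: (@le_lt_trans _ _ ((C + 1) * e)); first by rewrite ler_wpM2r ?(ltW e0)// lerDl.
  apply: (@le_lt_trans _ _ (eta / 2)); last by lra.
  rewrite mulrC -ler_pdivlMr ?ltr_wpDl//.
  by rewrite ge_min lexx orbT.
(* A horizon beyond all windows, with a margin of 1 because the time change moves times by less than
   [e <= 1]. *)
pose T := 1 + \sum_(j < k) (s j + 2 * eps).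
have sT j : (j < k)%N -> s j + 2 * eps <= T - 1.
  move=> jk; rewrite /T addrAC subrr add0r (bigD1 (Ordinal jk))//= lerDl.
  by apply: sumr_ge0 => i _; rewrite addr_ge0// mulr_ge0// ltW.
exists T, e; split=> // y [l [l0 lmono lsurj] [lt ly]]; apply: etaU.
have lge0 t : 0 <= t -> 0 <= l t.
  rewrite le_eqVlt => /predU1P[<-|t0]; first by rewrite l0.
  by rewrite ltW// -l0 lmono ?nnegrE// ltW.
rewrite -ball_normE /= ltr_norml; apply/andP; split.
  rewrite ltrNl opprB ltrBlDl; apply: le_lt_trans (le_compare (x := x) (y := y) (ltW e0) _) _.
    move=> u u0 us.
    (* Times of [y] are pulled back by surjectivity of the time change; in the opposite comparison
       times of [x] are pushed forward by [l]. *)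
    have [t tP] := choice (fun j : nat => let: ex_intro2 t a b := lsurj _ (u0 j) in
      ex_intro (fun t => 0 <= t /\ l t = u j) t (conj a b)).
    exists t => j; first by case: (tP j).
    move=> jk; have [t0 <-] := tP j.
    have ltt := lt _ t0; split; first exact: ltW.
    apply/ltW/ly; rewrite t0 /=.
    have := us j jk; have := sT j jk; have [_ <-] := tP j.
    by move: ltt; rewrite ltr_norml; lra.
  by rewrite -/C ltrD2l.
rewrite ltrBlDl; apply: le_lt_trans (le_compare (x := y) (y := x) (ltW e0) _) _.
  move=> u u0 us; exists (l \o u) => j; first exact: lge0.
  move=> jk; split; first by rewrite distrC ltW// lt.
  rewrite distrC; apply/ltW/ly; rewrite u0 /=.
  by have := us j jk; have := sT j jk; lra.
by rewrite -/C ltrD2l.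
Qed.

Lemma smooth_eval_approx x (delta : nat -> R) :
  (forall j v, (j < k)%N -> s j < v < s j + 2 * eps -> `|x v - x (s j)| <= delta j) ->
  `|smooth_eval k s eps Psi x - Psi (fun j => x (s j))| <= L * \sum_(j < k) delta j.
Proof.
move=> xd; set D := L * _; set p := Psi _.
have p0 : 0 <= p by case/andP: (Psi01 (fun j => x (s j))).
have d0 j : (j < k)%N -> 0 <= delta j.
  move=> jk; apply: le_trans (xd j (s j + eps) jk _) => //.
  by move: eps0; lra.
have D0 : 0 <= D by rewrite mulr_ge0// sumr_ge0// => j _; exact: d0.
have close u : (forall j, (j < k)%N -> s j < u j < s j + 2 * eps) ->
    `|Psi (fun j => x (u j)) - p| <= D.
  move=> us; apply: le_trans (Psilip _ _) _; rewrite ler_wpM2l//.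
  by apply: ler_sum => j _; apply: xd => //; exact: us.
have h1 : smooth_eval k s eps Psi x <= p + D.
  apply: smooth_eval_le => u u0.
  have [h|h] := leP (smooth_term k s eps Psi x u) 0.
    by rewrite (le_trans h)// addr_ge0.
  have := close u (smooth_term_gt0 h); rewrite ler_norml => /andP[_ h2].
  rewrite /smooth_term -/(pen u) ge_max addr_ge0//=.
  by have := pen_ge0 u; lra.
have h2 : p <= smooth_eval k s eps Psi x + D.
  (* The centres of the windows carry no penalty. *)
  pose u j := s j + eps.
  have u0 j : 0 <= u j by rewrite addr_ge0// ltW.
  have := smooth_term_le_eval x u0.
  have : `|Psi (fun j => x (u j)) - p| <= D.
    by apply: close => j _; rewrite /u; move: eps0; lra.
  have pu : pen u = 0.
    by rewrite /pen big1// => j _; rewrite /u subrr normr0 mul0r.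
  rewrite ler_norml /smooth_term -/(pen u) pu subr0.
  have /andP[+ _] := Psi01 (fun j => x (u j)).
  by move=> /max_idPr ->; lra.
by rewrite ler_norml; lra.
Qed.

End smooth_evaluation.

Section cadlag_limits.
Variables (R : realType) (E : normedModType R).
Implicit Types (x : cadlag E) (Psi : (nat -> E) -> R) (s : nat -> R).

Lemma pos_lower_bound (dl : nat -> R) k : (forall j, 0 < dl j) ->
  exists2 m, 0 < m & forall j, (j < k)%N -> m <= dl j.
Proof.
move=> dl0; elim: k => [|k [m m0 mP]]; first by exists 1.
exists (Num.min m (dl k)); first by rewrite lt_min m0 dl0.
move=> j; rewrite ltnS leq_eqVlt => /predU1P[->|/mP mj].
  by rewrite ge_min lexx orbT.
by rewrite ge_min mj.
Qed.

Lemma cadlag_right x t e : 0 <= t -> 0 < e ->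
  exists2 dl, 0 < dl & forall v, t <= v < t + dl -> `|x v - x t| < e.
Proof.
move=> t0 e0; have /asboolP[[xr _] _] := cadlagP x.
have /cvgrPdist_lt/(_ _ e0) := xr t t0.
move=> /nbhs_ballP[dl /= dl0 H]; exists dl => // v /andP[].
rewrite le_eqVlt => /predU1P[<-|tv] vt; first by rewrite subrr normr0.
rewrite distrC; apply: H => //; rewrite /ball/= distrC ger0_norm; lra.
Qed.

Lemma smooth_eval_cvg x k s L Psi : (forall j, 0 <= s j) -> mtests k L Psi ->
  smooth_eval k s n.+1%:R^-1 Psi x @[n --> \oo] --> Psi (fun j => x (s j)).
Proof.
move=> s0 tPsi; have [L0 _ _] := tPsi; apply/cvgrPdist_le => e e0.
pose e' := e / (L * k%:R + 1).
have Lk1 : 0 < L * k%:R + 1 by rewrite ltr_wpDl// mulr_ge0.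
have e'0 : 0 < e' by exact: divr_gt0.
have [dl dlP] := choice (fun j => let: ex_intro2 dl a b := @cadlag_right x (s j) e' (s0 j) e'0 in
   ex_intro (fun dl => 0 < dl /\ forall v, s j <= v < s j + dl -> `|x v - x (s j)| < e') dl (conj a b)).
have [m m0 mP] := pos_lower_bound k (fun j => (dlP j).1).
have m2 : 0 < m / 2 by rewrite divr_gt0.
near=> n.
have n2 : 2 * n.+1%:R^-1 < m.
  rewrite mulrC -ltr_pdivlMr//; near: n.
  exact: (near_infty_natSinv_lt (PosNum m2)).
rewrite distrC; apply: le_trans (smooth_eval_approx (delta := fun=> e') s0 _ tPsi _) _.
- by rewrite invr_gt0.
- move=> j v jk /andP[sv vs]; apply/ltW/(dlP j).2.
  rewrite ltW//=; apply: lt_le_trans vs _.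
  by rewrite lerD2l (le_trans (ltW n2))// mP.
- rewrite sumr_const card_ord -mulr_natl mulrA /e' mulrCA ger_pMr//.
  by rewrite ler_pdivrMr// mul1r lerDl.
Unshelve. all: by end_near. Qed.

Variables (d : measure_display) (Om : measurableType d).
Variable g : Om -> cadlag E.
Hypothesis rg : random_element g.

Lemma smooth_eval_bmeas k s L Psi eps : (forall j, 0 <= s j) -> 0 < eps ->
  mtests k L Psi -> bmeas (fun w => smooth_eval k s eps Psi (g w)).
Proof.
move=> s0 eps0 tPsi; split.
  apply: (random_element_cont rg (phi := smooth_eval k s eps Psi)).
  exact: smooth_eval_continuous s0 eps0 tPsi.
exists 1 => w; rewrite ger0_norm ?(smooth_eval_ge0 s0 eps0 tPsi)//.
exact: (smooth_eval_le1 s0 eps0 tPsi).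
Qed.

Lemma smooth_eval_Ex (P : probability Om R) k s L Psi :
  (forall j, 0 <= s j) -> mtests k L Psi ->
  bmeas (fun w => Psi (fun j => g w (s j))) /\
  Ex P (fun w => smooth_eval k s n.+1%:R^-1 Psi (g w)) @[n --> \oo]
    --> Ex P (fun w => Psi (fun j => g w (s j))).
Proof.
move=> s0 tPsi; apply: (Ex_cvg P (M := 1)).
- by move=> n; case: (smooth_eval_bmeas s0 _ tPsi (eps := n.+1%:R^-1)); rewrite ?invr_gt0.
- move=> n w; have n0 : 0 < n.+1%:R^-1 :> R by rewrite invr_gt0.
  rewrite ger0_norm ?(smooth_eval_ge0 s0 n0 tPsi)//.
  exact: (smooth_eval_le1 s0 n0 tPsi).
- by move=> w; exact: smooth_eval_cvg tPsi.
Qed.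

End cadlag_limits.

Section finite_dimensional_convergence.
Variables (R : realType) (E : normedModType R).
Variables (d d' : measure_display) (Om : measurableType d) (Om' : measurableType d').
Variables (P : probability Om R) (Q : probability Om' R).
Variables (X : nat -> Om -> cadlag E) (g : Om' -> cadlag E).
Hypotheses (rg : random_element g) (gX : cvg_in_law P Q X g).
Hypothesis X0 : forall N w, X N w 0 = 0.
Hypothesis mX : forall N k s eps L Psi, (forall j, 0 <= s j) -> 0 < eps ->
  mtests k L Psi -> measurable_fun [set: Om] (fun w => smooth_eval k s eps Psi (X N w)).
Hypothesis mX' : forall N k s L Psi, (forall j, 0 <= s j) ->
  mtests k L Psi -> measurable_fun [set: Om] (fun w => Psi (fun j => X N w (s j))).
Hypothesis X_mono : forall N w s v t, 0 <= s -> s <= v <= t ->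
  `|X N w v - X N w s| <= `|X N w t - X N w s|.
Hypothesis X_incr : forall s eps, 0 <= s -> 0 < eps -> \forall N \near \oo,
  Ex P (fun w => Num.min 1 `|X N w (s + eps) - X N w s|) <=
  Ex P (fun w => Num.min 1 `|X N w (2 * eps)|).

Lemma cvg_in_law_Ex (Phi : cadlag E -> R) : continuous Phi ->
  (forall x, 0 <= Phi x <= 1) ->
  (forall N, measurable_fun [set: Om] (Phi \o X N)) ->
  Ex P (Phi \o X N) @[N --> \oo] --> Ex Q (Phi \o g).
Proof.
move=> cPhi Phi01 mPhi.
have Phi1 x : `|Phi x| <= 1 by have /andP[? ?] := Phi01 x; rewrite ger0_norm.
have bX N : bmeas (Phi \o X N).
  by split; [exact: mPhi|exists 1 => w; exact: Phi1].
have bg : bmeas (Phi \o g).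
  by split; [exact: random_element_cont|exists 1 => w; exact: Phi1].
have := gX cPhi (ex_intro _ 1 Phi1).
rewrite (ExE Q bg) (_ : (fun n => _) = EFin \o (fun N => Ex P (Phi \o X N))).
  by move/fine_cvg.
by apply/funext => N; rewrite /= ExE.
Qed.

Let psi0 (a : nat -> E) : R := Num.min 1 `|a 0%N|.

Let psi0_tests : mtests 1 1 psi0.
Proof.
split=> // [a|a b]; first by rewrite /psi0 le_min ler01 normr_ge0 ge_min lexx.
rewrite big_ord1 mul1r; apply: le_trans (minr_lip _ _ _) _.
exact: ler_dist_dist.
Qed.

(** Evaluation at 0 is continuous for the Skorohod topology, because time changes fix 0. *)
Lemma limit_null_at0 : {ae Q, forall w, g w 0 = 0}.
Proof.
pose Phi (x : cadlag E) := Num.min 1 `|x 0|.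
have cPhi : continuous Phi.
  apply/continuousP => U oU; suff : skorohod_open (Phi @^-1` U) by [].
  move=> x Ux; have /nbhs_ballP[eta /= eta0 etaU] : nbhs (Phi x) U.
    exact: open_nbhs_nbhs.
  exists 0, eta; split=> // y [l [l0 _ _] [_ ly]]; apply: etaU.
  rewrite -ball_normE /=; apply: le_lt_trans (minr_lip _ _ _) _.
  have := ly 0; rewrite l0 lexx => /(_ isT); rewrite distrC.
  by apply: le_lt_trans; exact: ler_dist_dist.
have Phi01 x : 0 <= Phi x <= 1 by rewrite /Phi le_min ler01 normr_ge0 ge_min lexx.
have PhiX N : Phi \o X N = fun=> 0.
  by apply/funext => w; rewrite /Phi /= X0 normr0; apply/min_idPr.
have := cvg_in_law_Ex cPhi Phi01 _.
have -> : (fun N => Ex P (Phi \o X N)) = fun=> 0.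
  by apply/funext => N; rewrite PhiX Ex_cst.
move=> H; have EPhi : Ex Q (Phi \o g) = 0.
  have mPhiX N : measurable_fun [set: Om] (Phi \o X N).
    by rewrite PhiX; exact: measurable_cst.
  by have /cvg_lim <- // := H mPhiX; rewrite lim_cst.
have bPhi : bmeas (Phi \o g).
  split; first exact: random_element_cont.
  by exists 1 => w /=; have /andP[? ?] := Phi01 (g w); rewrite ger0_norm.
have := Ex_eq0 bPhi (fun w => (andP (Phi01 (g w))).1) EPhi.
apply: filterS => w /=; rewrite /Phi; case: leP => [_ /eqP|_ /normr0_eq0//].
by rewrite oner_eq0.
Qed.

Let A (eps : R) := Ex Q (fun w => smooth_eval 1 (fun=> 0) eps psi0 (g w)).

Let A_cvg0 : A n.+1%:R^-1 @[n --> \oo] --> (0 : R).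
Proof.
have [bp] := smooth_eval_Ex rg Q (fun=> lexx 0) psi0_tests.
rewrite (_ : Ex Q _ = 0)//.
rewrite /Ex /Rintegral.
rewrite (ae_eq_integral (cst 0%E))//.
- by rewrite integral0.
- by apply/measurable_EFinP; case: bp.
- apply: filterS limit_null_at0 => w gw _ /=.
  by rewrite /psi0 gw normr0; congr (_%:E); apply/min_idPr.
Qed.

(** Bounds an increment at any time [s] by a continuous functional that looks only near time 0 and
    whose limit is therefore small. *)
Let small_incr N s eps : 0 <= s -> 0 < eps ->
  Ex P (fun w => Num.min 1 `|X N w (s + eps) - X N w s|) <=
    Ex P (fun w => Num.min 1 `|X N w (2 * eps)|) ->
  Ex P (fun w => Num.min 1 `|X N w (s + eps) - X N w s|) <=
  Ex P (fun w => smooth_eval 1 (fun=> 0) (2 * eps) psi0 (X N w)).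
Proof.
move=> s0 eps0 /le_trans; apply.
have e20 : 0 < 2 * eps by rewrite mulr_gt0.
apply: le_Ex.
- split.
    by apply: (mX' N (s := fun=> 2 * eps) _ psi0_tests) => _; exact: ltW.
  by exists 1 => w; rewrite ger0_norm ?le_min ?ler01 ?normr_ge0 ?ge_min ?lexx.
- split; first exact: (mX N _ e20 psi0_tests).
  exists 1 => w; rewrite ger0_norm ?(smooth_eval_ge0 (fun=> lexx 0) e20 psi0_tests)//.
  exact: (smooth_eval_le1 (fun=> lexx 0) e20 psi0_tests).
(* The time [2 * eps] is the centre of the window of the smoothed evaluation at 0, hence is not
   penalized. *)
- move=> w; have := smooth_term_le_eval (fun=> 0) e20 psi0_tests (X N w) (u := fun=> 2 * eps) (fun=> ltW e20).
  apply: le_trans; rewrite /smooth_term big_ord1 add0r subrr normr0 mul0r subr0.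
  by rewrite le_max lexx orbT.
Qed.

(** If some [dl j] is at least 1, the right side is at least 1 thanks to the summand 1 in [L + 1];
    otherwise the truncations are void. *)
Let min1_sum k L a (dl : nat -> R) : 0 <= L -> (forall j, 0 <= dl j) ->
  a <= 1 -> a <= L * \sum_(j < k) dl j -> a <= (L + 1) * \sum_(j < k) Num.min 1 (dl j).
Proof.
move=> L0 dl0 a1 ad.
have s0 (I : {pred 'I_k}) : 0 <= \sum_(j < k | I j) Num.min 1 (dl j).
  by apply: sumr_ge0 => j _; rewrite le_min ler01 dl0.
have [/existsP[j dj]|/existsPn H] := boolP [exists j : 'I_k, 1 <= dl j].
  apply: (le_trans a1); rewrite (bigD1 j)//= (min_idPl dj).
  by have := s0 (fun i => i != j); nra.
have -> : \sum_(j < k) Num.min 1 (dl j) = \sum_(j < k) dl j.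
  apply: eq_bigr => j _; apply/min_idPr.
  by have := H j; rewrite -ltNge => /ltW.
apply: (le_trans ad); rewrite ler_wpM2r ?lerDl//.
by apply: sumr_ge0.
Qed.

(** Three errors of size e / 3: smoothing for the limit, by right continuity; convergence of the
    smoothed evaluations, by their continuity; smoothing for [X N], bounded by truncated increments
    after the times [s j], which [small_incr] transports to time 0. *)
Lemma finite_dim_cvg k s L Psi : (forall j, 0 <= s j) -> mtests k L Psi ->
  Ex P (fun w => Psi (fun j => X N w (s j))) @[N --> \oo] -->
  Ex Q (fun w => Psi (fun j => g w (s j))).
Proof.
move=> s0 tPsi; have [L0 Psi01 _] := tPsi.
have [bPsi cPsi] := smooth_eval_Ex rg Q s0 tPsi.
apply/cvgrPdist_le => e e0.
have e3 : 0 < e / 3 by lra.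
pose C := (L + 1) * k%:R.
have C0 : 0 <= C by rewrite mulr_ge0// addr_ge0.
have e4 : 0 < e / 3 / 2 / (C + 1) by rewrite !divr_gt0// ltr_wpDl.
have [n [nA nPsi]] : exists n : nat, A n.+1%:R^-1 <= e / 3 / 2 / (C + 1) /\
    `|Ex Q (fun w => Psi (fun j => g w (s j))) -
      Ex Q (fun w => smooth_eval k s (4 * n.+1)%:R^-1 Psi (g w))| <= e / 3.
  have /cvgrPdist_le/(_ _ e3)[n1 _ n1P] := cPsi.
  have /cvgr0Pnorm_le/(_ _ e4)[n2 _ n2P] := A_cvg0.
  exists (maxn n1 n2); split.
    by apply: le_trans (ler_norm _) _; apply: n2P; rewrite /= leq_maxr.
  have -> : (4 * (maxn n1 n2).+1 = (4 * (maxn n1 n2).+1).-1.+1)%N by rewrite mulnS.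
  by apply: n1P => /=; have := leq_maxl n1 n2; lia.
(* The window at scale [eps] has length [2 * eps], and the comparison with time 0 doubles it again;
   the factor 4 brings the result to [n.+1%:R^-1], where [A] is bounded. *)
set eps := (4 * n.+1)%:R^-1 in nPsi.
have eps0 : 0 < eps by rewrite invr_gt0 ltr0n.
have epsE : 2 * (2 * eps) = n.+1%:R^-1.
  by rewrite /eps natrM; field; rewrite ?pnatr_eq0.
have c1 := cvg_in_law_Ex (smooth_eval_continuous s0 eps0 tPsi)
  (fun x => introT andP (conj (smooth_eval_ge0 s0 eps0 tPsi x) (smooth_eval_le1 s0 eps0 tPsi x)))
  (fun N => mX N s0 eps0 tPsi).
have n10 : 0 < n.+1%:R^-1 :> R by rewrite invr_gt0.
have c2 := cvg_in_law_Ex (smooth_eval_continuous (fun=> lexx 0) n10 psi0_tests)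
  (fun x => introT andP (conj (smooth_eval_ge0 (fun=> lexx 0) n10 psi0_tests x)
     (smooth_eval_le1 (fun=> lexx 0) n10 psi0_tests x)))
  (fun N => mX N (fun=> lexx 0) n10 psi0_tests).
have incr : \forall N \near \oo, forall j, (j < k)%N ->
    Ex P (fun w => Num.min 1 `|X N w (s j + 2 * eps) - X N w (s j)|) <=
    Ex P (fun w => Num.min 1 `|X N w (2 * (2 * eps))|).
  elim: (k) => [|k' ih]; first exact: nearW.
  have e20 : 0 < 2 * eps by rewrite mulr_gt0.
  have := X_incr (s0 k') e20; apply: filterS2 ih => N ih h j.
  by rewrite ltnS leq_eqVlt => /predU1P[->//|/ih].
have /cvgrPdist_le/(_ _ e3) c1' := c1.
have /cvgrPdist_le/(_ _ e4) c2' := c2.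
near=> N.
have h1 : `|Ex Q (fun w => smooth_eval k s eps Psi (g w)) -
    Ex P (fun w => smooth_eval k s eps Psi (X N w))| <= e / 3 by near: N.
have h2 : `|A n.+1%:R^-1 -
    Ex P (fun w => smooth_eval 1 (fun=> 0) n.+1%:R^-1 psi0 (X N w))| <= e / 3 / 2 / (C + 1).
  by near: N.
have h3 j : (j < k)%N -> Ex P (fun w => Num.min 1 `|X N w (s j + 2 * eps) - X N w (s j)|)
    <= e / 3 / (C + 1).
  move=> jk; have e20 : 0 < 2 * eps by rewrite mulr_gt0.
  apply: le_trans (small_incr (s0 j) e20 _) _.
    by move: j jk; near: N.
  rewrite epsE; have -> : e / 3 / (C + 1) = e / 3 / 2 / (C + 1) + e / 3 / 2 / (C + 1).
    by rewrite -mulrDl -splitr.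
  by move: h2; rewrite distrC ler_norml; lra.
have bse : bmeas (fun w => smooth_eval k s eps Psi (X N w)).
  split; first exact: mX tPsi.
  exists 1 => w; rewrite ger0_norm ?(smooth_eval_ge0 s0 eps0 tPsi)//.
  exact: (smooth_eval_le1 s0 eps0 tPsi).
have bP : bmeas (fun w => Psi (fun j => X N w (s j))).
  split; first exact: mX' tPsi.
  by exists 1 => w; have /andP[? ?] := Psi01 (fun j => X N w (s j)); rewrite ger0_norm.
have bmin j : bmeas (fun w => Num.min 1 `|X N w (s j + 2 * eps) - X N w (s j)|).
  split; last first.
    by exists 1 => w; rewrite ger0_norm ?le_min ?ler01 ?normr_ge0 ?ge_min ?lexx.
  pose psi (a : nat -> E) : R := Num.min 1 `|a 1%N - a 0%N|.
  apply: (mX' N (k := 2) (L := 1) (s := fun i => if i is 0%N then s j else s j + 2 * eps) (Psi := psi)).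
    by case=> //= _; rewrite addr_ge0// mulr_ge0// ltW.
  split=> // [a|a b]; first by rewrite /psi le_min ler01 normr_ge0 ge_min lexx.
  rewrite big_ord_recl big_ord1 mul1r /=; apply: le_trans (minr_lip _ _ _) _.
  apply: le_trans (ler_dist_dist _ _) _; rewrite [leRHS]addrC.
  have -> : a 1%N - a 0%N - (b 1%N - b 0%N) = (a 1%N - b 1%N) - (a 0%N - b 0%N).
    by rewrite !opprB addrACA [in RHS]addrACA; congr (_ + _); rewrite addrC.
  exact: ler_normB.
have h4 : `|Ex P (fun w => smooth_eval k s eps Psi (X N w)) -
    Ex P (fun w => Psi (fun j => X N w (s j)))| <= e / 3.
  apply: (@le_trans _ _ (Ex P (fun w => (L + 1) * \sum_(j < k)
      Num.min 1 `|X N w (s j + 2 * eps) - X N w (s j)|))).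
    apply: distr_Ex => //.
      by apply: bmeasM; [exact: bmeas_cst|apply: (@bmeas_sum _ _ _ 'I_k) => j; exact: bmin].
    move=> w; apply: (min1_sum L0 (dl := fun j => `|X N w (s j + 2 * eps) - X N w (s j)|)) => //.
      have := smooth_eval_ge0 s0 eps0 tPsi (X N w).
      have := smooth_eval_le1 s0 eps0 tPsi (X N w).
      have /andP[] := Psi01 (fun j => X N w (s j)).
      by rewrite ler_norml; lra.
    apply: (smooth_eval_approx (delta := fun j => `|X N w (s j + 2 * eps) - X N w (s j)|) s0 eps0 tPsi) => j v jk /andP[sv vs].
    by apply: X_mono => //; rewrite !ltW.
  rewrite ExZ; last by apply: (@bmeas_sum _ _ _ 'I_k) => j; exact: bmin.
  rewrite (@Ex_sum _ _ _ P 'I_k); last by move=> j; exact: bmin.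
  apply: (@le_trans _ _ ((L + 1) * \sum_(j < k) (e / 3 / (C + 1)))).
    rewrite ler_wpM2l ?addr_ge0//; apply: ler_sum => j _; exact: h3.
  set q := e / 3 / (C + 1).
  rewrite sumr_const card_ord -[_ *+ k]mulr_natl mulrA -/C /q mulrCA ger_pMr//.
  by rewrite ler_pdivrMr ?mul1r ?lerDl// ltr_wpDl.
move: nPsi h1 h4; rewrite !ler_norml; lra.
Unshelve. all: by end_near. Qed.

End finite_dimensional_convergence.

(** * Configurations of discrete variables *)

Section discrete.
Context d (T : measurableType d).

(** All subsets of the target are tested: no sigma-algebra on it has to be chosen, and composition
    with an arbitrary map is free. Lists of words and labels are handled in this way. *)
Definition disc (S : Type) (X : T -> S) := forall B : set S, measurable (X @^-1` B).

Lemma disc_comp (S S' : Type) (X : T -> S) (h : S -> S') : disc X -> disc (h \o X).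
Proof. by move=> dX B; rewrite comp_preimage; exact: dX. Qed.

Lemma disc_cst (S : Type) (c : S) : disc (fun=> c).
Proof. by move=> B; rewrite preimage_cst; case: ifP. Qed.

Lemma disc_measurable d' (S : measurableType d') (X : T -> S) :
  disc X -> measurable_fun [set: T] X.
Proof. by move=> dX _ B mB; rewrite setTI; exact: dX. Qed.

Lemma countable_union_measurable (I : countType) (F : I -> set T) :
  (forall i, measurable (F i)) -> measurable (\bigcup_i F i).
Proof. by move=> mF; apply: countable_bigcupT_measurable. Qed.

(** Events are split along the countably many values of [N]; random offspring numbers and random
    sets of vertices enter through this lemma. *)
Lemma disc_bind (I : countType) (S : Type) (N : T -> I) (X : I -> T -> S) :
  disc N -> (forall i, disc (X i)) -> disc (fun w => X (N w) w).
Proof.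
move=> dN dX B.
rewrite (_ : _ @^-1` B = \bigcup_i (N @^-1` [set i] `&` X i @^-1` B)).
  by apply: countable_union_measurable => i; apply: measurableI; [exact: dN|exact: dX].
apply/seteqP; split => [w XB|w [i _ [/= <-]]] //.
by exists (N w).
Qed.

Lemma disc_pair (I : countType) (S : Type) (N : T -> I) (X : T -> S) :
  disc N -> disc X -> disc (fun w => (N w, X w)).
Proof.
move=> dN dX; apply: (@disc_bind I _ N (fun i w => (i, X w))) => // i.
exact: (disc_comp (pair i)).
Qed.

Lemma disc_fibers (I : countType) (N : T -> I) :
  (forall i, measurable (N @^-1` [set i])) -> disc N.
Proof.
move=> mN B; rewrite (_ : N @^-1` B = \bigcup_i (N @^-1` [set i] `&` [set w | B i])).
  apply: countable_union_measurable => i; apply: measurableI => //.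
  have [Bi|Bi] := pselect (B i).
    by rewrite (_ : [set w | _] = setT)//; apply/seteqP; split.
  by rewrite (_ : [set w | _] = set0)//; apply/seteqP; split.
apply/seteqP; split => [w XB|w [i _ [/= <-]]] //.
by exists (N w).
Qed.

Lemma disc_map (I J : countType) (X : I -> T -> J) (s : seq I) :
  (forall i, disc (X i)) -> disc (fun w => [seq X i w | i <- s]).
Proof.
move=> dX; elim: s => [|i s ih] /=; first exact: disc_cst.
apply: (@disc_bind _ _ (X i) (fun x w => x :: [seq X j w | j <- s])) => // x.
exact: (disc_comp (cons x)).
Qed.

(** Factorization through [N] without exhibiting the factor: agreement on the fibres of [N] is
    enough, every subset of [S] being allowed. *)
Lemma disc_factor (S S' : Type) (N : T -> S) (X : T -> S') : disc N ->
  (forall w w', N w = N w' -> X w = X w') -> disc X.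
Proof.
move=> dN NX B; rewrite (_ : X @^-1` B = N @^-1` (N @` (X @^-1` B))); first exact: dN.
apply/seteqP; split => [w XB|w [w' Xw' NN]]; first by exists w.
by rewrite /= -(NX w' w NN).
Qed.

End discrete.

(** * Conditioning on a discrete variable *)

Section disintegration.
Local Open Scope ereal_scope.
Context d (T : measurableType d) (R : realType) (mu : probability T R).
Context d' (S : measurableType d') (rho : probability S R).
Variable code : S -> nat.
Hypotheses (code_inj : injective code) (mS : forall B : set S, measurable B).

(** The space is partitioned by the values of [N], enumerated through [code]; the identity assumed
    on each fibre is what independence of [N] and [f s] provides. *)
Lemma integral_disintegrate (N : T -> S) (f : S -> T -> \bar R) (c : S -> \bar R) :
  disc N -> (forall s, measurable_fun [set: T] (f s)) -> (forall s w, 0 <= f s w) ->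
  (forall s, 0 <= c s) ->
  (forall s, \int[mu]_(w in N @^-1` [set s]) f s w = rho [set s] * c s) ->
  \int[mu]_w f (N w) w = \int[rho]_s c s.
Proof.
move=> dN mf f0 c0 fc.
have mfN : measurable_fun [set: T] (fun w => f (N w) w).
  move=> _ B mB; rewrite setTI.
  rewrite (_ : _ @^-1` B = \bigcup_n ((code \o N) @^-1` [set n] `&` (fun w => f (N w) w) @^-1` B)).
    apply: bigcupT_measurable => n.
    have [[s sn]|sn] := pselect (exists s, code s = n); last first.
      rewrite (_ : _ `&` _ = set0)//; apply/seteqP; split => // w [/= Nw _].
      by apply: sn; exists (N w).
    rewrite (_ : _ `&` _ = N @^-1` [set s] `&` f s @^-1` B).
      by apply: measurableI; [exact: dN|rewrite -[X in measurable X]setTI; exact: mf].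
    apply/seteqP; split => w [/= Nw]; last by rewrite Nw sn.
    by rewrite -sn in Nw; have := code_inj Nw => ->.
  apply/seteqP; split => [w XB|w [i _ []]] //.
  by exists (code (N w)).
have mc D : measurable_fun D c by move=> _ B mB; exact: mS.
have -> : [set: T] = \bigcup_n (code \o N) @^-1` [set n].
  by apply/seteqP; split => // w _; exists (code (N w)).
have -> : [set: S] = \bigcup_n code @^-1` [set n].
  by apply/seteqP; split => // w _; exists (code w).
rewrite ge0_integral_bigcup//=; last 3 first.
- by move=> n; exact: (dN (code @^-1` [set n])).
- exact: measurable_funTS.
- by apply/trivIsetP => i j _ _ ij; apply/seteqP; split => // w [/= -> /eqP]; rewrite (negbTE ij).
rewrite ge0_integral_bigcup//=; last first.
  by apply/trivIsetP => i j _ _ ij; apply/seteqP; split => // w [/= -> /eqP]; rewrite (negbTE ij).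
apply: eq_eseriesr => n _.
have [[s sn]|sn] := pselect (exists s, code s = n); last first.
  rewrite (_ : (code \o N) @^-1` [set n] = set0); last first.
    by apply/seteqP; split => // w /= Nw; apply: sn; exists (N w).
  rewrite (_ : code @^-1` [set n] = set0) ?integral_set0//.
  by apply/seteqP; split => // w /= Nw; apply: sn; exists w.
have -> : (code \o N) @^-1` [set n] = N @^-1` [set s].
  by apply/seteqP; split => w /= Nw; [apply: code_inj; rewrite sn|rewrite Nw].
have -> : code @^-1` [set n] = [set s].
  by apply/seteqP; split => w /= Nw; [apply: code_inj; rewrite sn|rewrite Nw].
rewrite (eq_integral (f s)); last by move=> w /set_mem/= ->.
rewrite fc (eq_integral (cst (c s))); last by move=> w /set_mem/= ->.
by rewrite integral_cst// muleC.
Qed.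

End disintegration.

(** * Laws with independent integer coordinates *)

Section configurations.
Variable V : choiceType.

(** [J] restricts the coordinates that may be constrained, so these sets generate the sigma-algebra
    of the coordinates in [J]. *)
Definition cylinders (J : pred V) : set_system (V -> int) :=
  [set C | exists (s : seq V) (A : V -> set int),
    [/\ uniq s, all J s & C = [set w | forall v, v \in s -> A v (w v)]]].

Definition config := g_sigma_algebraType (cylinders xpredT).

Implicit Types (J : pred V) (s : seq V) (A : V -> set int) (w : V -> int).

Lemma cylindersI J : setI_closed (cylinders J).
Proof.
move=> _ _ [s [A [us Js ->]]] [s' [A' [us' Js' ->]]].
exists (undup (s ++ s')), (fun v => [set z | (v \in s -> A v z) /\ (v \in s' -> A' v z)]).
split; first exact: undup_uniq.
  by apply/allP => v; rewrite mem_undup mem_cat => /orP[]; [move/allP: Js|move/allP: Js']; apply.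
apply/seteqP; split => [w [H H'] v _|w H]; first by split; [exact: H|exact: H'].
split => v vs; have := H v; rewrite mem_undup mem_cat vs ?orbT => /(_ isT)[].
  by move=> h1 _; exact: h1.
by move=> _ h2; exact: h2.
Qed.

Lemma cylindersT J : cylinders J setT.
Proof. by exists [::], (fun=> setT); split=> //; apply/seteqP; split. Qed.

Lemma cylinders_measurable J : cylinders J `<=` (@measurable _ config).
Proof.
move=> _ [s [A [us _ ->]]]; apply: sub_sigma_algebra.
by exists s, A; split => //; apply/allP.
Qed.

Lemma coord_disc (v : V) : disc (fun w : config => w v).
Proof.
move=> B; apply: sub_sigma_algebra; exists [:: v], (fun=> B); split => //.
by apply/seteqP; split => w /= H; [move=> u; rewrite inE => /eqP ->|apply: H; rewrite inE].
Qed.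

Definition depends (S : Type) J (f : config -> S) :=
  forall w w' : config, (forall v, J v -> w v = w' v) -> f w = f w'.

(** Setting the coordinates outside [J] to 0 does not change membership in [B], so [B] is its own
    preimage under this mask, and preimages of cylinders under the mask only involve [J]. *)
Lemma depends_sigma J (B : set config) : measurable B -> depends J B ->
  <<s cylinders J >> B.
Proof.
move=> mB dB; pose mask w v : int := if J v then w v else 0.
have -> : B = mask @^-1` B.
  apply/funext => w; rewrite /preimage/=; apply: dB => v Jv.
  by rewrite /mask Jv.
move: B mB {dB}; apply: smallest_sub.
  split=> /= [|B mB|F mF].
  - by rewrite preimage_set0; apply: sigma_algebra0; exact: smallest_sigma_algebra.
  - rewrite setTD preimage_setC -setTD.
    by apply: sigma_algebraCD => //; exact: smallest_sigma_algebra.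
  - by rewrite preimage_bigcup; exact: sigma_algebra_bigcup.
move=> _ [s [A [us _ ->]]] /=.
(* A masked coordinate has the value 0: its constraint either excludes 0, and the preimage is empty,
   or is void. *)
have [bad|good] := pselect (exists2 v, v \in s & ~~ J v /\ ~ A v 0).
  rewrite (_ : _ @^-1` _ = set0); first by apply: sigma_algebra0; exact: smallest_sigma_algebra.
  apply/seteqP; split => // w /= H; have [v vs [Jv nA]] := bad.
  by apply: nA; have := H v vs; rewrite /mask (negbTE Jv).
apply: sub_sigma_algebra; exists (seq.filter J s), A; split.
- exact: filter_uniq.
- exact: filter_all.
- apply/seteqP; split => w /= H v; last first.
    move=> vs; rewrite /mask; case: ifPn => [Jv|Jv].
      by apply: H; rewrite mem_filter Jv.
    by apply: contrapT => nA; apply: good; exists v.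
  by rewrite mem_filter => /andP[Jv vs]; have := H v vs; rewrite /mask Jv.
Qed.

Lemma reindex_measurable (tau : V -> V) :
  measurable_fun [set: config] (fun w : config => (w \o tau : config)).
Proof.
move=> _ B mB; rewrite setTI; move: B mB; apply: smallest_sub.
  split=> /= [|B mB|F mF].
  - by rewrite preimage_set0.
  - by rewrite setTD preimage_setC; exact: measurableC.
  - by rewrite preimage_bigcup; exact: bigcupT_measurable.
move=> _ [s [A [us _ ->]]] /=.
rewrite (_ : _ @^-1` _ = \bigcap_(v in [set` s]) [set w : config | A v (w (tau v))]).
  apply: fin_bigcap_measurable; first exact: finite_seq.
  by move=> v _; exact: coord_disc.
by apply/seteqP; split => w.
Qed.

Variable R : realType.

Definition independent_coords (mu : probability config R) :=
  forall s A, uniq s ->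
    mu [set w | forall v, v \in s -> A v (w v)] = (\prod_(v <- s) mu [set w | A v (w v)])%E.

Section independent_config.
Variable mu : probability config R.
Hypothesis indmu : independent_coords mu.

(** Cylinders over disjoint sets of coordinates are independent pi-systems. They are indexed by a
    boolean, so that [mutually_independent_sigma] passes to the sigma-algebras, to which the events
    belong by [depends_sigma]. *)
Lemma independent_events J1 J2 (B1 B2 : set config) :
  (forall v, J1 v -> ~~ J2 v) -> measurable B1 -> measurable B2 ->
  depends J1 B1 -> depends J2 B2 -> (mu (B1 `&` B2) = mu B1 * mu B2)%E.
Proof.
move=> J12 mB1 mB2 dB1 dB2.
pose J (b : bool) := if b then J1 else J2.
pose C (b : bool) : set_system config := cylinders (J b).
have mC b : C b `<=` @measurable _ config by exact: cylinders_measurable.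
have IC b : setI_closed (C b) by exact: cylindersI.
have cylE J' s A : uniq s -> all J' s -> measurable ([set w : config | forall v, v \in s -> A v (w v)]).
  by move=> us Js; apply: (@cylinders_measurable J'); exists s, A.
have two (s : seq bool) : uniq s -> [\/ s = [::], exists b, s = [:: b] | exists b, s = [:: b; ~~ b]].
  case: s => [|a [|b [|c s]]] /=; first by constructor 1.
  - by constructor 2; exists a.
  - by rewrite inE => /andP[ab _]; constructor 3; exists a; case: a b ab => -[].
  - rewrite !inE !negb_or => /and4P[/and3P[ab ac _] /andP[bc _] _ _].
    by case: a b c ab ac bc => [] [] [].
have C12 (D : bool -> set config) : C true (D true) -> C false (D false) ->
    (mu (D true `&` D false) = mu (D true) * mu (D false))%E.
  move=> [s1 [A1 [us1 /allP Js1 D1]]] [s2 [A2 [us2 /allP Js2 D2]]]; rewrite D1 D2.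
  have s12 v : v \in s1 -> v \in s2 = false.
    by move=> /Js1/J12 nJ; apply/negP => /Js2; apply/negP.
  rewrite !indmu// -[RHS](_ : (\prod_(v <- s1 ++ s2)
      mu [set w : config | (if v \in s1 then A1 v else A2 v) (w v)])%E = _); last first.
    rewrite big_cat/=; congr (_ * _)%E; apply: eq_big_seq => v vs; first by rewrite vs.
    by case: ifP => // vs1; rewrite (s12 _ vs1) in vs.
  rewrite -(@indmu (s1 ++ s2) (fun v => if v \in s1 then A1 v else A2 v)).
    congr (mu _); apply/seteqP; split => [w [H1 H2] v|w H].
      by rewrite mem_cat; case: ifP => [vs _|_ /= vs]; [exact: H1|exact: H2].
    split => v vs; have := H v; rewrite mem_cat vs ?orbT ; first by apply.
    by case: ifP => [/s12|_]; [rewrite vs|apply].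
  rewrite cat_uniq us1 us2 andbT/=; apply/hasPn => v vs2.
  by apply/negP => /s12; rewrite vs2.
have indC : mutually_independent mu C.
  move=> s D us sD; case: (two s us) sD => [->|[b ->]|[b ->]] sD.
  - rewrite big_nil (_ : \bigcap_(i in _) _ = setT); first exact: probability_setT.
    by apply/seteqP; split => // w _ i.
  - rewrite big_seq1; congr (mu _); apply/seteqP; split => [w H|w H i].
      by apply: H; rewrite /= inE.
    by rewrite /= inE => /eqP ->.
  - have H : C b (D b) /\ C (~~ b) (D (~~ b)) by split; apply: sD; rewrite !inE eqxx ?orbT.
    have -> : \bigcap_(i in [set` [:: b; ~~ b]]) D i = D true `&` D false.
      apply/seteqP; split => [w H'|w [H1 H2] i _]; last by case: i.
      by split; apply: H'; rewrite /= !inE; case: (b).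
    rewrite !big_cons big_nil mule1.
    by case: b H {us sD} => -[H1 H2] /=; rewrite C12//= muleC.
have := mutually_independent_sigma mC IC indC (s := [:: true; false])
  (A := fun b => if b then B1 else B2) isT.
rewrite !big_cons big_nil mule1 => <-; last first.
  by case=> _; exact: depends_sigma.
congr (mu _); apply/seteqP; split => [w [H1 H2] i _|w H]; first by case: i.
by split; [apply: (H true)|apply: (H false)].
Qed.

(** The diagonal map into the product of the two coarser sigma-algebras, generated by the
    coordinates in [J1] and in [J2], has a product law by [independent_events]; Tonelli then splits
    the integral. *)
Lemma integral_prod_depends J1 J2 (f h : config -> \bar R) :
  (forall v, J1 v -> ~~ J2 v) ->
  measurable_fun [set: config] f -> measurable_fun [set: config] h ->
  (forall w, 0 <= f w)%E -> (forall w, 0 <= h w)%E ->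
  depends J1 f -> depends J2 h ->
  (\int[mu]_w (f w * h w) = \int[mu]_w f w * \int[mu]_w h w)%E.
Proof.
move=> J12 mf mh f0 h0 df dh.
pose T1 := g_sigma_algebraType (cylinders J1).
pose T2 := g_sigma_algebraType (cylinders J2).
have subs J' : <<s cylinders J' >> `<=` (@measurable _ config).
  apply: smallest_sub; first exact: sigma_algebra_measurable.
  exact: cylinders_measurable.
have m1 : measurable_fun setT (id : config -> T1) by move=> _ B mB; rewrite setTI; exact: (subs J1 B mB).
have m2 : measurable_fun setT (id : config -> T2) by move=> _ B mB; rewrite setTI; exact: (subs J2 B mB).
pose X1 : {RV mu >-> T1} := HB.pack (id : config -> T1) (isMeasurableFun.Build _ _ _ _ _ m1).
pose X2 : {RV mu >-> T2} := HB.pack (id : config -> T2) (isMeasurableFun.Build _ _ _ _ _ m2).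
have m12 : measurable_fun setT (fun w : config => ((w : T1), (w : T2))).
  exact: (measurable_fun_pair m1 m2).
pose X12 : {RV mu >-> (T1 * T2)%type} :=
  HB.pack (fun w : config => ((w : T1), (w : T2))) (isMeasurableFun.Build _ _ _ _ _ m12).
pose mu1 := distribution mu X1. pose mu2 := distribution mu X2.
pose mu12 := distribution mu X12.
have mf1 : measurable_fun setT (f : T1 -> \bar R).
  move=> _ B mB; rewrite setTI; apply: depends_sigma.
    by rewrite -[X in measurable X]setTI; exact: mf.
  by move=> w w' ww'; rewrite /preimage /= (df w w' ww').
have mh2 : measurable_fun setT (h : T2 -> \bar R).
  move=> _ B mB; rewrite setTI; apply: depends_sigma.
    by rewrite -[X in measurable X]setTI; exact: mh.
  by move=> w w' ww'; rewrite /preimage /= (dh w w' ww').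
have sub_dep J' B : <<s cylinders J' >> B -> depends J' B.
  move: B; apply: smallest_sub.
    split=> /= [w w' //|B dB w w' ww'|F dF w w' ww'].
      by rewrite setTD /setC /mkset (dB w w' ww').
    rewrite /bigcup /mkset; apply/propext; split => -[n _ Fn]; exists n => //.
      by rewrite -(dF n w w' ww').
    by rewrite (dF n w w' ww').
  move=> _ [s [A [us /allP Js ->]]] w w' ww'; apply/propext; split => H v vs /=.
    by rewrite -ww'; [exact: H|exact: Js].
  by rewrite ww'; [exact: H|exact: Js].
have prodE X : measurable X -> (mu1 \x mu2)%E X = mu12 X.
  apply: product_measure_unique => A B mA mB.
  by apply: (independent_events J12); [exact: (subs J1 A mA)|exact: (subs J2 B mB)|exact: sub_dep|exact: sub_dep].
have mfh : measurable_fun setT (fun z : T1 * T2 => f z.1 * h z.2)%E.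
  apply: emeasurable_funM.
    exact: (measurableT_comp mf1 (@measurable_fst _ _ T1 T2)).
  exact: (measurableT_comp mh2 (@measurable_snd _ _ T1 T2)).
transitivity (\int[mu12]_z (f z.1 * h z.2))%E.
  by rewrite ge0_integral_distribution// => z; rewrite mule_ge0.
rewrite (eq_measure_integral (mu1 \x mu2)%E); last by move=> A mA _; rewrite [RHS]prodE.
rewrite fubini_tonelli1//=; last by move=> z; rewrite mule_ge0.
rewrite /fubini_F /=.
under eq_integral do rewrite ge0_integralZl//.
rewrite ge0_integralZr//; last by apply: integral_ge0.
by rewrite !ge0_integral_distribution.
Qed.

Lemma integral_setI_depends J1 J2 (D : set config) (f : config -> \bar R) :
  (forall v, J1 v -> ~~ J2 v) -> measurable D ->
  measurable_fun [set: config] f -> (forall w, 0 <= f w)%E ->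
  depends J1 D -> depends J2 f ->
  (\int[mu]_(w in D) f w = mu D * \int[mu]_w f w)%E.
Proof.
move=> J12 mD mf f0 dD df.
transitivity (\int[mu]_w ((\1_D w)%:E * f w))%E.
  rewrite [LHS]integral_mkcond; apply: eq_integral => w _.
  by rewrite patchE indicE; case: (w \in D); rewrite ?mul1e ?mul0e.
rewrite (integral_prod_depends J12)//.
- by rewrite integral_indic// setIT.
- exact/measurable_EFinP/measurable_indic.
- move=> w w' ww'; rewrite !indicE; have e := dD w w' ww'; congr (_%:R%:E).
  have [Dw|Dw] := pselect (D w).
    by rewrite mem_set// mem_set// -e.
  by rewrite memNset// memNset// -e.
Qed.

Lemma law_unique (mu' : probability config R) :
  (forall C, cylinders xpredT C -> mu C = mu' C) ->
  forall B, measurable B -> mu B = mu' B.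
Proof.
move=> muE; apply: (measure_unique (cylinders xpredT : set (set config)) (fun=> setT)) => //.
- exact: cylindersI.
- by move=> _; exact: cylindersT.
- by rewrite bigcup_const//; exists 0%N.
- by move=> _; rewrite ltey_eq fin_num_measure.
Qed.

(** A law with independent coordinates is determined by its marginals on cylinders. Subtrees and
    later trees thereby have the law of the original ones. *)
Lemma integral_reindex (tau : V -> V) (f : config -> \bar R) : injective tau ->
  (forall v (A : set int), mu [set w | A (w (tau v))] = mu [set w | A (w v)]) ->
  measurable_fun [set: config] f -> (forall w, 0 <= f w)%E ->
  (\int[mu]_w f (w \o tau) = \int[mu]_w f w)%E.
Proof.
move=> tau_inj taumu mf f0.
pose X : {RV mu >-> config} := HB.pack (fun w : config => (w \o tau : config))
  (isMeasurableFun.Build _ _ _ _ _ (reindex_measurable tau)).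
rewrite -[LHS](ge0_integral_distribution (P := mu) X mf f0).
apply: eq_measure_integral => B mB _; apply/esym; apply: law_unique => //.
move=> _ [s [A [us _ ->]]]; rewrite indmu//.
(* The constraint [A v] is moved to the coordinate [tau v]; injectivity makes it the only constraint
   there. *)
transitivity (mu [set w | forall u, u \in map tau s ->
    (fun u => [set z | forall v, tau v = u -> A v z]) u (w u)]).
  rewrite (@indmu (map tau s)
    (fun u => [set z | forall v, tau v = u -> A v z])) ?map_inj_uniq// big_map; apply: eq_bigr => v _.
  rewrite -taumu; congr (mu _); apply/seteqP; split => w /= H.
    by move=> v' /tau_inj ->.
  exact: H.
congr (mu _); apply/seteqP; split => w /= H; last by move=> u /mapP[v vs ->] v' /tau_inj ->; exact: H.
by move=> v vs; apply: (H (tau v)) => //; exact: map_f.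
Qed.

End independent_config.

End configurations.

(** * Labeled trees as functions of a configuration *)

Section generations.
Implicit Types (K : seq nat -> nat) (xi : seq nat -> int) (u v : seq nat).

(** The recursion splits off the first letter, whereas [gw_tree] grows at the last one: moments and
    survival are computed by conditioning on the children of the root. *)
Fixpoint generation (n : nat) K : seq (seq nat) :=
  if n is n'.+1 then
    flatten [seq [seq k :: v | v <- generation n' (K \o cons k)] | k <- iota 0 (K [::])]
  else [:: [::]].

(** Decomposition at the root of a tree that is defined by growth at the leaves, by induction on the
    last letter. *)
Lemma gw_tree_cons K k v :
  gw_tree K (k :: v) <-> (k < K [::])%N /\ gw_tree (K \o cons k) v.
Proof.
elim/last_ind: v => [|v j ih].
  split=> [T|[kK _]]; last exact: (@gw_child K [::] k (gw_root K) kK).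
  split; last exact: gw_root.
  move E : [:: k] T => kv T; case: T E => // u j Tu ju.
  by case: u Tu ju => [|a [|b u]]//= _ jK [->].
split=> [T|[kK T]].
  have [Tv jK] : gw_tree K (k :: v) /\ (j < K (k :: v))%N.
    move E : (k :: rcons v j) T => kv T; case: T E => // u j' Tu ju.
    by rewrite -rcons_cons => /rcons_inj[-> ->].
  by have [kK T'] := ih.1 Tv; split => //; exact: gw_child.
have [Tv jK] : gw_tree (K \o cons k) v /\ (j < K (k :: v))%N.
  move E : (rcons v j) T => kv T; case: T E => [|u j' Tu ju]; first by case: (v).
  by move=> /rcons_inj[-> ->].
by rewrite -rcons_cons; apply: gw_child => //; exact/ih.
Qed.

Lemma mem_generation n K v :
  v \in generation n K <-> gw_tree K v /\ size v = n.
Proof.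
elim: n K v => [|n ih] K v /=.
  rewrite inE; split=> [/eqP ->|[_ /size0nil ->]]//.
  by split => //; exact: gw_root.
split=> [/flatten_mapP[k]|].
  rewrite mem_iota => /andP[_ kK] /mapP[u /ih[Tu <-] ->].
  by split=> //; apply/gw_tree_cons.
case: v => [[_ //]|k v [/gw_tree_cons[kK Tv] [sv]]].
apply/flatten_mapP; exists k; first by rewrite mem_iota add0n.
by apply: map_f; exact/ih.
Qed.

Lemma uniq_generation n K : uniq (generation n K).
Proof.
elim: n K => [|n ih] K //=.
elim: (iota 0 (K [::])) (iota_uniq 0 (K [::])) => //= k s ihs /andP[ks us].
rewrite cat_uniq ihs// andbT map_inj_uniq ?ih//=; last by move=> ? ? [].
apply/hasPn => v /flatten_mapP[k' k's /mapP[u _ ->]].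
apply/negP => /mapP[u' _ [kk _]]; by rewrite -kk k's in ks.
Qed.

(** The densities depend on a tree only through this list, whose type is countable; it is empty when
    the tree is infinite. *)
Definition tree_labels K xi : seq int :=
  [seq label xi v | v <- fset_set (gw_tree K)].

Lemma occupationE K xi j : occupation K xi j = count_mem j (tree_labels K xi).
Proof.
rewrite /occupation /tree_labels count_map -size_filter.
apply: perm_size; apply: uniq_perm; [exact: fset_uniq|exact/filter_uniq/fset_uniq|].
by move=> v; rewrite mem_filter !inE andbC.
Qed.

(** The label [x] of the root is a parameter because the recursion restarts at the labels of the
    children. *)
Definition generation_sum (f : int -> nat) n (x : int) K xi : nat :=
  \sum_(v <- generation n K) f (x + label xi v)%R.

Definition visits f n x K xi : nat := \sum_(m < n) generation_sum f m x K xi.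

Lemma label_cons xi k v : label xi (k :: v) = xi [:: k] + label (xi \o cons k) v.
Proof. by rewrite /label /= big_ord_recl /= take0. Qed.

Lemma generation_sum0 f x K xi : generation_sum f 0 x K xi = f x.
Proof. by rewrite /generation_sum big_seq1 label_root addr0. Qed.

Lemma generation_sumS f n x K xi : generation_sum f n.+1 x K xi =
  (\sum_(k < K [::]) generation_sum f n (x + xi [:: (k : nat)])%R (K \o cons (k : nat)) (xi \o cons (k : nat)))%N.
Proof.
rewrite /generation_sum big_flatten/= big_map.
rewrite -(big_mkord xpredT (fun k => \sum_(v <- generation n (K \o cons k))
   f (x + xi [:: k] + label (xi \o cons k) v)%R)%N) /index_iota subn0.
apply: eq_bigr => k _; rewrite big_map; apply: eq_bigr => v _.
by rewrite label_cons addrA.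
Qed.

Lemma visits0 f x K xi : visits f 0 x K xi = 0%N.
Proof. by rewrite /visits big_ord0. Qed.

Lemma visitsS f n x K xi : visits f n.+1 x K xi = (f x +
  \sum_(k < K [::]) visits f n (x + xi [:: (k : nat)])%R (K \o cons (k : nat)) (xi \o cons (k : nat)))%N.
Proof.
rewrite /visits big_ord_recl generation_sum0; congr (_ + _)%N.
under eq_bigr do rewrite lift0 generation_sumS.
by rewrite exchange_big.
Qed.

Lemma leq_visits f m n x K xi : (m <= n)%N -> (visits f m x K xi <= visits f n x K xi)%N.
Proof.
move=> mn; rewrite /visits -!(big_mkord xpredT (fun m => generation_sum f m x K xi)).
by rewrite [X in (_ <= X)%N](big_cat_nat (n := m))//= leq_addr.
Qed.

Lemma gw_tree_take K v n : gw_tree K v -> gw_tree K (take n v).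
Proof.
elim=> [|u k Tu ih kK]; first exact: gw_root.
have [nu|un] := leqP n (size u); first by rewrite -cats1 takel_cat.
by rewrite take_oversize ?size_rcons//; exact: gw_child.
Qed.

Lemma generation_nil n m K : generation n K = [::] -> (n <= m)%N -> generation m K = [::].
Proof.
move=> gn nm; apply/eqP; rewrite -size_eq0 -leqn0 leqNgt; apply/negP.
case E : (generation m K) => [//|v s] _.
have /mem_generation[Tv sv] : v \in generation m K by rewrite E mem_head.
have : take n v \in generation n K.
  by apply/mem_generation; split; [exact: gw_tree_take|rewrite size_takel// sv].
by rewrite gn.
Qed.

Lemma gw_tree_finite n K : generation n K = [::] -> gw_tree K =
  [set` flatten [seq generation m K | m <- iota 0 n]].
Proof.
move=> gn; apply/seteqP; split => v /=.
  move=> Tv; apply/flatten_mapP; exists (size v); last exact/mem_generation.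
  rewrite mem_iota add0n /= ltnNge; apply/negP => nv.
  have : v \in generation (size v) K by apply/mem_generation.
  by rewrite (generation_nil gn nv).
by move=> /flatten_mapP[m _ /mem_generation[]].
Qed.

Lemma uniq_generations n K : uniq (flatten [seq generation m K | m <- iota 0 n]).
Proof.
elim: (iota 0 n) (iota_uniq 0 n) => //= m s ih /andP[ms us].
rewrite cat_uniq uniq_generation ih// andbT/=; apply/hasPn => v /flatten_mapP[m' m's].
move=> /mem_generation[_ sv]; apply/negP => /mem_generation[_ sv'].
by rewrite -sv' sv m's in ms.
Qed.

Lemma perm_tree n K : generation n K = [::] ->
  perm_eq (fset_set (gw_tree K)) (flatten [seq generation m K | m <- iota 0 n]).
Proof.
move=> gn; apply: uniq_perm; [exact: fset_uniq|exact: uniq_generations|].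
move=> v; rewrite (gw_tree_finite gn) in_fset_set ?inE//; last exact: finite_seq.
by rewrite mem_setE.
Qed.

(** Words of every length make the tree infinite, and [fset_set] of an infinite set is [fset0] by
    default. *)
Lemma gw_tree_infinite K : (forall n, generation n K != [::]) ->
  fset_set (gw_tree K) = fset0.
Proof.
move=> gK; rewrite /fset_set; case: pselect => // fT; exfalso.
have fS : finite_set (size @` gw_tree K) by exact: finite_image.
apply: infinite_nat; rewrite (_ : setT = size @` gw_tree K)//.
apply/seteqP; split => // n _.
have := gK n; case E : (generation n K) => [//|v s] _.
have /mem_generation[Tv <-] : v \in generation n K by rewrite E mem_head.
by exists v.
Qed.

Lemma sum_labels f n x K xi : generation n K = [::] ->
  (\sum_(z <- tree_labels K xi) f (x + z)%R)%N = visits f n x K xi.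
Proof.
move=> gn; rewrite /tree_labels big_map (perm_big _ (perm_tree gn)) big_flatten big_map.
by rewrite /visits -(big_mkord xpredT (fun m => generation_sum f m x K xi)) /index_iota subn0.
Qed.

End generations.

(* inl (i, v) indexes the offspring number of v in the i-th tree, inr (i, v) the displacement of v;
   a single tree is the one of index 0. *)
Definition gw_index := ((nat * seq nat) + (nat * seq nat))%type.
Definition gw_config := config gw_index.

(** All coordinates are integers, so that one space holds offspring numbers and displacements;
    [absz] decodes the former. *)
Definition offspring (w : gw_config) (v : seq nat) : nat := absz (w (inl (0%N, v))).
Definition displacement (w : gw_config) (v : seq nat) : int := w (inr (0%N, v)).

Definition child (k : nat) (a : gw_index) : gw_index :=
  match a with inl (i, v) => inl (i, k :: v) | inr (i, v) => inr (i, k :: v) end.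

Definition shift (i : nat) (a : gw_index) : gw_index :=
  match a with inl (i', v) => inl ((i' + i)%N, v) | inr (i', v) => inr ((i' + i)%N, v) end.

Lemma child_inj k : injective (child k).
Proof. by move=> [[i v]|[i v]] [[i' v']|[i' v']] // [-> ->]. Qed.

Lemma shift_inj i : injective (shift i).
Proof. by move=> [[j v]|[j v]] [[j' v']|[j' v']] // [/addIn -> ->]. Qed.

Definition tree (w : gw_config) : seq int := tree_labels (offspring w) (displacement w).
Definition visit f n x (w : gw_config) : nat := visits f n x (offspring w) (displacement w).
Definition survives n (w : gw_config) : bool := generation n (offspring w) != [::].

Section tree_measurability.
Implicit Types (w : gw_config).

Lemma disc_reindex S (X : gw_config -> S) tau : disc X -> disc (fun w => X (w \o tau)).
Proof.
move=> dX B; have := reindex_measurable tau measurableT (dX B).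
by rewrite setTI.
Qed.

Lemma disc_offspring v : disc (fun w => offspring w v).
Proof. exact: (disc_comp absz (coord_disc _)). Qed.

Lemma disc_displacement v : disc (fun w => displacement w v).
Proof. exact: coord_disc. Qed.

Lemma disc_generation n : disc (fun w => generation n (offspring w)).
Proof.
elim: n => [|n ih] /=; first exact: disc_cst.
apply: (@disc_bind _ _ _ _ (fun w => offspring w [::]) (fun j w =>
  flatten [seq [seq k :: v | v <- generation n (offspring w \o cons k)] | k <- iota 0 j])).
  exact: disc_offspring.
move=> j; apply: (disc_comp flatten).
apply: (@disc_map _ _ _ _ (fun k w => [seq k :: v | v <- generation n (offspring w \o cons k)])).
move=> k; apply: (disc_comp (map (cons k))).
exact: (disc_reindex (child k) ih).
Qed.

Lemma disc_survives n : disc (survives n).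
Proof. exact: (disc_comp (fun s => s != [::]) (disc_generation n)). Qed.

Lemma disc_label v : disc (fun w => label (displacement w) v).
Proof.
pose X (k : nat) w := displacement w (take k.+1 v).
have dX : disc (fun w => [seq X k w | k <- iota 0 (size v)]).
  by apply: disc_map => k; exact: disc_displacement.
apply: (disc_factor dX) => w w' H; rewrite /label.
rewrite -!(big_mkord xpredT (fun k => displacement _ (take k.+1 v))) /index_iota subn0.
by rewrite -[LHS](big_map (X^~ w) xpredT id) H big_map.
Qed.

Lemma disc_visit f n x : disc (visit f n x).
Proof.
pose X (m : nat) w := generation_sum f m x (offspring w) (displacement w).
have dX : disc (fun w => [seq X k w | k <- iota 0 n]).
  apply: disc_map => m.
  apply: (@disc_bind _ _ _ _ (fun w => generation m (offspring w)) (fun s w =>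
    (\sum_(v <- s) f (x + label (displacement w) v)%R)%N)); first exact: disc_generation.
  move=> s; have dL : disc (fun w => [seq label (displacement w) v | v <- s]).
    by apply: disc_map => v; exact: disc_label.
  apply: (disc_factor dL) => w w' H.
  by rewrite -2!(big_map (label (displacement _)) xpredT (fun z => f (x + z)%R)) H.
apply: (disc_factor dX) => w w' H; rewrite /visit /visits.
rewrite -2!(big_mkord xpredT (fun m => X m _)) /index_iota subn0.
by rewrite -2!(big_map (X^~ _) xpredT id) H.
Qed.

(** The set of vertices equals [S] when, for some [n], generation [n] is empty and the earlier
    generations enumerate [S]; the event of survival forever is added to the fibre of the default
    value [fset0]. *)
Lemma disc_tree : disc tree.
Proof.
suff dT : disc (fun w => fset_set (gw_tree (offspring w))).
  apply: (@disc_bind _ _ _ _ (fun w => fset_set (gw_tree (offspring w))) (fun (s : {fset seq nat}) w =>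
    [seq label (displacement w) v | v <- s])) => // s.
  by apply: disc_map => v; exact: disc_label.
apply: disc_fibers => S.
pose dead n := survives n @^-1` [set false].
have dsv n B : measurable (survives n @^-1` B) by exact: disc_survives.
pose allg n w := flatten [seq generation m (offspring w) | m <- iota 0 n].
have dall n : disc (allg n).
  apply: (disc_comp flatten).
  by apply: disc_map => m; exact: disc_generation.
rewrite (_ : _ @^-1` _ =
  \bigcup_n (survives n @^-1` [set false] `&` allg n @^-1` [set s | perm_eq S s]) `|`
  (\bigcap_n (survives n @^-1` [set true]) `&` [set _ | S = fset0])).
  apply: measurableU.
    by apply: bigcupT_measurable => n; apply: measurableI; [exact: dsv|exact: dall].
  apply: measurableI; first by apply: bigcapT_measurable => n; exact: dsv.
  have [S0|S0] := pselect (S = fset0).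
    by rewrite (_ : [set _ | _] = setT)//; apply/seteqP; split.
  by rewrite (_ : [set _ | _] = set0)//; apply/seteqP; split.
apply/seteqP; split => [w /= TS|w [[n _ [/= /negbFE/eqP gn pS]]|[gw /= S0]]].
- have [[n /negbTE gn]|gw] := pselect (exists n, ~~ survives n w).
    left; exists n => //; split => //=.
    by rewrite -TS; apply: perm_tree; move/negbFE/eqP: gn.
  have gw' n : survives n w by apply: contrapT => /negP H; apply: gw; exists n.
  right; split => [n _ /=|/=]; first exact: gw'.
  by rewrite -TS; exact: gw_tree_infinite.
- apply/fsetP => v; have /perm_mem -> := perm_tree gn.
  by have /perm_mem -> := pS.
- by rewrite /= S0; apply: gw_tree_infinite => n; have := gw n Logic.I.
Qed.

End tree_measurability.

(** * Moments of the number of visits and survival probabilities *)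

Lemma sume_const (R : realType) j (G : \bar R) : (0 <= G)%E ->
  (\sum_(k < j) G = j%:R%:E * G)%E.
Proof.
move=> G0; elim: j => [|j ih]; first by rewrite big_ord0 mul0e.
rewrite big_ord_recr /= ih -natr1 EFinD ge0_muleDl ?mul1e ?lee_fin//.
Qed.

Section gw_moments.
Local Open Scope ereal_scope.
Variables (R : realType) (nu : probability nat R) (F : probability int R).
Variable mu : probability gw_config R.

Record gw_law : Prop := {
  gw_independent : independent_coords mu;
  gw_offspring_law : forall p (A : set int),
    mu [set w | A (w (inl p))] = nu [set n | A (Posz n)];
  gw_displacement_law : forall p (A : set int), mu [set w | A (w (inr p))] = F A
}.
Hypothesis law : gw_law.
Implicit Types (f : int -> nat) (n k j : nat) (x y : int) (w : gw_config).

Let code_int (z : int) : nat := choice.pickle z.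
Let code_int_inj : injective code_int.
Proof. exact: (pcan_inj choice.pickleK). Qed.

Let disc_mnat (g : nat -> \bar R) D : measurable_fun D g.
Proof. by move=> _ B mB. Qed.
Let disc_mint (g : int -> \bar R) D : measurable_fun D g.
Proof. by move=> _ B mB. Qed.

Lemma integral_child k (g : gw_config -> \bar R) : measurable_fun setT g ->
  (forall w, 0 <= g w) -> \int[mu]_w g (w \o child k) = \int[mu]_w g w.
Proof.
apply: (integral_reindex (gw_independent law)); first exact: child_inj.
move=> [[i v]|[i v]] A /=.
  by rewrite !(gw_offspring_law law).
by rewrite !(gw_displacement_law law).
Qed.

Lemma integral_shift i (g : gw_config -> \bar R) : measurable_fun setT g ->
  (forall w, 0 <= g w) -> \int[mu]_w g (w \o shift i) = \int[mu]_w g w.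
Proof.
apply: (integral_reindex (gw_independent law)); first exact: shift_inj.
move=> [[i' v]|[i' v]] A /=.
  by rewrite !(gw_offspring_law law).
by rewrite !(gw_displacement_law law).
Qed.

Definition root_index : pred gw_index := pred1 (inl (0%N, [::])).
(** Contains the displacement of the child itself, indexed by the word [[:: k]]; these sets are
    disjoint for distinct [k], so the contributions of the children are independent. *)
Definition subtree_index k : pred gw_index := fun a =>
  match a with inl (i, v) | inr (i, v) => (i == 0%N) && (ohead v == Some k) end.
Definition nonroot_index : pred gw_index := fun a => a != inl (0%N, [::]).
Definition tree_index i : pred gw_index := fun a =>
  match a with inl (i', v) | inr (i', v) => i' == i end.

Lemma depends_visit f n x w w' : offspring w = offspring w' ->
  (forall v, v != [::] -> displacement w v = displacement w' v) ->
  visit f n x w = visit f n x w'.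
Proof.
move=> oww dww; rewrite /visit /visits oww; apply: eq_bigr => m _.
apply: eq_bigr => v _; congr (f (x + _)%R).
by apply: eq_bigr => i _; apply: dww; case: v i => [[]|].
Qed.

Definition child_visit f n x k w : nat :=
  visit f n (x + displacement w [:: k])%R (w \o child k).

Lemma depends_child_visit f n x k : depends (subtree_index k) (child_visit f n x k).
Proof.
move=> w w' ww'; rewrite /child_visit (_ : displacement w _ = displacement w' [:: k]); last first.
  by apply: ww' => /=; rewrite eqxx.
apply: depends_visit.
  by apply/funext => v; rewrite /offspring /= ww'//= eqxx.
by move=> v _; rewrite /displacement /= ww'//= eqxx.
Qed.

Lemma depends_child_survives n k :
  depends (subtree_index k) (fun w => survives n (w \o child k)).
Proof.
move=> w w' ww'; rewrite /survives (_ : offspring (w \o child k) = offspring (w' \o child k))//.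
by apply/funext => v; rewrite /offspring /= ww'//= eqxx.
Qed.

Lemma disc_child_visit f n x k : disc (child_visit f n x k).
Proof.
apply: (@disc_bind _ _ _ _ (fun w => displacement w [:: k])
  (fun z w => visit f n (x + z)%R (w \o child k))); first exact: disc_displacement.
by move=> z; apply: disc_reindex; exact: disc_visit.
Qed.

Lemma integral_root (g : nat -> gw_config -> \bar R) :
  (forall j, measurable_fun setT (g j)) -> (forall j w, 0 <= g j w) ->
  (forall j, depends nonroot_index (g j)) ->
  \int[mu]_w g (offspring w [::]) w = \int[nu]_j \int[mu]_w g j w.
Proof.
move=> mg g0 dg.
apply: (integral_disintegrate (code := id)) => //.
- exact: disc_offspring.
- by move=> j; exact: integral_ge0.
move=> j; rewrite (integral_setI_depends (gw_independent law)
  (J1 := root_index) (J2 := nonroot_index))//.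
- congr (_ * _); rewrite (_ : _ @^-1` _ = [set w | (absz @^-1` [set j]) (w (inl (0%N, [::])))])//.
  by rewrite (gw_offspring_law law); congr (nu _).
- by move=> a /eqP ->; rewrite /nonroot_index eqxx.
- exact: disc_offspring.
- by move=> w w' ww'; rewrite /preimage /mkset /offspring ww'.
Qed.

Lemma integral_displacement k (g : int -> gw_config -> \bar R) :
  (forall z, measurable_fun setT (g z)) -> (forall z w, 0 <= g z w) ->
  (forall z, depends (fun a => a != inr (0%N, [:: k])) (g z)) ->
  \int[mu]_w g (displacement w [:: k]) w = \int[F]_z \int[mu]_w g z w.
Proof.
move=> mg g0 dg.
apply: (integral_disintegrate (code := code_int)) => //.
- exact: disc_displacement.
- by move=> j; exact: integral_ge0.
move=> z; rewrite (integral_setI_depends (gw_independent law)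
  (J1 := pred1 (inr (0%N, [:: k]))) (J2 := fun a => a != inr (0%N, [:: k])))//.
- by congr (_ * _); rewrite -(gw_displacement_law law (0%N, [:: k])).
- by move=> a /eqP ->; rewrite eqxx.
- exact: disc_displacement.
- move=> w w' ww'; rewrite /preimage /mkset /displacement ww'//.
  exact/eqP.
Qed.

Let mphi (phi : nat -> \bar R) (X : gw_config -> nat) : disc X ->
  measurable_fun setT (fun w => phi (X w)).
Proof. by move=> dX _ B mB; rewrite setTI; exact: (disc_comp phi dX). Qed.

Lemma integral_child_visit (phi : nat -> \bar R) f n x k : (forall m, 0 <= phi m) ->
  \int[mu]_w phi (child_visit f n x k w) =
  \int[F]_z \int[mu]_w phi (visit f n (x + z)%R w).
Proof.
move=> phi0.
transitivity (\int[F]_z \int[mu]_w phi (visit f n (x + z)%R (w \o child k))); last first.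
  apply: eq_integral => z _; rewrite -[RHS](integral_child k)//.
  exact: (@mphi phi (visit f n (x + z)%R) (disc_visit _ _ _)).
apply: (@integral_displacement k (fun z w => phi (visit f n (x + z)%R (w \o child k)))).
- by move=> z; apply: mphi; apply: disc_reindex; exact: disc_visit.
- by move=> z w; exact: phi0.
- move=> z w w' ww'; congr phi; apply: depends_visit.
    by apply/funext => v; rewrite /offspring /= ww'.
  by move=> v v0; rewrite /displacement /= ww'//=; apply/eqP => -[] /eqP; rewrite (negbTE v0).
Qed.

Definition mean_visit f n x : \bar R := \int[mu]_w (visit f n x w)%:R%:E.
Definition mean_sqr_visit f n x : \bar R := \int[mu]_w ((visit f n x w)^2)%:R%:E.

Lemma mean_child_visit f n x k :
  \int[mu]_w (child_visit f n x k w)%:R%:E = \int[F]_z mean_visit f n (x + z)%R.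
Proof. exact: (integral_child_visit (phi := fun m => m%:R%:E)). Qed.

Lemma visit0 f x w : visit f 0 x w = 0%N. Proof. exact: visits0. Qed.

Lemma visitS f n x w : visit f n.+1 x w =
  (f x + \sum_(k < offspring w [::]) child_visit f n x k w)%N.
Proof. by rewrite /visit visitsS. Qed.

Lemma subtree_nonroot k a : subtree_index k a -> nonroot_index a.
Proof. by case: a => -[[|i] [|j v]]. Qed.

Lemma mean_visit0 f x : mean_visit f 0 x = 0.
Proof. by rewrite /mean_visit integral0_eq// => w _; rewrite visit0. Qed.

Lemma mean_visit_ge0 f n x : 0 <= mean_visit f n x.
Proof. by apply: integral_ge0 => w _; rewrite lee_fin. Qed.

Lemma mean_sqr_visit_ge0 f n x : 0 <= mean_sqr_visit f n x.
Proof. by apply: integral_ge0 => w _; rewrite lee_fin. Qed.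

Let disc_sum_child f n x j : disc (fun w => (\sum_(k < j) child_visit f n x k w)%N).
Proof.
have dX : disc (fun w => [seq child_visit f n x k w | k <- iota 0 j]).
  by apply: disc_map => k; exact: disc_child_visit.
apply: (disc_factor dX) => w w' H.
rewrite -2!(big_mkord xpredT (fun k => child_visit f n x k _)) /index_iota subn0.
by rewrite -2!(big_map (child_visit f n x ^~ _) xpredT id) H.
Qed.

Let dep_sum_child f n x j : depends nonroot_index (fun w => (\sum_(k < j) child_visit f n x k w)%N).
Proof.
move=> w w' ww'; apply: eq_bigr => k _; apply: depends_child_visit => a /subtree_nonroot.
exact: ww'.
Qed.

Hypothesis nu_mean : \int[nu]_j j%:R%:E = 1.

(** Mean offspring 1 removes the branching from first moments, which follow a random walk with step
    law [F]. *)
Lemma mean_sum_child f n x : \int[mu]_w (\sum_(k < offspring w [::]) child_visit f n x k w)%:R%:E =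
  \int[F]_z mean_visit f n (x + z)%R.
Proof.
set G := \int[F]_z _; have G0 : 0 <= G by apply: integral_ge0 => z _; exact: mean_visit_ge0.
rewrite (integral_root (g := fun j w => (\sum_(k < j) child_visit f n x k w)%:R%:E)).
- transitivity (\int[nu]_j (j%:R%:E * G)); last first.
    by rewrite ge0_integralZr ?nu_mean ?mul1e// => j _; rewrite lee_fin.
  apply: eq_integral => j _.
  transitivity (\int[mu]_w \sum_(k < j) (child_visit f n x k w)%:R%:E).
    by apply: eq_integral => w _; rewrite natr_sum sumEFin.
  rewrite ge0_integral_sum//.
  + under eq_bigr do rewrite (integral_child_visit (phi := fun m => m%:R%:E))// -/G.
    by rewrite sume_const.
  + by move=> k; apply: (mphi (fun m => m%:R%:E)); exact: disc_child_visit.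
- by move=> j; apply: (mphi (fun m => m%:R%:E)); exact: disc_sum_child.
- by move=> j w; rewrite lee_fin.
- by move=> j w w' ww'; rewrite (@dep_sum_child f n x j w w' ww').
Qed.

Lemma mean_visitS f n x :
  mean_visit f n.+1 x = (f x)%:R%:E + \int[F]_z mean_visit f n (x + z)%R.
Proof.
rewrite -mean_sum_child /mean_visit.
transitivity (\int[mu]_w ((f x)%:R%:E + (\sum_(k < offspring w [::]) child_visit f n x k w)%:R%:E)).
  by apply: eq_integral => w _; rewrite visitS natrD.
rewrite ge0_integralD//.
- by rewrite integral_cst// [X in _ * X]probability_setT mule1.
- apply: (mphi (fun m => m%:R%:E)).
  by apply: (@disc_bind _ _ _ _ _ (fun j w => (\sum_(k < j) child_visit f n x k w)%N)) => //; exact: disc_offspring.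
Qed.

(** Given [j] children, the diagonal gives [j] second moments, and each of the at most j^2 other
    pairs gives the square of the mean, by independence of the subtrees; then [j] is averaged, with
    mean 1. *)
Lemma mean_sqr_sum_child f n x :
  \int[mu]_w ((\sum_(k < offspring w [::]) child_visit f n x k w)^2)%:R%:E <=
  \int[F]_z mean_sqr_visit f n (x + z)%R +
    (\int[nu]_j (j ^ 2)%:R%:E) * (\int[F]_z mean_visit f n (x + z)%R) ^+ 2.
Proof.
move eG : (\int[F]_z mean_visit f n (x + z)%R) => G.
have G0 : 0 <= G by rewrite -eG; apply: integral_ge0 => z _; exact: mean_visit_ge0.
move eH : (\int[F]_z mean_sqr_visit f n (x + z)%R) => H.
have H0 : 0 <= H by rewrite -eH; apply: integral_ge0 => z _; exact: mean_sqr_visit_ge0.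
have G20 : 0 <= G ^+ 2 by rewrite expe2 mule_ge0.
rewrite (integral_root (g := fun j w => ((\sum_(k < j) child_visit f n x k w)^2)%:R%:E)); last 3 first.
- by move=> j; apply: (mphi (fun m => (m ^ 2)%:R%:E)); exact: disc_sum_child.
- by move=> j w; rewrite lee_fin.
- by move=> j w w' ww'; rewrite (@dep_sum_child f n x j w w' ww').
apply: (@le_trans _ _ (\int[nu]_j (j%:R%:E * H + (j ^ 2)%:R%:E * G ^+ 2))); last first.
  rewrite ge0_integralD//; last 2 first.
  - by move=> j _; rewrite mule_ge0.
  - by move=> j _; rewrite mule_ge0.
  rewrite ge0_integralZr// ge0_integralZr//.
  by rewrite nu_mean mul1e.
apply: ge0_le_integral => //.
- by move=> j _; apply: integral_ge0 => w _; rewrite lee_fin.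
move=> j _.
have sqrE w : ((\sum_(k < j) child_visit f n x k w)^2)%:R%:E =
  \sum_(k < j) \sum_(l < j) ((child_visit f n x k w)%:R%:E * (child_visit f n x l w)%:R%:E) :> \bar R.
  rewrite -mulnn natrM natr_sum EFinM -!sumEFin.
  rewrite ge0_sume_distrl; last by move=> k _; rewrite lee_fin.
  apply: eq_bigr => k _; rewrite ge0_sume_distrr//.
have mprod k l : measurable_fun setT (fun w : gw_config => ((child_visit f n x k w)%:R%:E * (child_visit f n x l w)%:R%:E : \bar R)).
  by apply: emeasurable_funM; apply: (mphi (fun m => m%:R%:E)); exact: disc_child_visit.
under eq_integral do rewrite sqrE.
rewrite ge0_integral_sum//; last 2 first.
- by move=> k; apply: emeasurable_sum => l; exact: mprod.
- by move=> k w _; apply: sume_ge0 => l _; rewrite mule_ge0// lee_fin.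
apply: (@le_trans _ _ (\sum_(k < j) (H + j%:R%:E * G ^+ 2))); last first.
  rewrite [X in X <= _](_ : _ = j%:R%:E * (H + j%:R%:E * G ^+ 2)); last first.
    by apply: sume_const; rewrite adde_ge0// mule_ge0.
  rewrite ge0_muleDr//; last by rewrite mule_ge0.
  by rewrite muleA -EFinM -natrM mulnn.
apply: lee_sum => k _; rewrite ge0_integral_sum//.
(* The diagonal is charged with [G ^+ 2] as well, so that pairs are counted by j^2. *)
apply: (@le_trans _ _ (\sum_(l < j) ((l == k)%:R%:E * H + G ^+ 2))).
  apply: lee_sum => l _; have [->|lk] := eqVneq l k.
    rewrite mul1e; under eq_integral do rewrite -EFinM -natrM mulnn.
    by rewrite (integral_child_visit (phi := fun m => (m ^ 2)%:R%:E))// [X in X <= _]eH leeDl.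
  rewrite mul0e add0e (integral_prod_depends (gw_independent law)
    (J1 := subtree_index k) (J2 := subtree_index l)).
  - by rewrite !mean_child_visit eG expe2.
  - move=> a; case: a => -[i [|b v]] /=; rewrite ?andbF// => /andP[-> /eqP[->]] /=;
      by apply: contra lk => /eqP[/val_inj ->].
  - by apply: (mphi (fun m => m%:R%:E)); exact: disc_child_visit.
  - by apply: (mphi (fun m => m%:R%:E)); exact: disc_child_visit.
  - by move=> w; rewrite lee_fin.
  - by move=> w; rewrite lee_fin.
  - by move=> w w' ww'; rewrite (@depends_child_visit f n x k w w' ww').
  - by move=> w w' ww'; rewrite (@depends_child_visit f n x l w w' ww').
rewrite big_split/= sume_const//; apply: leeD => //.
rewrite (bigD1 k)//= eqxx mul1e big1 ?adde0// => l /negbTE ->.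
by rewrite mul0e.
Qed.

Lemma mean_sqr_visitS f n x : mean_sqr_visit f n.+1 x <=
  ((f x) ^ 2)%:R%:E + (2 * f x)%:R%:E * (\int[F]_z mean_visit f n (x + z)%R) +
  \int[F]_z mean_sqr_visit f n (x + z)%R +
    (\int[nu]_j (j ^ 2)%:R%:E) * (\int[F]_z mean_visit f n (x + z)%R) ^+ 2.
Proof.
rewrite -[leRHS]addeA; apply: le_trans (leeD2l _ (mean_sqr_sum_child f n x)).
rewrite -mean_sum_child /mean_sqr_visit.
pose S w := (\sum_(k < offspring w [::]) child_visit f n x k w)%N.
have dS : disc S.
  by apply: (@disc_bind _ _ _ _ _ (fun j w => (\sum_(k < j) child_visit f n x k w)%N)) => //; exact: disc_offspring.
rewrite (eq_integral (fun w => ((f x ^ 2)%:R%:E + (2 * f x)%:R%:E * (S w)%:R%:E) + ((S w) ^ 2)%:R%:E)); last first.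
  move=> w _; rewrite visitS -/(S w) -EFinM -!EFinD -natrM -!natrD.
  by rewrite sqrnD addnAC mulnA.
have mS : measurable_fun setT (fun w => (S w)%:R%:E : \bar R) by apply: (mphi (fun m => m%:R%:E)).
rewrite ge0_integralD//; last 3 first.
- by move=> w _; rewrite adde_ge0 ?mule_ge0 ?lee_fin.
- by apply: emeasurable_funD => //; apply: emeasurable_funM.
- by apply: (mphi (fun m => (m ^ 2)%:R%:E)).
rewrite leeD2r// ge0_integralD//; last exact: emeasurable_funM.
rewrite ge0_integralZl//.
by rewrite integral_cst// [X in _ * X]probability_setT mule1.
Qed.

Lemma survivesS n w :
  survives n.+1 w = [exists k : 'I_(offspring w [::]), survives n (w \o child k)].
Proof.
apply/idP/existsP => [|[k]]; rewrite /survives /=.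
  case E : (flatten _) => [//|v s] _.
  have /flatten_mapP[k] : v \in flatten [seq [seq k :: v | v <- generation n (offspring w \o cons k)] | k <- iota 0 (offspring w [::])].
    by rewrite E mem_head.
  rewrite mem_iota => /andP[_ kK] vs; exists (Ordinal kK) => /=.
  by case: (generation n _) vs.
case E : (generation n _) => [//|v s] _.
suff : (k : nat) :: v \in flatten [seq [seq k :: v | v <- generation n (offspring w \o cons k)] | k <- iota 0 (offspring w [::])].
  by case: (flatten _).
apply/flatten_mapP; exists (k : nat); first by rewrite mem_iota /=.
by apply: map_f; rewrite [generation n _]E mem_head.
Qed.

Definition survival n : \bar R := mu (survives n @^-1` [set true]).

(* Bonferroni: a union of j >= 2 events costs at least the overlap of the first two. *)
Lemma survivalS n : survival n.+1 + nu [set j | (2 <= j)%N] * survival n ^+ 2 <= survival n.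
Proof.
(* [A k] refers to the coordinates below the word [[:: k]] whether or not the root has that child,
   so its probability does not depend on [k]. *)
pose A k := [set w : gw_config | survives n (w \o child k)].
have mA k : measurable (A k) by exact: (disc_reindex (child k) (disc_survives n) [set true]).
have intE (B : set gw_config) : measurable B -> mu B = \int[mu]_w (\1_B w)%:E.
  by move=> mB; rewrite integral_indic// setIT.
have PA k : mu (A k) = survival n.
  rewrite (intE _ (mA k)) /survival (intE (survives n @^-1` [set true])); last exact: disc_survives.
  rewrite -[RHS](integral_child k)//; apply/measurable_EFinP/measurable_indic.
  exact: disc_survives.
have dA k : depends (subtree_index k) (A k).
  by move=> w w' ww'; rewrite /A /mkset (@depends_child_survives n k w w' ww').
pose U j := \big[setU/set0]_(k < j) A k.
have mU j : measurable (U j) by exact: bigsetU_measurable.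
have UP j w : U j w <-> exists k : 'I_j, A k w.
  by rewrite /U -bigcup_mkord; split => [[k kj Ak]|[k Ak]]; [exists (Ordinal kj)|exists k => //; exact: ltn_ord].
have PU : survival n.+1 = \int[nu]_j mu (U j).
  rewrite /survival intE; last exact: disc_survives.
  transitivity (\int[mu]_w (\1_(U (offspring w [::])) w)%:E : \bar R).
    apply: eq_integral => w _; congr (_%:E); rewrite !indicE; congr ((nat_of_bool _)%:R).
    apply/idP/idP => /set_mem H; apply/mem_set.
      by move: H; rewrite /= survivesS => /existsP[k Hk]; apply/UP; exists k.
    by rewrite /= survivesS; apply/existsP; move/UP: H => [k Hk]; exists k.
  rewrite (integral_root (g := fun j w => (\1_(U j) w)%:E)).
  - by apply: eq_integral => j _; rewrite integral_indic// setIT.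
  - by move=> j; apply/measurable_EFinP/measurable_indic.
  - by move=> j w; rewrite lee_fin.
  - move=> j w w' ww'; rewrite !indicE; congr ((nat_of_bool _)%:R%:E).
    have e : U j w <-> U j w'.
      by split => /UP[k Ak]; apply/UP; exists k; [rewrite -(dA k w w')|rewrite (dA k w w')] => // a /subtree_nonroot; exact: ww'.
    by apply/idP/idP => /set_mem H; apply/mem_set/e.
set p := survival n in PA *; have p0 : 0 <= p by exact: measure_ge0.
have bonf j : mu (U j) + (2 <= j)%N%:R%:E * p ^+ 2 <= j%:R%:E * p.
  have -> : j%:R%:E * p = \int[mu]_w \sum_(k < j) (\1_(A k) w)%:E.
    rewrite ge0_integral_sum//; last by move=> k; apply/measurable_EFinP/measurable_indic.
    under eq_bigr do rewrite -intE// PA.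
    by rewrite sume_const.
  have p2 : p ^+ 2 = mu (A 0%N `&` A 1%N).
    rewrite (independent_events (gw_independent law) (J1 := subtree_index 0) (J2 := subtree_index 1))//.
      by rewrite !PA expe2.
    by move=> a; case: a => -[i [|b v]] /=; rewrite ?andbF// => /andP[_ /eqP[->]]; rewrite andbF.
  have -> : mu (U j) + (2 <= j)%N%:R%:E * p ^+ 2 =
      \int[mu]_w ((\1_(U j) w)%:E + (2 <= j)%N%:R%:E * (\1_(A 0%N `&` A 1%N) w)%:E).
    have mI : measurable (A 0%N `&` A 1%N) by exact: measurableI.
    have mi B : measurable B -> measurable_fun setT (fun w => (\1_B w)%:E : \bar R).
      by move=> mB; exact/measurable_EFinP/measurable_indic.
    rewrite ge0_integralD//; [|exact: mi|by apply: emeasurable_funM => //; exact: mi].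
    rewrite ge0_integralZl//; last exact: mi.
    by rewrite -!intE// p2.
  apply: ge0_le_integral => //.
  - by move=> w _; rewrite adde_ge0// ?mule_ge0// lee_fin.
  - apply: emeasurable_funD; first exact/measurable_EFinP/measurable_indic.
    apply: emeasurable_funM => //; apply/measurable_EFinP/measurable_indic.
    exact: measurableI.
  - by apply: emeasurable_sum => k; apply/measurable_EFinP/measurable_indic.
  move=> w _; rewrite sumEFin -EFinM -EFinD lee_fin !indicE.
  have s0 (P : pred 'I_j) : (0 <= \sum_(i < j | P i) (\1_(A i) w : R))%R.
    by apply: sumr_ge0 => i _.
  case: (leqP 2 j) => j2; rewrite ?mul0r ?addr0 ?mul1r; last first.
    have [/set_mem/UP[k Ak]|_] := boolP (w \in U j); last exact: s0.
    by rewrite (bigD1 k)//= indicE mem_set// lerDl.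
  have [/set_mem[A0 A1]|nA] := boolP (w \in A 0%N `&` A 1%N).
    have j0 : (0 < j)%N by exact: leq_trans j2.
    have e0 : \1_(A 0%N) w = 1%R :> R by rewrite indicE mem_set.
    have e1 : \1_(A 1%N) w = 1%R :> R by rewrite indicE mem_set.
    rewrite (bigD1 (Ordinal j0))//= (bigD1 (Ordinal j2))//= e0 e1.
    rewrite addrA -[leLHS]addr0 lerD ?s0// lerD// lern1; by case: (_ \in _).
  rewrite addr0; have [/set_mem/UP[k Ak]|_] := boolP (w \in U j); last exact: s0.
  by rewrite (bigD1 k)//= indicE mem_set// lerDl.
have p20 : 0 <= p ^+ 2 by rewrite expe2 mule_ge0.
rewrite PU.
have -> : nu [set j | (2 <= j)%N] * p ^+ 2 = \int[nu]_j ((2 <= j)%N%:R%:E * p ^+ 2).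
  rewrite ge0_integralZr//.
  congr (_ * _).
  transitivity (\int[nu]_j (\1_[set j | (2 <= j)%N] j)%:E : \bar R).
    by rewrite integral_indic// setIT.
  apply: eq_integral => j _.
  by congr ((nat_of_bool _)%:R%:E); apply/idP/idP => [/set_mem//|H]; exact/mem_set.
have t0 j : 0 <= (2 <= j)%N%:R%:E * p ^+ 2 by rewrite mule_ge0// lee_fin.
rewrite -ge0_integralD//.
apply: (@le_trans _ _ (\int[nu]_j (j%:R%:E * p))).
  by apply: ge0_le_integral => // j _; rewrite adde_ge0.
by rewrite ge0_integralZr// nu_mean mul1e.
Qed.

End gw_moments.

Lemma integral_prob_cst d (T : measurableType d) (R : realType)
    (P : probability T R) (c : \bar R) : (\int[P]_x c = c)%E.
Proof.
by rewrite integral_cst// [X in (_ * X)%E](_ : _ = 1%E) ?mule1//; exact: probability_setT.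
Qed.

(** * Moments of the offspring and displacement laws *)

Section moments_of_laws.
Variables (R : realType).

Lemma offspring_moments (nu : probability nat R) :
  ('E_nu[fun k : nat => k%:R%R : R] = 1)%E ->
  (0 < 'V_nu[fun k : nat => k%:R%R : R] < +oo)%E ->
  [/\ (\int[nu]_j j%:R%:E = 1)%E, (\int[nu]_j (j ^ 2)%:R%:E < +oo)%E
    & (0 < nu [set j | (2 <= j)%N])%E].
Proof.
move=> nu1; have m1 : (\int[nu]_j j%:R%:E = 1)%E by rewrite -nu1 unlock.
have mnat (g : nat -> \bar R) (D : set nat) : measurable_fun D g by move=> _ B mB.
have vE : ('V_nu[fun k : nat => k%:R : R] = \int[nu]_j ((j%:R - 1) ^+ 2)%:E)%E.
  rewrite /variance covariance.unlock nu1 unlock; apply: eq_integral => j _.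
  by rewrite expr2.
rewrite vE.
move=> /andP[v0 voo]; split => //.
  (* The bound j^2 <= 2 (j - 1)^2 + 2 amounts to (j - 2)^2 >= 0. *)
  apply: (@le_lt_trans _ _ (\int[nu]_j ((2%:E * ((j%:R - 1) ^+ 2)%:E) + 2%:E))%E).
    apply: ge0_le_integral => // j _; rewrite ?lee_fin//.
    rewrite natrX; have := sqr_ge0 (j%:R - 2 : R); nra.
  rewrite ge0_integralD//; last by move=> j _; rewrite -EFinM lee_fin mulr_ge0// sqr_ge0.
  rewrite ge0_integralZl//; last by move=> j _; rewrite lee_fin sqr_ge0.
  by rewrite integral_prob_cst lte_add_pinfty ?ltry// lte_mul_pinfty.
rewrite lt0e measure_ge0 andbT; apply/eqP => n2.
have int2 : (\int[nu]_(j in [set j | (2 <= j)%N]) (j ^ 2)%:R%:E = 0 :> \bar R)%E.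
  exact: null_set_integral.
rewrite integral_mkcond in int2.
(* On 0 and 1 the sum (j - 1)^2 + j equals 1. If no other value is taken, variance plus mean is at
   most 1, and mean 1 leaves a zero variance. *)
have : (\int[nu]_j ((j%:R - 1) ^+ 2)%:E + 1 <= 1 :> \bar R)%E.
  rewrite -{1}m1 -ge0_integralD//; last by move=> j _; rewrite lee_fin sqr_ge0.
  apply: (@le_trans _ _ (\int[nu]_j (1 + ((fun j => (j ^ 2)%:R%:E) \_ [set j | (2 <= j)%N]) j))%E).
    apply: ge0_le_integral => //.
      by move=> j _; rewrite adde_ge0// lee_fin ?sqr_ge0.
    move=> j _; rewrite patchE; case: ifPn => [/set_mem|/negP j2].
      by move=> _; rewrite -!EFinD lee_fin natrX; have : 0 <= j%:R :> R by []; nra.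
    have {j2} : (j < 2)%N by rewrite ltnNge; apply/negP => H; apply: j2; exact/mem_set.
    by case: j => [|[|]]// _; rewrite adde0 -!EFinD lee_fin; lra.
  rewrite ge0_integralD//; last by move=> j _; apply: erestrict_ge0 => ? _; rewrite lee_fin.
  by rewrite int2 adde0 integral_prob_cst.
by rewrite -leeBrDr// subee// leNgt v0.
Qed.

Lemma displacement_moments (F : probability int R) :
  ('E_F[fun k : int => k%:~R%R : R] = 0)%E ->
  (0 < 'V_F[fun k : int => k%:~R%R : R] < +oo)%E ->
  exists2 s2 : R, 0 <= s2 & forall x : R,
    (\int[F]_z ((x + z%:~R) ^+ 2)%:E = (x ^+ 2 + s2)%:E)%E.
Proof.
move=> F0; have m0 : (\int[F]_z z%:~R%:E = 0 :> \bar R)%E by rewrite -F0 unlock.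
have mint (g : int -> \bar R) (D : set int) : measurable_fun D g by move=> _ B mB.
have vE : ('V_F[fun k : int => k%:~R : R] = \int[F]_z (z%:~R ^+ 2)%:E)%E.
  rewrite /variance covariance.unlock F0 unlock; apply: eq_integral => j _.
  by rewrite -[X in X%:E]/((j%:~R - 0) * (j%:~R - 0)) subr0 expr2.
rewrite vE => /andP[_ voo].
have isqr : F.-integrable setT (fun z : int => ((z%:~R : R) ^+ 2)%:E).
  apply/integrableP; split => //.
  rewrite (eq_integral (fun z : int => ((z%:~R : R) ^+ 2)%:E))//.
  by move=> z _; rewrite gee0_abs// lee_fin sqr_ge0.
have icst (c : R) : F.-integrable setT (fun z : int => c%:E).
  by apply: finite_measure_integrable_cst.
have iid : F.-integrable setT (fun z : int => (z%:~R : R)%:E).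
  apply: (le_integrable measurableT (g := fun z => (1%:E + ((z%:~R : R) ^+ 2)%:E)%E)) => //.
    move=> z _; rewrite -EFinD /= lee_fin [leRHS]ger0_norm ?addr_ge0 ?sqr_ge0//.
    by rewrite ler_norml; apply/andP; split; nra.
  exact: integrableD.
have fin2 : (\int[F]_z ((z%:~R : R) ^+ 2)%:E)%E \is a fin_num by exact: integrable_fin_num.
exists (fine (\int[F]_z ((z%:~R : R) ^+ 2)%:E)%E).
  by apply: fine_ge0; apply: integral_ge0 => z _; rewrite lee_fin sqr_ge0.
move=> x.
rewrite (eq_integral (fun z => ((x ^+ 2)%:E + ((2 * x)%:E * (z%:~R)%:E + (z%:~R ^+ 2)%:E)))%E); last first.
  by move=> z _; rewrite -EFinM -!EFinD; congr (_%:E); ring.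
have i2 : F.-integrable setT (fun z : int => ((2 * x)%:E * (z%:~R : R)%:E)%E).
  exact: integrableZl.
rewrite integralD//; last exact: integrableD.
rewrite integralD// integralZl// m0 mule0 add0e EFinD fineK//; congr (_ + _)%E.
exact: integral_prob_cst.
Qed.

End moments_of_laws.

(** * Survival, Green function and second moments *)

Section gw_bounds.
Variables (R : realType) (nu : probability nat R) (F : probability int R).
Variable mu : probability gw_config R.
Hypothesis law : gw_law nu F mu.
Hypothesis nu_mean : (\int[nu]_j j%:R%:E = 1)%E.
Implicit Types (n N : nat) (x : int).

Let mint (g : int -> \bar R) (D : set int) : measurable_fun D g.
Proof. by move=> _ B mB. Qed.

(** The recursion p' <= p - c p^2, with c = nu {j >= 2}, forces decay like 1 / (c n). *)
Lemma survival_bound : (0 < nu [set j | (2 <= j)%N])%E ->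
  exists2 c : R, 0 < c & forall n, (n%:R%:E * survival mu n <= c^-1%:E)%E.
Proof.
move=> n2; set q := nu _ in n2.
have qfin : q \is a fin_num by exact: fin_num_measure.
have pfin n : survival mu n \is a fin_num.
  by apply: fin_num_measure; exact: disc_survives.
exists (fine q); first by rewrite fine_gt0// n2 ltey_eq qfin.
pose p n := fine (survival mu n).
have pE n : survival mu n = (p n)%:E by rewrite /p fineK.
set c := fine q; have c0 : 0 < c by rewrite /c fine_gt0// n2 ltey_eq qfin.
have p0 n : 0 <= p n by rewrite /p fine_ge0// measure_ge0.
have pS n : p n.+1 + c * p n ^+ 2 <= p n.
  have := survivalS law nu_mean n; rewrite -/q -(fineK qfin) !pE.
  by rewrite expe2 -!EFinM -EFinD lee_fin -expr2.
have H n : c * n%:R * p n <= 1.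
  elim: n => [|n ih]; first by rewrite mulr0 mul0r.
  have := pS n; have := p0 n; have := p0 n.+1; rewrite -natr1.
  have : 0 <= n%:R :> R by [].
  (* At 0 the induction hypothesis gives no bound on [p 0]; there t - t^2 <= 1 suffices, for t = c p
     0. *)
  case: n ih => [_|n ih].
    move=> _ _ a0 h; rewrite add0r mulr1.
    have := ler_wpM2l (ltW c0) h; have := sqr_ge0 (c * p 0%N - 1).
    have : 0 <= c * p 0%N by rewrite mulr_ge0// ltW.
    by rewrite (_ : c * (_ + _) = c * p 1%N + (c * p 0%N) ^+ 2); [nra|ring].
  have n1 : 1 <= n.+1%:R :> R by rewrite ler1n.
  move=> _ b0 a0 h; move: ih n1 b0 a0 h; set a := p n.+1; set b := p n.+2.
  set m := n.+1%:R => ih n1 b0 a0 h.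
  have ca0 : 0 <= c * a by rewrite mulr_ge0// ltW.
  have ca1 : c * a <= 1 by nra.
  have h1 : c * b <= c * a - (c * a) ^+ 2 by nra.
  have h2 : c * (m + 1) * b <= (m + 1) * (c * a - (c * a) ^+ 2) by nra.
  have h3 : m * (c * a) <= 1 by nra.
  (* From m t <= 1 follows (m + 1) t (1 - t) <= (1 + t) (1 - t) <= 1. *)
  move: h2 h3 ca0 ca1; set t := c * a => h2 h3 t0 t1; nra.
move=> n; rewrite pE -EFinM lee_fin -[leRHS]mul1r ler_pdivlMr//.
by have := H n; nra.
Qed.

Lemma mean_visit_cst1 n x : mean_visit mu (fun=> 1%N) n x = n%:R%:E.
Proof.
elim: n x => [|n ih] x; first by rewrite mean_visit0.
rewrite (mean_visitS law nu_mean); under eq_integral do rewrite ih.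
by rewrite integral_prob_cst -EFinD -[n.+1]add1n natrD.
Qed.

Lemma le_mean_visit (f f' : int -> nat) n x : (forall z, (f z <= f' z)%N) ->
  (mean_visit mu f n x <= mean_visit mu f' n x)%E.
Proof.
move=> ff'; elim: n x => [|n ih] x; first by rewrite !mean_visit0.
rewrite !(mean_visitS law nu_mean); apply: leeD; first by rewrite lee_fin ler_nat.
by apply: ge0_le_integral => // z _; exact: mean_visit_ge0.
Qed.

Definition dirac_at (j z : int) : nat := z == j.

(** Since the mean offspring is 1, this is the Green function at 0, over [n] steps, of the random
    walk with step law [F]. *)
Definition green n : \bar R := mean_visit mu (dirac_at 0) n 0.

Lemma mean_visit_dirac j n x : mean_visit mu (dirac_at j) n x = mean_visit mu (dirac_at 0) n (x - j).
Proof.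
elim: n x => [|n ih] x; first by rewrite !mean_visit0.
rewrite (mean_visitS law nu_mean (dirac_at j) n x) (mean_visitS law nu_mean (dirac_at 0) n (x - j)).
have -> : dirac_at 0 (x - j) = dirac_at j x by rewrite /dirac_at subr_eq0.
have e z : mean_visit mu (dirac_at j) n (x + z)%R = mean_visit mu (dirac_at 0) n (x - j + z)%R.
  by rewrite ih addrAC.
by under eq_integral do rewrite e.
Qed.

Lemma mean_visit_nondecr f n x : (mean_visit mu f n x <= mean_visit mu f n.+1 x)%E.
Proof.
elim: n x => [|n ih] x; first by rewrite mean_visit0 mean_visit_ge0.
rewrite (mean_visitS law nu_mean f n x) (mean_visitS law nu_mean f n.+1 x).
apply: leeD; first exact: lexx.
by apply: ge0_le_integral => // z _; exact: mean_visit_ge0.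
Qed.

Lemma le_green m n : (m <= n)%N -> (green m <= green n)%E.
Proof.
move=> /subnK <-; elim: (n - m)%N => [//|k ih].
by rewrite addSn; apply: le_trans ih _; exact: mean_visit_nondecr.
Qed.

Lemma integral_le_cst (P : probability int R) (g : int -> \bar R) (M : \bar R) :
  (forall z, 0 <= g z)%E -> (forall z, g z <= M)%E -> (\int[P]_z g z <= M)%E.
Proof.
move=> g0 gM; apply: (@le_trans _ _ (\int[P]_z M)%E).
  by apply: ge0_le_integral.
by rewrite integral_prob_cst.
Qed.

(* Maximum principle: starting elsewhere costs the time to reach 0. *)
Lemma mean_visit_max n x : (mean_visit mu (dirac_at 0) n x <= green n)%E.
Proof.
elim: n x => [|n ih] x; first by rewrite /green !mean_visit0.
have [->//|x0] := eqVneq x 0.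
rewrite (mean_visitS law nu_mean) /dirac_at (negbTE x0) add0e.
apply: le_trans (le_green (leqnSn n)).
by apply: integral_le_cst => z; [exact: mean_visit_ge0|exact: ih].
Qed.

Lemma green_le n : (green n <= n%:R%:E)%E.
Proof.
rewrite -(mean_visit_cst1 n 0); apply: le_mean_visit => z.
by rewrite /dirac_at; case: eqP.
Qed.

Lemma green_fin n : green n \is a fin_num.
Proof.
rewrite ge0_fin_numE ?mean_visit_ge0//.
by apply: le_lt_trans (green_le n) _; exact: ltry.
Qed.

Lemma mean_visit_sum (I : Type) (s : seq I) (f : I -> int -> nat) n x :
  (mean_visit mu (fun z => \sum_(i <- s) f i z)%N n x =
  \sum_(i <- s) mean_visit mu (f i) n x)%E.
Proof.
elim: n x => [|n ih] x.
  by rewrite mean_visit0 big1// => i _; rewrite mean_visit0.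
rewrite (mean_visitS law nu_mean); under eq_integral do rewrite ih.
rewrite ge0_integral_sum//; last by move=> i z _; exact: mean_visit_ge0.
rewrite natr_sum -sumEFin -big_split/=; apply: eq_bigr => i _.
by rewrite (mean_visitS law nu_mean).
Qed.

Variable s2 : R.
Hypothesis s20 : 0 <= s2.
Hypothesis F_sqr : forall x : R,
  (\int[F]_z ((x + z%:~R) ^+ 2)%:E = (x ^+ 2 + s2)%:E)%E.

(** Chebyshev's inequality summed over generations: the indicator of the window plus z^2 / L^2 is at
    least 1 at every label z, and the mean square of a label in generation m is x^2 + m s2. *)
Lemma mean_visit_window (L n : nat) x : (0 < L)%N ->
  (n%:R%:E <= mean_visit mu (fun z => absz z <= L)%N n x +
    ((n%:R * x%:~R ^+ 2 + s2 * n%:R ^+ 2) / L%:R ^+ 2)%:E)%E.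
Proof.
move=> L0; have LR : 0 < L%:R ^+ 2 :> R by rewrite exprn_gt0// ltr0n.
elim: n x => [|n ih] x.
  by rewrite mean_visit0 add0e lee_fin divr_ge0 ?(ltW LR)// mul0r expr0n mulr0 addr0.
rewrite (mean_visitS law nu_mean).
set G := (\int[F]_z _)%E.
have step : (n%:R%:E <= G + ((n%:R * (x%:~R ^+ 2 + s2) + s2 * n%:R ^+ 2) / L%:R ^+ 2)%:E)%E.
  apply: (@le_trans _ _ (\int[F]_z (mean_visit mu (fun z => absz z <= L)%N n (x + z) +
     ((n%:R / L%:R ^+ 2)%:E * ((x%:~R + z%:~R) ^+ 2)%:E + (s2 * n%:R ^+ 2 / L%:R ^+ 2)%:E)))%E).
    rewrite -[leLHS](integral_prob_cst F).
    apply: ge0_le_integral => //.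
    move=> z _; apply: le_trans (ih (x + z)) _.
    rewrite leeD2l// -EFinM -EFinD lee_fin intrD mulrDl.
    by rewrite [X in X + _ <= _]mulrAC.
  have c0 : 0 <= s2 * n%:R ^+ 2 / L%:R ^+ 2 by rewrite divr_ge0 ?(ltW LR)// mulr_ge0// sqr_ge0.
  have c1 : 0 <= n%:R / L%:R ^+ 2 :> R by rewrite divr_ge0// ltW.
  rewrite ge0_integralD//; last 2 first.
  - by move=> z _; exact: mean_visit_ge0.
  - by move=> z _; rewrite -EFinM -EFinD lee_fin addr_ge0// mulr_ge0// sqr_ge0.
  rewrite [X in (_ + X <= _)%E]ge0_integralD//; last first.
    by move=> z _; rewrite -EFinM lee_fin mulr_ge0// sqr_ge0.
  rewrite ge0_integralZl//; last by move=> z _; rewrite lee_fin sqr_ge0.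
  rewrite F_sqr integral_prob_cst leeD2l// -EFinM -EFinD lee_fin mulrDl.
  by rewrite [X in _ <= X + _]mulrAC.
have G0 : (0 <= G)%E by apply: integral_ge0 => z _; exact: mean_visit_ge0.
rewrite -natr1 EFinD; apply: (le_trans (leeD2r 1%:E step)).
rewrite -[leLHS]addeA [X in (_ <= X + _)%E]addeC -[leRHS]addeA leeD2l// -!EFinD lee_fin.
have main : 1 <= (`|x| <= L)%N%:R + x%:~R ^+ 2 / L%:R ^+ 2 :> R.
  have [xL|Lx] := leqP (absz x) L; first by rewrite lerDl divr_ge0 ?sqr_ge0// ltW.
  rewrite add0r ler_pdivlMr// mul1r -(real_normK (num_real x%:~R)) ler_sqr ?nnegrE//.
  by rewrite -intr_norm -abszE pmulrn ler_int; lia.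
have -> : ((n%:R + 1) * x%:~R ^+ 2 + s2 * (n%:R + 1) ^+ 2) / L%:R ^+ 2 =
  (n%:R * (x%:~R ^+ 2 + s2) + s2 * n%:R ^+ 2) / L%:R ^+ 2 + x%:~R ^+ 2 / L%:R ^+ 2
  + (s2 * (n%:R + 1)) / L%:R ^+ 2 :> R by field; rewrite pnatr_eq0 -lt0n.
have : 0 <= (s2 * (n%:R + 1)) / L%:R ^+ 2 by rewrite divr_ge0 ?(ltW LR)// mulr_ge0.
move: main; set q := _ / _; set q' := _ / _; set q'' := _ / _; lra.
Qed.

(* By Chebyshev, half of the n expected individuals lie in a window of width of order sqrt n, and no
   point receives more than green n of them. *)
Lemma green_lower : exists2 c : R, 0 < c & forall n, (0 < n)%N ->
  ((c * Num.sqrt n%:R)%:E <= green n)%E.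
Proof.
(* With L > r sqrt n the Chebyshev term s2 n^2 / L^2 is at most n / 2; the window then has 2 L + 1
   <= (2 r + 3) sqrt n points, whence the constant. *)
pose r : R := Num.sqrt (2 * s2).
have r0 : 0 <= r by exact: sqrtr_ge0.
exists (2 * (2 * r + 3))^-1; first by rewrite invr_gt0 mulr_gt0// ltr_wpDl// mulr_ge0.
move=> n n0; set t := Num.sqrt n%:R.
have t1 : 1 <= t by rewrite /t -[leLHS]sqrtr1 ler_sqrt ?ler1n.
have tt : t ^+ 2 = n%:R by rewrite sqr_sqrtr.
pose L := (Num.truncn (r * t)).+1.
have rt0 : 0 <= r * t by rewrite mulr_ge0// (le_trans _ t1).
have /andP[Ll Lr] := truncn_itv rt0; rewrite -/L in Lr.
have L1 : L%:R <= r * t + 1 by rewrite /L -natr1 lerD2r.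
have rr : r ^+ 2 = 2 * s2 by rewrite sqr_sqrtr// mulr_ge0.
have := mean_visit_window n 0 (ltn0Sn (Num.truncn (r * t))); rewrite -/L.
set W := mean_visit _ _ _ _.
have WE : (W <= (2 * L + 1)%:R%:E * green n)%E.
  apply: (@le_trans _ _ (mean_visit mu (fun z => \sum_(i < 2 * L + 1) dirac_at (i%:Z - L%:Z) z)%N n 0)).
    apply: le_mean_visit => z; have [zL|//] := leqP (absz z) L.
    have zi : (absz (z + L%:Z)%R < 2 * L + 1)%N by lia.
    rewrite (bigD1 (Ordinal zi))//= /dirac_at (_ : z == _)//; apply/eqP; lia.
  rewrite mean_visit_sum; apply: (@le_trans _ _ (\sum_(i < 2 * L + 1) green n)%E).
    by apply: lee_sum => i _; rewrite mean_visit_dirac; exact: mean_visit_max.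
  by rewrite sume_const//; exact: mean_visit_ge0.
rewrite expr0n mulr0 add0r => nW; have := le_trans nW (leeD2r _ WE).
rewrite -(fineK (green_fin n)) -EFinM -EFinD !lee_fin -tt natrD natrM.
set gam := fine _; have gam0 : 0 <= gam by rewrite fine_ge0// mean_visit_ge0.
have L0 : 0 < L%:R :> R by rewrite ltr0n.
have : s2 * (t ^+ 2) ^+ 2 / L%:R ^+ 2 <= t ^+ 2 / 2.
  rewrite ler_pdivrMr ?exprn_gt0//.
  have : (r * t) ^+ 2 <= L%:R ^+ 2 by rewrite ler_sqr ?nnegrE// ltW.
  rewrite exprMn rr; have := sqr_ge0 t; set u := t ^+ 2; set v := L%:R ^+ 2; nra.
set q := _ / _ => h1 h2.
rewrite mulrC ler_pdivrMr; last by rewrite mulr_gt0// ltr_wpDl// mulr_ge0.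
have h3 : t ^+ 2 / 2 <= (2 * (r * t + 1) + 1) * gam.
  apply: (@le_trans _ _ ((2 * L%:R + 1) * gam)); first lra.
  by rewrite ler_wpM2r//; lra.
have h4 : (2 * (r * t + 1) + 1) * gam <= (2 * r + 3) * t * gam.
  by rewrite ler_wpM2r//; nra.
have h5 : t * t <= t * (gam * (2 * (2 * r + 3))) by move: h3 h4; rewrite expr2; lra.
by rewrite ler_pM2l in h5; [|lra].
Qed.

Variable kappa : R.
Hypothesis kappa0 : 0 <= kappa.
Hypothesis nu_sqr : (\int[nu]_j (j ^ 2)%:R%:E <= kappa%:E)%E.

(** A visit to 0 adds at most 1 + 2 g, which the mean collects, and each generation adds at most
    kappa g^2 through pairs of children; g = [green N] bounds all the means by the maximum
    principle. The growth, linear in [n], is of the order that a sum over [N] trees can afford. *)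
Lemma mean_sqr_visit_bound N n x : (n <= N)%N ->
  (mean_sqr_visit mu (dirac_at 0) n x <=
   (1 + 2 * green N) * mean_visit mu (dirac_at 0) n x + (n%:R * kappa)%:E * green N ^+ 2)%E.
Proof.
set g := green N; have g0 : (0 <= g)%E by exact: mean_visit_ge0.
have g20 : (0 <= g ^+ 2)%E by rewrite expe2 mule_ge0.
have c0 : (0 <= 1 + 2 * g)%E by rewrite adde_ge0// mule_ge0.
elim: n x => [|n ih] x nN.
  rewrite mean_visit0 mule0 add0e mul0r mul0e /mean_sqr_visit integral0_eq// => w _.
  by rewrite visit0.
apply: le_trans (mean_sqr_visitS law nu_mean _ _ _) _.
set G := (\int[F]_z mean_visit _ _ _ _)%E; set H := (\int[F]_z mean_sqr_visit _ _ _ _)%E.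
have G0 : (0 <= G)%E by apply: integral_ge0 => z _; exact: mean_visit_ge0.
have Gg : (G <= g)%E.
  apply: integral_le_cst => z; first exact: mean_visit_ge0.
  by apply: le_trans (mean_visit_max _ _) _; apply: le_green; exact: ltnW.
have HG : (H <= (1 + 2 * g) * G + (n%:R * kappa)%:E * g ^+ 2)%E.
  apply: (@le_trans _ _ (\int[F]_z ((1 + 2 * g) * mean_visit mu (dirac_at 0) n (x + z) +
     (n%:R * kappa)%:E * g ^+ 2))%E).
    apply: ge0_le_integral => //.
      by move=> z _; exact: mean_sqr_visit_ge0.
    by move=> z _; apply: ih; exact: ltnW.
  rewrite ge0_integralD//; last 2 first.
  - by move=> z _; rewrite mule_ge0// mean_visit_ge0.
  - by move=> z _; rewrite mule_ge0// lee_fin mulr_ge0.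
  rewrite ge0_integralZl//; last by move=> z _; exact: mean_visit_ge0.
  by rewrite integral_prob_cst.
have kG : (\int[nu]_j (j ^ 2)%:R%:E * G ^+ 2 <= kappa%:E * g ^+ 2)%E.
  apply: lee_pmul => //; first by apply: integral_ge0.
    by rewrite expe2 mule_ge0.
  by rewrite !expe2; apply: lee_pmul.
rewrite (mean_visitS law nu_mean) -/G /dirac_at.
apply: (@le_trans _ _ ((x == 0)%:R%:E + (2 * (x == 0))%:R%:E * g +
    ((1 + 2 * g) * G + (n%:R * kappa)%:E * g ^+ 2) + kappa%:E * g ^+ 2)%E).
  apply: leeD => //; apply: leeD => //; apply: leeD.
    by case: eqP.
  by rewrite lee_pmul.
have -> : ((n.+1%:R * kappa)%:E * g ^+ 2 = (n%:R * kappa)%:E * g ^+ 2 + kappa%:E * g ^+ 2)%E.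
  by rewrite -natr1 mulrDl mul1r EFinD ge0_muleDl// lee_fin mulr_ge0.
rewrite [X in (_ <= X + _)%E]ge0_muleDr//.
have -> : ((1 + 2 * g) * (x == 0)%:R%:E = (x == 0)%:R%:E + (2 * (x == 0))%:R%:E * g)%E.
  by case: eqP => _; rewrite ?mule1 ?mul0e ?adde0 ?mule0.
by rewrite !addeA.
Qed.

End gw_bounds.

(** * Sequences of independent trees *)

(** Functions of the first [n] terms; for trees, whose type is countable, this alone gives
    measurability. *)
Definition finitary (L S : Type) (n : nat) (f : (nat -> L) -> S) :=
  forall t t', (forall i, (i < n)%N -> t i = t' i) -> f t = f t'.

Lemma disc_ext d (T : measurableType d) S (f g : T -> S) : f =1 g -> disc f -> disc g.
Proof. by move=> /funext ->. Qed.

Definition forest (w : gw_config) (i : nat) : seq int := tree (w \o shift i).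

Definition later (L : Type) (m : nat) (t : nat -> L) : nat -> L := fun i => t (i + m)%N.

Lemma forest_shift m (w : gw_config) : forest (w \o shift m) = later m (forest w).
Proof.
apply/funext => i; rewrite /forest /later; congr tree; apply/funext => -[[i' v]|[i' v]] /=;
by rewrite addnA.
Qed.

Lemma disc_forest S n (f : (nat -> seq int) -> S) : finitary n f ->
  disc (fun w => f (forest w)).
Proof.
move=> fn; apply: (@disc_factor _ _ _ _ (fun w => [seq forest w i | i <- iota 0 n])).
  apply: (@disc_map _ _ nat (seq int : countType) (fun i w => forest w i)) => i.
  exact: (disc_reindex (shift i) disc_tree).
move=> w w' ww'; apply: fn => i iN.
have := congr1 (fun s => nth [::] s i) ww'.
by rewrite !(nth_map 0%N) ?size_iota// nth_iota.
Qed.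

Lemma depends_forest S n (f : (nat -> seq int) -> S) : finitary n f ->
  depends (fun a => match a with inl (i, _) | inr (i, _) => (i < n)%N end)
    (fun w => f (forest w)).
Proof.
move=> fn w w' ww'; apply: fn => i iN; rewrite /forest /tree; congr tree_labels; apply/funext => v.
  by rewrite /offspring /=; congr absz; exact: ww'.
by rewrite /displacement /=; exact: ww'.
Qed.

Lemma depends_later S n (f : (nat -> seq int) -> S) :
  depends (fun a => match a with inl (i, _) | inr (i, _) => (n <= i)%N end)
    (fun w => f (later n (forest w))).
Proof.
move=> w w' ww'; congr f; apply/funext => i; rewrite /later /forest /tree.
congr tree_labels; apply/funext => v.
  by rewrite /offspring /=; congr absz; apply: ww'; rewrite leq_addl.
by rewrite /displacement /=; apply: ww'; rewrite leq_addl.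
Qed.

Lemma disc_bmeas d (T : measurableType d) (R : realType) (f : T -> R) :
  disc f -> (forall x, 0 <= f x <= 1) -> bmeas f.
Proof.
move=> df f01; split; first exact: disc_measurable.
by exists 1 => x; have /andP[? ?] := f01 x; rewrite ger0_norm.
Qed.

Lemma Ex_fine d (T : measurableType d) (R : realType) (P : probability T R) (f : T -> R) :
  bmeas f -> (\int[P]_x (f x)%:E = (Ex P f)%:E)%E.
Proof. by move=> bf; rewrite -(ExE P bf) unlock. Qed.

Section forests.
Variables (R : realType) (nu : probability nat R) (F : probability int R).
Variable mu : probability gw_config R.
Hypothesis law : gw_law nu F mu.
Implicit Types (f h : (nat -> seq int) -> R).

Let bm n f : finitary n f -> (forall t, 0 <= f t <= 1) -> bmeas (fun w => f (forest w)).
Proof. by move=> fn f01; apply: disc_bmeas => //; exact: disc_forest fn. Qed.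

Let bml m n f : finitary n f -> (forall t, 0 <= f t <= 1) ->
  bmeas (fun w => f (later m (forest w))).
Proof.
move=> fn f01; apply: disc_bmeas => //.
rewrite (_ : (fun w => _) = fun w : gw_config => (fun w => f (forest w)) (w \o shift m)); last first.
  by apply/funext => w /=; rewrite forest_shift.
exact: (disc_reindex (X := fun w => f (forest w)) (shift m) (disc_forest fn)).
Qed.

Lemma Ex_later m n f : finitary n f -> (forall t, 0 <= f t <= 1) ->
  Ex mu (fun w => f (later m (forest w))) = Ex mu (fun w => f (forest w)).
Proof.
move=> fn f01; apply: EFin_inj; rewrite -!Ex_fine; [|exact: bm fn f01|exact: bml fn f01].
rewrite -(integral_shift law m (g := fun w => (f (forest w))%:E)).
- by apply: eq_integral => w _; rewrite forest_shift.
- by apply/measurable_EFinP; exact: (bm fn f01).1.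
- by move=> w; rewrite lee_fin; case/andP: (f01 (forest w)).
Qed.

Lemma Ex_prod_later m n f h : finitary m f -> (forall t, 0 <= f t <= 1) ->
  finitary n h -> (forall t, 0 <= h t <= 1) ->
  Ex mu (fun w => f (forest w) * h (later m (forest w))) =
  Ex mu (fun w => f (forest w)) * Ex mu (fun w => h (forest w)).
Proof.
move=> fm f01 hn h01; rewrite -(Ex_later m hn h01).
have bf := bm fm f01; have bh := bml m hn h01.
apply: EFin_inj; rewrite EFinM -!Ex_fine//; last exact: bmeasM.
apply: (integral_prod_depends (gw_independent law)
  (J1 := (fun a => match a with inl (i, _) | inr (i, _) => (i < m)%N end))
  (J2 := (fun a => match a with inl (i, _) | inr (i, _) => (m <= i)%N end))
  (f := fun w => (f (forest w))%:E) (h := fun w => (h (later m (forest w)))%:E)).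
- by move=> [[i v]|[i v]]; rewrite -ltnNge.
- by apply/measurable_EFinP; exact: bf.1.
- by apply/measurable_EFinP; exact: bh.1.
- by move=> w; rewrite lee_fin; case/andP: (f01 (forest w)).
- by move=> w; rewrite lee_fin; case/andP: (h01 (later m (forest w))).
- exact: (depends_forest (f := fun t => (f t)%:E) (n := m) (fun t t' tt' => congr1 EFin (fm t t' tt'))).
- exact: (depends_later (fun t => (h t)%:E)).
Qed.

End forests.

(* Paley-Zygmund *)
Lemma second_moment_bound d (T : measurableType d) (R : realType) (P : probability T R)
    (V : T -> R) (m C : R) : measurable_fun [set: T] V -> (forall x, 0 <= V x) ->
  0 < m -> 1 <= C -> (\int[P]_x (V x)%:E = m%:E)%E ->
  (\int[P]_x (V x ^+ 2)%:E <= (C * m ^+ 2)%:E)%E ->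
  (4 * C)^-1 <= Ex P (fun x => Num.min 1 (V x / m)).
Proof.
(* Pointwise V <= B min(1, V / m) + V^2 / B. The choice of [B] makes the mean of the last term at
   most m / 2, and leaves m / (2 B) = 1 / (4 C). *)
move=> mV V0 m0 C1 EV EV2; pose B := 2 * C * m.
have C0 : 0 < C by lra.
have B0 : 0 < B by rewrite !mulr_gt0.
have bq : bmeas (fun x => Num.min 1 (V x / m)).
  split; first by apply: measurable_minr => //; apply: measurable_funM.
  exists 1 => x; rewrite ger0_norm ?ge_min ?lexx// le_min ler01 divr_ge0//; exact: ltW.
have q0 x : 0 <= Num.min 1 (V x / m) by rewrite le_min ler01 divr_ge0//; exact: ltW.
have mV2 : measurable_fun [set: T] (fun x => V x ^+ 2) by exact: measurable_funX.
have : (m%:E <= B%:E * (Ex P (fun x => Num.min 1 (V x / m)))%:E + B^-1%:E * (C * m ^+ 2)%:E)%E.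
  apply: (@le_trans _ _ (\int[P]_x (B%:E * (Num.min 1 (V x / m))%:E + B^-1%:E * (V x ^+ 2)%:E))%E).
    rewrite -EV; apply: ge0_le_integral => //.
    - by move=> x _; rewrite lee_fin.
    - exact/measurable_EFinP.
    - apply/measurable_EFinP; apply: measurable_funD; apply: measurable_funM => //.
      exact: bq.1.
    - move=> x _; rewrite -!EFinM -EFinD lee_fin; have V0x := V0 x.
      have [Vm|mV'] := leP (V x) m.
        rewrite (min_idPr _); last by rewrite ler_pdivrMr// mul1r.
        rewrite (_ : B * (V x / m) = 2 * C * V x); last by rewrite /B; field; lra.
        by rewrite ler_wpDr ?mulr_ge0 ?invr_ge0 ?(ltW B0) ?sqr_ge0//; nra.
      rewrite (min_idPl _); last by rewrite ler_pdivlMr// mul1r ltW.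
      rewrite -(ler_pM2l B0) mulrDr mulr1 mulVKf ?gt_eqF//.
      have := sqr_ge0 (V x - B); nra.
  rewrite (_ : (\int[P]_x _)%E = (\int[P]_x (B%:E * (Num.min 1 (V x / m))%:E) +
      \int[P]_x (B^-1%:E * (V x ^+ 2)%:E))%E); last first.
    apply: ge0_integralD => //; first
      [ by move=> x _; rewrite -EFinM lee_fin mulr_ge0// ?sqr_ge0// ?invr_ge0 ltW
      | by apply/measurable_EFinP/measurable_funM => //; exact: bq.1 ].
  have -> : (\int[P]_x (B%:E * (Num.min 1 (V x / m))%:E) =
      B%:E * \int[P]_x (Num.min 1 (V x / m))%:E)%E.
    apply: ge0_integralZl => //; first
      [exact/measurable_EFinP/bq.1|by move=> x _; rewrite lee_fin|by rewrite lee_fin ltW].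
  have -> : (\int[P]_x (B^-1%:E * (V x ^+ 2)%:E) =
      B^-1%:E * \int[P]_x (V x ^+ 2)%:E)%E.
    apply: ge0_integralZl => //; first
      [exact/measurable_EFinP|by move=> x _; rewrite lee_fin sqr_ge0|by rewrite lee_fin invr_ge0 ltW].
  by rewrite Ex_fine// leeD2l// lee_pmul2l// lte_fin invr_gt0.
rewrite -!EFinM -EFinD lee_fin; set q := Ex _ _.
rewrite (_ : B^-1 * (C * m ^+ 2) = m / 2); last by rewrite /B; field; lra.
move=> h; rewrite -[leLHS]mul1r ler_pdivrMr ?mulr_gt0//.
rewrite -(ler_pM2l m0); move: h; rewrite /B; lra.
Qed.

(** * Bounds for sums over independent trees *)

Section forest_bounds.
Variables (R : realType) (nu : probability nat R) (F : probability int R).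
Variable mu : probability gw_config R.
Hypothesis law : gw_law nu F mu.
Hypothesis nu_mean : ('E_nu[fun k : nat => k%:R%R : R] = 1)%E.
Hypothesis nu_variance : (0 < 'V_nu[fun k : nat => k%:R%R : R] < +oo)%E.
Hypothesis F_mean : ('E_F[fun k : int => k%:~R%R : R] = 0)%E.
Hypothesis F_variance : (0 < 'V_F[fun k : int => k%:~R%R : R] < +oo)%E.

Let mnat (X : gw_config -> nat) : disc X -> measurable_fun setT (fun w => (X w)%:R%:E : \bar R).
Proof. by move=> dX; exact: disc_measurable (disc_comp (fun n => n%:R%:E : \bar R) dX). Qed.

Lemma measure_shift i (B : set gw_config) : measurable B ->
  mu [set w : gw_config | B (w \o shift i : gw_config)] = mu B.
Proof.
move=> mB; have mB' := reindex_measurable (shift i) measurableT mB; rewrite setTI in mB'.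
have := integral_indic mu measurableT mB'; rewrite setIT => <-.
have := integral_indic mu measurableT mB; rewrite setIT => <-.
rewrite -(integral_shift law i (g := fun w => (\1_B w)%:E))//; last exact/measurable_EFinP.
Qed.

(** Survival forever is less likely than survival for [n] generations, of probability O(1/n), and
    there are countably many trees. *)
Lemma extinction_ae : {ae mu, forall w, forall i, exists n, ~~ survives n (w \o shift i)}.
Proof.
have [nu1 nu2 nu3] := offspring_moments nu_mean nu_variance.
have [c c0 cP] := survival_bound law nu1 nu3.
have sm n : measurable (survives n @^-1` [set true]) by exact: disc_survives.
suff H i : mu.-negligible (\bigcap_n ((fun w : gw_config => survives n (w \o shift i)) @^-1` [set true])).
  have := negligible_bigcup H; apply: negligibleS => w /= H'.
  apply: contrapT => H2; apply: H' => i; apply: contrapT => H3; apply: H2.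
  by exists i => // n _ /=; apply: contrapT => /negP H4; apply: H3; exists n.
have smi n : measurable ((fun w : gw_config => survives n (w \o shift i)) @^-1` [set true]).
  by have /(_ [set true]) := disc_reindex (shift i) (disc_survives n).
apply/negligibleP; first exact: bigcapT_measurable.
apply/eqP; rewrite eq_le measure_ge0 andbT; apply/lee_addgt0Pr => e e0; rewrite add0e.
pose n := (Num.truncn (c^-1 / e)).+1.
have : (mu (\bigcap_n ((fun w : gw_config => survives n (w \o shift i)) @^-1` [set true])) <= survival mu n)%E.
  apply: (@le_trans _ _ (mu ((fun w : gw_config => survives n (w \o shift i)) @^-1` [set true]))).
    apply: le_measure; rewrite ?inE//; first exact: bigcapT_measurable.
    exact: bigcap_inf.
  by rewrite (measure_shift i (sm n)).
move=> h; apply: (le_trans h).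
have := cP n; have fp : survival mu n \is a fin_num by exact: fin_num_measure.
rewrite -(fineK fp) -EFinM !lee_fin => h2.
have n0 : 0 < n%:R :> R by rewrite ltr0n.
rewrite -(ler_pM2l n0); apply: (le_trans h2).
have ce0 : 0 <= c^-1 / e by rewrite divr_ge0 ?invr_ge0// ltW.
have /andP[_ hn] := truncn_itv ce0; rewrite -/n in hn.
by rewrite -ler_pdivrMr// ltW.
Qed.

Definition visits_sum (f : int -> nat) n N (w : gw_config) : nat :=
  (\sum_(i < N) visit f n 0 (w \o shift i))%N.

Lemma disc_visits_sum f n N : disc (visits_sum f n N).
Proof.
elim: N => [|N ih].
  apply: (disc_ext (f := fun=> 0%N)); last exact: disc_cst.
  move=> w.
  by rewrite /visits_sum big_ord0.
have := disc_comp (fun p => p.1 + p.2)%N (disc_pair ih (disc_reindex (shift N) (disc_visit f n 0))).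
by apply: disc_ext => w; rewrite /visits_sum big_ord_recr.
Qed.

Lemma integral_visit_shift (f : int -> nat) n (phi : nat -> \bar R) i : (forall j, 0 <= phi j)%E ->
  (\int[mu]_w phi (visit f n 0 (w \o shift i)) = \int[mu]_w phi (visit f n 0 w))%E.
Proof.
move=> phi0; apply: (integral_shift law i (g := fun w => phi (visit f n 0 w))) => //.
exact: disc_measurable (disc_comp phi (disc_visit f n 0)).
Qed.

Lemma mean_visits_sum f n N : (\int[mu]_w (visits_sum f n N w)%:R%:E = N%:R%:E * mean_visit mu f n 0)%E.
Proof.
rewrite /visits_sum; under eq_integral do rewrite natr_sum -sumEFin.
rewrite ge0_integral_sum//; last first.
  by move=> i; apply: (mnat (X := fun w => visit f n 0 (w \o shift i))); exact: (disc_reindex (shift i) (disc_visit f n 0)).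
under eq_bigr do rewrite (integral_visit_shift f n (phi := fun j => j%:R%:E))//.
by rewrite sume_const//; exact: mean_visit_ge0.
Qed.

Lemma mean_sqr_visits_sum f n N : (\int[mu]_w (((visits_sum f n N w)%:R : R) ^+ 2)%:E <=
  N%:R%:E * mean_sqr_visit mu f n 0 + (N%:R%:E * mean_visit mu f n 0) ^+ 2)%E.
Proof.
pose v i (w : gw_config) := visit f n 0 (w \o shift i).
have dv i : disc (v i) by exact: (disc_reindex (shift i) (disc_visit f n 0)).
have G0 : (0 <= mean_visit mu f n 0)%E by exact: mean_visit_ge0.
have M0 : (0 <= mean_sqr_visit mu f n 0)%E by exact: mean_sqr_visit_ge0.
have vE i : (\int[mu]_w (v i w)%:R%:E = mean_visit mu f n 0)%E.
  exact: (integral_visit_shift f n (phi := fun j => j%:R%:E)).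
have mvv i j : measurable_fun setT (fun w => (v i w * v j w)%:R%:E : \bar R).
  exact: mnat (disc_comp (fun p => p.1 * p.2)%N (disc_pair (dv i) (dv j))).
have eq1 w : (((visits_sum f n N w)%:R : R) ^+ 2)%:E =
    (\sum_(i < N) \sum_(j < N) (v i w * v j w)%:R%:E)%E.
  rewrite /visits_sum expr2 -natrM big_distrlr/= natr_sum -sumEFin.
  by apply: eq_bigr => i _; rewrite natr_sum -sumEFin.
under eq_integral do rewrite eq1.
rewrite ge0_integral_sum//; first last.
- by move=> i w _; apply: sume_ge0 => j _; rewrite lee_fin.
- by move=> i; apply: emeasurable_sum => j.
have -> : (N%:R%:E * mean_sqr_visit mu f n 0 + (N%:R%:E * mean_visit mu f n 0) ^+ 2 =
  \sum_(i < N) (mean_sqr_visit mu f n 0 + mean_visit mu f n 0 * (\sum_(j < N) mean_visit mu f n 0)))%E.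
  rewrite expe2 big_split/= !sume_const//; last by rewrite mule_ge0// mule_ge0.
  by rewrite -!muleA.
apply: lee_sum => i _; rewrite ge0_integral_sum//.
rewrite (bigD1 i)//=; apply: leeD.
  rewrite (_ : (\int[mu]_w _)%E = mean_sqr_visit mu f n 0)//.
  rewrite /mean_sqr_visit -(integral_visit_shift f n (phi := fun j => (j ^ 2)%:R%:E) i)//.
rewrite ge0_sume_distrr; last by [].
rewrite [leRHS](bigD1 i)//= -[leLHS]add0e; apply: leeD; first exact: mule_ge0.
apply: lee_sum => j ji.
have -> : (\int[mu]_w (v i w * v j w)%:R%:E = \int[mu]_w ((v i w)%:R%:E * (v j w)%:R%:E))%E.
  by apply: eq_integral => w _; rewrite natrM EFinM.
rewrite (integral_prod_depends (gw_independent law) (J1 := tree_index i) (J2 := tree_index j)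
  (f := fun w => (v i w)%:R%:E) (h := fun w => (v j w)%:R%:E)).
- by rewrite !vE.
- by move=> [[i' u]|[i' u]] /= /eqP ->; apply/negP => /eqP/val_inj ij; rewrite ij eqxx in ji.
- exact: mnat.
- exact: mnat.
- by move=> w; rewrite lee_fin.
- by move=> w; rewrite lee_fin.
- move=> w w' ww'; congr (_%:R%:E); rewrite /v /visit; congr visits; apply/funext => u.
    by rewrite /offspring /=; congr absz; apply: ww' => /=.
  by rewrite /displacement /=; apply: ww' => /=.
- move=> w w' ww'; congr (_%:R%:E); rewrite /v /visit; congr visits; apply/funext => u.
    by rewrite /offspring /=; congr absz; apply: ww' => /=.
  by rewrite /displacement /=; apply: ww' => /=.
Qed.

(** For N trees and N generations the mean is N g with g = [green N], and the second moment is of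
    order (N g)^2 because one tree contributes at most order N g^2. Paley-Zygmund applies at the
    scale N g, and N^(3/2) <= N g / c since c sqrt N <= g. *)
Lemma visits_sum_lower : exists2 c : R, 0 < c & forall N, (0 < N)%N ->
  c <= Ex mu (fun w => Num.min 1 (N%:R `^ (- (3 / 2)) * (visits_sum (dirac_at 0) N N w)%:R)).
Proof.
have [nu1 nu2 nu3] := offspring_moments nu_mean nu_variance.
have [s2 s20 Fs2] := displacement_moments F_mean F_variance.
have [c c0 cP] := green_lower law nu1 s20 Fs2.
have [kappa kappa0 kappaP] : exists2 k : R, 0 <= k & (\int[nu]_j (j ^ 2)%:R%:E <= k%:E)%E.
  have i0 : (0 <= \int[nu]_j (j ^ 2)%:R%:E :> \bar R)%E by exact: integral_ge0.
  exists (fine (\int[nu]_j (j ^ 2)%:R%:E)%E); first exact: fine_ge0.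
  by rewrite fineK// ge0_fin_numE.
(* The second moment is at most N g + 2 N g^2 + kappa (N g)^2 + (N g)^2, where N and g are at least
   1. The truncation of [c] at 1 lets the constant pass inside the minimum. *)
pose C := 4 + kappa; pose c' := Num.min 1 c.
have c'0 : 0 < c' by rewrite /c' lt_min ltr01.
exists (c' * (4 * C)^-1); first by rewrite mulr_gt0// invr_gt0 mulr_gt0// ltr_wpDr.
move=> N N0; set V := fun w => (visits_sum (dirac_at 0) N N w)%:R : R.
have dV S (h : R -> S) : disc (fun w => h (V w)).
  exact: (disc_comp (fun j => h j%:R) (disc_visits_sum (dirac_at 0) N N)).
pose g := fine (green mu N).
have gE : green mu N = g%:E by rewrite /g fineK// (green_fin law nu1).
have g1 : 1 <= g.
  rewrite -lee_fin -gE; apply: le_trans (le_green law nu1 N0).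
  rewrite /green (mean_visitS law nu1) /dirac_at eqxx; under eq_integral do rewrite mean_visit0.
  by rewrite integral0 adde0.
have NR : 1 <= N%:R :> R by rewrite ler1n.
have Ng : 0 < N%:R * g by rewrite mulr_gt0//; lra.
have := @second_moment_bound _ _ _ mu V (N%:R * g) C.
move=> /(_ (disc_measurable (dV _ id)) (fun w => ler0n _ _) Ng).
have C1 : 1 <= C by rewrite /C; lra.
have EV : (\int[mu]_w (V w)%:E = (N%:R * g)%:E)%E.
  by rewrite mean_visits_sum EFinM -gE.
have EV2 : (\int[mu]_x (V x ^+ 2)%:E <= (C * (N%:R * g) ^+ 2)%:E)%E.
  apply: le_trans (mean_sqr_visits_sum _ _ _) _.
  have h := mean_sqr_visit_bound law nu1 kappa0 kappaP 0 (leqnn N).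
  rewrite -/(green mu N) gE in h *.
  apply: (le_trans (leeD2r _ (lee_pmul _ _ (lexx _) h))) => //; first exact: mean_sqr_visit_ge0.
  rewrite !expe2 !(=^~ EFinM, =^~ EFinD) lee_fin /C.
  set x : R := N%:R in NR *.
  have h1 : x * g <= (x * g) ^+ 2 by rewrite expr2 ler_peMl ?mulr_ge0//; nra.
  have h2 : x * g ^+ 2 <= (x * g) ^+ 2.
    by rewrite exprMn ler_wpM2r ?sqr_ge0// expr2 ler_peMl//; lra.
  move: h1 h2; rewrite !exprMn !expr2; lra.
move=> /(_ C1 EV EV2) lower.
apply: (le_trans (ler_wpM2l (ltW c'0) lower)).
have b1 : bmeas (fun x => Num.min 1 (V x / (N%:R * g))).
  apply: disc_bmeas; first exact: dV _ (fun v => Num.min 1 (v / (N%:R * g))).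
  by move=> x; rewrite ge_min lexx le_min ler01 divr_ge0// ltW.
rewrite -ExZ//; apply: le_Ex.
- by apply: bmeasM => //; exact: bmeas_cst.
- apply: disc_bmeas; first exact: dV _ (fun v => Num.min 1 (N%:R `^ (- (3 / 2)) * v)).
  by move=> x; rewrite ge_min lexx le_min ler01 mulr_ge0// powR_ge0.
move=> w; rewrite -/(V w) le_min; apply/andP; split.
  rewrite -[leRHS]mulr1; apply: ler_pM; rewrite ?ge_min ?lexx// ?(ltW c'0)//.
  by rewrite le_min ler01 divr_ge0// ltW.
apply: (@le_trans _ _ (c * (V w / (N%:R * g)))).
  apply: ler_pM; rewrite ?ge_min ?lexx ?orbT// ?(ltW c'0)//.
  by rewrite le_min ler01 divr_ge0// ltW.
rewrite mulrCA mulrC ler_wpM2r//.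
rewrite ler_pdivrMr//.
have cg : c * Num.sqrt N%:R <= g by rewrite -lee_fin -gE; exact: cP.
have -> : N%:R `^ (- (3 / 2)) = (N%:R * Num.sqrt N%:R)^-1 :> R.
  rewrite powRN; congr (_^-1); rewrite (_ : 3 / 2 = 1 + 2^-1 :> R); last lra.
  by rewrite powRD ?powRr1 ?powR12_sqrt// pnatr_eq0 gtn_eqF// implybT.
have s0 : 0 < Num.sqrt N%:R :> R by rewrite sqrtr_gt0 (lt_le_trans ltr01).
have NsG : 0 < N%:R * Num.sqrt N%:R :> R by rewrite mulr_gt0// (lt_le_trans ltr01).
rewrite mulrC ler_pdivlMr// mulrCA ler_wpM2l//; lra.
Qed.

(* Either one of the s N trees survives to generation n ~ N M, or the sum is carried by the first n
   generations, of mean s N n. *)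
Lemma total_progeny_upper : exists2 C : R, 0 <= C & forall (s N : nat) (M : R), (0 < N)%N -> 1 <= M ->
  Ex mu (fun w => Num.min 1 ((\sum_(i < s * N) size (forest w i))%:R / (N%:R ^+ 2 * M ^+ 2))) <=
    C * s%:R / M.
Proof.
have [nu1 nu2 nu3] := offspring_moments nu_mean nu_variance.
have [c c0 cP] := survival_bound law nu1 nu3.
exists (c^-1 + 2); first by rewrite addr_ge0// invr_ge0 ltW.
(* As n > N M, some of the s N trees survives with probability at most s / (c M); as n <= 2 N M, the
   earlier generations contribute s N n / (N M)^2 <= 2 s / M. *)
move=> s N M N0 M1; pose n := (Num.truncn (N%:R * M)).+1.
have NR : 1 <= N%:R :> R by rewrite ler1n.
have NM0 : 0 <= N%:R * M by rewrite mulr_ge0//; lra.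
have /andP[n1 n2] := truncn_itv NM0; rewrite -/n in n2.
have n3 : n%:R <= 2 * (N%:R * M) by rewrite /n -natr1; nra.
pose U := visits_sum (fun=> 1%N) n (s * N).
pose V (w : gw_config) := (\sum_(i < s * N) survives n (w \o shift i))%N.
have dV : disc V.
  rewrite /V; elim: (s * N)%N => [|m ih]; first last.
  have := disc_comp (fun p => p.1 + nat_of_bool p.2)%N (disc_pair ih (disc_reindex (shift m) (disc_survives n))).
    by apply: disc_ext => w; rewrite big_ord_recr.
  by apply: (disc_ext (f := fun=> 0%N)); [move=> w; rewrite big_ord0|exact: disc_cst].
have mV := mnat dV.
have mU := mnat (disc_visits_sum (fun=> 1%N) n (s * N)).
pose D := N%:R ^+ 2 * M ^+ 2.
have D0 : 0 < D by rewrite mulr_gt0// exprn_gt0//; lra.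
pose q w := Num.min 1 ((\sum_(i < s * N) size (forest w i))%:R / D).
rewrite -/q.
have bq : bmeas q.
  apply: disc_bmeas.
    apply: (disc_forest (n := s * N) (f := fun t => Num.min 1 ((\sum_(i < s * N) size (t i))%:R / D))).
    by move=> t t' tt'; congr (Num.min _ (_%:R / _)); apply: eq_bigr => i _; rewrite tt'.
  by move=> w; rewrite /q ge_min lexx le_min ler01 divr_ge0// ltW.
have q0 w : 0 <= q w by rewrite /q le_min ler01 divr_ge0// ltW.
rewrite -lee_fin -Ex_fine//.
apply: (@le_trans _ _ (\int[mu]_w ((V w)%:R%:E + D^-1%:E * (U w)%:R%:E))%E).
  apply: ge0_le_integral => //.
  - by move=> w _; rewrite lee_fin.
  - by apply/measurable_EFinP; exact: bq.1.
  - by apply: emeasurable_funD => //; exact: emeasurable_funM.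
  move=> w _; rewrite -EFinM -EFinD lee_fin.
  have [/hasP[i _ si]|/hasPn ns] := boolP (has (fun i : 'I_(s * N) => survives n (w \o shift i)) (index_enum _)).
    rewrite ler_wpDr ?mulr_ge0// ?invr_ge0 ?(ltW D0)// /q ge_min ler1n.
    by rewrite /V (bigD1 i)//= si.
  rewrite ler_wpDl// /q ge_min; apply/orP; right.
  rewrite [leRHS]mulrC ler_pM2r ?invr_gt0// ler_nat /U /visits_sum.
  apply: leq_sum => i _.
  have := ns i (mem_index_enum _); rewrite negbK => /eqP si.
  rewrite /visit -(sum_labels (fun=> 1%N) 0 (displacement (w \o shift i)) si).
  by rewrite sum1_size.
rewrite ge0_integralD//; first last.
- by apply: emeasurable_funM.
- by move=> w _; rewrite -EFinM lee_fin mulr_ge0// invr_ge0 ltW.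
rewrite ge0_integralZl//; last by rewrite lee_fin invr_ge0 ltW.
rewrite mean_visits_sum (mean_visit_cst1 law nu1).
have -> : (\int[mu]_w (V w)%:R%:E = (s * N)%:R%:E * survival mu n)%E.
  rewrite /V; under eq_integral do rewrite natr_sum -sumEFin.
  rewrite ge0_integral_sum//; last first.
    move=> i; apply: (mnat (X := fun w => survives n (w \o shift i))).
    exact: disc_comp nat_of_bool (disc_reindex (shift i) (disc_survives n)).
  rewrite -(sume_const (s * N)%N (measure_ge0 mu _)); apply: eq_bigr => i _.
  rewrite (integral_shift law i (g := fun w => (survives n w)%:R%:E))//; last first.
    exact: (mnat (disc_comp nat_of_bool (disc_survives n))).
  have H := integral_indic mu measurableT (disc_survives n [set true]); rewrite setIT in H.
  apply: etrans H; by apply: eq_integral => w _; rewrite indicE; congr ((nat_of_bool _)%:R%:E); apply/idP/idP => [H|/set_mem//]; exact/mem_set.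
have := cP n; have fp : survival mu n \is a fin_num.
  by apply: fin_num_measure; exact: disc_survives.
rewrite -(fineK fp); set p := fine _; rewrite -!EFinM -EFinD !lee_fin natrM => h.
have p0 : 0 <= p by rewrite /p fine_ge0.
have M0 : 0 < M by lra.
have N0' : 0 < N%:R :> R by lra.
have h1 : s%:R * N%:R * p <= c^-1 * s%:R / M.
  rewrite ler_pdivlMr// -[X in X * M]mulrA -mulrA [c^-1 * _]mulrC ler_wpM2l//.
  by apply: le_trans h; rewrite mulrAC ler_wpM2r// ltW.
have h2 : D^-1 * (s%:R * N%:R * n%:R) <= 2 * s%:R / M.
  rewrite mulrC ler_pdivrMr// (_ : 2 * s%:R / M * D = s%:R * N%:R * (2 * (N%:R * M))).
    by rewrite ler_wpM2l// mulr_ge0.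
  by rewrite /D; field; rewrite gt_eqF.
by rewrite [_ * s%:R]mulrDl [leRHS]mulrDl; exact: lerD.
Qed.

End forest_bounds.

(** * Transfer to the space of coordinates *)

Section canonical_configuration.
Variables (R : realType) (d : measure_display) (Om : measurableType d).
Variables (P : probability Om R) (nu : probability nat R) (F : probability int R).
Variables (K : nat -> seq nat -> {RV P >-> nat}) (xi : nat -> seq nat -> {RV P >-> int}).
Hypothesis brw : iid_branching_random_walks nu F K xi.

(** Sends the given variables to the coordinate space, where reindexing acts; its law has
    independent coordinates with the prescribed marginals. *)
Definition configuration (w : Om) : gw_config := fun a =>
  match a with inl (i, v) => Posz (K i v w) | inr (i, v) => xi i v w end.

Definition trees (w : Om) (i : nat) : seq int :=
  tree_labels (fun v => K i v w) (fun v => xi i v w).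

Lemma forest_configuration w : forest (configuration w) = trees w.
Proof. by apply/funext => i. Qed.

Lemma disc_configuration a : disc (fun w => configuration w a).
Proof.
case: a => -[i v] B; rewrite -[_ @^-1` _]setTI.
  exact: (measurable_funPT (K i v) measurableT [set n | B (Posz n)]).
exact: (measurable_funPT (xi i v) measurableT B).
Qed.

Lemma measurable_configuration : measurable_fun [set: Om] configuration.
Proof.
move=> _ B mB; rewrite setTI; move: B mB; apply: smallest_sub.
  split=> /= [|B mB|G mG].
  - by rewrite preimage_set0.
  - by rewrite setTD preimage_setC; exact: measurableC.
  - by rewrite preimage_bigcup; exact: bigcupT_measurable.
move=> _ [s [A [us _ ->]]] /=.
rewrite (_ : _ @^-1` _ = \bigcap_(v in [set` s]) [set w | A v (configuration w v)]).
  apply: fin_bigcap_measurable; first exact: finite_seq.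
  by move=> v _; exact: disc_configuration.
by apply/seteqP; split => w.
Qed.

Definition configuration_rv : {RV P >-> gw_config} := HB.pack configuration
  (isMeasurableFun.Build _ _ _ _ _ measurable_configuration).

Definition configuration_law : probability gw_config R := distribution P configuration_rv.

Lemma configuration_gw_law : gw_law nu F configuration_law.
Proof.
split.
- move=> s A us; rewrite /configuration_law /distribution /pushforward /=.
  have := indep_offspring_displacement brw (A := fun a => [set w | A a (configuration w a)]) us.
  rewrite (_ : \bigcap_(_ in _) _ = configuration @^-1` [set w | forall v, v \in s -> A v (w v)]); last first.
    by apply/seteqP; split => w.
  move=> H; apply: H => -[[i v]|[i v]] _.
    by exists [set n | A (inl (i, v)) (Posz n)].
  by exists (A (inr (i, v))).
- move=> [i v] A; exact: (law_offspring brw i v [set n | A (Posz n)]).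
- move=> [i v] A; exact: (law_displacement brw i v A).
Qed.

Lemma Ex_trees n (f : (nat -> seq int) -> R) : finitary n f -> (forall t, 0 <= f t <= 1) ->
  bmeas (fun w => f (trees w)) /\
  Ex P (fun w => f (trees w)) = Ex configuration_law (fun w => f (forest w)).
Proof.
move=> fn f01.
have b1 : bmeas (fun w => f (forest w)) by apply: disc_bmeas => //; exact: disc_forest fn.
have b2 : bmeas (fun w => f (trees w)).
  have : measurable_fun [set: Om] ((fun w => f (forest w)) \o configuration).
    by apply: measurableT_comp measurable_configuration; exact: b1.1.
  split; last by exists 1 => w; have /andP[? ?] := f01 (trees w); rewrite ger0_norm.
  by move: H; congr measurable_fun; apply/funext => w /=; rewrite forest_configuration.
split=> //; apply: EFin_inj; rewrite -!Ex_fine//.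
rewrite (ge0_integral_distribution (P := P) configuration_rv (f := fun w => (f (forest w))%:E)).
- by apply: eq_integral => w _ /=; rewrite forest_configuration.
- by apply/measurable_EFinP; exact: b1.1.
- by move=> w; rewrite lee_fin; case/andP: (f01 (forest w)).
Qed.

Lemma trees_later m n (f : (nat -> seq int) -> R) : finitary n f -> (forall t, 0 <= f t <= 1) ->
  Ex P (fun w => f (later m (trees w))) = Ex P (fun w => f (trees w)).
Proof.
move=> fn f01; rewrite (Ex_trees fn f01).2 -(Ex_later configuration_gw_law m fn f01).
apply: (Ex_trees (n := n + m) (f := fun t => f (later m t)) _ _).2 => // t t' tt'.
by apply: fn => i ni; apply: tt'; rewrite ltn_add2r.
Qed.

Lemma trees_prod_later m n (f h : (nat -> seq int) -> R) :
  finitary m f -> (forall t, 0 <= f t <= 1) -> finitary n h -> (forall t, 0 <= h t <= 1) ->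
  Ex P (fun w => f (trees w) * h (later m (trees w))) =
  Ex P (fun w => f (trees w)) * Ex P (fun w => h (trees w)).
Proof.
move=> fm f01 hn h01; rewrite (Ex_trees fm f01).2 (Ex_trees hn h01).2.
rewrite -(Ex_prod_later configuration_gw_law fm f01 hn h01).
apply: (Ex_trees (n := n + m) (f := fun t => f t * h (later m t)) _ _).2.
  move=> t t' tt'; congr (_ * _).
    by apply: fm => i im; apply: tt'; rewrite (leq_trans im)// leq_addl.
  by apply: hn => i ni; apply: tt'; rewrite ltn_add2r.
by move=> t; have /andP[? ?] := f01 t; have /andP[? ?] := h01 (later m t); rewrite mulr_ge0// mulr_ile1.
Qed.

Hypothesis nu_mean : ('E_nu[fun k : nat => k%:R%R : R] = 1)%E.
Hypothesis nu_variance : (0 < 'V_nu[fun k : nat => k%:R%R : R] < +oo)%E.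
Hypothesis F_mean : ('E_F[fun k : int => k%:~R%R : R] = 0)%E.
Hypothesis F_variance : (0 < 'V_F[fun k : int => k%:~R%R : R] < +oo)%E.

Lemma occupation_lower : exists2 c : R, 0 < c & forall N, (0 < N)%N ->
  c <= Ex P (fun w => Num.min 1 (N%:R `^ (- (3 / 2)) * (\sum_(i < N) count_mem 0%R (trees w i))%:R)).
Proof.
have [c c0 cP] := visits_sum_lower configuration_gw_law nu_mean nu_variance F_mean F_variance.
exists c => // N N0; apply: (le_trans (cP N N0)).
pose f (t : nat -> seq int) : R := Num.min 1 (N%:R `^ (- (3 / 2)) * (\sum_(i < N) count_mem 0%R (t i))%:R).
have fN : finitary N f.
  by move=> t t' tt'; congr (Num.min _ (_ * _%:R)); apply: eq_bigr => i _; rewrite tt'.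
have f01 t : 0 <= f t <= 1 by rewrite /f ge_min lexx le_min ler01 mulr_ge0// powR_ge0.
rewrite (Ex_trees fN f01).2.
pose q (w : gw_config) : R := Num.min 1 (N%:R `^ (- (3 / 2)) * (visits_sum (dirac_at 0) N N w)%:R).
rewrite -/q.
have bq : bmeas q.
  apply: disc_bmeas.
    exact: (disc_comp (fun m => Num.min 1 (N%:R `^ (- (3 / 2)) * m%:R)) (disc_visits_sum (dirac_at 0) N N)).
  by move=> w; rewrite /q ge_min lexx le_min ler01 mulr_ge0// powR_ge0.
have bf : bmeas (fun w => f (forest w)) by apply: disc_bmeas => //; exact: disc_forest fN.
rewrite -lee_fin -!Ex_fine//; apply: ae_ge0_le_integral => //.
- by move=> w _; rewrite lee_fin le_min ler01 mulr_ge0// powR_ge0.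
- by apply/measurable_EFinP; exact: bq.1.
- by move=> w _; rewrite lee_fin; case/andP: (f01 (forest w)).
- by apply/measurable_EFinP; exact: bf.1.
(* Counts are 0 by default on an infinite tree, so occupation dominates visits only on the almost
   sure event of extinction. *)
have := extinction_ae configuration_gw_law nu_mean nu_variance.
apply: (@filterS _ _ (ae_filter_ringOfSetsType configuration_law)) => w ext _.
rewrite lee_fin /q /f le_min !ge_min lexx /=; apply/orP; right.
rewrite ler_wpM2l ?powR_ge0// ler_nat; apply: leq_sum => i _.
have [n] := ext i; rewrite negbK => /eqP nn.
(* Past the extinction time, visits before generation [maxn N n] count the whole tree. *)
apply: leq_trans (leq_visits (dirac_at 0) 0 _ _ (leq_maxl N n)) _.
rewrite -(sum_labels (dirac_at 0) 0 (displacement (w \o shift i)) (generation_nil nn (leq_maxr N n))).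
rewrite -sum1_count [leqRHS]big_mkcond; apply: leq_sum => z _.
by rewrite add0r /dirac_at /=; case: eqP.
Qed.

Lemma progeny_upper : exists2 C : R, 0 <= C & forall (s N : nat) (M : R), (0 < N)%N -> 1 <= M ->
  Ex P (fun w => Num.min 1 ((\sum_(i < s * N) size (trees w i))%:R / (N%:R ^+ 2 * M ^+ 2))) <=
    C * s%:R / M.
Proof.
have [C C0 CP] := total_progeny_upper configuration_gw_law nu_mean nu_variance.
exists C => // s N M N0 M1; apply: le_trans (CP s N M N0 M1).
pose f (t : nat -> seq int) : R := Num.min 1 ((\sum_(i < s * N) size (t i))%:R / (N%:R ^+ 2 * M ^+ 2)).
suff [_ ->] : bmeas (fun w => f (trees w)) /\
  Ex P (fun w => f (trees w)) = Ex configuration_law (fun w => f (forest w)) by [].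
apply: (@Ex_trees (s * N)).
- by move=> t t' tt'; congr (Num.min _ (_%:R / _)); apply: eq_bigr => i _; rewrite tt'.
- move=> t; rewrite ge_min lexx le_min ler01 divr_ge0// mulr_ge0// ?exprn_ge0//.
  exact: le_trans ler01 M1.
Qed.

End canonical_configuration.

(** * Limits of sums of independent identically distributed elements *)

(** Stationarity and independence as partial sums use them, by forgetting the first [m] terms and by
    cutting after them; measurability is asked of real functions only, so [L] carries no
    sigma-algebra. *)
Record iid_sequence (R : realType) d (Om : measurableType d) (P : probability Om R)
    (L : Type) (t : Om -> nat -> L) : Prop := {
  iid_bmeas : forall n (f : (nat -> L) -> R), finitary n f ->
    (forall u, 0 <= f u <= 1) -> bmeas (fun w => f (t w));
  iid_later : forall m n (f : (nat -> L) -> R), finitary n f ->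
    (forall u, 0 <= f u <= 1) ->
    Ex P (fun w => f (later m (t w))) = Ex P (fun w => f (t w));
  iid_prod : forall m n (f h : (nat -> L) -> R), finitary m f ->
    (forall u, 0 <= f u <= 1) -> finitary n h -> (forall u, 0 <= h u <= 1) ->
    Ex P (fun w => f (t w) * h (later m (t w))) =
    Ex P (fun w => f (t w)) * Ex P (fun w => h (t w))
}.

(** The count is below b + 1 <= 2 b: an increment over a time [eps] involves no more trees than the
    path at time [2 * eps]. *)
Lemma truncnD_le (R : realType) (a b : R) : 0 <= a -> 1 <= b ->
  (Num.truncn (a + b) - Num.truncn a <= Num.truncn (2 * b))%N.
Proof.
move=> a0 b1.
have /andP[a1 a2] := truncn_itv a0.
have /andP[c1 c2] := truncn_itv (addr_ge0 a0 (le_trans ler01 b1)).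
rewrite truncn_ge_nat; last by lra.
have le_a : (Num.truncn a <= Num.truncn (a + b))%N by apply: le_truncn; lra.
rewrite natrB//; rewrite -natr1 in a2; lra.
Qed.

(** Intervals of equal length contain numbers of integers that differ by at most one: the single
    tree by which increments fail to be stationary before the limit. *)
Lemma truncn_shift (R : realType) (a b h : R) : 0 <= a <= b -> 0 <= h ->
  let n := (Num.truncn (b + h) - Num.truncn (a + h))%N in
  let n' := (Num.truncn b - Num.truncn a)%N in
  (n <= n'.+1)%N /\ (n' <= n.+1)%N.
Proof.
move=> /andP[a0 ab] h0 n n'.
have b0 : 0 <= b by lra.
have /andP[a1 a2] := truncn_itv a0; have /andP[b1 b2] := truncn_itv b0.
have /andP[c1 c2] := truncn_itv (addr_ge0 a0 h0).
have /andP[d1 d2] := truncn_itv (addr_ge0 b0 h0).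
have le1 : (Num.truncn a <= Num.truncn b)%N by exact: le_truncn.
have le2 : (Num.truncn (a + h) <= Num.truncn (b + h))%N by apply: le_truncn; lra.
rewrite -!natr1 in a2 b2 c2 d2; rewrite /n /n'.
split; rewrite -ltnS -(ltr_nat R) -2!natr1 !natrB//; lra.
Qed.

Lemma tests_min (R : realType) (E : normedModType R) (phi : E -> R) (L : R) x y :
  0 <= L -> (forall x, 0 <= phi x <= 1) -> (forall x y, `|phi x - phi y| <= L * `|x - y|) ->
  `|phi x - phi y| <= (L + 1) * Num.min 1 `|x - y|.
Proof.
move=> L0 phi01 phiL; have := phiL x y; have := phi01 x; have := phi01 y.
move=> /andP[a1 a2] /andP[b1 b2] h.
have h2 : `|phi x - phi y| <= 1 by rewrite ler_norml; lra.
have n0 := normr_ge0 (x - y).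
case: (leP 1 `|x - y|) => c; [rewrite mulr1; lra|nra].
Qed.

Lemma tests_ge0 (R : realType) (E : normedModType R) (phi : E -> R) : tests phi ->
  exists2 L : R, 0 <= L & forall x y, `|phi x - phi y| <= L * `|x - y|.
Proof.
move=> [_ [L phiL]]; exists `|L| => // x y; apply: le_trans (phiL x y) _.
by rewrite ler_wpM2r// ler_norm.
Qed.

Lemma prod_diff_le (R : realType) m (a b : nat -> R) :
  (forall j, 0 <= a j <= 1) -> (forall j, 0 <= b j <= 1) ->
  `|\prod_(j < m) a j - \prod_(j < m) b j| <= \sum_(j < m) `|a j - b j|.
Proof.
move=> a01 b01; elim: m => [|m ih]; first by rewrite !big_ord0 subrr normr0.
rewrite !big_ord_recr /=.
set A := \prod_(j < m) a j in ih *; set B := \prod_(j < m) b j in ih *.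
have B01 : 0 <= B <= 1.
  by rewrite /B prodr_ge0/= ?prodr_ile1// => i _; have /andP[] := b01 i.
rewrite (_ : A * a m - B * b m = (A - B) * a m + B * (a m - b m)); last by ring.
apply: le_trans (ler_normD _ _) _; rewrite !normrM; apply: lerD.
  have /andP[am0 am1] := a01 m; rewrite (ger0_norm am0).
  by apply: le_trans ih; rewrite ler_piMr.
by have /andP[B0 B1] := B01; rewrite (ger0_norm B0) ler_piMl.
Qed.

Section iid_sums.
Variables (R : realType) (E : normedModType R).
Variables (d d' : measure_display) (Om : measurableType d) (Om' : measurableType d').
Variables (P : probability Om R) (Q : probability Om' R).
Variables (L : Type) (t : Om -> nat -> L) (b : nat -> L -> E).
Hypothesis iid : iid_sequence P t.

Definition psum N m (u : nat -> L) : E := \sum_(i < m) b N (u i).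

Definition step_path N (u : nat -> L) : cadlag E := cadlag_step (psum N ^~ u) N.

Variable g : Om' -> cadlag E.
Hypotheses (rg : random_element g) (gX : cvg_in_law P Q (fun N w => step_path N (t w)) g).
Hypothesis norm_mono : forall N m n u, (m <= n)%N -> `|psum N m u| <= `|psum N n u|.
Hypothesis small : forall l, b N l @[N --> \oo] --> 0.

Let fl N (s : R) := Num.truncn (s * N%:R).

Let stepE N u s : step_path N u s = psum N (fl N s) u.
Proof. by []. Qed.

Let le_fl N (s v : R) : s <= v -> (fl N s <= fl N v)%N.
Proof. by move=> sv; apply: le_truncn; rewrite ler_wpM2r. Qed.

Lemma psum_finitary N m : finitary m (psum N m).
Proof. by move=> u u' uu'; apply: eq_bigr => i _; rewrite uu'. Qed.

Lemma psumB N m n u : (m <= n)%N -> psum N n u - psum N m u = psum N (n - m) (later m u).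
Proof.
move=> /subnK mn; rewrite -{1}mn addnC /psum big_split_ord /= [LHS]addrC addKr.
by apply: eq_bigr => i _; rewrite /later addnC.
Qed.

Lemma finitary_le (S : Type) m n (f : (nat -> L) -> S) : (m <= n)%N ->
  finitary m f -> finitary n f.
Proof. by move=> mn fm u u' uu'; apply: fm => i im; apply: uu'; exact: leq_trans mn. Qed.

Let Psi_eq k C (Psi : (nat -> E) -> R) a a' : mtests k C Psi ->
  (forall j, (j < k)%N -> a j = a' j) -> Psi a = Psi a'.
Proof.
move=> [_ _ lip] aa'; apply/eqP; rewrite -subr_eq0 -normr_le0; apply: le_trans (lip a a') _.
by rewrite big1 ?mulr0// => i _; rewrite aa'// subrr normr0.
Qed.

Let maxfl N k (s : nat -> R) := \max_(j < k) fl N (s j).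

Let fdd_finitary N k s C (Psi : (nat -> E) -> R) : mtests k C Psi ->
  finitary (maxfl N k s) (fun u => Psi (fun j => step_path N u (s j))).
Proof.
move=> tPsi u u' uu'; apply: (Psi_eq tPsi) => j jk; rewrite !stepE.
apply: psum_finitary => i ij; apply: uu'; apply: leq_trans ij _.
exact: (@leq_bigmax _ (fun j : 'I_k => fl N (s j)) (Ordinal jk)).
Qed.

(** The supremum is over uncountably many times, but a term that looks beyond some [s j + 2 * eps]
    is 0; so it is a function of finitely many trees, which makes it measurable. *)
Let smooth_finitary N k (s : nat -> R) (eps C : R) (Psi : (nat -> E) -> R) : 0 < eps -> mtests k C Psi ->
  finitary (maxfl N k (fun j => s j + 2 * eps))
    (fun u => smooth_eval k s eps Psi (step_path N u)).
Proof.
move=> eps0 tPsi.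
suff H u u' v : (forall i, (i < maxfl N k (fun j => s j + 2 * eps)%R)%N -> u i = u' i) ->
    smooth_term k s eps Psi (step_path N u) v <= smooth_term k s eps Psi (step_path N u') v.
  move=> u u' uu'; rewrite /smooth_eval; congr sup; apply: eq_imagel => v _.
  by apply/eqP; rewrite eq_le !H// => i iN; rewrite uu'.
move=> uu'; have [pos|/le_trans->//] := ltP 0 (smooth_term k s eps Psi (step_path N u) v); last first.
  by rewrite /smooth_term le_max lexx.
have vk := smooth_term_gt0 eps0 tPsi pos.
rewrite /smooth_term (Psi_eq (a' := fun j => step_path N u' (v j)) tPsi)// => j jk.
rewrite !stepE; apply: psum_finitary => i ij; apply: uu'; apply: leq_trans ij _.
apply: leq_trans (@leq_bigmax _ (fun j : 'I_k => fl N (s j + 2 * eps)) (Ordinal jk)).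
by apply: le_fl; have /andP[_ /ltW] := vk j jk.
Qed.

Let X N w := step_path N (t w).

Let X0 N w : X N w 0 = 0.
Proof. by rewrite /X stepE /fl mul0r truncn0 /psum big_ord0. Qed.

Let mX N k (s : nat -> R) (eps C : R) (Psi : (nat -> E) -> R) : (forall j, 0 <= s j) -> 0 < eps ->
  mtests k C Psi -> measurable_fun [set: Om] (fun w => smooth_eval k s eps Psi (X N w)).
Proof.
move=> s0 eps0 tPsi; apply: (iid_bmeas iid (smooth_finitary (s := s) (N := N) eps0 tPsi) _).1 => u.
by rewrite (smooth_eval_ge0 s0 eps0 tPsi) (smooth_eval_le1 s0 eps0 tPsi).
Qed.

Lemma fdd_bmeas N k s C (Psi : (nat -> E) -> R) :
  mtests k C Psi -> bmeas (fun w => Psi (fun j => X N w (s j))).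
Proof.
move=> tPsi; apply: (iid_bmeas iid (fdd_finitary (s := s) (N := N) tPsi)) => u.
by have [_ ? _] := tPsi.
Qed.

Let X_mono N w s v r : 0 <= s -> s <= v <= r ->
  `|X N w v - X N w s| <= `|X N w r - X N w s|.
Proof.
move=> s0 /andP[sv vr]; rewrite /X !stepE !psumB ?le_fl ?(le_trans sv)//.
by apply: norm_mono; rewrite leq_sub2r// le_fl.
Qed.

Let min01 (x : E) : 0 <= Num.min 1 `|x| <= 1.
Proof. by rewrite le_min ler01 normr_ge0 ge_min lexx. Qed.

Let min_finitary N m : finitary m (fun u => Num.min 1 `|psum N m u| : R).
Proof. by move=> u u' /psum_finitary ->. Qed.

(** Once eps N >= 1, the increment has the law of a partial sum from the start, with at most as many
    trees as there are at time [2 * eps]; monotonicity of the norm concludes. *)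
Let X_incr (s eps : R) : 0 <= s -> 0 < eps -> \forall N \near \oo,
  Ex P (fun w => Num.min 1 `|X N w (s + eps) - X N w s|) <=
  Ex P (fun w => Num.min 1 `|X N w (2 * eps)|).
Proof.
move=> s0 eps0; near=> N.
have Neps : 1 <= eps * N%:R.
  rewrite -ler_pdivrMl// mulr1; near: N; exact: nbhs_infty_ger.
rewrite [leLHS](_ : _ = Ex P (fun w => Num.min 1 `|psum N (fl N (s + eps) - fl N s) (later (fl N s) (t w))|)); last first.
  by congr Ex; apply/funext => w; rewrite /X !stepE psumB// le_fl// lerDl ltW.
rewrite (iid_later iid (f := fun u => Num.min 1 `|psum N (fl N (s + eps) - fl N s) u|) (fl N s) (@min_finitary _ _))//.
apply: le_Ex.
- exact: (iid_bmeas iid (@min_finitary _ _)).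
- exact: (iid_bmeas iid (f := fun u => Num.min 1 `|psum N (fl N (2 * eps)) u|) (@min_finitary _ _)).
move=> w; rewrite -[X N w (2 * eps)]/(psum N (fl N (2 * eps)) (t w)) le_min !ge_min lexx /=.
apply/orP; right; apply: norm_mono; rewrite /fl mulrDl -mulrA.
by apply: truncnD_le => //; exact: mulr_ge0.
Unshelve. all: by end_near. Qed.

Lemma fdd_cvg k s C (Psi : (nat -> E) -> R) : (forall j, 0 <= s j) -> mtests k C Psi ->
  Ex P (fun w => Psi (fun j => step_path N (t w) (s j))) @[N --> \oo] -->
  Ex Q (fun w => Psi (fun j => g w (s j))).
Proof.
apply: (finite_dim_cvg rg gX X0 mX _ X_mono X_incr).
by move=> N k' s' C' Psi' _ tPsi; exact: (fdd_bmeas _ _ tPsi).1.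
Qed.

Lemma fdd_limit_bmeas k s C (Psi : (nat -> E) -> R) : (forall j, 0 <= s j) -> mtests k C Psi ->
  bmeas (fun w => Psi (fun j => g w (s j))).
Proof. by move=> s0 tPsi; have [] := smooth_eval_Ex rg Q s0 tPsi. Qed.

Lemma limit_at0 : {ae Q, forall w, g w 0 = 0}.
Proof. exact: (limit_null_at0 rg gX X0). Qed.

Let pair (r s : R) (j : nat) : R := if j is 0%N then r else s.

Let pair_ge0 r s : 0 <= r -> 0 <= s -> forall j, 0 <= pair r s j.
Proof. by move=> r0 s0 []. Qed.

Lemma mtests_incr phi : tests phi ->
  exists C, mtests 2 C (fun a : nat -> E => phi (a 1%N - a 0%N)).
Proof.
move=> tphi; have [C C0 phiC] := tests_ge0 tphi; exists C; split=> // [a|a a'].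
  exact: tphi.1.
rewrite big_ord_recl big_ord1 /=; apply: le_trans (phiC _ _) _; rewrite ler_wpM2l//.
rewrite [leRHS]addrC.
have -> : a 1%N - a 0%N - (a' 1%N - a' 0%N) = (a 1%N - a' 1%N) - (a 0%N - a' 0%N).
  by rewrite !opprB addrACA [in RHS]addrACA; congr (_ + _); rewrite addrC.
exact: ler_normB.
Qed.

Lemma increment_cvg phi r s : tests phi -> 0 <= r -> 0 <= s ->
  Ex P (fun w => phi (step_path N (t w) s - step_path N (t w) r)) @[N --> \oo] -->
  Ex Q (fun w => phi (g w s - g w r)).
Proof.
move=> tphi r0 s0; have [C tPsi] := mtests_incr tphi.
exact: (fdd_cvg (pair_ge0 r0 s0) tPsi).
Qed.

Lemma increment_random r s : 0 <= r -> 0 <= s -> random_element (fun w => g w s - g w r).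
Proof.
move=> r0 s0; apply: random_element_tests => phi tphi; have [C tPsi] := mtests_incr tphi.
exact: (fdd_limit_bmeas (pair_ge0 r0 s0) tPsi).1.
Qed.

Lemma marginal_random s : 0 <= s -> random_element (fun w => g w s).
Proof.
move=> s0; apply: random_element_tests => phi tphi; have [C C0 phiC] := tests_ge0 tphi.
have tPsi : mtests 1 C (fun a : nat -> E => phi (a 0%N)).
  split=> // [a|a a']; first exact: tphi.1.
  by rewrite big_ord1.
exact: (fdd_limit_bmeas (fun=> s0) tPsi).1.
Qed.

Let tests_psum N m phi : tests phi -> finitary m (fun u => phi (psum N m u)).
Proof. by move=> _ u u' /psum_finitary ->. Qed.

(** The added tree moves the test by its truncated norm, up to the factor [C + 1], and has the law
    of the first tree. *)
Let one_more N m phi C : tests phi -> 0 <= C ->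
    (forall x y, `|phi x - phi y| <= C * `|x - y|) ->
  `|Ex P (fun w => phi (psum N m.+1 (t w))) - Ex P (fun w => phi (psum N m (t w)))| <=
  (C + 1) * Ex P (fun w => Num.min 1 `|b N (t w 0%N)|).
Proof.
move=> tphi C0 phiC.
have fb : finitary 1 (fun u => Num.min 1 `|b N (u 0%N)| : R) by move=> u u' uu'; rewrite uu'.
have bb := iid_bmeas iid fb (fun u => min01 _).
have fbm : finitary m.+1 (fun u => Num.min 1 `|b N (u m)| : R) by move=> u u' uu'; rewrite uu'.
rewrite -(iid_later iid m fb (fun u => min01 _)) /later add0n -ExZ; last first.
  exact: (iid_bmeas iid fbm (fun u => min01 _)).
apply: distr_Ex.
- exact: (iid_bmeas iid (@tests_psum N m.+1 phi tphi) (fun u => tphi.1 _)).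
- exact: (iid_bmeas iid (@tests_psum N m phi tphi) (fun u => tphi.1 _)).
- apply: bmeasM; first exact: bmeas_cst.
  exact: (iid_bmeas iid fbm (fun u => min01 _)).
move=> w; apply: le_trans (tests_min _ _ C0 tphi.1 phiC) _.
by rewrite /psum big_ord_recr /= [X in `|X|]addrC addKr.
Qed.

Let small_Ex : Ex P (fun w => Num.min 1 `|b N (t w 0%N)|) @[N --> \oo] --> (0 : R).
Proof.
have [] := @Ex_cvg _ _ _ P (fun N w => Num.min 1 `|b N (t w 0%N)|) (fun=> 0) 1.
- move=> N; have fb : finitary 1 (fun u => Num.min 1 `|b N (u 0%N)| : R) by move=> u u' uu'; rewrite uu'.
  exact: (iid_bmeas iid fb (fun u => min01 _)).1.
- by move=> N w; have /andP[? ?] := min01 (b N (t w 0%N)); rewrite ger0_norm.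
- move=> w; have /cvgr0Pnorm_le H := small (t w 0%N).
  apply/cvgr0Pnorm_le => e e0; apply: filterS (H e e0) => N h.
  have /andP[q0 _] := min01 (b N (t w 0%N)).
  by rewrite ger0_norm// ge_min h orbT.
by rewrite Ex_cst.
Qed.

(** Before the limit both increments are, in law, sums of numbers of trees that differ by at most
    one, and one tree is negligible. *)
Lemma increment_stationary phi r s h : tests phi -> 0 <= r <= s -> 0 <= h ->
  Ex Q (fun w => phi (g w (s + h) - g w (r + h))) = Ex Q (fun w => phi (g w s - g w r)).
Proof.
move=> tphi /andP[r0 rs] h0; have s0 : 0 <= s by exact: le_trans rs.
have c1 := increment_cvg tphi (addr_ge0 r0 h0) (addr_ge0 s0 h0).
have c2 := increment_cvg tphi r0 s0.
have [C C0 phiC] := tests_ge0 tphi.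
have XE N r' s' : r' <= s' ->
    Ex P (fun w => phi (step_path N (t w) s' - step_path N (t w) r')) =
    Ex P (fun w => phi (psum N (fl N s' - fl N r') (t w))).
  move=> rs'; rewrite -(iid_later iid (fl N r') (@tests_psum N (fl N s' - fl N r') phi tphi) (fun u => tphi.1 _)).
  by congr Ex; apply/funext => w; rewrite !stepE psumB// le_fl.
apply/eqP; rewrite -subr_eq0 -normr_le0; apply/ler_addgt0Pr => e e0; rewrite add0r.
have e3 : 0 < e / 3 by lra.
have e4 : 0 < e / 3 / (C + 1) by rewrite divr_gt0// ltr_wpDl.
have /cvgrPdist_le/(_ _ e3) {}c1 := c1.
have /cvgrPdist_le/(_ _ e3) {}c2 := c2.
have /cvgr0Pnorm_le/(_ _ e4) c3 := small_Ex.
have [N [h1 h2 h3]] : exists N, [/\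
  `|Ex Q (fun w => phi (g w (s + h) - g w (r + h))) -
    Ex P (fun w => phi (step_path N (t w) (s + h) - step_path N (t w) (r + h)))| <= e / 3,
  `|Ex Q (fun w => phi (g w s - g w r)) -
    Ex P (fun w => phi (step_path N (t w) s - step_path N (t w) r))| <= e / 3 &
  `|Ex P (fun w => Num.min 1 `|b N (t w 0%N)|)| <= e / 3 / (C + 1)].
  have [N [[h1 h2] h3]] := filter_ex (filterI (filterI c1 c2) c3).
  by exists N.
have {}h3 m : `|Ex P (fun w => phi (psum N m.+1 (t w))) - Ex P (fun w => phi (psum N m (t w)))| <= e / 3.
  apply: le_trans (one_more _ _ tphi C0 phiC) _.
  rewrite mulrC -ler_pdivlMr ?ltr_wpDl//; exact: le_trans (ler_norm _) h3.
move: h1 h2; rewrite !XE ?lerD2r//.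
have [n1 n2] : (fl N (s + h) - fl N (r + h) <= (fl N s - fl N r).+1)%N /\
   (fl N s - fl N r <= (fl N (s + h) - fl N (r + h)).+1)%N.
  rewrite /fl !mulrDl; apply: truncn_shift; last exact: mulr_ge0.
  by rewrite mulr_ge0//= ler_wpM2r.
set n := (fl N (s + h) - fl N (r + h))%N in n1 n2 *; set n' := (fl N s - fl N r)%N in n1 n2 *.
have h4 : `|Ex P (fun w => phi (psum N n (t w))) - Ex P (fun w => phi (psum N n' (t w)))| <= e / 3.
  have [->|[->|->]] : n = n' \/ n = n'.+1 \/ n' = n.+1 by clear -n1 n2; lia.
  - by rewrite subrr normr0 ltW.
  - exact: h3.
  - by rewrite distrC; exact: h3.
move: h4; rewrite !ler_norml; lra.
Qed.

Lemma mtests_prod_incr m (phi : nat -> E -> R) : (forall j, tests (phi j)) ->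
  exists C, mtests m.+1 C (fun a : nat -> E => \prod_(j < m) phi j (a j.+1 - a j)).
Proof.
move=> tphi.
have H j : exists c : R, 0 <= c /\ forall x y, `|phi j x - phi j y| <= c * `|x - y|.
  by have [c c0 ?] := tests_ge0 (tphi j); exists c.
have [C Cphi] := choice H.
exists (\sum_(j < m) (C j * 2)); split.
- by apply: sumr_ge0 => j _; rewrite mulr_ge0// (Cphi j).1.
- move=> a; apply/andP; split; [apply: prodr_ge0|apply: prodr_ile1] => j _;
  by have /andP[a0 a1] := (tphi j).1 (a j.+1 - a j); rewrite a0 ?a1.
move=> a a'.
apply: le_trans (prod_diff_le m (a := fun j => phi j (a j.+1 - a j)) (b := fun j => phi j (a' j.+1 - a' j)) _ _) _.
- by move=> j; exact: (tphi j).1.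
- by move=> j; exact: (tphi j).1.
rewrite mulr_suml; apply: ler_sum => j _; apply: le_trans ((Cphi j).2 _ _) _.
rewrite -mulrA ler_wpM2l ?(Cphi j).1//.
have -> : a j.+1 - a j - (a' j.+1 - a' j) = (a j.+1 - a' j.+1) - (a j - a' j).
  by rewrite !opprB addrACA [in RHS]addrACA; congr (_ + _); rewrite addrC.
apply: le_trans (ler_normB _ _) _; rewrite mulr_natl mulr2n; apply: lerD.
  rewrite (bigD1 (lift ord0 j))//= /bump/= add1n lerDl sumr_ge0//.
by rewrite (bigD1 (widen_ord (leqnSn m) j))//= lerDl sumr_ge0.
Qed.

(** The last increment is peeled off: the earlier ones are functions of the first [r m] trees, and
    it is a function of the later ones. *)
Let prod_step N (phi : nat -> E -> R) (r : nat -> nat) m : (forall j, tests (phi j)) ->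
  {homo r : i j / (i <= j)%N} ->
  Ex P (fun w => \prod_(j < m) phi j (psum N (r j.+1) (t w) - psum N (r j) (t w))) =
  \prod_(j < m) Ex P (fun w => phi j (psum N (r j.+1) (t w) - psum N (r j) (t w))).
Proof.
move=> tphi rmono; elim: m => [|m ih].
  by rewrite big_ord0 -[RHS](Ex_cst P 1); congr Ex; apply/funext => w; rewrite big_ord0.
rewrite big_ord_recr /= -ih.
pose f u := \prod_(j < m) phi j (psum N (r j.+1) u - psum N (r j) u).
pose h u := phi m (psum N (r m.+1 - r m) u).
have fh w : \prod_(j < m.+1) phi j (psum N (r j.+1) (t w) - psum N (r j) (t w)) =
    f (t w) * h (later (r m) (t w)).
  by rewrite big_ord_recr /= psumB// rmono.
under eq_fun do rewrite fh.
have hE : Ex P (fun w => phi m (psum N (r m.+1) (t w) - psum N (r m) (t w))) =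
    Ex P (fun w => h (t w)).
  rewrite -(iid_later iid (r m) (@tests_psum N (r m.+1 - r m) _ (tphi m)) (fun u => (tphi m).1 _)).
  by congr Ex; apply/funext => w; rewrite psumB// rmono.
rewrite hE; apply: (iid_prod iid (m := r m) (n := (r m.+1 - r m)%N) (f := f) (h := h)).
- move=> u u' uu'; apply: eq_bigr => j _.
  have [j1 j2] : (r j.+1 <= r m)%N /\ (r j <= r m)%N by split; apply: rmono => //; exact: ltnW.
  by rewrite (finitary_le j1 (@psum_finitary _ _) uu') (finitary_le j2 (@psum_finitary _ _) uu').
- move=> u; apply/andP; split; [apply: prodr_ge0|apply: prodr_ile1] => j _;
  by have /andP[a0 a1] := (tphi j).1 (psum N (r j.+1) u - psum N (r j) u); rewrite a0 ?a1.
- exact: tests_psum.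
- by move=> u; exact: (tphi m).1.
Qed.

Theorem limit_levy : levy_process Q (fun s w => g w s).
Proof.
split.
- exact: marginal_random.
- exact: limit_at0.
- by apply: aeW => w; have /asboolP[] := cadlagP (g w).
- move=> r s h /andP[r0 rs] h0; have s0 : 0 <= s by exact: le_trans rs.
  apply: same_law_tests.
  + by apply: increment_random; exact: addr_ge0.
  + exact: increment_random.
  by move=> phi tphi; apply: increment_stationary => //; rewrite r0.
move=> s s0 smono.
have s0' j : 0 <= s j by apply: le_trans s0 _; exact: smono.
apply: (independent_tests (X := fun k w => g w (s k.+1) - g w (s k))).
  by move=> k; exact: increment_random.
move=> m phi tphi; have [C tPsi] := mtests_prod_incr m tphi.
have c1 := fdd_cvg s0' tPsi.
have c2 : (\prod_(j < m) Ex P (fun w => phi j (step_path N (t w) (s j.+1) - step_path N (t w) (s j))))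
   @[N --> \oo] --> \prod_(j < m) Ex Q (fun w => phi j (g w (s j.+1) - g w (s j))).
  by apply: cvg_bigprod => j; exact: increment_cvg.
have XE : (fun N => Ex P (fun w => \prod_(j < m) phi j (step_path N (t w) (s j.+1) - step_path N (t w) (s j)))) =
   (fun N => \prod_(j < m) Ex P (fun w => phi j (step_path N (t w) (s j.+1) - step_path N (t w) (s j)))).
  apply/funext => N; apply: (@prod_step N phi (fun j => fl N (s j)) m) => // i j ij.
  by apply: le_fl; exact: smono.
rewrite XE in c1; exact: (cvg_unique _ c1 c2).
Qed.

(** The truncated distance to [D] is a test that vanishes on all increments before the limit, hence
    almost surely in the limit. This gives one null set for each pair of times; rational pairs and
    right continuity make it common to all. *)
Lemma limit_closed (D : set E) : closed D -> (forall N n u, D (psum N n u)) ->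
  {ae Q, forall w, forall r s, 0 <= r <= s -> D (g w s - g w r)}.
Proof.
move=> cD DX.
have tphi : tests (dist_compl (~` D)).
  split; first by move=> x; rewrite dist_compl_ge0 dist_compl_le1.
  by exists 1 => x y; rewrite mul1r; exact: dist_compl_lip.
have zero r s : 0 <= r <= s -> {ae Q, forall w, D (g w s - g w r)}.
  move=> /andP[r0 rs]; have s0 : 0 <= s by exact: le_trans rs.
  have c := increment_cvg tphi r0 s0.
  have : Ex Q (fun w => dist_compl (~` D) (g w s - g w r)) = 0.
    apply: (cvg_unique _ c) => //; rewrite (_ : (fun N : nat => _) = fun=> 0); first exact: cvg_cst.
    apply/funext => N; rewrite -[RHS](Ex_cst P 0); congr Ex; apply/funext => w.
    apply/eqP; rewrite eq_le dist_compl_ge0 andbT.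
    apply: (le_trans (dist_compl_le _ (h := step_path N (t w) s - step_path N (t w) r) _)).
      by move=> /(_ _); rewrite !stepE psumB ?le_fl//; apply; exact: DX.
    by rewrite subrr normr0.
  move=> Ex0; have bphi := tests_bmeas (increment_random r0 s0) tphi.
  have := Ex_eq0 bphi (fun w => dist_compl_ge0 _ _) Ex0.
  apply: (@filterS _ _ (ae_filter_ringOfSetsType Q)) => w /= h.
  apply: contrapT => nD; have := (dist_compl_gt0 (g w s - g w r) (closed_openC cD)).2 nD.
  by rewrite h ltxx.
(* Pairs of rationals are enumerated by [pickle], to intersect countably many almost sure events. *)
have : {ae Q, forall w, forall n : nat, forall p q : rat, choice.pickle (p, q) = n ->
    0 <= (ratr p : R) <= ratr q -> D (g w (ratr q) - g w (ratr p))}.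
  apply: ae_foralln => n.
  have [[[p q] <-]|np] := pselect (exists pq : rat * rat, choice.pickle pq = n); last first.
    by apply: aeW => w p q pq; case: np; exists (p, q).
  have [pq|npq] := boolP (0 <= (ratr p : R) <= ratr q); last first.
    by apply: aeW => w p' q' /(pcan_inj choice.pickleK)[-> ->] H; rewrite H in npq.
  have := zero _ _ pq; apply: (@filterS _ _ (ae_filter_ringOfSetsType Q)) => w h.
  by move=> p' q' /(pcan_inj choice.pickleK)[-> ->].
apply: (@filterS _ _ (ae_filter_ringOfSetsType Q)) => w H r s /andP[r0 rs].
apply: contrapT => nD; have := closed_openC cD; rewrite openE => /(_ _ nD).
move=> /nbhs_ballP[e /= e0 De].
have e2 : 0 < e / 2 by rewrite divr_gt0.
have s0 : 0 <= s by exact: le_trans rs.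
have [d1 d10 H1] := cadlag_right (g w) r0 e2.
have [d2 d20 H2] := cadlag_right (g w) s0 e2.
pose dl := Num.min d1 d2; have dl0 : 0 < dl by rewrite lt_min d10.
have [p] := rat_in_itvoo (ltr_pwDr dl0 (lexx r)); rewrite in_itv/= => /andP[rp pr].
(* The second rational is taken above the first one too, which matters when [r = s]. *)
have : Num.max s (ratr p) < s + dl.
  by rewrite gt_max ltrDl dl0 (lt_le_trans pr)// lerD2r.
move=> /rat_in_itvoo[q]; rewrite in_itv/= gt_max => /andP[/andP[sq pq] qs].
have h1 : `|g w (ratr p) - g w r| < e / 2.
  by apply: H1; rewrite (ltW rp) (lt_le_trans pr)// lerD2l ge_min lexx.
have h2 : `|g w (ratr q) - g w s| < e / 2.
  by apply: H2; rewrite (ltW sq) (lt_le_trans qs)// lerD2l ge_min lexx orbT.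
apply: (De (g w (ratr q) - g w (ratr p))).
  rewrite -ball_normE /= [e]splitr.
  have -> : g w s - g w r - (g w (ratr q) - g w (ratr p)) =
      (g w (ratr p) - g w r) - (g w (ratr q) - g w s).
    by rewrite !opprB addrACA [in RHS]addrACA (addrC (g w s)).
  by apply: le_lt_trans (ler_normB _ _) _; apply: ltrD.
apply: (H (choice.pickle (p, q)) p q) => //.
by rewrite (le_trans r0 (ltW rp)) ltW.
Qed.

End iid_sums.

Lemma lip1_continuous (R : realType) (E : normedModType R) (phi : E -> R) :
  (forall x y, `|phi x - phi y| <= `|x - y|) -> continuous phi.
Proof.
move=> lip x; apply/cvgrPdist_le => e e0; near=> y; apply: le_trans (lip x y) _.
by near: y; apply: cvgr_dist_le => //; exact: cvg_id.
Unshelve. all: by end_near. Qed.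

(** * Rescaled densities in C0 *)

Section C0_facts.
Variable R : realType.
Implicit Types (f h : C0 R) (a b x : R).


Lemma C0_eval_le f x : `|f x| <= `|f|.
Proof. exact: C0_norm_ub. Qed.

Lemma C0_norm_leP f (M : R) : (forall x, `|f x| <= M) -> `|f| <= M.
Proof. exact: C0_norm_le. Qed.

Lemma C0_sumE (I : Type) (s : seq I) (F : I -> C0 R) x :
  (\sum_(i <- s) F i) x = \sum_(i <- s) F i x.
Proof. by apply: (big_morph (fun f : C0 R => f x)). Qed.

Lemma C0_eq f h : f =1 h -> f = h.
Proof. by move=> fh; apply/val_inj/funext. Qed.

Lemma le_C0_norm f h : (forall x, 0 <= f x <= h x) -> `|f| <= `|h|.
Proof.
move=> fh; apply: C0_norm_leP => x; have /andP[f0 fhx] := fh x.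
by rewrite ger0_norm//; apply: le_trans fhx _; apply: le_trans (C0_eval_le h x); exact: ler_norm.
Qed.

Lemma C0_eval_continuous x : continuous (fun f => f x).
Proof.
exact: (lip1_continuous (phi := fun f : C0 R => f x) (fun f h => C0_eval_le (f - h) x)).
Qed.

Definition C0_cone : set (C0 R) := [set f | forall x, 0 <= f x].

Lemma closed_C0_cone : closed C0_cone.
Proof.
rewrite (_ : C0_cone = \bigcap_(x in [set: R]) [set f | 0 <= f x]).
  apply: closed_bigI => x _.
  by apply: (@closed_comp _ _ (fun f : C0 R => f x) [set y | 0 <= y]); [move=> ? _; exact: C0_eval_continuous|exact: closed_ge].
by apply/seteqP; split => f /= H; [move=> x _|move=> x]; exact: H.
Qed.

Lemma rescaleB a b f h : rescale a b (f - h) = rescale a b f - rescale a b h.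
Proof. by apply: C0_eq => x /=; case: ifP => _; [rewrite -mulrBr|rewrite subrr]. Qed.

Lemma rescale_norm a b f : `|rescale a b f| <= `|a| * `|f|.
Proof.
apply: C0_norm_leP => x /=; case: ifP => _; last by rewrite normr0 mulr_ge0.
by rewrite normrM ler_wpM2l//; exact: C0_eval_le.
Qed.

Lemma rescale_sum (I : Type) (s : seq I) (F : I -> C0 R) a b :
  rescale a b (\sum_(i <- s) F i) = \sum_(i <- s) rescale a b (F i).
Proof.
apply: C0_eq => x; rewrite C0_sumE /=; case: ifP => _; last by rewrite big1.
by rewrite C0_sumE mulr_sumr.
Qed.

Lemma rescale_rescale a b a' b' f : 0 < b -> 0 < b' ->
  rescale a b (rescale a' b' f) = rescale (a * a') (b * b') f.
Proof.
by move=> b0 b'0; apply: C0_eq => x; rewrite !rescaleE ?mulr_gt0// mulrA (mulrCA b') mulrA.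
Qed.

(* Uniformity in x comes from compactness on a large interval, and from the decay of f outside. *)
Lemma dilation_uniform f (b_ : nat -> R) b e : 0 < b -> 0 < e -> b_ n @[n --> \oo] --> b ->
  \forall n \near \oo, forall x, `|f (b_ n * x) - f (b * x)| <= e.
Proof.
move=> b0 e0 bb; have e2 : 0 < e / 2 by rewrite divr_gt0.
have [A A0 fA] : exists2 A : R, 0 < A & forall y, A <= `|y| -> `|f y| <= e / 2.
  have /cvgr0Pnorm_le/(_ _ e2)[A1 [_ fA1]] := @C0_pinfty _ f.
  have /cvgr0Pnorm_le/(_ _ e2)[A2 [_ fA2]] := @C0_ninfty _ f.
  exists (Num.max 1 (Num.max (A1 + 1) (1 - A2))); first by rewrite lt_max ltr01.
  move=> y; rewrite !ge_max => /and3P[_ h1 h2].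
  case: (ger0P y) h1 h2 => y0 h1 h2; [apply: fA1|apply: fA2]; lra.
have bpos : \forall n \near \oo, b / 2 < b_ n.
  by apply: (cvgr_gt b bb); lra.
have near_cpt : \forall n \near \oo, `[- (2 * A / b), 2 * A / b]%classic `<=`
    (fun x => `|f (b_ n * x) - f (b * x)| <= e).
  have /compact_near_coveringP := @segment_compact R (- (2 * A / b)) (2 * A / b).
  apply => x _.
  have c1 : (fun p : R * nat => f (b_ p.2 * p.1)) @ filter_prod (nbhs x) \oo --> f (b * x).
    apply: (@cvg_comp _ _ _ (fun p : R * nat => b_ p.2 * p.1) f _ _ _ _ (@C0_cts R f (b * x))).
    apply: cvgM; last exact: cvg_fst.
    by apply: cvg_comp bb; exact: cvg_snd.
  have c2 : (fun p : R * nat => f (b * p.1)) @ filter_prod (nbhs x) \oo --> f (b * x).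
    apply: (@cvg_comp _ _ _ (fun p : R * nat => b * p.1) f _ _ _ _ (@C0_cts R f (b * x))).
    apply: cvgM; first exact: cvg_cst.
    exact: cvg_fst.
  have FF : Filter (filter_prod (nbhs (x : R)) \oo) by exact: filter_prod_filter.
  have := @cvgB _ _ _ _ FF _ _ _ _ c1 c2; rewrite subrr => /cvgr0Pnorm_le/(_ _ e0).
  exact.
near=> n => x; have [xs|xs] := leP `|x| (2 * A / b).
  have : `[- (2 * A / b), 2 * A / b]%classic x by rewrite /= in_itv/= -ler_norml.
  by move: x {xs}; near: n.
have bn : b / 2 < b_ n by near: n.
have x0 : 0 < `|x| by apply: le_lt_trans xs; rewrite divr_ge0 ?mulr_ge0// ltW.
have xs' : 2 * A < `|x| * b by rewrite -ltr_pdivrMr.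
rewrite [e]splitr; apply: le_trans (ler_normB _ _) _; apply: lerD; apply: fA.
  by rewrite normrM (gtr0_norm (lt_trans _ bn)) ?divr_gt0//; nra.
by rewrite normrM (gtr0_norm b0); lra.
Unshelve. all: by end_near. Qed.

Lemma rescale_cvg f (a_ b_ : nat -> R) a b : 0 < b -> (forall n, 0 < b_ n) ->
  a_ n @[n --> \oo] --> a -> b_ n @[n --> \oo] --> b ->
  rescale (a_ n) (b_ n) f @[n --> \oo] --> rescale a b f.
Proof.
move=> b0 bn0 aa bb; apply/cvgrPdist_le => e e0.
pose K := `|f| + `|a| + 1; have K0 : 0 < K by rewrite ltr_wpDl// addr_ge0.
have d0 : 0 < e / K / 2 by rewrite !divr_gt0.
have ha : \forall n \near \oo, `|a - a_ n| <= e / K / 2 by exact: (cvgrPdist_le _ _).1 aa _ d0.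
have hb := dilation_uniform f b0 d0 bb.
have ha2 : \forall n \near \oo, `|a - a_ n| <= 1 by exact: (cvgrPdist_le _ _).1 aa _ ltr01.
near=> n.
have hb' x : `|f (b_ n * x) - f (b * x)| <= e / K / 2 by move: x; near: n; exact: hb.
apply: C0_norm_leP => x.
rewrite [X in `|X|](_ : _ = (a - a_ n) * f (b * x) - a_ n * (f (b_ n * x) - f (b * x))); last first.
  rewrite -[LHS]/(rescale a b f x - rescale (a_ n) (b_ n) f x) !rescaleE//; ring.
have h1 : `|a - a_ n| <= e / K / 2 by near: n.
have h2 := hb' x.
have h3 : `|a - a_ n| <= 1 by near: n.
have h4 : `|a_ n| <= `|a| + 1.
  rewrite -[a_ n](subKr a); apply: le_trans (ler_normB _ _) _; exact: lerD.
apply: le_trans (ler_normB _ _) _; rewrite !normrM.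
have h5 := C0_eval_le f (b * x).
apply: (@le_trans _ _ (e / K / 2 * `|f| + (`|a| + 1) * (e / K / 2))).
  by apply: lerD; apply: ler_pM.
rewrite mulrC -mulrDl addrA -/K; set k := K in K0 *.
by rewrite mulrA mulrCA divff ?gt_eqF// mulr1; lra.
Unshelve. all: by end_near. Qed.

Lemma linear_interpolationE (c : int -> R) x : linear_interpolation c x =
  (1 - (x - (Num.floor x)%:~R)) * c (Num.floor x) +
  (x - (Num.floor x)%:~R) * c (Num.floor x + 1).
Proof. by rewrite /linear_interpolation; ring. Qed.

Lemma floor_frac x : 0 <= x - (Num.floor x)%:~R < 1.
Proof. have /andP[h1 h2] := floor_itv x; rewrite intrD in h2; lra. Qed.

Lemma linear_interpolation_ge0 (c : int -> R) x : (forall j, 0 <= c j) ->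
  0 <= linear_interpolation c x.
Proof.
move=> c0; rewrite linear_interpolationE; have /andP[h1 h2] := floor_frac x.
by rewrite addr_ge0// mulr_ge0//; lra.
Qed.

Lemma linear_interpolation_sum (I : Type) (s : seq I) (c : I -> int -> R) x :
  linear_interpolation (fun j => \sum_(i <- s) c i j) x =
  \sum_(i <- s) linear_interpolation (c i) x.
Proof.
rewrite linear_interpolationE !mulr_sumr -big_split/=.
by apply: eq_bigr => i _; rewrite linear_interpolationE.
Qed.

Lemma linear_interpolation_int (c : int -> R) (j : int) : linear_interpolation c j%:~R = c j.
Proof. by rewrite /linear_interpolation intrKfloor subrr mul0r addr0. Qed.

Lemma linear_interpolation_le1 (z : int) x :
  linear_interpolation (fun j => (z == j)%:R) x <= \1_`[z%:~R - 1, z%:~R + 1] x.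
Proof.
rewrite linear_interpolationE; have /andP[h1 h2] := floor_frac x.
set k := Num.floor x in h1 h2 *; rewrite indicE.
have [->|zk] := eqVneq z k.
  rewrite mem_set /= ?in_itv/=; last lra.
  by rewrite (_ : k == k + 1 = false); [rewrite mulr0; lra|apply/negbTE; lia].
have [->|zk1] := eqVneq z (k + 1); last by rewrite !mulr0 addr0.
by rewrite mem_set /= ?in_itv/= ?intrD; lra.
Qed.

End C0_facts.

Section tree_densities.
Variable R : realType.
Implicit Types (l : seq int) (u : nat -> seq int).

Lemma count_bounded l : exists n : nat, forall j : int,
  (n < absz j)%N -> (count_mem j l)%:R = 0 :> R.
Proof.
exists (\max_(v <- l) absz v) => j nj.
rewrite (_ : count_mem j l = 0%N)//; apply/eqP; rewrite -leqn0 leqNgt -has_count has_pred1.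
apply: contraL nj => jl; rewrite -leqNgt.
exact: (@leq_bigmax_seq _ _ predT absz).
Qed.

Definition tree_density N l : C0 R :=
  rescale (N%:R `^ (- (3 / 2))) (Num.sqrt N%:R)
    (MkC0 (linear_interpolation_subproof (count_bounded l))).

Lemma tree_density_ge0 N l x : 0 <= tree_density N l x.
Proof.
rewrite /=; case: ifP => // _; rewrite mulr_ge0 ?powR_ge0//.
exact: linear_interpolation_ge0.
Qed.

Lemma psum_ge0 N m u x : 0 <= psum tree_density N m u x.
Proof. by rewrite /psum C0_sumE sumr_ge0// => i _; exact: tree_density_ge0. Qed.

Lemma psum_mono N m n u : (m <= n)%N ->
  `|psum tree_density N m u| <= `|psum tree_density N n u|.
Proof.
move=> mn; apply: le_C0_norm => x; rewrite psum_ge0/= -subr_ge0.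
rewrite -[_ - _]/((psum tree_density N n u - psum tree_density N m u) x) psumB//.
exact: psum_ge0.
Qed.

Lemma tree_density_small l : tree_density N l @[N --> \oo] --> (0 : C0 R).
Proof.
set a := MkC0 (linear_interpolation_subproof (count_bounded l)).
apply/cvgr0Pnorm_le => e e0; near=> N.
apply: le_trans (rescale_norm _ _ a) _; rewrite ger0_norm ?powR_ge0//.
have N1 : 1 <= N%:R :> R by rewrite ler1n; near: N; exact: nbhs_infty_gt.
have N0 : 0 < N%:R :> R by exact: lt_le_trans N1.
apply: (@le_trans _ _ (N%:R^-1 * `|a|)).
  rewrite ler_wpM2r// -[leRHS]powR_inv1 ?(ltW N0)//; apply: ler_powR => //; lra.
rewrite mulrC ler_pdivrMr// -ler_pdivrMl//.
by near: N; exact: nbhs_infty_ger.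
Unshelve. all: by end_near. Qed.

Lemma psumE N m u : psum tree_density N m u =
  rescale (N%:R `^ (- (3 / 2))) (Num.sqrt N%:R) (psum (fun _ l => MkC0 (linear_interpolation_subproof (count_bounded l))) 0 m u).
Proof. by rewrite /psum rescale_sum. Qed.

(** Both sides sum the same p n trees; only the normalization changes, from q n to p n. This is
    exact scaling at the time p / q. *)
Lemma psum_rescale p q n u : (0 < p)%N -> (0 < q)%N -> (0 < n)%N ->
  psum tree_density (q * n) (p * n) u =
  rescale ((p%:R / q%:R) `^ (3 / 2)) (Num.sqrt (p%:R / q%:R))^-1 (psum tree_density (p * n) (p * n) u).
Proof.
move=> p0 q0 n0; rewrite !psumE.
have pR : 0 < p%:R :> R by rewrite ltr0n.
have qR : 0 < q%:R :> R by rewrite ltr0n.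
have nR : 0 < n%:R :> R by rewrite ltr0n.
rewrite rescale_rescale ?invr_gt0 ?sqrtr_gt0 ?divr_gt0// ?ltr0n ?muln_gt0 ?p0//; congr rescale.
  rewrite !natrM !powRM ?invr_ge0 ?(ltW pR) ?(ltW qR) ?(ltW nR)//.
  have qi : (q%:R^-1 : R) `^ (3 / 2) = (q%:R `^ (3 / 2))^-1.
    apply: (mulIf (x := q%:R `^ (3 / 2))); first by rewrite gt_eqF// powR_gt0.
    by rewrite -powRM ?invr_ge0 ?(ltW qR)// !mulVf ?powR1// gt_eqF// powR_gt0.
  by rewrite qi !powRN; field; rewrite !gt_eqF ?powR_gt0.
rewrite !natrM !sqrtrM ?invr_ge0 ?(ltW pR) ?(ltW qR)// sqrtrV ?(ltW qR)//.
by field; rewrite !gt_eqF ?sqrtr_gt0.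
Qed.

Lemma psum_at0 N m u : (0 < N)%N -> psum tree_density N m u 0 =
  N%:R `^ (- (3 / 2)) * (\sum_(i < m) count_mem 0%R (u i))%:R.
Proof.
move=> N0; rewrite /psum C0_sumE natr_sum mulr_sumr; apply: eq_bigr => i _.
by rewrite rescaleE ?sqrtr_gt0 ?ltr0n// mulr0 /= -[X in linear_interpolation _ X]/(0%:~R) linear_interpolation_int.
Qed.

Lemma tree_density_le N l x : (0 < N)%N -> tree_density N l x <=
  N%:R `^ (- (3 / 2)) *
    \sum_(z <- l) \1_`[(z%:~R - 1) / Num.sqrt N%:R, (z%:~R + 1) / Num.sqrt N%:R] x.
Proof.
move=> N0; have s0 : 0 < Num.sqrt N%:R :> R by rewrite sqrtr_gt0 ltr0n.
rewrite rescaleE//= ler_wpM2l ?powR_ge0//.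
rewrite (_ : (fun j => _) = fun j => \sum_(z <- l) (z == j)%:R); last first.
  by apply/funext => j; rewrite -sum1_count natr_sum big_mkcond; apply: eq_bigr => z _ /=; case: eqP.
rewrite linear_interpolation_sum; apply: ler_sum => z _.
apply: le_trans (linear_interpolation_le1 _ _) _.
rewrite !indicE ler_nat; case: (boolP (_ \in _)) => // /set_mem /=; rewrite in_itv/= => /andP[h1 h2].
by rewrite mem_set//= in_itv/= ler_pdivrMr// ler_pdivlMr// mulrC h1.
Qed.

End tree_densities.

(** * Integrals over segments *)

Section C0_integrals.
Variable R : realType.
Implicit Types (f h : C0 R) (A : R).
Let mu := @lebesgue_measure R.

Lemma C0_measurable f (D : set R) : measurable_fun D f.
Proof. by apply: measurable_funTS; apply: continuous_measurable_fun; exact: C0_cts. Qed.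

Lemma C0_integrable_segment f A : mu.-integrable `[- A, A] (EFin \o f).
Proof.
apply: continuous_compact_integrable; first exact: segment_compact.
by apply: continuous_subspaceT; exact: C0_cts.
Qed.

(** Restricted to a segment because there the integral is Lipschitz for the supremum norm, while the
    total integral is not continuous and can be infinite. *)
Definition mass A f : R := \int[mu]_(x in `[- A, A]) f x.

Lemma mass_lip A f h : 0 <= A -> `|mass A f - mass A h| <= 2 * A * `|f - h|.
Proof.
move=> A0; rewrite /mass -RintegralB//; [|exact: C0_integrable_segment..].
have i : mu.-integrable `[- A, A] (EFin \o (f \- h)).
  exact: (C0_integrable_segment (f - h)).
apply: le_trans (le_normr_Rintegral _ i) _ => //.
have ia : mu.-integrable `[- A, A] (EFin \o (fun x => `|f x - h x|)).
  have := integrable_abse i; apply: eq_integrable => //.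
have ic : mu.-integrable `[- A, A] (EFin \o (fun=> `|f - h|)).
  apply: continuous_compact_integrable; first exact: segment_compact.
  by apply: continuous_subspaceT => x; exact: cvg_cst.
apply: (@le_trans _ _ (\int[mu]_(x in `[- A, A]) `|f - h|)).
  by apply: le_Rintegral => // x _; exact: (C0_eval_le (f - h)).
have mE : fine (mu `[- A, A]%classic) = 2 * A.
  rewrite /mu lebesgue_measure_itv/= lte_fin; case: (ltP (- A) A) => h' /=; first by rewrite opprK; lra.
  lra.
by rewrite Rintegral_cst// mE mulrC.
Qed.

(** Each individual is spread over a segment of length 2 / sqrt N at a height of at most N^(-3/2),
    hence contributes at most 2 / N^2. *)
Lemma mass_psum A N m u : 0 <= A -> (0 < N)%N -> mass A (psum (@tree_density R) N m u) <=
  2 * (\sum_(i < m) size (u i))%:R / N%:R ^+ 2.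
Proof.
move=> A0 N0; have s0 : 0 < Num.sqrt N%:R :> R by rewrite sqrtr_gt0 ltr0n.
have NR : 0 < N%:R :> R by rewrite ltr0n.
pose I (z : int) : set R := `[(z%:~R - 1) / Num.sqrt N%:R, (z%:~R + 1) / Num.sqrt N%:R]%classic.
pose c : R := N%:R `^ (- (3 / 2)).
have c0 : 0 <= c by exact: powR_ge0.
have mI z : measurable (I z) by exact: measurable_itv.
have intI z : (\int[mu]_x (\1_(I z) x)%:E = (2 / Num.sqrt N%:R)%:E)%E.
  have := integral_indic mu measurableT (mI z); rewrite setIT => ->.
  apply: etrans (lebesgue_measure_itv `[(z%:~R - 1) / Num.sqrt N%:R, (z%:~R + 1) / Num.sqrt N%:R]) _.
  rewrite /= lte_fin ltr_pM2r ?invr_gt0//.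
  by rewrite ifT; [rewrite -EFinB -mulrBl; congr (_ / _)%:E; ring|lra].
pose S x : \bar R := (\sum_(i < m) \sum_(z <- u i) (\1_(I z) x)%:E)%E.
have S0 x : (0 <= S x)%E by apply: sume_ge0 => i _; apply: sume_ge0 => z _; rewrite lee_fin.
have mS : measurable_fun [set: R] S.
  by apply: emeasurable_sum => i; apply: emeasurable_sum => z; apply/measurable_EFinP.
have h1 x : ((psum (@tree_density R) N m u x)%:E <= c%:E * S x)%E.
  rewrite /S; under eq_bigr do rewrite sumEFin; rewrite sumEFin -EFinM lee_fin /psum C0_sumE mulr_sumr.
  by apply: ler_sum => i _; exact: tree_density_le.
have h2 : (\int[mu]_x S x = (2 / Num.sqrt N%:R * (\sum_(i < m) size (u i))%:R)%:E)%E.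
  rewrite ge0_integral_sum//; first last.
  - by move=> i x _; apply: sume_ge0 => z _; rewrite lee_fin.
  - move=> i; apply: emeasurable_sum => z; apply/measurable_EFinP.
    exact: (measurable_indic (mI z)).
  rewrite natr_sum mulr_sumr -sumEFin; apply: eq_bigr => i _.
  rewrite ge0_integral_sum//; last by move=> z; apply/measurable_EFinP; exact: (measurable_indic (mI z)).
  under eq_bigr do rewrite intI.
  by rewrite sumEFin big_const_seq count_predT iter_addr addr0 mulr_natr.
have h3 : (\int[mu]_(x in `[(- A)%R, A]) (psum (@tree_density R) N m u x)%:E <=
    (c * (2 / Num.sqrt N%:R * (\sum_(i < m) size (u i))%:R))%:E)%E.
  rewrite EFinM -h2 -ge0_integralZl//.
  apply: (@le_trans _ _ (\int[mu]_(x in `[(- A)%R, A]) (c%:E * S x))%E).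
    apply: ge0_le_integral => //.
    - by move=> x _; rewrite lee_fin psum_ge0.
    - by apply/measurable_EFinP; exact: C0_measurable.
    - by apply: measurable_funTS; apply: emeasurable_funM.
  apply: ge0_subset_integral => //.
    by apply: emeasurable_funM.
  by move=> x _; rewrite mule_ge0.
have i := C0_integrable_segment (psum (@tree_density R) N m u) A.
rewrite -lee_fin /mass /Rintegral fineK; last exact: integrable_fin_num.
apply: (le_trans h3); rewrite lee_fin.
have -> : c = (N%:R * Num.sqrt N%:R)^-1.
  rewrite /c powRN; congr (_^-1); rewrite (_ : 3 / 2 = 1 + 2^-1 :> R); last lra.
  by rewrite powRD ?powRr1 ?powR12_sqrt// pnatr_eq0 gtn_eqF// implybT.
have -> : N%:R ^+ 2 = N%:R * Num.sqrt N%:R ^+ 2 :> R by rewrite sqr_sqrtr// expr2.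
set T := _%:R; set q := Num.sqrt _ in s0 *; set n := N%:R in NR *.
by rewrite le_eqVlt; apply/orP; left; apply/eqP; field; rewrite !gt_eqF.
Qed.

End C0_integrals.

(** * Identification of the limit of the densities *)

Section density_limit.
Variables (R : realType) (nu : probability nat R) (F : probability int R).
Hypothesis nu_mean : ('E_nu[fun k : nat => k%:R%R : R] = 1)%E.
Hypothesis nu_variance : (0 < 'V_nu[fun k : nat => k%:R%R : R] < +oo)%E.
Hypothesis F_mean : ('E_F[fun k : int => k%:~R%R : R] = 0)%E.
Hypothesis F_variance : (0 < 'V_F[fun k : int => k%:~R%R : R] < +oo)%E.
Variables (d : measure_display) (Om : measurableType d) (P : probability Om R).
Variables (K : nat -> seq nat -> {RV P >-> nat}) (xi : nat -> seq nat -> {RV P >-> int}).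
Hypothesis brw : iid_branching_random_walks nu F K xi.
Variables (d' : measure_display) (Om' : measurableType d') (Q : probability Om' R).
Variable g : Om' -> cadlag (C0 R).
Hypothesis g_random : random_element g.
Hypothesis g_limit : cvg_in_law P Q
  (fun N w => density_process R (fun i v => K i v w) (fun i v => xi i v w) N) g.

Lemma density_step_path N w :
  density_process R (fun i v => K i v w) (fun i v => xi i v w) N =
  step_path (@tree_density R) N (trees K xi w).
Proof.
apply/val_inj/funext => s /=; set m := Num.truncn _; rewrite psumE.
congr rescale; apply: C0_eq => x; rewrite /psum C0_sumE /= -linear_interpolation_sum.
congr linear_interpolation; apply/funext => j; rewrite /total_occupation natr_sum.
by apply: eq_bigr => i _; rewrite occupationE.
Qed.

Lemma trees_iid : iid_sequence P (trees K xi).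
Proof.
split.
- by move=> n f fn f01; have [] := @Ex_trees _ _ _ P K xi n f fn f01.
- by move=> m n f; exact: (trees_later brw).
- by move=> m n f h; exact: (trees_prod_later brw).
Qed.

Let gX : cvg_in_law P Q (fun N w => step_path (@tree_density R) N (trees K xi w)) g.
Proof.
have := g_limit; congr (cvg_in_law P Q _ g); apply/funext => N; apply/funext => w.
exact: density_step_path.
Qed.

Lemma density_limit_levy : levy_process Q (fun s w => g w s).
Proof. exact: (limit_levy trees_iid g_random gX (@psum_mono R) (@tree_density_small R)). Qed.

Lemma density_limit_increment r s : 0 <= r -> 0 <= s ->
  random_element (fun w => g w s - g w r).
Proof. exact: (increment_random Q g_random). Qed.

Lemma density_limit_ge0 :
  {ae Q, forall w, forall r s, 0 <= r <= s -> forall x, 0 <= (g w s - g w r) x}.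
Proof.
apply: (limit_closed trees_iid g_random gX (@psum_mono R) (closed_C0_cone (R := R))).
by move=> N n u x; exact: psum_ge0.
Qed.

Let marginal_cvg phi s : tests phi -> 0 <= s ->
  Ex P (fun w => phi (step_path (@tree_density R) N (trees K xi w) s)) @[N --> \oo] -->
  Ex Q (fun w => phi (g w s)).
Proof.
move=> tphi s0; have [C C_ge0 phiC] := tests_ge0 tphi.
have tPsi : mtests 1 C (fun a : nat -> C0 R => phi (a 0%N)).
  split=> // [a|a a']; first exact: tphi.1.
  by rewrite big_ord1.
exact: (fdd_cvg trees_iid g_random gX (@psum_mono R) (fun=> s0) tPsi).
Qed.

Let rg s : 0 <= s -> random_element (fun w => g w s).
Proof. exact: levy_random density_limit_levy s. Qed.

Lemma tests_rescale a b (phi : C0 R -> R) : tests phi -> tests (phi \o rescale a b).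
Proof.
move=> tphi; split; first by move=> f; exact: tphi.1.
have [C C_ge0 phiC] := tests_ge0 tphi; exists (C * `|a|) => f h.
apply: le_trans (phiC _ _) _; rewrite -mulrA ler_wpM2l// -rescaleB; exact: rescale_norm.
Qed.

(** At scale q n the time p / q, and at scale p n the time 1, use the same p n trees; the limits
    along these two subsequences are identified by [psum_rescale]. *)
Let scaling_rat p q phi : (0 < p)%N -> (0 < q)%N -> tests phi ->
  Ex Q (fun w => phi (g w (p%:R / q%:R))) =
  Ex Q (fun w => phi (rescale ((p%:R / q%:R) `^ (3 / 2)) (Num.sqrt (p%:R / q%:R))^-1 (g w 1))).
Proof.
move=> p0 q0 tphi; have pR : 0 < p%:R :> R by rewrite ltr0n.
have qR : 0 < q%:R :> R by rewrite ltr0n.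
have sub k : (0 < k)%N -> ((k * n.+1)%N @[n --> \oo] --> \oo).
  move=> k0 A [n0 _ h]; exists n0 => // n /= n0n; apply: h => /=.
  by apply: leq_trans n0n _; rewrite (leq_trans (leqnSn n))// leq_pmull.
set D := rescale ((p%:R / q%:R) `^ (3 / 2)) (Num.sqrt (p%:R / q%:R))^-1.
pose F1 N := Ex P (fun w => phi (step_path (@tree_density R) N (trees K xi w) (p%:R / q%:R))).
pose F2 N := Ex P (fun w => phi (D (step_path (@tree_density R) N (trees K xi w) 1))).
have c1 : F1 (q * n.+1)%N @[n --> \oo] --> Ex Q (fun w => phi (g w (p%:R / q%:R))).
  by apply: cvg_comp (sub q q0) _; apply: marginal_cvg => //; rewrite divr_ge0// ltW.
have c2 : F2 (p * n.+1)%N @[n --> \oo] --> Ex Q (fun w => phi (D (g w 1))).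
  by apply: cvg_comp (sub p p0) _; apply: (marginal_cvg (tests_rescale _ _ tphi)).
have E : (fun n => F1 (q * n.+1)%N) = (fun n => F2 (p * n.+1)%N).
  apply/funext => n; congr Ex; apply/funext => w; congr phi => /=.
  rewrite mul1r natrK [in LHS]natrM mulrA divfK ?gt_eqF// -natrM natrK.
  exact: psum_rescale.
by rewrite E in c1; exact: (cvg_unique _ c1 c2).
Qed.

Lemma density_limit_scaling s : 0 < s ->
  same_law Q (fun w => g w s) (fun w => rescale (s `^ (3 / 2)) (Num.sqrt s)^-1 (g w 1)).
Proof.
move=> s0.
have rr r : random_element (fun w => rescale (r `^ (3 / 2)) (Num.sqrt r)^-1 (g w 1)).
  apply: random_element_tests => phi tphi.
  exact: (tests_bmeas (rg ler01) (tests_rescale _ _ tphi)).1.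
apply: same_law_tests; [exact: rg (ltW s0)|exact: rr|] => phi tphi.
(* Rational times that tend to [s] strictly from the right, so that right continuity of the path
   applies. *)
pose r n : R := (Num.truncn (s * n.+1%:R)).+1%:R / n.+1%:R.
have n0 n : 0 < n.+1%:R :> R by rewrite ltr0n.
have rP n : s < r n <= s + n.+1%:R^-1.
  have /andP[t1 t2] := truncn_itv (mulr_ge0 (ltW s0) (ltW (n0 n))).
  rewrite ltr_pdivlMr// t2/= ler_pdivrMr// mulrDl mulVf ?gt_eqF//.
  by rewrite -natr1 lerD2r.
have r0 n : 0 < r n by have /andP[h _] := rP n; exact: lt_trans h.
have rs : r n @[n --> \oo] --> s.
  apply: (@squeeze_cvgr _ _ _ _ (fun=> s) (fun n => s + n.+1%:R^-1)).
  - by apply: nearW => n; have /andP[/ltW-> ->] := rP n.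
  - exact: cvg_cst.
  - rewrite -[X in _ --> X]addr0; apply: cvgD; first exact: cvg_cst.
    exact: cvg_harmonic.
have p32 (x : R) : 0 < x -> x `^ (3 / 2) = x * Num.sqrt x.
  move=> x0; rewrite (_ : 3 / 2 = 1 + 2^-1 :> R); last lra.
  by rewrite powRD ?gt_eqF ?implybT// powRr1 ?powR12_sqrt// ltW.
have sr : Num.sqrt (r n) @[n --> \oo] --> Num.sqrt s.
  by apply: (cvg_comp _ _ rs); exact: sqrt_continuous.
have phi1 f : `|phi f| <= 1 by have /andP[? ?] := tphi.1 f; rewrite ger0_norm.
have cphi : continuous phi by exact: tests_continuous.
have gr w : g w (r n) @[n --> \oo] --> g w s.
  apply/cvgrPdist_lt => e e0; have [dl dl0 H] := cadlag_right (g w) (ltW s0) e0.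
  have /cvgrPdist_lt/(_ _ dl0) := rs; apply: filterS => n.
  have /andP[/ltW sr' _] := rP n; rewrite distrC ger0_norm ?subr_ge0// ltrBlDl => h.
  by rewrite distrC; apply: H; rewrite sr'.
have dr w : rescale ((r n) `^ (3 / 2)) (Num.sqrt (r n))^-1 (g w 1) @[n --> \oo] -->
    rescale (s `^ (3 / 2)) (Num.sqrt s)^-1 (g w 1).
  apply: rescale_cvg.
  - by rewrite invr_gt0 sqrtr_gt0.
  - by move=> n; rewrite invr_gt0 sqrtr_gt0.
  - rewrite p32// (_ : (fun n => _) = fun n => r n * Num.sqrt (r n)); last first.
      by apply/funext => n; rewrite p32.
    exact: cvgM.
  - by apply: cvgV sr; rewrite gt_eqF// sqrtr_gt0.
have [_ c1] := @Ex_cvg _ _ _ Q (fun n w => phi (g w (r n))) (fun w => phi (g w s)) 1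
  (fun n => (tests_bmeas (rg (ltW (r0 n))) tphi).1) (fun n w => phi1 _)
  (fun w => cvg_comp _ _ (gr w) (cphi _)).
have [_ c2] := @Ex_cvg _ _ _ Q
  (fun n w => phi (rescale ((r n) `^ (3 / 2)) (Num.sqrt (r n))^-1 (g w 1)))
  (fun w => phi (rescale (s `^ (3 / 2)) (Num.sqrt s)^-1 (g w 1))) 1
  (fun n => (tests_bmeas (rr (r n)) tphi).1) (fun n w => phi1 _)
  (fun w => cvg_comp _ _ (dr w) (cphi _)).
have E : (fun n => Ex Q (fun w => phi (g w (r n)))) =
    (fun n => Ex Q (fun w => phi (rescale ((r n) `^ (3 / 2)) (Num.sqrt (r n))^-1 (g w 1)))).
  by apply/funext => n; exact: scaling_rat.
by rewrite E in c1; exact: (cvg_unique _ c1 c2).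
Qed.

Lemma density_limit_at0 : exists2 c : R, 0 < c &
  c <= Ex Q (fun w => Num.min 1 `|g w 1 0|).
Proof.
have [c c0 cP] := occupation_lower brw nu_mean nu_variance F_mean F_variance.
exists c => //.
have tphi : tests (fun f : C0 R => Num.min 1 `|f 0|).
  split=> [f|]; first by rewrite le_min ler01 normr_ge0 ge_min lexx.
  exists 1 => f h; rewrite mul1r; apply: le_trans (minr_lip _ _ _) _.
  by apply: le_trans (ler_dist_dist _ _) _; exact: (C0_eval_le (f - h)).
have c1 := marginal_cvg tphi ler01.
apply: (cvgr_to_ge c1); near=> N; have N0 : (0 < N)%N by near: N; exact: nbhs_infty_gt.
apply: (le_trans (cP N N0)); rewrite le_eqVlt; apply/orP; left; apply/eqP.
congr Ex; apply/funext => w /=; rewrite mul1r natrK psum_at0// ger0_norm//.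
Unshelve. all: by end_near. Qed.

(** The constant does not depend on [A]: this uniformity is what bounds the total mass, although
    only segments pass to the limit in law. *)
Lemma density_limit_mass : exists2 C : R, 0 <= C & forall (s : nat) (A M : R), 0 <= A -> 1 <= M ->
  Ex Q (fun w => Num.min 1 (`|mass A (g w s%:R)| / M ^+ 2)) <= C * s%:R / M.
Proof.
have [C C_ge0 CP] := progeny_upper brw nu_mean nu_variance.
exists (2 * C); first by rewrite mulr_ge0.
move=> s A M A0 M1; have M0 : 0 < M by lra.
have M2 : 0 < M ^+ 2 by rewrite exprn_gt0.
have tphi_lip (f h : C0 R) : `|Num.min 1 (`|mass A f| / M ^+ 2) - Num.min 1 (`|mass A h| / M ^+ 2)| <=
    2 * A / M ^+ 2 * `|f - h|.
  apply: le_trans (minr_lip _ _ _) _.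
  rewrite -mulrBl normrM (gtr0_norm (x := (M ^+ 2)^-1)) ?invr_gt0// mulrAC ler_wpM2r ?invr_ge0 ?(ltW M2)//.
  by apply: le_trans (ler_dist_dist _ _) _; exact: mass_lip.
have tphi : tests (fun f : C0 R => Num.min 1 (`|mass A f| / M ^+ 2)).
  split=> [f|]; first by rewrite le_min ler01 divr_ge0 ?(ltW M2)// ge_min lexx.
  by exists (2 * A / M ^+ 2).
have c1 := marginal_cvg tphi (ler0n R s).
apply: (cvgr_to_le c1); near=> N; have N0 : (0 < N)%N by near: N; exact: nbhs_infty_gt.
have NR : 0 < N%:R ^+ 2 :> R by rewrite exprn_gt0// ltr0n.
pose h (u : nat -> seq int) : R := Num.min 1 ((\sum_(i < s * N) size (u i))%:R / (N%:R ^+ 2 * M ^+ 2)).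
have bh : bmeas (fun w => h (trees K xi w)).
  apply: (iid_bmeas trees_iid (n := s * N)).
    by move=> u u' uu'; congr (Num.min _ (_%:R / _)); apply: eq_bigr => i _; rewrite uu'.
  by move=> u; rewrite /h ge_min lexx le_min ler01 divr_ge0// mulr_ge0// ltW.
apply: (@le_trans _ _ (2 * Ex P (fun w => h (trees K xi w)))); last first.
  by rewrite -!mulrA ler_pM2l// mulrA; exact: CP.
rewrite -ExZ//; apply: le_Ex.
- have tPsi : mtests 1 (2 * A / M ^+ 2) (fun a : nat -> C0 R => Num.min 1 (`|mass A (a 0%N)| / M ^+ 2)).
    split=> [|a|a a']; first by rewrite divr_ge0 ?(ltW M2)// mulr_ge0.
      exact: tphi.1.
    by rewrite big_ord1; exact: tphi_lip.
  exact: (@fdd_bmeas R _ _ _ P _ _ (@tree_density R) trees_iid N 1 (fun=> s%:R) _ _ tPsi).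
- by apply: bmeasM => //; exact: bmeas_cst.
move=> w; rewrite [step_path _ _ _ _]/= -natrM natrK.
have m0 : 0 <= mass A (psum (@tree_density R) N (s * N) (trees K xi w)).
  by apply: Rintegral_ge0 => x _; exact: psum_ge0.
rewrite (ger0_norm m0).
have := mass_psum (s * N) (trees K xi w) A0 N0; rewrite /h.
set T := (\sum_(i < _) _)%:R; set m := mass _ _ => mT.
have T0 : 0 <= T / (N%:R ^+ 2 * M ^+ 2) by rewrite divr_ge0 ?ler0n// mulr_ge0// ltW.
have : m / M ^+ 2 <= 2 * (T / (N%:R ^+ 2 * M ^+ 2)).
  rewrite ler_pdivrMr//; apply: (le_trans mT); rewrite le_eqVlt; apply/orP; left; apply/eqP.
  by field; rewrite !gt_eqF// ltr0n.
set q := T / _ in T0 * => h1.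
case: (leP 1 q) => q1; first by rewrite mulr1 ge_min; apply/orP; left; lra.
by rewrite ge_min h1 orbT.
Unshelve. all: by end_near. Qed.

End density_limit.

(** * Borel images of Levy processes *)

Lemma ae_eq_prob (R : realType) d (T : measurableType d) (P : probability T R) (A B : set T) :
  measurable A -> measurable B -> {ae P, forall w, A w <-> B w} -> P A = P B.
Proof.
move=> mA mB AB.
have := integral_indic P measurableT mA; rewrite setIT => <-.
have := integral_indic P measurableT mB; rewrite setIT => <-.
apply: ge0_ae_eq_integral => //.
- by apply/measurable_EFinP; exact: measurable_indic.
- by apply/measurable_EFinP; exact: measurable_indic.
move: AB; apply: (@filterS _ _ (ae_filter_ringOfSetsType P)) => w AB _.
by rewrite !indicE; congr ((nat_of_bool _)%:R%:E); apply/idP/idP => /set_mem/AB; exact: mem_set.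
Qed.

Lemma random_element_comp (R : realType) d (T : measurableType d) (E E' : topologicalType)
    (X : T -> E) (f : E -> E') : random_element X ->
  (forall B, <<s @open E' >> B -> <<s @open E >> (f @^-1` B)) -> random_element (f \o X).
Proof. by move=> rX mf B /mf; exact: rX. Qed.

Lemma borel_continuous (E E' : topologicalType) (f : E -> E') : continuous f ->
  forall B, <<s @open E' >> B -> <<s @open E >> (f @^-1` B).
Proof.
move=> cf.
move=> B; move: B; apply: smallest_sub => /=.
  split=> /= [|B mB|G mG].
  - by rewrite preimage_set0; exact: sigma_algebra0.
  - by rewrite setTD preimage_setC -setTD; exact: sigma_algebraCD.
  - by rewrite preimage_bigcup; exact: sigma_algebra_bigcup.
by move=> U oU; apply: sub_sigma_algebra; apply: open_comp => // x _; exact: cf.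
Qed.

Lemma random_element_real (R : realType) d (T : measurableType d) (f : T -> R) :
  measurable_fun [set: T] f -> random_element f.
Proof.
move=> mf; apply: random_element_preimage => U oU; rewrite -[X in measurable X]setTI.
by apply: mf => //; exact: open_measurable.
Qed.

(** Increments of [Y] are related to those of [X] only almost surely and along the path. This suits
    the integral over the line, which is Borel on C0 but is neither continuous nor additive outside
    integrable functions. *)
Lemma levy_map (R : realType) d (Om : measurableType d) (Q : probability Om R)
    (E E' : normedModType R) (X : R -> Om -> E) (Y : R -> Om -> E') (f : E -> E') :
  levy_process Q X ->
  (forall r s, 0 <= r -> 0 <= s -> random_element (fun w => X s w - X r w)) ->
  (forall B, <<s @open E' >> B -> <<s @open E >> (f @^-1` B)) ->
  (forall s, 0 <= s -> random_element (Y s)) ->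
  (forall r s, 0 <= r -> 0 <= s -> random_element (fun w => Y s w - Y r w)) ->
  {ae Q, forall w, Y 0 w = 0} -> {ae Q, forall w, is_cadlag (Y^~ w)} ->
  {ae Q, forall w, forall r s, 0 <= r <= s -> Y s w - Y r w = f (X s w - X r w)} ->
  levy_process Q Y.
Proof.
move=> LX rX mf rY rYI Y0 cY YX.
have prob r s B : 0 <= r <= s -> <<s @open E' >> B ->
    Q ((fun w => Y s w - Y r w) @^-1` B) = Q ((fun w => X s w - X r w) @^-1` (f @^-1` B)).
  move=> /andP[r0 rs] mB; have s0 : 0 <= s by exact: le_trans rs.
  apply: ae_eq_prob; [exact: rYI|by apply: rX => //; exact: mf|].
  move: YX; apply: (@filterS _ _ (ae_filter_ringOfSetsType Q)) => w H /=.
  by rewrite H// r0.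
split=> //.
- move=> r s h rs h0 B mB; have /andP[r0 rs'] := rs.
  rewrite prob//; last by rewrite addr_ge0//= lerD2r.
  rewrite prob//; exact: (levy_stationary LX rs h0 (mf _ mB)).
move=> t t0 tmono u A uu HA.
have tp k : 0 <= t k <= t k.+1.
  by rewrite (le_trans t0) ?tmono.
have /choice[B HB] : forall k, exists B, <<s @open E' >> B /\
    (k \in u -> (fun w => Y (t k.+1) w - Y (t k) w) @^-1` B = A k).
  move=> k; have [ku|nku] := boolP (k \in u); last by exists setT; split=> //; exact: sub_sigma_algebra openT.
  by have [B mB e] := HA _ ku; exists B; split.
have mA k : k \in u -> measurable (A k).
  move=> ku; have /andP[tk tkk] := tp k.
  by rewrite -(HB k).2//; apply: (rYI _ _ tk (le_trans tk tkk)); exact: (HB k).1.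
pose A' k := (fun w => X (t k.+1) w - X (t k) w) @^-1` (f @^-1` B k).
have mA' k : measurable (A' k).
  have /andP[tk tkk] := tp k.
  by apply: (rX _ _ tk (le_trans tk tkk)); apply: mf; exact: (HB k).1.
have ind := @levy_independent _ _ _ _ _ _ LX t t0 tmono u A' uu _.
transitivity (Q (\bigcap_(k in [set` u]) A' k)).
  apply: ae_eq_prob.
  - by apply: fin_bigcap_measurable; [exact: finite_seq|move=> k /=; exact: mA].
  - by apply: fin_bigcap_measurable; [exact: finite_seq|move=> k _; exact: mA'].
  move: YX; apply: (@filterS _ _ (ae_filter_ringOfSetsType Q)) => w H.
  by split=> h k /= ku; have := h k ku; rewrite -(HB k).2// /A' /= H.
rewrite ind; last by move=> k _; exists (f @^-1` B k) => //; apply: mf; exact: (HB k).1.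
rewrite big_seq [RHS]big_seq; apply: eq_bigr => k ku.
by rewrite -(HB k).2// prob//; exact: (HB k).1.
Qed.

Lemma Ex_ae_eq (R : realType) d (T : measurableType d) (P : probability T R) (f h : T -> R) :
  bmeas f -> bmeas h -> {ae P, forall w, f w = h w} -> Ex P f = Ex P h.
Proof.
move=> bf bh fh; apply: EFin_inj; rewrite -!Ex_fine//.
apply: ae_eq_integral => //; [exact/measurable_EFinP/bf.1|exact/measurable_EFinP/bh.1|].
by move: fh; apply: (@filterS _ _ (ae_filter_ringOfSetsType P)) => w H _; rewrite H.
Qed.

Lemma lip_continuous (R : realType) (E E' : normedModType R) (C : R) (f : E -> E') :
  (forall x y, `|f x - f y| <= C * `|x - y|) -> continuous f.
Proof.
move=> lip x; apply/cvgrPdist_le => e e0.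
have C1 : 0 < `|C| + 1 by rewrite ltr_wpDl.
have e1 : 0 < e / (`|C| + 1) by rewrite divr_gt0.
have /cvgrPdist_le/(_ _ e1) := @cvg_id _ (nbhs x); apply: filterS => y xy.
apply: le_trans (lip x y) _; apply: (@le_trans _ _ ((`|C| + 1) * `|x - y|)).
  by rewrite ler_wpM2r//; have := ler_norm C; lra.
by rewrite mulrC -ler_pdivlMr.
Qed.

(** * The integral as a Borel functional on C0 *)

Section integral_functional.
Variable R : realType.
Implicit Types (f h : C0 R).
Let mu := @lebesgue_measure R.

Lemma mass_cvg f : (forall x, 0 <= f x) ->
  (mass n%:R f)%:E @[n --> \oo] --> (\int[mu]_x (f x)%:E)%E.
Proof.
move=> f0.
have E n : (mass n%:R f)%:E = (\int[mu]_(x in `[(- n%:R)%R, n%:R]) (f x)%:E)%E.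
  by rewrite /mass /Rintegral fineK//; apply: integrable_fin_num => //; exact: C0_integrable_segment.
under eq_fun do rewrite E.
have -> : [set: R] = \bigcup_n `[(- n%:R), n%:R]%classic.
  apply/seteqP; split => // x _; exists (Num.truncn `|x|).+1 => //=.
  rewrite in_itv/= -ler_norml; have /andP[_ h] := truncn_itv (normr_ge0 x).
  exact: ltW.
apply: ge0_nondecreasing_set_cvg_integral => //.
- move=> m n mn; apply/subsetPset => x /=; rewrite !in_itv/= => /andP[h1 h2].
  have mnR : m%:R <= n%:R :> R by rewrite ler_nat.
  by apply/andP; split; lra.
- by move=> n; apply/measurable_EFinP; exact: C0_measurable.
- by move=> n x _; rewrite lee_fin.
Qed.

Let pos f : C0 R := C0_max f 0.

Let pos_lip f h : `|pos f - pos h| <= `|f - h|.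
Proof.
apply: C0_norm_leP => x; apply: le_trans (C0_eval_le (f - h) x).
rewrite -[(pos f - pos h) x]/(Num.max (f x) 0 - Num.max (h x) 0) -[(f - h) x]/(f x - h x).
have ab (u v : R) : u <= v -> `|Num.max u 0 - Num.max v 0| <= `|u - v|.
  move=> uv; rewrite !(distrC _ (Num.max v 0)) !(distrC _ v) [leRHS]ger0_norm ?subr_ge0// ler_norml.
  by case: (leP u 0) => u0; case: (leP v 0) => v0; lra.
have [/ab//|/ltW/ab] := leP (f x) (h x).
by rewrite distrC [X in _ <= X -> _]distrC.
Qed.

Lemma measurable_ge0_C0_integral d (T : measurableType d) (X : T -> C0 R) : random_element X ->
  (forall w x, 0 <= X w x) -> measurable_fun [set: T] (fun w => \int[mu]_x (X w x)%:E)%E.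
Proof.
move=> rX X0; apply: (emeasurable_fun_cvg (fun n w => (mass n%:R (X w))%:E)).
  move=> n; apply/measurable_EFinP; apply: (random_element_cont rX).
  exact: (@lip_continuous R (C0 R) R _ _ (fun f h => mass_lip f h (ler0n R n))).
by move=> w _; apply: mass_cvg.
Qed.

(** For nonnegative functions the integral is the limit of the Lipschitz functionals [mass n%:R];
    positive and negative parts give the general case. As a real number it is [fine] of an extended
    integral, hence 0 where the latter is infinite. *)
Lemma measurable_C0_integral d (T : measurableType d) (X : T -> C0 R) : random_element X ->
  measurable_fun [set: T] (fun w => \int[mu]_x X w x).
Proof.
move=> rX; apply: (measurableT_comp (fine_measurable (R:=R) measurableT)).
have rpos (s : R) : random_element (fun w => pos (s *: X w)).
  apply: (@random_element_comp R _ T (C0 R) (C0 R) X (fun f : C0 R => pos (s *: f)) rX).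
  apply: borel_continuous.
  apply: (@lip_continuous _ _ _ `|s|) => f h; apply: le_trans (pos_lip _ _) _.
  by rewrite -scalerBr normrZ.
have pos0 f x : 0 <= pos f x by rewrite /= le_max lexx orbT.
rewrite (_ : (fun w => _) = (fun w => \int[mu]_x (pos (1 *: X w) x)%:E -
    \int[mu]_x (pos (-1 *: X w) x)%:E)%E); last first.
  apply/funext => w; rewrite integralE; congr (_ - _)%E; apply: eq_integral => x _.
    by rewrite funeposE scale1r /= EFin_max.
  by rewrite funenegE scaleN1r /= EFin_max.
by apply: emeasurable_funB; apply: measurable_ge0_C0_integral.
Qed.

Lemma borel_C0_integral (B : set R) : <<s @open R >> B ->
  <<s @open (C0 R) >> ((fun f : C0 R => \int[mu]_x f x) @^-1` B).
Proof.
pose X : g_sigma_algebraType (@open (C0 R)) -> C0 R := id.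
have rX : random_element X by move=> A.
exact: (random_element_real (measurable_C0_integral rX)).
Qed.

Lemma integral_rescale f a b : 0 < b -> 0 <= a -> (forall x, 0 <= f x) ->
  (\int[mu]_x (rescale a b f x)%:E = (a / b)%:E * \int[mu]_x (f x)%:E)%E.
Proof.
move=> b0 a0 f0; pose G (y : R) : R := b * y.
have dG x : derivable G x 1 by apply: derivableZ; exact: derivable_id.
have GE : G^`()%classic = cst b.
  by apply/funext => x; rewrite derive1Ml; [rewrite derive1_id mulr1|exact: derivable_id].
have sub : (\int[mu]_x (f x)%:E = \int[mu]_x (((f \o G) * G^`()%classic) x)%:E)%E.
  apply: (@increasing_ge0_integration_by_substitutionT R G f); last exact: f0.
  - by move=> x y xy; rewrite /G ltr_pM2l.
  - by rewrite GE => x; exact: cvg_cst.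
  - by rewrite GE; exact: is_cvg_cst.
  - by rewrite GE; exact: is_cvg_cst.
  - exact: dG.
  - by apply: gt0_cvgMrNy => //; exact: cvg_id.
  - by apply: gt0_cvgMry => //; exact: cvg_id.
  - exact: C0_cts.
rewrite sub -ge0_integralZl//.
- apply: eq_integral => x _; rewrite rescaleE// -EFinM; congr (_%:E).
  by rewrite -[(_ * _) x]/(f (b * x) * G^`()%classic x) GE /cst; field; rewrite gt_eqF.
- apply/measurable_EFinP; rewrite GE; apply: measurable_funM => //.
  apply: continuous_measurable_fun => x.
  by apply: (@continuous_comp _ _ _ G f); [exact: mulrl_continuous|exact: C0_cts].
- move=> x _; rewrite lee_fin -[(_ * _) x]/(f (b * x) * G^`()%classic x) GE mulr_ge0//; exact: ltW.
- by rewrite lee_fin divr_ge0// ltW.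
Qed.

End integral_functional.

Lemma C0_subE (R : realType) (f h : C0 R) x : (f - h) x = f x - h x.
Proof. by []. Qed.

(** * Local time at 0 and total mass *)

Section local_time_and_mass.
Variables (R : realType) (d : measure_display) (Om : measurableType d).
Variables (Q : probability Om R) (g : Om -> cadlag (C0 R)).
Let mu := @lebesgue_measure R.
Hypothesis levy : levy_process Q (fun s w => g w s).
Hypothesis incr_random : forall r s, 0 <= r -> 0 <= s -> random_element (fun w => g w s - g w r).
Hypothesis ge0 : {ae Q, forall w, forall r s, 0 <= r <= s -> forall x, 0 <= (g w s - g w r) x}.
Hypothesis scaling : forall s, 0 < s ->
  same_law Q (fun w => g w s) (fun w => rescale (s `^ (3 / 2)) (Num.sqrt s)^-1 (g w 1)).
Hypothesis at0 : exists2 c : R, 0 < c & c <= Ex Q (fun w => Num.min 1 `|g w 1 0|).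
Hypothesis mass_bound : exists2 C : R, 0 <= C & forall (s : nat) (A M : R), 0 <= A -> 1 <= M ->
  Ex Q (fun w => Num.min 1 (`|mass A (g w s%:R)| / M ^+ 2)) <= C * s%:R / M.

Let rg s : 0 <= s -> random_element (fun w => g w s).
Proof. exact: levy_random levy s. Qed.

Let aeI (A B : Om -> Prop) : {ae Q, forall w, A w} -> {ae Q, forall w, B w} ->
  {ae Q, forall w, A w /\ B w}.
Proof. by move=> a b; exact: (@filterI _ _ (ae_filter_ringOfSetsType Q)). Qed.

Let aeS (A B : Om -> Prop) : (forall w, A w -> B w) -> {ae Q, forall w, A w} ->
  {ae Q, forall w, B w}.
Proof. by move=> AB; apply: (@filterS _ _ (ae_filter_ringOfSetsType Q)). Qed.

Let increasing : {ae Q, forall w, forall r s, 0 <= r <= s -> forall x, 0 <= g w r x <= g w s x}.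
Proof.
apply: aeS (aeI ge0 (levy0 levy)) => w [H g0] r s /andP[r0 rs] x.
apply/andP; split.
  have := H 0 r; rewrite lexx r0 => /(_ isT x).
  by rewrite C0_subE g0 subr0.
by rewrite -subr_ge0; apply: (H r s _ x); rewrite r0.
Qed.

Lemma subordinator_real (Y : R -> Om -> R) : levy_process Q Y ->
  {ae Q, forall w, forall r s, 0 <= r <= s -> Y r w <= Y s w} -> subordinator Q Y.
Proof.
move=> LY YY; split=> //; apply: aeS YY => w H r s rs.
have : 0 <= Y s w - Y r w by rewrite subr_ge0; exact: H.
exact.
Qed.

Lemma not_null_at0 : ~ {ae Q, forall w, g w 1 0 = 0}.
Proof.
move=> H; have [c c0] := at0; apply/negP; rewrite -ltNge; apply: le_lt_trans c0.
have tphi : tests (fun f : C0 R => Num.min 1 `|f 0|).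
  split=> [f|]; first by rewrite le_min ler01 normr_ge0 ge_min lexx.
  exists 1 => f h; rewrite mul1r; apply: le_trans (minr_lip _ _ _) _.
  by apply: le_trans (ler_dist_dist _ _) _; exact: (C0_eval_le (f - h)).
rewrite (Ex_ae_eq (h := fun=> 0)) ?Ex_cst//.
- exact: (tests_bmeas (rg ler01) tphi).
- exact: bmeas_cst.
by apply: aeS H => w ->; rewrite normr0; apply/min_idPr.
Qed.

Lemma local_time_stable : stable_subordinator Q (2 / 3) (fun s w => g w s 0).
Proof.
have LY : levy_process Q (fun s w => g w s 0).
  have cev := @C0_eval_continuous R 0.
  apply: (@levy_map _ _ _ Q (C0 R) R (fun s w => g w s) (fun s w => g w s 0)
    (fun f : C0 R => f 0) levy incr_random (borel_continuous cev)).
  - by move=> s s0; exact: (@random_element_comp R _ Om (C0 R) R (fun w => g w s) (fun f : C0 R => f 0) (rg s0) (borel_continuous cev)).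
  - by move=> r s r0 s0; exact: (@random_element_comp R _ Om (C0 R) R (fun w => g w s - g w r) (fun f : C0 R => f 0) (incr_random r0 s0) (borel_continuous cev)).
  - by apply: aeS (levy0 levy) => w ->.
  - apply: aeW => w; have /asboolP[[rc lc] _] := cadlagP (g w); split=> t t0.
      exact: (cvg_comp _ _ (rc t t0) (cev _)).
    have /cvg_ex[l gl] := lc t t0; apply/cvg_ex; exists (l 0).
    exact: (cvg_comp _ _ gl (cev _)).
  - exact: aeW.
split.
- by lra.
- apply: subordinator_real LY _; apply: aeS increasing => w H r s rs.
  by have /andP[] := H r s rs 0.
- move=> H; apply: not_null_at0; apply: aeS H => w; exact.
- move=> s s0 B mB.
  have mB' := borel_continuous (@C0_eval_continuous R 0) mB.
  rewrite -[LHS]/(Q ((fun w => g w s) @^-1` ((fun f : C0 R => f 0) @^-1` B))) (scaling s0 mB').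
  rewrite (_ : (2 / 3)^-1 = 3 / 2 :> R); last by field.
  have e w : rescale (s `^ (3 / 2)) (Num.sqrt s)^-1 (g w 1) 0 = s `^ (3 / 2) * g w 1 0.
    by rewrite rescaleE ?invr_gt0 ?sqrtr_gt0// mulr0.
  by have -> : (fun w => s `^ (3 / 2) * g w 1 0) =
    (fun w => rescale (s `^ (3 / 2)) (Num.sqrt s)^-1 (g w 1) 0) by apply/funext => w; rewrite e.
Qed.

Let pos_of w s : (forall r s, 0 <= r <= s -> forall x, 0 <= g w r x <= g w s x) -> 0 <= s ->
  forall x, 0 <= g w s x.
Proof. by move=> H s0 x; have /andP[] := H s s (introT andP (conj s0 (lexx s))) x. Qed.

(** [h k n] is the mass over [[-n, n]] divided by (k + 1)^2 and cut at 1. It increases in n to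
    [H k], of mean at most C s / (k + 1), and [H] decreases in k to a limit of mean 0. Almost surely
    some [H k] is thus below 1, and (k + 1)^2 bounds the masses over all segments. *)
Let integrable_nat (s : nat) :
  {ae Q, forall w, mu.-integrable [set: R] (EFin \o g w s%:R)}.
Proof.
have [C C_ge0 CP] := mass_bound; have s0 : 0 <= s%:R :> R by [].
(* Taking absolute values makes the masses monotone in [n] for every [w]; almost surely nothing
   changes, by positivity. *)
pose av (f : C0 R) : C0 R := C0_max f (- f).
have avE f x : av f x = `|f x|.
  rewrite (_ : av f x = Num.max (f x) (- f x))//.
  by case: (ger0P (f x)) => h; [apply/max_idPl|apply/max_idPr]; lra.
have av_lip f h : `|av f - av h| <= `|f - h|.
  apply: C0_norm_leP => x; apply: le_trans (C0_eval_le (f - h) x).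
  by rewrite !C0_subE !avE; exact: ler_dist_dist.
pose z n w := mass n%:R (av (g w s%:R)).
have zlip n f h : `|mass n%:R (av f) - mass n%:R (av h)| <= 2 * n%:R * `|f - h|.
  by apply: le_trans (mass_lip _ _ _) _ => //; rewrite ler_wpM2l.
have z0 n w : 0 <= z n w by apply: Rintegral_ge0 => x _; rewrite avE.
have zmono w : nondecreasing_seq (z ^~ w).
  move=> m n mn; rewrite /z /mass /Rintegral fine_le//.
  - by apply: integrable_fin_num => //; exact: C0_integrable_segment.
  - by apply: integrable_fin_num => //; exact: C0_integrable_segment.
  have mnR : m%:R <= n%:R :> R by rewrite ler_nat.
  apply: ge0_subset_integral => //.
  - by apply/measurable_EFinP; exact: C0_measurable.
  - by move=> x _; rewrite lee_fin avE.
  - by move=> x /=; rewrite !in_itv/= => /andP[h1 h2]; apply/andP; split; lra.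
pose h (k n : nat) w := Num.min 1 (z n w / k.+1%:R ^+ 2).
have k2 k : 0 < k.+1%:R ^+ 2 :> R by rewrite exprn_gt0.
have h01 k n w : 0 <= h k n w <= 1.
  by rewrite /h ge_min lexx le_min ler01 divr_ge0// ltW.
have bh k n : bmeas (h k n).
  apply: (tests_bmeas (phi := fun f => Num.min 1 (mass n%:R (av f) / k.+1%:R ^+ 2)) (rg s0)).
  split=> [f|].
    rewrite ge_min lexx le_min ler01 divr_ge0 ?(ltW (k2 k))//.
    by apply: Rintegral_ge0 => x _; rewrite avE.
  exists (2 * n%:R / k.+1%:R ^+ 2) => f f'; apply: le_trans (minr_lip _ _ _) _.
  rewrite -mulrBl normrM (gtr0_norm (x := (k.+1%:R ^+ 2)^-1)) ?invr_gt0// mulrAC.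
  by rewrite ler_wpM2r ?invr_ge0 ?(ltW (k2 k)).
have Eh k n : Ex Q (h k n) <= C * s%:R / k.+1%:R.
  have k1 : 1 <= k.+1%:R :> R by rewrite ler1n.
  apply: le_trans (CP s n%:R k.+1%:R (ler0n _ _) k1).
  rewrite le_eqVlt; apply/orP; left; apply/eqP; apply: Ex_ae_eq => //.
    apply: (tests_bmeas (phi := fun f => Num.min 1 (`|mass n%:R f| / k.+1%:R ^+ 2)) (rg s0)).
    split=> [f|]; first by rewrite ge_min lexx le_min ler01 divr_ge0 ?(ltW (k2 k)).
    exists (2 * n%:R / k.+1%:R ^+ 2) => f f'; apply: le_trans (minr_lip _ _ _) _.
    rewrite -mulrBl normrM (gtr0_norm (x := (k.+1%:R ^+ 2)^-1)) ?invr_gt0// mulrAC.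
    rewrite ler_wpM2r ?invr_ge0 ?(ltW (k2 k))//; apply: le_trans (ler_dist_dist _ _) _.
    exact: mass_lip.
  apply: aeS increasing => w H; rewrite /h /z; congr (Num.min _ (_ / _)).
  have gp := pos_of H s0.
  have -> : av (g w s%:R) = g w s%:R by apply: C0_eq => x; rewrite avE ger0_norm.
  by rewrite ger0_norm//; apply: Rintegral_ge0 => x _.
pose H k w := lim (h k n w @[n --> \oo]).
have h_nd k w : nondecreasing_seq (h k ^~ w).
  move=> m n mn; rewrite /h le_min ge_min lexx /= ge_min; apply/orP; right.
  by rewrite ler_wpM2r ?invr_ge0 ?(ltW (k2 k))//; exact: zmono.
have h_cvg k w : h k n w @[n --> \oo] --> H k w.
  apply: nondecreasing_is_cvgn => //.
  by exists 1 => _ [n _ <-]; have /andP[] := h01 k n w.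
have hH k n w : h k n w <= H k w.
  by apply: (nondecreasing_cvgn_le (h_nd k w)); apply: cvgP (h_cvg k w).
have H01 k w : 0 <= H k w <= 1.
  apply/andP; split; first by apply: le_trans (hH k 0%N w); have /andP[] := h01 k 0%N w.
  by apply: (cvgr_to_le (h_cvg k w)); apply: nearW => n; have /andP[] := h01 k n w.
have abs1 (x : R) : 0 <= x <= 1 -> `|x| <= 1 by move=> /andP[? ?]; rewrite ger0_norm.
have bH k : bmeas (H k) /\ Ex Q (H k) <= C * s%:R / k.+1%:R.
  have [b c] := Ex_cvg Q (f_ := h k) (M := 1) (fun n => (bh k n).1)
    (fun n w => abs1 _ (h01 k n w)) (h_cvg k).
  split=> //; apply: (cvgr_to_le c); apply: nearW => n; exact: Eh.
pose Z w := lim (H k w @[k --> \oo]).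
have H_ni w : nonincreasing_seq (H ^~ w).
  move=> k l kl; apply: (cvgr_to_le (h_cvg l w)); apply: nearW => n.
  apply: le_trans (hH k n w); rewrite /h le_min ge_min lexx /= ge_min; apply/orP; right.
  rewrite ler_wpM2l// lef_pV2 ?posrE// ler_pXn2r ?nnegrE// ler_nat; exact: kl.
have H_cvg w : H k w @[k --> \oo] --> Z w.
  apply: nonincreasing_is_cvgn => //.
  by exists 0 => _ [k _ <-]; have /andP[] := H01 k w.
have [bZ cZ] := Ex_cvg Q (f_ := H) (M := 1) (fun k => (bH k).1.1)
    (fun k w => abs1 _ (H01 k w)) H_cvg.
have Z0 w : 0 <= Z w.
  by apply: (cvgr_to_ge (H_cvg w)); apply: nearW => k; have /andP[] := H01 k w.
have EZ : Ex Q Z = 0.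
  apply/eqP; rewrite eq_le Ex_ge0// andbT.
  have c0 : C * s%:R / k.+1%:R @[k --> \oo] --> (0 : R).
    by rewrite -[X in _ --> X](mulr0 (C * s%:R)); apply: cvgMr; exact: cvg_harmonic.
  by apply: (ler_cvg_to cZ c0); apply: nearW => k; exact: (bH k).2.
have := Ex_eq0 bZ Z0 EZ; apply: aeS => w Zw.
have [k Hk] : exists k, H k w < 1.
  apply: contrapT => nH; have : 1 <= Z w.
    apply: (cvgr_to_ge (H_cvg w)); apply: nearW => k; rewrite leNgt; apply/negP => h'.
    by apply: nH; exists k.
  by rewrite Zw; lra.
have zk n : z n w <= k.+1%:R ^+ 2.
  have : h k n w < 1 by exact: le_lt_trans (hH k n w) Hk.
  by rewrite /h gt_min ltxx /= ltr_pdivrMr// mul1r => /ltW.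
have av0 x : 0 <= av (g w s%:R) x by rewrite avE.
apply/integrableP; split; first by apply/measurable_EFinP; exact: C0_measurable.
rewrite (_ : (\int[mu]_x _)%E = (\int[mu]_x (av (g w s%:R) x)%:E)%E); last first.
  by apply: eq_integral => x _; rewrite avE.
apply: (@le_lt_trans _ _ (k.+1%:R ^+ 2)%:E); last exact: ltry.
apply: (cvge_to_le (mass_cvg av0)); apply: nearW => n.
by rewrite lee_fin; exact: zk.
Qed.

Let good (w : Om) : Prop :=
  (forall r s, 0 <= r <= s -> forall x, 0 <= g w r x <= g w s x) /\
  (forall s, 0 <= s -> mu.-integrable [set: R] (EFin \o g w s)).

Lemma good_ae : {ae Q, forall w, good w}.
Proof.
have all_nat : {ae Q, forall w, forall n : nat, mu.-integrable [set: R] (EFin \o g w n%:R)}.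
  by apply: ae_foralln => n; exact: integrable_nat.
apply: aeS (aeI increasing all_nat) => w [H I]; split=> // s s0.
pose n := (Num.truncn s).+1.
have sn : s <= n%:R by have /andP[_ /ltW] := truncn_itv s0.
apply: le_integrable (I n) => //.
  by apply/measurable_EFinP; exact: C0_measurable.
move=> x _ /=; have /andP[a1 a2] := H s n%:R (introT andP (conj s0 sn)) x.
by rewrite lee_fin !ger0_norm//; exact: le_trans a2.
Qed.

Lemma integrable_ae : {ae Q, forall w, forall s, 0 <= s ->
  mu.-integrable [set: R] (EFin \o g w s)}.
Proof. by apply: aeS good_ae => w []. Qed.

Let Y s w := \int[mu]_x g w s x.

Let Y_mono w r s : good w -> 0 <= r <= s -> Y r w <= Y s w.
Proof.
move=> [H I] rs; have /andP[r0 rs'] := rs; have s0 : 0 <= s by exact: le_trans rs'.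
by apply: le_Rintegral; [|exact: I|exact: I|move=> x _; have /andP[] := H r s rs x].
Qed.

Let Y_incr w r s : good w -> 0 <= r <= s -> Y s w - Y r w = \int[mu]_x (g w s - g w r) x.
Proof.
move=> [H I] rs; have /andP[r0 rs'] := rs; have s0 : 0 <= s by exact: le_trans rs'.
by rewrite /Y -RintegralB//; exact: I.
Qed.

(** Dominated convergence along the times [t + n.+1%:R^-1], with the density at time [t + 1] as
    dominating function; monotonicity in time fills the gaps. *)
Let Y_right w t : good w -> 0 <= t -> Y u w @[u --> t^'+] --> Y t w.
Proof.
move=> gw t0; have [H I] := gw; apply/cvgrPdist_le => e e0.
have n0 n : 0 < n.+1%:R^-1 :> R by rewrite invr_gt0.
have tn n : 0 <= t + n.+1%:R^-1 by rewrite addr_ge0// ltW.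
have gt x : g w (t + n.+1%:R^-1) x @[n --> \oo] --> g w t x.
  have gE : g w (t + n.+1%:R^-1) @[n --> \oo] --> g w t; last first.
    exact: (cvg_comp _ _ gE (@C0_eval_continuous R x (g w t))).
  apply/cvgrPdist_lt => e' e'0; have [dl dl0 Hd] := cadlag_right (g w) t0 e'0.
  have /cvgr0Pnorm_lt/(_ _ dl0) := @cvg_harmonic R; apply: filterS => n.
  rewrite ger0_norm ?(ltW (n0 n))// => h; rewrite distrC; apply: Hd.
  by rewrite lerDl ltW//= ltrD2l.
have c : Y (t + n.+1%:R^-1) w @[n --> \oo] --> Y t w.
  have t1 : 0 <= t + 1 by rewrite addr_ge0.
  apply: fine_cvg; rewrite fineK; last by apply: integrable_fin_num => //; exact: I.
  apply: (@dominated_cvg _ _ _ mu setT measurableT (fun n x => (g w (t + n.+1%:R^-1) x)%:E)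
    (fun x => (g w t x)%:E) (fun x => (g w (t + 1) x)%:E)) => //.
  - by move=> n; apply/measurable_EFinP; exact: C0_measurable.
  - by move=> x _; apply: cvg_EFin; [exact: nearW|exact: gt].
  - exact: I.
  - move=> n x _ /=; have h : 0 <= t + n.+1%:R^-1 <= t + 1.
      by rewrite tn lerD2l invf_le1 ?ler1n.
    by have /andP[a1 a2] := H _ _ h x; rewrite lee_fin ger0_norm.
have /cvgrPdist_le/(_ _ e0)[n _ /(_ n (leqnn n))] := c.
have tt : 0 <= t <= t + n.+1%:R^-1 by rewrite t0 lerDl ltW.
move=> /= h; near=> u.
have tu : t < u by near: u; exact: nbhs_right_gt.
have un : u < t + n.+1%:R^-1 by near: u; apply: nbhs_right_lt; rewrite ltrDl.
have h1 : 0 <= t <= u by rewrite t0 ltW.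
have h2 : 0 <= u <= t + n.+1%:R^-1 by rewrite (le_trans t0) ltW.
move: (Y_mono gw h1) (Y_mono gw h2) (Y_mono gw tt) h.
by rewrite !ler_norml; lra.
Unshelve. all: by end_near. Qed.

Let Y_left w t : good w -> 0 < t -> cvg (Y u w @[u --> t^'-]).
Proof.
move=> gw t0; apply: nondecreasing_at_left_is_cvgr.
  near=> x; have x0 : 0 <= x by near: x; exact: nbhs_left_ge.
  move=> u v; rewrite !in_itv/= => /andP[xu _] /andP[xv _] uv; apply: Y_mono => //.
  by rewrite uv (le_trans x0)// ltW.
near=> x; have x0 : 0 <= x by near: x; exact: nbhs_left_ge.
exists (Y t w) => _ [u /= /[!in_itv]/= /andP[xu ut] <-]; apply: Y_mono => //.
by rewrite (ltW ut) (le_trans x0)// ltW.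
Unshelve. all: by end_near. Qed.

Let mY s : 0 <= s -> measurable_fun [set: Om] (Y s).
Proof. by move=> s0; exact: measurable_C0_integral (rg s0). Qed.

Let Y_levy : levy_process Q Y.
Proof.
apply: (@levy_map _ _ _ Q (C0 R) R (fun s w => g w s) Y
    (fun f : C0 R => \int[mu]_x f x) levy incr_random (@borel_C0_integral R)).
- by move=> s s0; apply: random_element_real; exact: mY.
- by move=> r s r0 s0; apply: random_element_real; apply: measurable_funB; exact: mY.
- apply: aeS (levy0 levy) => w g0; rewrite /Y g0.
  exact: (congr1 fine (integral0 mu setT)).
- apply: aeS good_ae => w gw; split=> t t0; [exact: Y_right|exact: Y_left].
- by apply: aeS good_ae => w gw r s rs; exact: Y_incr.
Qed.

Lemma integral_gt0 (f : C0 R) : (forall x, 0 <= f x) -> 0 < f 0 ->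
  (0 < \int[mu]_x (f x)%:E)%E.
Proof.
move=> f0 fp; have f2 : 0 < f 0 / 2 by rewrite divr_gt0.
have /cvgrPdist_lt/(_ _ f2) := @C0_cts R f 0.
move=> /nbhs_ballP[e /= e0 He].
have e2 : 0 < e / 2 by rewrite divr_gt0.
apply: (@lt_le_trans _ _ (\int[mu]_(x in `[(- (e / 2))%R, (e / 2)%R]) (f 0 / 2)%:E)%E).
  rewrite integral_cst// mule_gt0// ?lte_fin//.
  apply: (@lt_le_trans _ _ (e / 2)%:E); first by rewrite lte_fin.
  rewrite [leRHS](lebesgue_measure_itv `[(- (e / 2)), (e / 2)]) /= lte_fin.
  by rewrite ifT; [rewrite lee_fin; lra|lra].
apply: (@le_trans _ _ (\int[mu]_(x in `[(- (e / 2))%R, (e / 2)%R]) (f x)%:E)%E).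
  apply: ge0_le_integral => //.
  - by move=> x _; rewrite lee_fin ltW.
  - by apply/measurable_EFinP; exact: C0_measurable.
  move=> x /=; rewrite in_itv/= => /andP[x1 x2]; rewrite lee_fin.
  have : `|f 0 - f x| < f 0 / 2.
    by apply: He; rewrite -ball_normE /= sub0r normrN ltr_norml; lra.
  by rewrite ltr_norml; lra.
apply: ge0_subset_integral => //.
- by apply/measurable_EFinP; exact: C0_measurable.
- by move=> x _; rewrite lee_fin.
Qed.

Lemma total_mass_stable : stable_subordinator Q (1 / 2) (fun s w => \int[mu]_x g w s x).
Proof.
split.
- by lra.
- by apply: subordinator_real Y_levy _; apply: aeS good_ae => w gw r s rs; exact: Y_mono.
(* If the mass at time 1 is 0, continuity and nonnegativity force the density to vanish at 0. *)
- move=> H; apply: not_null_at0; apply: aeS (aeI H good_ae) => w [YZ [mono I]].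
  have pos1 := pos_of mono ler01.
  apply/eqP; rewrite eq_le pos1 andbT leNgt; apply/negP => /(integral_gt0 pos1).
  have := YZ 1 ler01; rewrite /Rintegral.
  have fin : (\int[mu]_x (g w 1 x)%:E)%E \is a fin_num by apply: integrable_fin_num => //; exact: I ler01.
  by move=> YE; rewrite -(fineK fin) YE ltxx.
- move=> s s0 B mB; have mB' := borel_C0_integral mB.
  rewrite -[LHS]/(Q ((fun w => g w s) @^-1` ((fun f : C0 R => \int[mu]_x f x) @^-1` B))) (scaling s0 mB').
  rewrite (_ : (1 / 2)^-1 = 2 :> R); last by field.
  have rr : random_element (fun w => rescale (s `^ (3 / 2)) (Num.sqrt s)^-1 (g w 1)).
    apply: (@random_element_comp R _ Om (C0 R) (C0 R) (fun w => g w 1)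
      (rescale (s `^ (3 / 2)) (Num.sqrt s)^-1) (rg ler01)).
    apply: borel_continuous.
    apply: (@lip_continuous _ _ _ `|s `^ (3 / 2)|) => f h.
    by rewrite -rescaleB; exact: rescale_norm.
  apply: ae_eq_prob.
  + exact: rr.
  + rewrite -[X in measurable X]setTI; apply: measurable_funM => //; first exact: mY.
    exact: (@random_element_real R _ (measurableTypeR R) id (@measurable_id _ _ setT) B mB).
  apply: aeS good_ae => w [mono I] /=.
  suff -> : \int[mu]_x rescale (s `^ (3 / 2)) (Num.sqrt s)^-1 (g w 1) x =
    s `^ 2 * \int[mu]_x g w 1 x by [].
  have fin : (\int[mu]_x (g w 1 x)%:E)%E \is a fin_num by apply: integrable_fin_num => //; exact: I ler01.
  (* Stretching space by sqrt s multiplies the integral by sqrt s, and 3/2 + 1/2 = 2 is the inverse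
     of the exponent 1/2. *)
  rewrite /Rintegral integral_rescale ?invr_gt0 ?sqrtr_gt0 ?powR_ge0//; last exact: pos_of ler01.
  rewrite invrK -(fineK fin) -EFinM /=; congr (_ * _).
  rewrite -powR12_sqrt ?(ltW s0)// -powRD; last by rewrite gt_eqF ?implybT.
  by congr (_ `^ _); field.
Qed.

End local_time_and_mass.

(** * Jumps *)

Section cadlag_jumps.
Variables (R : realType) (E : normedModType R) (x : R -> E).
Hypothesis cx : is_cadlag x.

Definition jump u : E := x u - lim (x v @[v --> u^'-]).

Lemma left_limit u : 0 < u -> x v @[v --> u^'-] --> lim (x v @[v --> u^'-]).
Proof. exact: cx.2. Qed.

Lemma cadlag_near_right t e : 0 <= t -> 0 < e -> exists2 dl : R, 0 < dl &
  forall v, t <= v -> v < t + dl -> `|x t - x v| < e.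
Proof.
move=> t0 e0; have /cvgrPdist_lt/(_ _ e0) := cx.1 t t0.
move=> /nbhs_ballP[dl /= dl0 H]; exists dl => // v.
rewrite le_eqVlt => /predU1P[<-|tv] vt; first by rewrite subrr normr0.
by apply: H => //; rewrite /ball/= distrC ger0_norm; lra.
Qed.

Lemma cadlag_near_left t e : 0 < t -> 0 < e -> exists2 dl : R, 0 < dl &
  forall v, t - dl < v -> v < t -> `|lim (x v @[v --> t^'-]) - x v| < e.
Proof.
move=> t0 e0; have /cvgrPdist_lt/(_ _ e0) := left_limit t0.
move=> /nbhs_ballP[dl /= dl0 H]; exists dl => // v vt tv.
by apply: H => //; rewrite /ball/= ger0_norm; lra.
Qed.

(** Times on the same side of [t] have close values, by the limits from the right and from the left;
    [t] itself counts as being on the right. *)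
Lemma cadlag_local t a : 0 <= t -> 0 < a -> exists2 dl : R, 0 < dl &
  forall u v, 0 <= u -> t - dl < u -> u <= v -> v < t + dl -> ~~ (u < t <= v) ->
    `|x v - x u| <= a.
Proof.
move=> t0 a0; have a2 : 0 < a / 2 by rewrite divr_gt0.
have [d1 d10 H1] := cadlag_near_right t0 a2.
have [d2 d20 H2] : exists2 d2, 0 < d2 & forall u v, 0 <= u -> t - d2 < u -> u <= v -> v < t ->
    `|x v - x u| <= a.
  have [t00|t_gt0] := leP t 0.
    by exists 1 => // u v u0 _ uv vt; move: (le_lt_trans u0 (le_lt_trans uv vt)); rewrite ltNge t00.
  have [d2 d20 H2] := cadlag_near_left t_gt0 a2; exists d2 => // u v _ ut uv vt.
  have h1 := H2 u ut (le_lt_trans uv vt); have h2 := H2 v (lt_le_trans ut uv) vt.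
  rewrite -(subrKA (lim (x v @[v --> t^'-]))); apply: le_trans (ler_normD _ _) _.
  by rewrite [a]splitr; apply: lerD; [rewrite distrC|]; exact: ltW.
exists (Num.min d1 d2); first by rewrite lt_min d10.
move=> u v u0 tu uv vt; rewrite negb_and -leNgt -ltNge => /orP[ut|vt'].
  have vt1 : v < t + d1 by apply: lt_le_trans vt _; rewrite lerD2l ge_min lexx.
  have h1 := H1 v (le_trans ut uv) vt1; have h2 := H1 u ut (le_lt_trans uv vt1).
  rewrite -(subrKA (x t)); apply: le_trans (ler_normD _ _) _.
  by rewrite [a]splitr; apply: lerD; [rewrite distrC|]; exact: ltW.
apply: H2 => //; apply: le_lt_trans tu; rewrite lerD2l lerN2 ge_min lexx orbT //.
Qed.

Lemma eventually_all (C : seq R) (P : R -> R -> Prop) :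
  (forall c, c \in C -> exists2 dl : R, 0 < dl & forall h, 0 < h < dl -> P c h) ->
  exists2 dl : R, 0 < dl & forall c h, c \in C -> 0 < h < dl -> P c h.
Proof.
elim: C => [|c C ih] H; first by exists 1.
have [d1 d10 H1] := H c (mem_head _ _).
have [d2 d20 H2] := ih (fun c' cC => H c' (mem_behead (s := c :: C) cC)).
exists (Num.min d1 d2); first by rewrite lt_min d10.
move=> c' h; rewrite inE lt_min => /predU1P[->|cC] /and3P[h0 hd1 hd2].
  by apply: H1; rewrite h0.
by apply: H2 => //; rewrite h0.
Qed.

(** Compactness of [[0, T]] leaves finitely many centres: an increment over a short interval can
    exceed [a] only by crossing one of them. *)
Lemma cadlag_cover (T a : R) : 0 < a -> exists C : seq R, [/\ uniq C,
  (forall c, c \in C -> 0 < c <= T) &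
  exists2 h : R, 0 < h & forall u v, 0 <= u -> u <= v -> v <= T -> v < u + h ->
    (forall c, c \in C -> ~~ (u < c <= v)) -> `|x v - x u| <= a].
Proof.
move=> a0.
have /choice[dl dlP] : forall t, exists dl, 0 < dl /\ (0 <= t ->
    forall u v, 0 <= u -> t - dl < u -> u <= v -> v < t + dl -> ~~ (u < t <= v) ->
    `|x v - x u| <= a).
  move=> t; have [t0|t0] := leP 0 t; last by exists 1; split=> //; rewrite leNgt t0.
  by have [dl dl0 H] := cadlag_local t0 a0; exists dl.
have dl0 t := (dlP t).1.
have := @segment_compact R 0 T; rewrite compact_cover => /(_ R `[0, T]%classic
  (fun t => ball t (dl t / 2))) [].
- by move=> t _; apply: ball_open; rewrite divr_gt0.
- by move=> t t0T; exists t => //; apply: ballxx; rewrite divr_gt0.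
move=> D DT Dcover.
have [h h0 H] := @eventually_all D (fun c h => h < dl c / 2) (fun c _ =>
  ex_intro2 _ _ (dl c / 2) (divr_gt0 (dl0 c) (ltr0n _ 2)) (fun h hh => (andP hh).2)).
(* The centre 0 may be dropped, as an interval []u, v]] with [0 <= u] never contains it. *)
exists [seq c <- D | 0 < c <= T]; split.
- exact/filter_uniq/fset_uniq.
- by move=> c; rewrite mem_filter => /andP[].
have h2 : 0 < h / 2 by rewrite divr_gt0.
exists (h / 2) => // u v u0 uv vT vu noC.
have : `[0, T]%classic u by rewrite /= in_itv/= u0 (le_trans uv).
move=> /Dcover[c /= cD]; rewrite /ball/= => uc.
have /set_mem := DT _ cD; rewrite /= in_itv/= => /andP[c0 cT].
have hc : h / 2 < dl c / 2 by apply: H => //; rewrite h2 gtr_pMr//; lra.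
move: uc; rewrite ltr_norml => /andP[uc1 uc2].
have dc := dl0 c.
apply: ((dlP c).2 c0) => //; try lra.
apply/negP => /andP[uc cv].
have := noC c; rewrite mem_filter cD uc cv (le_lt_trans u0 uc) (le_trans cv vT).
by move=> /(_ isT).
Qed.

Definition grid_incr (n k : nat) : E := x (k.+1%:R / n%:R) - x (k%:R / n%:R).

Definition small_sum (n T : nat) (a : R) : R :=
  \sum_(k < T * n) if `|grid_incr n k| <= a then `|grid_incr n k| else 0.

(** Cells are open on the left and closed on the right, so the increment over the cell of [c] tends
    to the value at [c] minus the left limit, even when [c] is a grid point. *)
Definition in_cell (n k : nat) (c : R) : bool := k%:R / n%:R < c <= k.+1%:R / n%:R.

Lemma cell_exists n c : (0 < n)%N -> 0 < c -> exists k, in_cell n k c.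
Proof.
move=> n0 c0; have nR : 0 < n%:R :> R by rewrite ltr0n.
have cn : 0 < c * n%:R by rewrite mulr_gt0.
have /andP[tl tr] := truncn_itv (ltW cn).
suff [k kP] : exists k : nat, k%:R < c * n%:R <= k.+1%:R.
  by exists k; rewrite /in_cell ltr_pdivrMr// ler_pdivlMr.
move: tl; rewrite le_eqVlt => /predU1P[tE|tl]; last first.
  by exists (Num.truncn (c * n%:R)); rewrite tl ltW.
case: (Num.truncn _) tE => [tE|k tE]; first by rewrite -tE ltxx in cn.
by exists k; rewrite -tE ltr_nat ltnSn lexx.
Qed.

Lemma cell_uniq n k k' c : (0 < n)%N -> in_cell n k c -> in_cell n k' c -> k = k'.
Proof.
move=> n0; have nR : 0 < n%:R :> R by rewrite ltr0n.
rewrite /in_cell !ltr_pdivrMr// !ler_pdivlMr// => /andP[a1 a2] /andP[b1 b2].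
have := lt_le_trans a1 b2; have := lt_le_trans b1 a2; rewrite !ltr_nat; lia.
Qed.

Lemma grid_incr_jump c e : 0 < c -> 0 < e -> exists2 dl : R, 0 < dl &
  forall n k, (0 < n)%N -> n%:R^-1 < dl -> in_cell n k c -> `|grid_incr n k - jump c| <= e.
Proof.
move=> c0 e0; have e2 : 0 < e / 2 by rewrite divr_gt0.
have [d1 d10 H1] := cadlag_near_right (ltW c0) e2.
have [d2 d20 H2] := cadlag_near_left c0 e2.
exists (Num.min d1 d2); first by rewrite lt_min d10.
move=> n k n0; rewrite lt_min => /andP[nd1 nd2] /andP[kc ck].
have nR : 0 < n%:R :> R by rewrite ltr0n.
have kS : k.+1%:R / n%:R = k%:R / n%:R + n%:R^-1 :> R by rewrite -natr1 mulrDl mul1r.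
have h1 : `|x c - x (k.+1%:R / n%:R)| < e / 2 by apply: H1 => //; rewrite kS; lra.
have h2 : `|lim (x v @[v --> c^'-]) - x (k%:R / n%:R)| < e / 2.
  by apply: H2 => //; move: ck; rewrite kS; lra.
rewrite /grid_incr /jump; set l := lim _ in h2 *.
rewrite (_ : _ - _ - _ = (l - x (k%:R / n%:R)) - (x c - x (k.+1%:R / n%:R))); last first.
  by rewrite !opprB addrC addrACA [in RHS]addrACA; congr (_ + _); rewrite addrC.
by apply: le_trans (ler_normB _ _) _; rewrite [e]splitr lerD// ltW.
Qed.

Lemma sum_cells (V : zmodType) n T (C : seq R) (F : nat -> R -> V) : (0 < n)%N ->
  (forall c, c \in C -> 0 < c <= T%:R) ->
  exists k : R -> nat, (forall c, c \in C -> in_cell n (k c) c) /\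
  \sum_(i < T * n) \sum_(c <- C | in_cell n i c) F i c = \sum_(c <- C) F (k c) c.
Proof.
move=> n0 CT.
have /choice[k kP] : forall c, exists k, c \in C -> in_cell n k c.
  move=> c; have [cC|] := boolP (c \in C); last by exists 0%N.
  by have /andP[c0 _] := CT c cC; have [k ?] := cell_exists n0 c0; exists k.
exists k; split=> //.
under eq_bigr do rewrite big_mkcond.
rewrite exchange_big/= big_seq [RHS]big_seq; apply: eq_bigr => c cC.
have nR : 0 < n%:R :> R by rewrite ltr0n.
have kc : (k c < T * n)%N.
  have /andP[h _] := kP c cC; have /andP[_ cT] := CT c cC.
  by rewrite -(ltr_nat R) natrM -ltr_pdivrMr//; exact: lt_le_trans cT.
rewrite (bigD1 (Ordinal kc))//= kP// big1 ?addr0// => i ik.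
case: ifP => // ic; have := cell_uniq n0 ic (kP c cC) => /= ikc.
by move/eqP: ik; case; exact/val_inj.
Qed.

(* The increments over the cells that contain a large jump converge to the jumps; eventually all the
   others have norm at most a, hence enter small_sum. *)
Lemma jump_approx (T : nat) (a eta : R) : 0 < a ->
  (forall dl : R, 0 < dl -> exists n : nat, [/\ (0 < n)%N, n%:R^-1 < dl & small_sum n T a <= eta]) ->
  forall e, 0 < e -> exists C : seq R, [/\ uniq C, (forall c, c \in C -> 0 < c <= T%:R) &
    `|x T%:R - x 0 - \sum_(c <- C) jump c| <= eta + e].
Proof.
move=> a0 freq e e0; have [C [uC CT [h h0 Hh]]] := cadlag_cover T%:R a0.
exists C; split=> //.
pose e' := e / (size C).+1%:R; have e'0 : 0 < e' by rewrite divr_gt0.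
have [d1 d10 H1] : exists2 dl : R, 0 < dl & forall c h, c \in C -> 0 < h < dl ->
    forall n k, (0 < n)%N -> n%:R^-1 = h -> in_cell n k c -> `|grid_incr n k - jump c| <= e'.
  apply: eventually_all => c cC; have /andP[c0 _] := CT c cC.
  have [dl dl0 H] := grid_incr_jump c0 e'0; exists dl => // h' /andP[_ hd] n k n0 nh.
  by apply: H => //; rewrite nh.
(* Cells shorter than the gaps between the points of [C] contain at most one of them. *)
have [d2 d20 H2] : exists2 dl : R, 0 < dl & forall c h, c \in C -> 0 < h < dl ->
    forall c', c' \in C -> c != c' -> h < `|c - c'|.
  apply: eventually_all => c cC.
  have [dl dl0 H] : exists2 dl : R, 0 < dl & forall c' h, c' \in C -> 0 < h < dl ->
      c != c' -> h < `|c - c'|.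
    apply: eventually_all => c' c'C; have [->|cc'] := eqVneq c c'; first by exists 1.
    by exists `|c - c'|; [rewrite normr_gt0 subr_eq0|move=> h' /andP[]].
  by exists dl => // h' hh c' c'C; exact: H.
have [n [n0 nd Sn]] : exists n : nat, [/\ (0 < n)%N, n%:R^-1 < Num.min h (Num.min d1 d2) &
    small_sum n T a <= eta].
  by apply: freq; rewrite !lt_min h0 d10.
move: nd; rewrite !lt_min => /and3P[nh nd1 nd2].
have nR : 0 < n%:R :> R by rewrite ltr0n.
have ni : 0 < n%:R^-1 :> R by rewrite invr_gt0.
have [k [kP kE]] := sum_cells (fun _ => jump) n0 CT.
have [k' [kP' kE']] := sum_cells (fun i c => `|grid_incr n i - jump c|) n0 CT.
have tele : x T%:R - x 0 = \sum_(i < T * n) grid_incr n i.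
  rewrite -(big_mkord xpredT (grid_incr n)) /grid_incr (telescope_sumr (fun i => x (i%:R / n%:R)))//.
  by rewrite mul0r natrM mulfK// gt_eqF.
rewrite tele -kE -sumrB; apply: le_trans (ler_norm_sum _ _ _) _.
apply: (@le_trans _ _ (small_sum n T a + \sum_(c <- C) `|grid_incr n (k' c) - jump c|)); last first.
  apply: lerD => //; apply: (@le_trans _ _ (\sum_(c <- C) e')).
    rewrite big_seq [leRHS]big_seq; apply: ler_sum => c cC.
    by apply: (H1 c n%:R^-1) => //; [rewrite ni|exact: kP'].
  rewrite big_const_seq count_predT iter_addr addr0 -mulr_natr /e' mulrAC.
  by rewrite ler_pdivrMr// ler_wpM2l ?(ltW e0)// ler_nat.
rewrite -kE' /small_sum -big_split/=; apply: ler_sum => i _.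
have [/hasP[c cC ic]|/hasPn noC] := boolP (has (in_cell n i) C).
  have one (V : zmodType) (F : R -> V) : \sum_(c <- C | in_cell n i c) F c = F c.
    rewrite big_mkcond (bigD1_seq c cC uC)//= ic big1_seq ?addr0// => c' /andP[cc' c'C].
    case: ifP => // ic'.
    have : n%:R^-1 < `|c - c'|.
      by apply: H2 => //; [rewrite ni|rewrite eq_sym].
    move: ic ic'; rewrite /in_cell -natr1 mulrDl mul1r => /andP[c1 c2] /andP[c3 c4].
    by rewrite ltNge ler_norml; case/negP; apply/andP; split; lra.
  by rewrite !one lerDr; case: ifP.
have no (V : zmodType) (F : R -> V) : \sum_(c <- C | in_cell n i c) F c = 0.
  by rewrite big1_seq// => c /andP[ic cC]; move: (noC c cC); rewrite ic.
rewrite !no subr0 addr0 ifT//.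
have iT : (i < T * n)%N by [].
apply: Hh.
- by rewrite divr_ge0.
- by rewrite ler_pM2r ?invr_gt0// ler_nat.
- by rewrite ler_pdivrMr// -natrM ler_nat.
- by rewrite -natr1 mulrDl mul1r ltrD2l.
- by move=> c cC; exact: noC.
Qed.

End cadlag_jumps.

(** * Increasing paths that are sums of their jumps *)

Section increasing_path.
Variables (R : realType) (x : R -> C0 R).
Hypotheses (cx : is_cadlag x) (x0 : x 0 = 0).
Hypothesis incr : forall r s, 0 <= r <= s -> C0_cone (x s - x r).

Lemma cone_left_limit s u : 0 <= s -> s < u -> C0_cone (lim (x v @[v --> u^'-]) - x s).
Proof.
move=> s0 su y; have u0 : 0 < u by exact: le_lt_trans su.
have c := cvg_comp _ _ (left_limit cx u0) (@C0_eval_continuous R y _).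
rewrite C0_subE subr_ge0; apply: cvgr_to_ge c _.
near=> v; rewrite /= -subr_ge0 -C0_subE; apply: incr; apply/andP; split => //.
by near: v; exact: nbhs_left_ge.
Unshelve. all: by end_near. Qed.

Lemma jump_ge0 u y : 0 < u -> 0 <= jump x u y.
Proof.
move=> u0; have c := cvg_comp _ _ (left_limit cx u0) (@C0_eval_continuous R y _).
rewrite C0_subE subr_ge0; apply: cvgr_to_le c _.
near=> v; rewrite /= -subr_ge0 -C0_subE; apply: incr; apply/andP; split; near: v.
  exact: nbhs_left_ge.
exact: nbhs_left_le.
Unshelve. all: by end_near. Qed.

(** What remains of the increment once the jumps are removed is a sum of increments up to left
    limits, all of them in the cone. *)
Lemma cone_sub_path s t (C : seq R) : 0 <= s -> path <%R s C -> last s C <= t ->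
  C0_cone (x t - x s - \sum_(c <- C) jump x c).
Proof.
elim: C s => [|c C ih] s s0 /=.
  by move=> _ st; rewrite big_nil subr0; apply: incr; rewrite s0.
move=> /andP[sc pC] lt y; have c0 : 0 <= c by rewrite (le_trans s0)// ltW.
have := ih c c0 pC lt y; have := cone_left_limit s0 sc y.
rewrite big_cons /jump !C0_subE.
set l := lim _; set S := \sum_(_ <- _) _.
rewrite -[(x c - l + S) y]/(x c y - l y + S y); lra.
Qed.

Lemma cone_sub_jumps s t (C : seq R) : 0 <= s <= t -> uniq C ->
  (forall c, c \in C -> s < c <= t) -> C0_cone (x t - x s - \sum_(c <- C) jump x c).
Proof.
move=> /andP[s0 st] uC HC; rewrite -(perm_big _ (permEl (perm_sort <=%R C))).
have sub c : c \in sort <=%R C -> s < c <= t by rewrite mem_sort; exact: HC.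
apply: cone_sub_path => //.
  rewrite (path_sortedE lt_trans) lt_sorted_uniq_le sort_uniq uC sort_le_sorted !andbT.
  by apply/allP => c /sub /andP[].
have := mem_last s (sort <=%R C); rewrite inE => /predU1P[->//|/sub/andP[]//].
Qed.

Hypothesis approx : forall (T : nat) (e : R), 0 < e -> exists C : seq R,
  [/\ uniq C, (forall c, c \in C -> 0 < c <= T%:R) &
    `|x T%:R - x 0 - \sum_(c <- C) jump x c| <= e].

(** Let [T] be an integer beyond [t] and [C] a finite set whose jumps nearly exhaust the path up to
    [T]. For any finite set that contains [C], the remainder at [t] is nonnegative and at most the
    remainder of [C] at [T], because the remainder over []t, T]] is nonnegative too. Monotonicity of
    the norm on the cone concludes. *)
Lemma sum_of_jumps t : 0 <= t ->
  summability.partial_sum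
    (fun u => if 0 < u <= t then x u - lim (x v @[v --> u^'-]) else 0) A
    @[A --> summability.totally] --> x t.
Proof.
move=> t0; have FF : Filter (@summability.totally R) := @filter_filter _ _ summability.totally_filter.
apply/cvgrPdist_le => e e0.
pose T := (Num.truncn t).+1.
have tT : t <= T%:R by have /andP[_ /ltW] := truncn_itv t0.
have [C [uC CT CE]] := approx T e0.
exists [fset c in C]%fset => // B /= CB.
have {}CB c : c \in C -> c \in B by move=> cC; apply: (fsubsetP CB); rewrite inE.
pose B1 := [seq c <- B | 0 < c <= t]; pose B2 := [seq c <- B | t < c <= T%:R].
have -> : summability.partial_sum
    (fun u => if 0 < u <= t then x u - lim (x v @[v --> u^'-]) else 0) B =
    \sum_(c <- B1) jump x c.
  by rewrite big_filter big_mkcond big_seq_fsetE.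
have uB1 : uniq B1 by exact/filter_uniq/fset_uniq.
have uB2 : uniq B2 by exact/filter_uniq/fset_uniq.
have h1 : C0_cone (x t - x 0 - \sum_(c <- B1) jump x c).
  by apply: cone_sub_jumps => //; [rewrite lexx|move=> c; rewrite mem_filter => /andP[]].
have h2 : C0_cone (x T%:R - x t - \sum_(c <- B2) jump x c).
  by apply: cone_sub_jumps => //; [rewrite t0|move=> c; rewrite mem_filter => /andP[]].
have h3 y : (\sum_(c <- C) jump x c) y <= (\sum_(c <- B1) jump x c) y + (\sum_(c <- B2) jump x c) y.
  have pC : perm_eq C [seq c <- B | c \in C].
    apply: uniq_perm => //; first exact/filter_uniq/fset_uniq.
    by move=> c; rewrite mem_filter; case: (boolP (c \in C)) => // /CB ->.
  rewrite (perm_big _ pC) !C0_sumE !big_filter (big_mkcond (fun c => c \in C)) (big_mkcond (fun c => 0 < c <= t)).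
  rewrite (big_mkcond (fun c => t < c <= T%:R)) -big_split/=; apply: ler_sum => c _.
  have p1 : 0 <= (if 0 < c <= t then jump x c y else 0).
    by case: ifP => // /andP[c0 _]; exact: jump_ge0.
  have p2 : 0 <= (if t < c <= T%:R then jump x c y else 0).
    by case: ifP => // /andP[c0 _]; apply: jump_ge0; exact: le_lt_trans c0.
  case: ifP => [cC|_]; last exact: addr_ge0.
  have /andP[c0 cT] := CT c cC; have [ct|tc] := leP c t.
    by rewrite c0 /= addr0.
  by rewrite c0 cT /= add0r.
apply: le_trans CE; apply: le_C0_norm => y.
have := h1 y; have := h2 y; have := h3 y; rewrite !C0_subE x0.
set S := (\sum_(c <- C) jump x c) y; set S1 := (\sum_(c <- B1) jump x c) y.
set S2 := (\sum_(c <- B2) jump x c) y.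
rewrite -[(0 : C0 R) y]/(0 : R); lra.
Qed.

End increasing_path.

Lemma Ex_same_distribution (R : realType) d (T : measurableType d) (P : probability T R)
    (X Y phi : T -> R) (f : R -> R) :
  measurable_fun [set: T] X -> measurable_fun [set: T] Y ->
  (forall B, measurable B -> P (X @^-1` B) = P (Y @^-1` B)) ->
  measurable_fun [set: R] f -> (forall y, 0 <= f y) ->
  Ex P (f \o X) = Ex P (f \o Y).
Proof.
move=> mX mY XY mf f0.
pose X' : {RV P >-> R} := mfun_Sub (mem_set mX : X \in mfun).
pose Y' : {RV P >-> R} := mfun_Sub (mem_set mY : Y \in mfun).
have mf' : measurable_fun [set: R] (EFin \o f) by exact/measurable_EFinP.
have e (Z : {RV P >-> R}) : (\int[distribution P Z]_y (f y)%:E = \int[P]_x (f (Z x))%:E)%E.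
  have := ge0_integral_pushforward (@measurable_funPT _ _ _ _ Z) P measurableT mf' _.
  by rewrite preimage_setT; apply=> y _; rewrite lee_fin.
rewrite /Ex /Rintegral -[in LHS](e X') -(e Y'); congr fine.
by apply: eq_measure_integral => A mA _; exact: XY.
Qed.

Lemma C0_rescale_norm (R : realType) (a b : R) (f : C0 R) : 0 <= a -> 0 < b ->
  `|rescale a b f| = a * `|f|.
Proof.
move=> a0 b0; apply/eqP; rewrite eq_le; apply/andP; split.
  by rewrite -[a in leRHS]ger0_norm// rescale_norm.
have [->|an0] := eqVneq a 0; first by rewrite mul0r.
have {an0}a0 : 0 < a by rewrite lt_neqAle eq_sym an0.
rewrite mulrC -ler_pdivlMr//; apply: C0_norm_leP => x.
rewrite ler_pdivlMr//; apply: le_trans (C0_eval_le _ (b^-1 * x)).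
by rewrite rescaleE// mulrA divff ?gt_eqF// mul1r normrM (gtr0_norm a0) mulrC.
Qed.

Definition cut (R : realType) (a z : R) : R := if z <= a then z else 0.

Lemma measurable_cut (R : realType) (a : R) : measurable_fun [set: R] (cut a).
Proof.
apply: measurable_fun_ifT => //.
by apply: measurable_fun_ler.
Qed.

Lemma cut_bound (R : realType) (a z : R) : 0 <= a -> 0 <= z -> 0 <= cut a z <= a.
Proof. by move=> a0 z0; rewrite /cut; case: ifP => [->|_]; rewrite ?z0 ?lexx ?a0. Qed.

Lemma bmeas_cut (R : realType) d (T : measurableType d) (a : R) (Z : T -> R) : 0 <= a ->
  (forall w, 0 <= Z w) -> measurable_fun [set: T] Z -> bmeas (fun w => cut a (Z w)).
Proof.
move=> a0 Z0 mZ; split; first exact: measurableT_comp (@measurable_cut R a) mZ.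
by exists a => w; have /andP[h1 h2] := cut_bound a0 (Z0 w); rewrite ger0_norm.
Qed.

Lemma Ex_indic_fine (R : realType) d (T : measurableType d) (P : probability T R) (A : set T) :
  measurable A -> Ex P \1_A = fine (P A).
Proof. by move=> mA; rewrite -Ex_indic. Qed.

(** Induction gives (1 - q)^n (1 + n q) <= 1, since (1 - q) (1 + q) <= 1. *)
Lemma bernoulli_pow (R : realType) (q : R) n : 0 <= q <= 1 -> 2^-1 <= (1 - q) ^+ n -> q * n%:R <= 1.
Proof.
move=> /andP[q0 q1] H.
have : (1 - q) ^+ n * (1 + n%:R * q) <= 1.
  elim: n {H} => [|n ih]; first by rewrite expr0 mul0r addr0 mul1r.
  apply: le_trans ih; rewrite exprSr -mulrA ler_wpM2l ?exprn_ge0 ?subr_ge0//.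
  rewrite -natr1; have := mulr_ge0 (mulr_ge0 q0 q0) (ler0n R n); nra.
have : 0 <= n%:R * q by rewrite mulr_ge0.
set u := n%:R * q => u0; set y := (1 - q) ^+ n in H *.
have : 2^-1 * (1 + u) <= y * (1 + u) by rewrite ler_wpM2r//; lra.
have -> : q * n%:R = u by rewrite mulrC.
lra.
Qed.


(** * Tail of the norm and small increments *)

Section pure_jump.
Variables (R : realType) (d : measure_display) (Om : measurableType d).
Variables (Q : probability Om R) (g : Om -> cadlag (C0 R)).
Hypothesis levy : levy_process Q (fun s w => g w s).
Hypothesis incr_random : forall r s, 0 <= r -> 0 <= s -> random_element (fun w => g w s - g w r).
Hypothesis ge0 : {ae Q, forall w, forall r s, 0 <= r <= s -> forall x, 0 <= (g w s - g w r) x}.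
Hypothesis scaling : forall s, 0 < s ->
  same_law Q (fun w => g w s) (fun w => rescale (s `^ (3 / 2)) (Num.sqrt s)^-1 (g w 1)).

Let zeta w : R := `|g w 1|.

Let incr n k w : R := `|grid_incr (g w) n k|.

Let aeI (A B : Om -> Prop) : {ae Q, forall w, A w} -> {ae Q, forall w, B w} ->
  {ae Q, forall w, A w /\ B w}.
Proof. by move=> a b; exact: (@filterI _ _ (ae_filter_ringOfSetsType Q)). Qed.

Let aeS (A B : Om -> Prop) : (forall w, A w -> B w) -> {ae Q, forall w, A w} ->
  {ae Q, forall w, B w}.
Proof. by move=> AB; apply: (@filterS _ _ (ae_filter_ringOfSetsType Q)). Qed.

Let norm_cont : continuous (fun f : C0 R => `|f|).
Proof. exact: norm_continuous. Qed.

Let zeta_ge0 w : 0 <= zeta w.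
Proof. exact: normr_ge0. Qed.

Let incr_ge0 n k w : 0 <= incr n k w.
Proof. exact: normr_ge0. Qed.

Let m_zeta : measurable_fun [set: Om] zeta.
Proof. exact: (random_element_cont (levy_random levy ler01) norm_cont). Qed.

Let m_incr n k : measurable_fun [set: Om] (incr n k).
Proof.
have rI : random_element (fun w => grid_incr (g w) n k) by apply: incr_random; rewrite divr_ge0.
exact: (random_element_cont rI norm_cont).
Qed.

Let m_le (Z : Om -> R) a : measurable_fun [set: Om] Z -> measurable [set w | Z w <= a].
Proof.
move=> mZ; rewrite [X in measurable X](_ : _ = Z @^-1` `]-oo, a]).
  by rewrite -[X in measurable X]setTI; apply: mZ.
by apply/seteqP; split => w /=; rewrite in_itv.
Qed.

Let m_gt (Z : Om -> R) a : measurable_fun [set: Om] Z -> measurable [set w | a < Z w].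
Proof.
move=> mZ; rewrite [X in measurable X](_ : _ = ~` [set w | Z w <= a]).
  exact/measurableC/m_le.
by apply/seteqP; split => w /=; rewrite ltNge => /negP.
Qed.

Let borel_norm (B : set R) : measurable B -> <<s @open (C0 R) >> ((fun f : C0 R => `|f|) @^-1` B).
Proof.
move=> mB; apply: (borel_continuous norm_cont).
have {mB} : (RGenOpens.G (R := R)).-sigma.-measurable B.
  by rewrite -RGenOpens.measurableE; exact: mB.
move: B; apply: smallest_sub; first exact: smallest_sigma_algebra.
by move=> _ [x [y ->]]; apply: sub_sigma_algebra; exact: interval_open.
Qed.

Let scale_exponent m : (4 ^+ m)^-1 `^ (3 / 2) = (8 ^+ m)^-1 :> R.
Proof.
have e2 : (4 ^+ m)^-1 = ((2 ^+ m)^-1) `^ 2%:R :> R.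
  have -> : 4 = 2 ^+ 2 :> R by rewrite -natrX.
  by rewrite powR_mulrn ?invr_ge0 ?exprn_ge0// exprVn -!exprM mulnC.
have e3 : (8 ^+ m)^-1 = ((2 ^+ m)^-1) `^ 3%:R :> R.
  have -> : 8 = 2 ^+ 3 :> R by rewrite -natrX.
  by rewrite powR_mulrn ?invr_ge0 ?exprn_ge0// exprVn -!exprM mulnC.
by rewrite e2 e3 -powRrM; congr (_ `^ _); field.
Qed.

(** Stationarity moves the increment to the origin, and scaling at u = 4^-m carries it to time 1,
    where u^(3/2) = 8^-m. *)
Lemma grid_incr_law m k (B : set R) : measurable B ->
  Q (incr (4 ^ m) k @^-1` B) = Q ((fun w => (8 ^+ m)^-1 * zeta w) @^-1` B).
Proof.
move=> mB; have bB := borel_norm mB; set u : R := (4 ^ m)%:R^-1.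
have nR : 0 < (4 ^ m)%:R :> R by rewrite ltr0n expn_gt0.
have u0 : 0 < u by rewrite invr_gt0.
have ku : 0 <= k%:R / (4 ^ m)%:R :> R by rewrite divr_ge0.
have h0 : 0 <= (0 : R) <= u by rewrite lexx ltW.
have := levy_stationary levy h0 ku bB.
rewrite add0r (_ : u + _ = k.+1%:R / (4 ^ m)%:R); last by rewrite -natr1 mulrDl mul1r addrC.
rewrite -[X in X = _ -> _]/(Q (incr (4 ^ m) k @^-1` B)) => ->.
transitivity (Q ((fun w => g w u) @^-1` ((fun f : C0 R => `|f|) @^-1` B))).
  apply: ae_eq_prob; [exact: (incr_random (lexx 0) (ltW u0))|exact: (levy_random levy (ltW u0))|].
  by apply: aeS (levy0 levy) => w /= ->; rewrite subr0.
rewrite (scaling u0 bB); congr (Q _); apply/funext => w /=; congr (B _).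
rewrite C0_rescale_norm ?powR_ge0 ?invr_gt0 ?sqrtr_gt0//.
by congr (_ * _); rewrite /u natrX scale_exponent.
Qed.

Let cut_law m k a : Ex Q (fun w => cut a (incr (4 ^ m) k w)) = Ex Q (fun w => cut a ((8 ^+ m)^-1 * zeta w)).
Proof.
have mz : measurable_fun [set: Om] (fun w => (8 ^+ m)^-1 * zeta w) by exact: measurable_funM.
(* Extended by 0 to negative reals: the transfer of expectations asks for a function that is
   nonnegative on the whole line. *)
pose f (z : R) : R := if 0 <= z then cut a z else 0.
have fE (Z : Om -> R) : (forall w, 0 <= Z w) -> (fun w => cut a (Z w)) = f \o Z.
  by move=> Z0; apply/funext => w /=; rewrite /f Z0.
rewrite (fE (incr _ _))// (fE (fun w => (8 ^+ m)^-1 * zeta w)); last first.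
  by move=> w; rewrite mulr_ge0// invr_ge0 exprn_ge0.
apply: Ex_same_distribution => //.
- exact: grid_incr_law.
- by apply: measurable_fun_ifT => //; [exact: measurable_fun_ler|exact: measurable_cut].
- by move=> y; rewrite /f /cut; case: ifP => // y0; case: ifP.
Qed.

(* The maximum of the 4^r increments over [0, 1], each distributed as zeta / 8^r, is at most zeta. *)
Lemma norm_tail : exists2 M : R, 0 < M &
  forall r, Ex Q \1_[set w | M * 8 ^+ r < zeta w] * 4 ^+ r <= 1.
Proof.
(* [M] will be a level that [zeta] exceeds with probability at most 1/2. If [zeta] is at most [M],
   so are all the increments, whence (1 - q)^(4^r) >= 1/2 for q = P(zeta > M 8^r). *)
have [k kP] : exists k : nat, Ex Q \1_[set w | k.+1%:R < zeta w] <= 2^-1.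
  have := @Ex_cvg _ _ _ Q (fun k => \1_[set w | k.+1%:R < zeta w]) (fun=> 0) 1.
  case.
  - by move=> k; apply: measurable_indic; exact: m_gt.
  - by move=> k w; rewrite indicE; case: (_ \in _); rewrite ?normr1 ?normr0.
  - move=> w; apply: cvg_near_cst; exists (Num.truncn (zeta w)) => // k /= kz.
    rewrite indicE memNset//= => kz'.
    have /andP[_] := truncn_itv (zeta_ge0 w); rewrite ltNge => /negP; apply.
    by apply: le_trans (ltW kz'); rewrite ler_nat ltnS.
  move=> _; rewrite Ex_cst => /cvgrPdist_le/(_ 2^-1).
  rewrite invr_gt0 ltr0n => /(_ isT)[k _ kP]; exists k.
  by have := kP k (leqnn k); rewrite /= sub0r normrN; apply: le_trans; exact: ler_norm.
exists k.+1%:R => // r; set M : R := k.+1%:R.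
set q := Ex Q _.
have q01 : 0 <= q <= 1.
  rewrite /q Ex_indic_fine; last exact: m_gt.
  by rewrite fine_ge0//= -[1]/(fine 1%E) fine_le ?fin_num_measure ?probability_le1//; exact: m_gt.
rewrite -natrX; apply: bernoulli_pow => //.
have M8 : 0 <= M * 8 ^+ r by rewrite mulr_ge0// exprn_ge0.
pose A i := [set w | incr (4 ^ r) i w <= M].
have mA i : measurable (A i) by exact: m_le.
have QA i : Q (A i) = (1 - q)%:E.
  have := @grid_incr_law r i `]-oo, M] (measurable_itv _).
  rewrite (_ : incr (4 ^ r) i @^-1` `]-oo, M] = A i); last first.
    by apply/seteqP; split => w /=; rewrite in_itv.
  move=> ->; rewrite EFinB /q Ex_indic; last exact: m_gt.
  rewrite -probability_setC; last exact: m_gt.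
  congr (Q _); apply/seteqP; split => w /=; rewrite in_itv/= ler_pdivrMl ?exprn_gt0// [8 ^+ r * M]mulrC.
    by rewrite leNgt => /negP.
  by move/negP; rewrite -leNgt.
have t0 : 0 <= (0%N)%:R / (4 ^ r)%:R :> R by rewrite mul0r.
have tmono : {homo (fun i : nat => i%:R / (4 ^ r)%:R : R) : m n / (m <= n)%N >-> m <= n}.
  by move=> m n mn; rewrite ler_wpM2r// ler_nat.
have ind := @levy_independent _ _ _ _ _ _ levy _ t0 tmono (iota 0 (4 ^ r)) A (iota_uniq _ _) _.
have {ind} : Q (\bigcap_(i in [set` iota 0 (4 ^ r)]) A i) = ((1 - q) ^+ (4 ^ r))%:E.
  rewrite ind; last first.
    move=> i _; exists ((fun f : C0 R => `|f|) @^-1` `]-oo, M]); first exact: borel_norm.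
    by apply/seteqP; split => w /=; rewrite in_itv.
  under eq_bigr do rewrite QA.
  by rewrite prodEFin big_const_seq count_predT size_iota -Monoid.iteropE.
move=> QI; rewrite -lee_fin -QI.
have mI : measurable (\bigcap_(i in [set` iota 0 (4 ^ r)]) A i).
  by apply: fin_bigcap_measurable; [exact: finite_seq|move=> i _; exact: mA].
have mS : measurable [set w | zeta w <= M] by exact: m_le.
apply: (@le_trans _ _ (Q [set w | zeta w <= M])).
  have -> : [set w | zeta w <= M] = ~` [set w | M < zeta w].
    by apply/seteqP; split => w /=; rewrite leNgt => /negP.
  rewrite probability_setC; last exact: m_gt.
  rewrite -Ex_indic; last exact: m_gt.
  by rewrite -EFinB lee_fin; move: kP; rewrite -/M; lra.
rewrite (_ : Q [set w | zeta w <= M] =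
    Q ([set w | zeta w <= M] `&` \bigcap_(i in [set` iota 0 (4 ^ r)]) A i)).
  by apply: le_measure; rewrite ?inE//; exact: measurableI.
apply: ae_eq_prob => //; first exact: measurableI.
apply: aeS (aeI ge0 (levy0 levy)) => w [H g0] /=; split=> [zM|[]//]; split=> // i /=.
rewrite mem_iota/= add0n => ir; apply: le_trans zM; apply: le_C0_norm => x.
have nR : 0 < (4 ^ r)%:R :> R by rewrite ltr0n expn_gt0.
have i0 : 0 <= i%:R / (4 ^ r)%:R :> R by rewrite divr_ge0.
have i1 : i%:R / (4 ^ r)%:R <= i.+1%:R / (4 ^ r)%:R :> R by apply: tmono.
have i2 : i.+1%:R / (4 ^ r)%:R <= 1 :> R by rewrite ler_pdivrMr// mul1r ler_nat.
have := H _ _ (introT andP (conj (lexx 0) i0)) x.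
have := H _ _ (introT andP (conj i0 i1)) x.
have := H _ _ (introT andP (conj (le_trans i0 i1) i2)) x.
by rewrite /grid_incr g0 !C0_subE -[(0 : C0 R) x]/(0 : R) => a1 a2 a3; apply/andP; split; lra.
Qed.

(** Raising the level from a = M 8^r to 8 a adds at most 8 a P(zeta > a) <= 8 M 2^r; these layers
    form a geometric sum. *)
Lemma cut_mean M r : 0 < M ->
  (forall r, Ex Q \1_[set w | M * 8 ^+ r < zeta w] * 4 ^+ r <= 1) ->
  Ex Q (fun w => cut (M * 8 ^+ r) (zeta w)) <= 8 * M * 2 ^+ r.
Proof.
move=> M0 tail; have M8 j : 0 <= M * 8 ^+ j by rewrite mulr_ge0 ?exprn_ge0// ltW.
have bc j : bmeas (fun w => cut (M * 8 ^+ j) (zeta w)) by exact: bmeas_cut.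
have bi j : bmeas (\1_[set w | M * 8 ^+ j < zeta w] : Om -> R).
  split; first by apply: measurable_indic; exact: m_gt.
  by exists 1 => w; rewrite indicE; case: (_ \in _); rewrite ?normr1 ?normr0.
elim: r => [|r ih].
  rewrite expr0 !mulr1; apply: (@le_trans _ _ (Ex Q (fun=> M))).
    apply: le_Ex; [by have := bc 0%N; rewrite expr0 mulr1|exact: bmeas_cst|move=> w].
    by have /andP[] := cut_bound (ltW M0) (zeta_ge0 w).
  by rewrite Ex_cst; lra.
set a := M * 8 ^+ r in ih; have a8 : M * 8 ^+ r.+1 = 8 * a by rewrite /a exprS mulrCA.
apply: (@le_trans _ _ (Ex Q (fun w => cut a (zeta w) + 8 * a * \1_[set w | a < zeta w] w))).
  apply: le_Ex; [exact: bc|apply: bmeasD; first exact: bc|].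
    by apply: bmeasM; [exact: bmeas_cst|exact: bi].
  move=> w; rewrite a8 indicE; have [za|az] := leP (zeta w) a.
    rewrite memNset/=; last by rewrite ltNge za.
    rewrite mulr0 addr0 /cut za; case: ifP => // _; exact: zeta_ge0.
  rewrite mem_set// mulr1 /cut [zeta w <= a]leNgt az/= add0r; case: ifP => // _.
  by rewrite mulr_ge0//; exact: M8.
rewrite ExD; [|exact: bc|by apply: bmeasM; [exact: bmeas_cst|exact: bi]].
have bir : bmeas (\1_[set w | a < zeta w] : Om -> R) := bi r.
rewrite (ExZ Q (8 * a) bir).
have := tail r; rewrite -/a; set p := Ex Q \1_ _ => pr.
have : 8 * a * p <= 8 * M * 2 ^+ r.
  have e : 8 ^+ r = 4 ^+ r * 2 ^+ r :> R by rewrite -exprMn -natrM.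
  rewrite (_ : 8 * a * p = 8 * M * 2 ^+ r * (p * 4 ^+ r)); last by rewrite /a e; ring.
  by rewrite ler_piMr// !mulr_ge0 ?exprn_ge0// ltW.
rewrite [2 ^+ r.+1]exprS; set y := 2 ^+ r in ih *; lra.
Qed.

(** There are T 4^m increments, and each cut increment has mean at most 8^-m times 8 M 2^(m-l); as
    4^m 2^m = 8^m, the mesh disappears from the bound. *)
Lemma small_sum_mean M T l m : 0 < M ->
  (forall r, Ex Q \1_[set w | M * 8 ^+ r < zeta w] * 4 ^+ r <= 1) -> (l <= m)%N ->
  bmeas (fun w => small_sum (g w) (4 ^ m) T (M / 8 ^+ l)) /\
  Ex Q (fun w => small_sum (g w) (4 ^ m) T (M / 8 ^+ l)) <= T%:R * (8 * M) / 2 ^+ l.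
Proof.
move=> M0 tail lm; set a := M / 8 ^+ l.
have a0 : 0 <= a by rewrite divr_ge0 ?exprn_ge0// ltW.
have bc k : bmeas (fun w => cut a (incr (4 ^ m) k w)) by exact: bmeas_cut.
have sE : (fun w => small_sum (g w) (4 ^ m) T a) =
    (fun w => \sum_(k < T * 4 ^ m) cut a (incr (4 ^ m) k w)) by [].
split; first by rewrite sE; apply: bmeas_sum => k; exact: bc.
rewrite sE Ex_sum//; under eq_bigr do rewrite cut_law.
have p8 j : 0 < 8 ^+ j :> R by rewrite exprn_gt0.
have -> : (fun w => cut a ((8 ^+ m)^-1 * zeta w)) =
    (fun w => (8 ^+ m)^-1 * cut (M * 8 ^+ (m - l)) (zeta w)).
  apply/funext => w; rewrite /cut ler_pdivrMl//.
  have -> : 8 ^+ m * a = M * 8 ^+ (m - l).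
    by rewrite /a -{1}(subnK lm) exprD; field; rewrite gt_eqF.
  by case: ifP => _; rewrite ?mulr0.
rewrite ExZ; last by apply: bmeas_cut => //; rewrite mulr_ge0// ?ltW.
rewrite sumr_const card_ord -(mulr_natl _ (T * 4 ^ m)) natrM natrX.
have := cut_mean (m - l) M0 tail; set h := Ex Q _ => hh.
have e : 8 ^+ m = 4 ^+ m * 2 ^+ m :> R by rewrite -exprMn -natrM.
have e2 : 2 ^+ m = 2 ^+ (m - l) * 2 ^+ l :> R by rewrite -exprD subnK.
have q4 : 4 ^+ m != 0 :> R by rewrite gt_eqF// exprn_gt0.
have q2 j : 0 < 2 ^+ j :> R by rewrite exprn_gt0.
have -> : T%:R * 4 ^+ m * ((8 ^+ m)^-1 * h) = T%:R * (h / (2 ^+ (m - l))) / 2 ^+ l.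
  by rewrite e e2; field; rewrite q4 !gt_eqF.
rewrite ler_wpM2r ?invr_ge0 ?(ltW (q2 _))//; apply: ler_wpM2l => //.
by rewrite ler_pdivrMr.
Qed.

(** Markov's inequality gives, for every m >= l, probability at most c / 2^l to the event that the
    small sum exceeds [dl]. The same bound holds for exceeding it at all m >= N, then for the union
    over N of these increasing events; the intersection over l is null. The outcome is a sequence of
    meshes along which the small sums stay below [dl], the form in which [jump_approx] uses it. *)
Lemma small_sums_vanish M T (dl : R) : 0 < M -> 0 < dl ->
  (forall r, Ex Q \1_[set w | M * 8 ^+ r < zeta w] * 4 ^+ r <= 1) ->
  {ae Q, forall w, exists l, forall N, exists2 m, (N <= m)%N &
    small_sum (g w) (4 ^ m) T (M / 8 ^+ l) <= dl}.
Proof.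
move=> M0 dl0 tail; pose V l m w := small_sum (g w) (4 ^ m) T (M / 8 ^+ l).
have a0 l : 0 <= M / 8 ^+ l by rewrite divr_ge0 ?exprn_ge0// ltW.
have mV l m : measurable_fun [set: Om] (V l m).
  have bc k : bmeas (fun w => cut (M / 8 ^+ l) (incr (4 ^ m) k w)) by exact: bmeas_cut.
  by have [] : bmeas (V l m) by apply: bmeas_sum => k; exact: bc.
have V0 l m w : 0 <= V l m w by apply: sumr_ge0 => k _; case: ifP.
pose B l N := \bigcap_(m in [set m | (N <= m)%N]) [set w | dl < V l m w].
have mB l N : measurable (B l N).
  by apply: bigcap_measurable => [|m _]; [exists N => /=|exact: m_gt].
pose U l := \bigcup_N B l N.
have mU l : measurable (U l) by exact: bigcupT_measurable.
pose c := T%:R * (8 * M) / dl.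
have QB l N : (Q (B l N) <= (c / 2 ^+ l)%:E)%E.
  have mN := leq_maxr l N; have lm := leq_maxl l N; set m := maxn l N in lm mN.
  have [bV EV] := small_sum_mean T M0 tail lm.
  have mS : measurable [set w | dl < V l m w] by exact: m_gt.
  apply: (@le_trans _ _ (Q [set w | dl < V l m w])).
    by apply: le_measure; rewrite ?inE// => w /(_ m mN).
  rewrite -Ex_indic// lee_fin -(ler_pM2l dl0).
  have -> : dl * (c / 2 ^+ l) = T%:R * (8 * M) / 2 ^+ l.
    by rewrite /c; field; rewrite gt_eqF// gt_eqF// exprn_gt0.
  have bi : bmeas (\1_[set w | dl < V l m w] : Om -> R).
    split; first exact: measurable_indic.
    by exists 1 => w; rewrite indicE; case: (_ \in _); rewrite ?normr1 ?normr0.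
  rewrite -ExZ//; apply: le_trans EV; apply: le_Ex => //.
    by apply: bmeasM => //; exact: bmeas_cst.
  move=> w; rewrite indicE; have [/set_mem/= h|_] := boolP (w \in _); last by rewrite mulr0; exact: V0.
  by rewrite mulr1 ltW.
have QU l : (Q (U l) <= (c / 2 ^+ l)%:E)%E.
  have := @nondecreasing_cvg_mu _ _ _ Q (B l) (mB l) (mU l) _.
  move=> H; apply: (cvge_to_le (H _)); last by apply: nearW => N; exact: QB.
  move=> N N' NN'; apply/subsetPset => w Bw m /= N'm; apply: Bw => /=; exact: leq_trans N'm.
pose bad := \bigcap_l U l.
have mbad : measurable bad by exact: bigcapT_measurable.
exists bad; split => //.
  have Qb l : (Q bad <= (c / 2 ^+ l)%:E)%E.
    by apply: le_trans (QU l); apply: le_measure; rewrite ?inE// => w /(_ l Logic.I).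
  have fb : Q bad \is a fin_num by exact: fin_num_measure.
  apply/eqP; rewrite eq_le measure_ge0 andbT -(fineK fb) lee_fin.
  apply/ler_addgt0Pl => e e0; rewrite addr0.
  pose l := (Num.truncn (c / e)).+1.
  have c0 : 0 <= c / e by rewrite /c !divr_ge0 ?mulr_ge0 ?(ltW M0) ?(ltW dl0) ?(ltW e0).
  have /andP[_ cl] := truncn_itv c0.
  have l2 : c / e <= 2 ^+ l.
    apply: le_trans (ltW cl) _; rewrite -natrX ler_nat.
    exact: ltnW (ltn_expl _ _).
  rewrite -lee_fin fineK//; apply: le_trans (Qb l) _; rewrite lee_fin.
  by rewrite ler_pdivrMr ?exprn_gt0// mulrC -ler_pdivrMr.
move=> w /= H l _; apply: contrapT => nU; apply: H; exists l => N.
apply: contrapT => H; apply: nU; exists N => // m /= Nm; rewrite ltNge; apply/negP => Vd.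
by apply: H; exists m.
Qed.

Lemma pure_jump_ae : pure_jump_process Q (fun s w => g w s).
Proof.
have [M M0 tail] := norm_tail.
have van : {ae Q, forall w, forall T i : nat, exists l, forall N, exists2 m, (N <= m)%N &
    small_sum (g w) (4 ^ m) T (M / 8 ^+ l) <= i.+1%:R^-1}.
  by apply: ae_foralln => T; apply: ae_foralln => i; apply: small_sums_vanish.
apply: aeS (aeI van (aeI ge0 (levy0 levy))) => w [V [H g0]] t t0.
have /asboolP[cg _] := cadlagP (g w).
apply: sum_of_jumps => // T e e0.
have e2 : 0 < e / 2 by rewrite divr_gt0.
pose i := Num.truncn (2 / e).
have i0 : i.+1%:R^-1 <= e / 2.
  have /andP[_ h] : i%:R <= 2 / e < i.+1%:R by apply: truncn_itv; rewrite divr_ge0// ltW.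
  by rewrite -[e / 2]invrK lef_pV2 ?posrE ?invr_gt0// invf_div ltW.
have [l lP] := V T i.
have al : 0 < M / 8 ^+ l by rewrite divr_gt0 ?exprn_gt0.
rewrite [e]splitr; apply: (jump_approx cg al) => // dl dl0.
have [m Nm sm] := lP (Num.truncn dl^-1).+1.
exists (4 ^ m)%N; split; [by rewrite expn_gt0| |exact: le_trans i0].
have /andP[_ h] := truncn_itv (ltW (etrans (invr_gt0 dl) dl0)).
rewrite -[dl]invrK ltf_pV2 ?posrE ?invr_gt0 ?ltr0n ?expn_gt0//.
apply: lt_le_trans h _; rewrite ler_nat; apply: leq_trans Nm _.
exact: ltnW (ltn_expl _ _).
Qed.

End pure_jump.

Theorem theorem1p4 (R : realType)
    (nu : probability nat R)
    (nu_mean : ('E_nu[fun k : nat => k%:R%R : R] = 1)%E)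
    (nu_variance : (0 < 'V_nu[fun k : nat => k%:R%R : R] < +oo)%E)
    (F : probability int R)
    (F_span : forall (a : int) (m : nat), (2 <= m)%N ->
       F [set a + m%:Z * k | k in [set: int]] <> 1%E)
    (F_mean : ('E_F[fun k : int => k%:~R%R : R] = 0)%E)
    (F_variance : (0 < 'V_F[fun k : int => k%:~R%R : R] < +oo)%E)
    (d : measure_display) (Om : measurableType d) (P : probability Om R)
    (K : nat -> seq nat -> {RV P >-> nat})
    (xi : nat -> seq nat -> {RV P >-> int})
    (brw : iid_branching_random_walks nu F K xi)
    (d' : measure_display) (Om' : measurableType d') (Q : probability Om' R)
    (g : Om' -> cadlag (C0 R))
    (g_random : random_element g)
    (g_limit : cvg_in_law P Q
       (fun N w => density_process R (fun i v => K i v w) (fun i v => xi i v w) N)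
       g) :
  [/\ forall s : R, 0 < s ->
        same_law Q (fun w => g w s)
          (fun w => rescale (s `^ (3 / 2)) (Num.sqrt s)^-1 (g w 1)),
      stable_subordinator Q (2 / 3) (fun s w => g w s 0),
      {ae Q, forall w, forall s, 0 <= s ->
        (@lebesgue_measure R).-integrable [set: R] (EFin \o g w s)} /\
      stable_subordinator Q (1 / 2)
        (fun s w => \int[@lebesgue_measure R]_x g w s x)
    & subordinator Q (fun s w => g w s) /\
      pure_jump_process Q (fun s w => g w s)].
Proof.
have levy := density_limit_levy brw g_random g_limit.
have ge0 := density_limit_ge0 brw g_random g_limit.
have scaling := density_limit_scaling brw g_random g_limit.
have at0 := density_limit_at0 nu_mean nu_variance F_mean F_variance brw g_random g_limit.
have mass_bound := density_limit_mass nu_mean nu_variance brw g_random g_limit.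
have incr := density_limit_increment Q g_random.
split=> //.
- exact: local_time_stable.
- split; first exact: (integrable_ae levy ge0 mass_bound).
  exact: (total_mass_stable levy incr ge0 scaling at0 mass_bound).
- by split; [split|exact: pure_jump_ae].
Qed.
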